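(* Let the weights $\mathbf W$, the activation $\sigma$, the deterministic data $\mathbf X$, the teacher model and the test point satisfy the assumptions in the context, let $\lambda\ge0$ and $n\ge\max\{n_0,n_1\}$. With probability at least $1-\log^{-C_\sigma}(N)$, when $N/\log^{2C_\sigma}(N)\gg n$ (i.e. $N/(n\log^{2C_\sigma}N)\to\infty$ as $n\to\infty$), $$\mathcal L(\hat f_\lambda^{(\mathsf{RF})})\ \ge\ \|P_{>\ell}f^*\|_2^2+\sigma_\varepsilon^2\,\mathbb E_{\mathbf x}\!\left[\mathbf K_{m,\ell}^\top\mathbf K_{\ell,\lambda}^{-2}\mathbf K_{m,\ell}\right]-o_n(1)\ \ge\ \|P_{>\ell}f^*\|_2^2-o_n(1),$$ where $\mathbf K_{m,\ell}:=\mathbf K_\ell(\mathbf X,\mathbf x)\in\mathbb R^n$, $\mathbf K_{\ell,\lambda}:=\lambda\mathrm{Id}+\mathbf K_\ell(\mathbf X,\mathbf X)$, and $o_n(1)$ denotes a quantity tending to $0$ as $n\to\infty$.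
   Context: $\|\cdot\|_F$ is the Frobenius norm, $\|\cdot\|_2$ of a vector is the Euclidean norm, $A^{\odot k}$ the entrywise (Hadamard) $k$-th power, $\log^a(N)=(\log N)^a$, $\mathbb N=\{0,1,2,\dots\}$. Weights: $\mathbf W\in\mathbb R^{N\times d}$ has i.i.d. $\mathcal N(0,1)$ entries; the probability in the claim is over $\mathbf W$. Activation: $\sigma:\mathbb R\to\mathbb R$ (applied entrywise to vectors and matrices) satisfies $|\sigma(x)|\le C_\sigma(1+|x|)^{C_\sigma}$ for all $x$, for a constant $C_\sigma\ge0$. With $\xi\sim\mathcal N(0,1)$, $\|\sigma\|_2=(\mathbb E[\sigma^2(\xi)])^{1/2}$, $\|\sigma\|_4=(\mathbb E[\sigma^4(\xi)])^{1/4}$. The normalized Hermite polynomials are $h_k(x)=\frac{1}{\sqrt{k!}}(-1)^ke^{x^2/2}\frac{d^k}{dx^k}e^{-x^2/2}$, and $\zeta_k(g)=\mathbb E[g(\xi)h_k(\xi)]$ for $g\in L^2(\mathcal N(0,1))$. Data: for each $n$, $\mathbf X=[\mathbf x_1,\dots,\mathbf x_n]\in\mathbb R^{d\times n}$ (with $d=d_n$ growing with $n$) is deterministic with $\|\mathbf x_i\|=1$ for all $i$. $\ell\in\mathbb N$ is the smallest integer such that $\lim_{n\to\infty}\|(\mathbf X^\top\mathbf X)^{\odot(\ell+1)}-\mathrm{Id}\|_F=0$, and $\sigma_{>\ell}^2:=\|\sigma\|_2^2-\sum_{k=0}^\ell\zeta_k^2(\sigma)$ is assumed to be $>0$. $n_0$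 is the smallest integer such that for all $n\ge n_0$, $\max_{i\ne j}|\mathbf x_i^\top\mathbf x_j|\le1/\sqrt2$ and $\|(\mathbf X^\top\mathbf X)^{\odot(\ell+1)}-\mathrm{Id}\|_F\le\sigma_{>\ell}^2/(4\|\sigma\|_4^2)$. Teacher model: $f^*(\mathbf x)=\tau(\langle\boldsymbol\beta,\mathbf x\rangle)$ with $\boldsymbol\beta\sim\mathcal N(0,\mathrm{Id}_d)$ random and $\tau\in L^4(\mathcal N(0,1))$; for $0\le k\le\ell$, $\zeta_k(\tau)\ne0$ whenever $\zeta_k(\sigma)\ne0$. Training labels are $\mathbf y=\tau(\mathbf X^\top\boldsymbol\beta)+\boldsymbol\varepsilon\in\mathbb R^n$ ($\tau$ entrywise), $\boldsymbol\varepsilon\sim\mathcal N(\mathbf 0,\sigma_\varepsilon^2\mathrm{Id})$. For a unit vector $\mathbf x$, $(P_{>\ell}f^* )(\mathbf x)=\sum_{k\ge\ell+1}\zeta_k(\tau)h_k(\boldsymbol\beta^\top\mathbf x)$ and $\|P_{>\ell}f^*\|_2^2=\mathbb E_{\mathbf x,\boldsymbol\beta}[(P_{>\ell}f^*(\mathbf x))^2]=\sum_{k\ge\ell+1}\zeta_k^2(\tau)$. Test point: $\mathbf x\in\mathbb R^d$ is random, and almost surely $\|\mathbf x\|=1$ and $\lim_{n\to\infty}\sqrt n\,\|(\mathbf X^\top\mathbf x)^{\odot(\ell+1)}\|_2=0$. $n_1$ is the smallest integer such that for all $n\ge n_1$, $\sup_{i\in[n]}|\langle\mathbf x,\mathbf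 x_i\rangle|\le1/\sqrt2$ and $\|(\mathbf X^\top\mathbf x)^{\odot(\ell+1)}\|_2\le\sigma_{>\ell}^2/(4\|\sigma\|_4^2)$. The variables $\mathbf W,\boldsymbol\beta,\boldsymbol\varepsilon,\mathbf x$ are independent. Kernels and predictor: $\mathbf K_N(\mathbf x,\mathbf z)=\frac1N\sigma(\mathbf W\mathbf x)^\top\sigma(\mathbf W\mathbf z)$, $\mathbf K_N=(\mathbf K_N(\mathbf x_i,\mathbf x_j))_{i,j\le n}$, $\mathbf K_N(\mathbf x,\mathbf X)$ is the row vector with entries $\mathbf K_N(\mathbf x,\mathbf x_i)$, and $\hat f^{(\mathsf{RF})}_\lambda(\mathbf x)=\mathbf K_N(\mathbf x,\mathbf X)(\mathbf K_N+\lambda\mathrm{Id})^{-1}\mathbf y$. The polynomial kernel is $\mathbf K_\ell(\mathbf x,\mathbf z)=\|\sigma\|_2^2$ if $\mathbf x=\mathbf z$ and $\sum_{k=0}^\ell\zeta_k^2(\sigma)(\mathbf x^\top\mathbf z)^k$ otherwise; $\mathbf K_\ell(\mathbf X,\mathbf x)=(\mathbf K_\ell(\mathbf x_i,\mathbf x))_{i\le n}$ and $\mathbf K_\ell(\mathbf X,\mathbf X)=(\mathbf K_\ell(\mathbf x_i,\mathbf x_j))_{i,j\le n}$. The generalization error is $\mathcal L(\hat f)=\mathbb E[|\hat f(\mathbf x)-f^*(\mathbf x)|^2]$, expectation over $\boldsymbol\varepsilon,\mathbf x,\boldsymbol\beta$ (with $\mathbf W$ held fixed). *)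

(* Defs.v *)
From HB Require Import structures.
From mathcomp Require Import all_boot all_order all_algebra.
From mathcomp Require Import all_classical all_reals all_analysis.

Set Implicit Arguments.
Unset Strict Implicit.
Unset Printing Implicit Defensive.

Import Order.TTheory GRing.Theory Num.Theory.
Import numFieldTopology.Exports numFieldNormedType.Exports.

Local Open Scope classical_set_scope.
Local Open Scope ring_scope.

Definition is_least (Q : nat -> Prop) (m : nat) : Prop :=
  Q m /\ (forall k, Q k -> (m <= k)%N).

Section LinearAlgebra.
Context {R : realType}.

(* The library norm on matrices is the sup norm, so the Frobenius norm (which
   is the Euclidean norm on column vectors) is defined here. *)
Definition frob (m n : nat) (A : 'M[R]_(m, n)) : R :=
  Num.sqrt (\sum_i \sum_j A i j ^+ 2).

Definition dot (d : nat) (x z : 'cV[R]_d) : R := (x^T *m z) 0 0.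

Definition hadamard_pow (m n : nat) (A : 'M[R]_(m, n)) (k : nat) :
  'M[R]_(m, n) := map_mx (fun t => t ^+ k) A.

End LinearAlgebra.

Section Hermite.
Context {R : realType}.

Definition std_gauss : probability _ R := normal_prob (0 : R) 1.

Definition hermite (k : nat) (x : R) : R :=
  (Num.sqrt (k`!%:R))^-1 * (-1) ^+ k * expR (x ^+ 2 / 2)
  * derive1n k (fun t : R => expR (- (t ^+ 2) / 2)) x.

Definition zeta (k : nat) (g : R -> R) : R :=
  (\int[std_gauss]_x (g x * hermite k x))%R.

Definition gauss_norm (p : R) (g : R -> R) : R :=
  fine ('N[std_gauss]_(p%:E)[EFin \o g])%E.

Definition sigma_tail_sq (l : nat) (sigma : R -> R) : R :=
  gauss_norm 2 sigma ^+ 2 - \sum_(k < l.+1) zeta k sigma ^+ 2.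

(* [g] is (a version of) the sum, in L^2 of the standard Gaussian law, of the
   series of the [zeta k tau * hermite k] over [k >= l + 1]; for a unit vector
   [x], [beta |-> g (dot beta x)] is then the sum of
   [zeta k tau * hermite k (dot beta x)] in L^2 of the Gaussian law of [beta]. *)
Definition is_hermite_tail (l : nat) (tau g : R -> R) : Prop :=
  g \in Lfun std_gauss 2%:E /\
  ('N[std_gauss]_(2%:E)[EFin \o (fun x =>
     g x - \sum_(l.+1 <= k < m) zeta k tau * hermite k x)%R])%E
    @[m --> \oo] --> 0%E.

End Hermite.

Section Kernels.
Context {R : realType}.
Variables (sigma : R -> R).

Definition rf_kernel (N d : nat) (W : 'M[R]_(N, d)) (x z : 'cV[R]_d) : R :=
  N%:R^-1 * dot (map_mx sigma (W *m x)) (map_mx sigma (W *m z)).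

Definition rf_kernel_mx (N d n : nat) (W : 'M[R]_(N, d)) (X : 'M[R]_(d, n)) :
  'M[R]_n := \matrix_(i, j) rf_kernel W (col i X) (col j X).

Definition rf_kernel_row (N d n : nat) (W : 'M[R]_(N, d)) (x : 'cV[R]_d)
  (X : 'M[R]_(d, n)) : 'rV[R]_n := \row_i rf_kernel W x (col i X).

(* [invmx A] is [A] itself when [A] is singular; [rf_kernel_mx W X] is positive
   semidefinite, so this can only occur for [lambda = 0]. *)
Definition rf_predictor (lambda : R) (N d n : nat) (W : 'M[R]_(N, d))
    (X : 'M[R]_(d, n)) (y : 'cV[R]_n) (x : 'cV[R]_d) : R :=
  (rf_kernel_row W x X *m invmx (rf_kernel_mx W X + lambda%:M) *m y) 0 0.

Definition poly_kernel (l d : nat) (x z : 'cV[R]_d) : R :=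
  if x == z then gauss_norm 2 sigma ^+ 2
  else \sum_(k < l.+1) zeta k sigma ^+ 2 * dot x z ^+ k.

Definition poly_kernel_mx (l d n : nat) (X : 'M[R]_(d, n)) : 'M[R]_n :=
  \matrix_(i, j) poly_kernel l (col i X) (col j X).

Definition poly_kernel_col (l d n : nat) (X : 'M[R]_(d, n)) (x : 'cV[R]_d) :
  'cV[R]_n := \col_i poly_kernel l (col i X) x.

Definition variance_term (l : nat) (lambda : R) (d n : nat)
    (X : 'M[R]_(d, n)) (x : 'cV[R]_d) : R :=
  let Km := poly_kernel_col l X x in
  let Kinv := invmx (lambda%:M + poly_kernel_mx l X) in
  (Km^T *m (Kinv *m Kinv) *m Km) 0 0.

End Kernels.

Section Probability.
Context {R : realType} {disp : measure_display} {Omega : measurableType disp}.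
Variable P : probability Omega R.

(* [normal_prob 0 0] is not the Dirac mass at 0, hence the case distinction. *)
Definition centered_gauss (s : R) (B : set R) : \bar R :=
  if s == 0 then \d_(0 : R) B else normal_prob 0 s B.

Definition sigma_algebra_of (K : Type) (Y : K -> Omega -> R) :
  set (set Omega) :=
  <<s \bigcup_k preimage_set_system setT (Y k) measurable >>.

Definition independent_algebras (I : finType) (F : I -> set (set Omega)) :
  Prop :=
  forall (J : {set I}) (E : I -> set Omega),
    (forall i, i \in J -> F i (E i)) ->
    P (\bigcap_(i in [set i | i \in J]) E i) = (\prod_(i in J) P (E i))%E.

Definition iid (I : finType) (law : set R -> \bar R) (Y : I -> Omega -> R) :
  Prop :=
  [/\ forall i, measurable_fun setT (Y i),
      forall i B, measurable B -> P (Y i @^-1` B) = law B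
    & independent_algebras (fun i => sigma_algebra_of (fun _ : unit => Y i))].

Definition entries (m n : nat) (A : Omega -> 'M[R]_(m, n)) :
  'I_m * 'I_n -> Omega -> R := fun ij omega => A omega ij.1 ij.2.

(* The expectation is over [beta], [eps] and [x] only: the weights [w] are a
   fixed matrix here, to be replaced by the value of the random weights, which
   are independent of [beta], [eps] and [x]. *)
Definition gen_error (sigma tau : R -> R) (lambda : R) (N d n : nat)
    (X : 'M[R]_(d, n)) (beta : Omega -> 'cV[R]_d) (eps : Omega -> 'cV[R]_n)
    (x : Omega -> 'cV[R]_d) (w : 'M[R]_(N, d)) : \bar R :=
  ('E_P[fun omega =>
     (let y := map_mx tau (X^T *m beta omega) + eps omega in
      `|rf_predictor sigma lambda w X y (x omega)
        - tau (dot (beta omega) (x omega))| ^+ 2)%R])%E.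

End Probability.

(* Main.v *)
(* Condition on the weights and write v = (K_N + lambda)^-1 K_N(X, x), so that
   the prediction is v^T y.  The error splits into a bias
   E_beta (v^T tau(X^T beta) - tau(beta^T x))^2 and the noise sigma_eps^2 |v|^2.

   Bias: expand tau in Hermite polynomials.  The Gram matrices
   (x_i^T x_j)^(.k), bordered by the test point, are positive semidefinite for
   every k, and for k > l they dominate (1 - eta) Id, where
   eta = |(X^T X)^(.(l+1)) - Id|_F.  Minimizing over v, each degree k > l
   contributes at least zeta_k(tau)^2 (1 - s^2 / (1 - eta)) with
   s = |(X^T x)^(.(l+1))|, and the degrees k <= l contribute at least 0.  No
   control of v is needed.

   Noise: with v_l and z the images of the polynomial kernel column under
   K_{l,lambda}^-1 and K_{l,lambda}^-2, the equation (K_N + lambda) v = k_N gives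
   v_l . v = (v_l - (K_N + lambda) z) . v + z . k_N, and hence
   (1 + t) |v|^2 >= |v_l|^2 - O(t) - (error)^2 / t for every t > 0.  The means of
   the random kernels are given by the Mehler formula up to O(eta + s), and their
   fluctuations along the deterministic vector z have variance
   O(n log^C(N) / N), because sigma(u)^2 is at most
   C^2 16^C log^C(N) + sigma(u)^2 exp(u^2 / 8) / N.  Markov's inequality with t
   tending slowly to 0 gives the probability 1 - log^(-C)(N).

   At lambda = 0 the kernel matrix must also be invertible.  Some zeta_M(sigma)
   with M > l does not vanish, so by Paley-Zygmund and Gaussian
   hypercontractivity for polynomials of degree M a row of sigma(W X) avoids any
   given hyperplane with probability at least p > 0; the rank can increase at
   most n times over the N independent rows, so the matrix is singular with
   probability at most n / (p N). *)
Require Import Defs.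
From HB Require Import structures.
From mathcomp Require Import all_boot all_order all_algebra.
From mathcomp Require Import all_classical all_reals all_analysis.
From mathcomp Require Import measurable_realfun.
From mathcomp Require Import zify ring lra.

Set Implicit Arguments.
Unset Strict Implicit.
Unset Printing Implicit Defensive.

Import Order.TTheory GRing.Theory Num.Theory.
Import numFieldTopology.Exports numFieldNormedType.Exports.

Local Open Scope classical_set_scope.
Local Open Scope ring_scope.

(** The obstacle is that neither the norm of [(K_N + lambda)^-1] nor closeness of the random kernel
    matrix to its mean in operator norm is available. The noise bound avoids both: it needs one
    scalar identity along [z], and [z] depends on the data and the test point but not on the
    weights, so second moments of averages over independent rows suffice. The low-degree part of the
    kernel may have eigenvalues of order [n]; its quadratic form at [z] stays bounded nevertheless,
    because [K_{l,lambda}] maps [z] back to [v_l], which is bounded. The two powers of [log^C(N)] in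
    the growth condition are spent separately: one bounds [sigma(u)^2] inside the variance, the
    other is lost in Markov's inequality. Covariances involve only pairs of linear forms, so that
    part of the Gaussian analysis reduces to the plane, where an explicit density for a correlated
    pair yields the Mehler expansion, completeness of the Hermite polynomials and rotation
    invariance. Independence is kept as a property of sub-sigma-algebras of one sample space, and
    Tonelli is obtained through the diagonal map. *)

Ltac mfun1 := match goal with
  | H : measurable_fun ?A ?f |- measurable_fun ?A ?f => exact: H
  | |- measurable_fun _ (fun _ => ?c) => exact: measurable_cst
  | |- measurable_fun _ (fun x => x) => exact: measurable_id
  | |- measurable_fun _ (fun x => x.1) => exact: measurable_fst
  | |- measurable_fun _ (fun x => x.2) => exact: measurable_snd
  | |- measurable_fun _ (fun x => (@?f x, @?g x)) => apply: measurable_fun_pair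
  | |- measurable_fun _ (fun x => @?f x ^+ _) => apply: measurable_funX
  | |- measurable_fun _ (fun x => @?f x + @?g x) => apply: measurable_funD
  | |- measurable_fun _ (fun x => - @?f x) => apply: measurable_funN
  | |- measurable_fun _ (fun x => @?f x * @?g x) => apply: measurable_funM
  | |- measurable_fun _ (fun x => expR (@?f x)) =>
      apply: (measurableT_comp (@measurable_expR _))
  | |- measurable_fun _ (fun x => (@?f x).1) =>
      apply: (measurableT_comp measurable_fst)
  | |- measurable_fun _ (fun x => (@?f x).2) =>
      apply: (measurableT_comp measurable_snd)
  | |- measurable_fun _ _ => assumption
  end.
Ltac mfun := repeat mfun1.

(** * Square-integrable functions and moments *)

Section Expectation.
Context d (T : measurableType d) (R : realType) (mu : probability T R).
Implicit Types f g h : T -> R.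

Definition intg f := mu.-integrable setT (EFin \o f).
Definition Ex f : R := \int[mu]_x f x.
Definition L2 f := measurable_fun setT f /\ intg (fun x => f x ^+ 2).

Lemma intg_measurable f : intg f -> measurable_fun setT f.
Proof. by move=> /measurable_int /measurable_EFinP. Qed.

Lemma intg_cst c : intg (fun _ => c).
Proof. exact: finite_measure_integrable_cst. Qed.

Lemma intgD f g : intg f -> intg g -> intg (fun x => f x + g x).
Proof. by move=> fi gi; exact: (integrableD measurableT fi gi). Qed.

Lemma intgZ c f : intg f -> intg (fun x => c * f x).
Proof. by move=> fi; exact: (integrableZl measurableT c fi). Qed.

Lemma intgN f : intg f -> intg (fun x => - f x).
Proof. by move=> fi; exact: (integrableN fi). Qed.

Lemma intgB f g : intg f -> intg g -> intg (fun x => f x - g x).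
Proof. by move=> mf mg; apply: intgD => //; exact: intgN. Qed.

Lemma intg_sum (I : Type) (s : seq I) (Q : pred I) (F : I -> T -> R) :
  (forall i, Q i -> intg (F i)) -> intg (fun x => \sum_(i <- s | Q i) F i x).
Proof.
move=> iF; elim: s => [|i s IH].
  by under [X in intg X]eq_fun do rewrite big_nil; exact: intg_cst.
under [X in intg X]eq_fun do rewrite big_cons.
case: (boolP (Q i)) => Qi; last exact: IH.
by apply: intgD => //; exact: iF.
Qed.

Lemma le_intg f g : measurable_fun setT f -> (forall x, `|f x| <= g x) ->
  intg g -> intg f.
Proof.
move=> mf fg; apply: le_integrable => //; first exact/measurable_EFinP.
by move=> x _ /=; rewrite lee_fin (le_trans (fg x)) ?ler_norm.
Qed.

Lemma intg_norm f : intg f -> intg (fun x => `|f x|).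
Proof. by move=> /integrable_norm. Qed.

Lemma ExE f : intg f -> (\int[mu]_x (f x)%:E)%E = (Ex f)%:E.
Proof. by move=> fi; rewrite /Ex /Rintegral fineK // integrable_fin_num. Qed.

Lemma Ex_cst c : Ex (fun _ => c) = c.
Proof. by rewrite /Ex Rintegral_cst //= probability_setT mulr1. Qed.

Lemma ExD f g : intg f -> intg g -> Ex (fun x => f x + g x) = Ex f + Ex g.
Proof. by move=> ? ?; rewrite /Ex RintegralD. Qed.

Lemma ExZ c f : intg f -> Ex (fun x => c * f x) = c * Ex f.
Proof. by move=> ?; rewrite /Ex RintegralZl. Qed.

Lemma ExN f : intg f -> Ex (fun x => - f x) = - Ex f.
Proof.
move=> fi; rewrite -mulN1r -ExZ //; congr Ex; apply/funext => x.
by rewrite mulN1r.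
Qed.

Lemma ExB f g : intg f -> intg g -> Ex (fun x => f x - g x) = Ex f - Ex g.
Proof. by move=> ? ?; rewrite /Ex RintegralB. Qed.

Lemma Ex_sum (I : Type) (s : seq I) (Q : pred I) (F : I -> T -> R) :
  (forall i, Q i -> intg (F i)) ->
  Ex (fun x => \sum_(i <- s | Q i) F i x) = \sum_(i <- s | Q i) Ex (F i).
Proof.
move=> iF; elim: s => [|i s IH].
  rewrite big_nil -[RHS](Ex_cst 0); congr Ex; apply/funext => x.
  by rewrite big_nil.
rewrite big_cons.
under [X in Ex X]eq_fun do rewrite big_cons.
case: (boolP (Q i)) => Qi; last exact: IH.
by rewrite ExD ?IH //; [exact: iF | exact: intg_sum].
Qed.

Lemma Ex_ge0 f : (forall x, 0 <= f x) -> 0 <= Ex f.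
Proof. by move=> f0; apply: Rintegral_ge0. Qed.

Lemma le_Ex f g : intg f -> intg g -> (forall x, f x <= g x) -> Ex f <= Ex g.
Proof. by move=> fi gi fg; apply: le_Rintegral. Qed.

Lemma le_norm_Ex f : intg f -> `|Ex f| <= Ex (fun x => `|f x|).
Proof. by move=> fi; apply: le_normr_Rintegral. Qed.

Lemma ge0_intg f : measurable_fun setT f -> (forall x, 0 <= f x) ->
  (\int[mu]_x (f x)%:E < +oo)%E -> intg f.
Proof.
move=> mf f0 fy; apply/integrableP; split; first exact/measurable_EFinP.
by under eq_integral do rewrite /= ger0_norm //.
Qed.

Lemma eq_Ex f g : (forall x, f x = g x) -> Ex f = Ex g.
Proof. by move=> /funext ->. Qed.

Lemma eq_intg f g : (forall x, f x = g x) -> intg f -> intg g.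
Proof. by move=> /funext ->. Qed.

Lemma L2_cst c : L2 (fun _ => c).
Proof. by split; [exact: measurable_cst | exact: intg_cst]. Qed.

Lemma L2_sq f : L2 f -> intg (fun x => f x ^+ 2).
Proof. by case. Qed.

Lemma L2_meas f : L2 f -> measurable_fun setT f.
Proof. by case. Qed.

Lemma L2_mul f g : L2 f -> L2 g -> intg (fun x => f x * g x).
Proof.
move=> [mf f2] [mg g2]; apply: (@le_intg _ (fun x => f x ^+ 2 + g x ^+ 2)).
- exact: measurable_funM.
- move=> x; rewrite normrM -(real_normK (num_real (f x))).
  rewrite -(real_normK (num_real (g x))).
  have := sqr_ge0 (`|f x| - `|g x|); have := sqr_ge0 (`|f x| + `|g x|).
  have := normr_ge0 (f x); have := normr_ge0 (g x); nra.
- exact: intgD.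
Qed.

Lemma L2_intg f : L2 f -> intg f.
Proof.
move=> f2; have := L2_mul f2 (L2_cst 1).
by apply: eq_intg => x; rewrite mulr1.
Qed.

Lemma L2D f g : L2 f -> L2 g -> L2 (fun x => f x + g x).
Proof.
move=> f2 g2; split; first by apply: measurable_funD; exact: L2_meas.
apply: (@eq_intg (fun x => f x ^+ 2 + (2 * (f x * g x) + g x ^+ 2))).
  by move=> x; ring.
apply: intgD; first exact: L2_sq.
by apply: intgD; [apply/intgZ/L2_mul | exact: L2_sq].
Qed.

Lemma L2Z c f : L2 f -> L2 (fun x => c * f x).
Proof.
move=> f2; split; first by apply: measurable_funM => //; exact: L2_meas.
apply: (@eq_intg (fun x => c ^+ 2 * f x ^+ 2)).
  by move=> x; ring.
exact/intgZ/L2_sq.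
Qed.

Lemma L2N f : L2 f -> L2 (fun x => - f x).
Proof.
move=> f2; have := L2Z (-1) f2.
by under eq_fun do rewrite mulN1r.
Qed.

Lemma L2B f g : L2 f -> L2 g -> L2 (fun x => f x - g x).
Proof. by move=> f2 g2; apply: L2D => //; exact: L2N. Qed.

Lemma L2_sum (I : Type) (s : seq I) (Q : pred I) (F : I -> T -> R) :
  (forall i, Q i -> L2 (F i)) -> L2 (fun x => \sum_(i <- s | Q i) F i x).
Proof.
move=> iF; elim: s => [|i s IH].
  by under [X in L2 X]eq_fun do rewrite big_nil; exact: L2_cst.
under [X in L2 X]eq_fun do rewrite big_cons.
case: (boolP (Q i)) => Qi; last exact: IH.
by apply: L2D => //; exact: iF.
Qed.

Lemma le_L2 f g : measurable_fun setT f -> (forall x, `|f x| <= g x) ->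
  L2 g -> L2 f.
Proof.
move=> mf fg [mg g2]; split => //; apply: le_intg g2.
  exact: measurable_funX.
move=> x; rewrite normrX; apply: lerXn2r; rewrite ?nnegrE //.
exact: le_trans (fg x).
Qed.

Lemma ExMC f g : Ex (fun x => f x * g x) = Ex (fun x => g x * f x).
Proof. by apply: eq_Ex => x; rewrite mulrC. Qed.

Lemma Ex_sqrD f g : L2 f -> L2 g ->
  Ex (fun x => (f x + g x) ^+ 2) =
  Ex (fun x => f x ^+ 2) + 2 * Ex (fun x => f x * g x) + Ex (fun x => g x ^+ 2).
Proof.
move=> f2 g2.
rewrite (@eq_Ex _ (fun x => f x ^+ 2 + (2 * (f x * g x) + g x ^+ 2))); last first.
  by move=> x; ring.
have i1 := L2_sq f2; have i2 := L2_sq g2; have i3 := L2_mul f2 g2.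
have i4 := intgZ 2 i3.
by rewrite ExD ?ExD ?ExZ ?addrA //; exact: intgD.
Qed.

Lemma Ex_sqrB f g : L2 f -> L2 g ->
  Ex (fun x => (f x - g x) ^+ 2) =
  Ex (fun x => f x ^+ 2) - 2 * Ex (fun x => f x * g x) + Ex (fun x => g x ^+ 2).
Proof.
move=> f2 g2; rewrite (Ex_sqrD f2 (L2N g2)); congr (_ + _ + _).
  rewrite -mulrN; congr (_ * _); rewrite -ExN; last exact: L2_mul.
  by apply: eq_Ex => x; ring.
by apply: eq_Ex => x; ring.
Qed.

(* The discriminant of [t |-> E (f - t g)^2] is nonpositive. *)
Lemma Cauchy_Schwarz f g : L2 f -> L2 g ->
  Ex (fun x => f x * g x) ^+ 2 <=
  Ex (fun x => f x ^+ 2) * Ex (fun x => g x ^+ 2).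
Proof.
move=> f2 g2; set a := Ex (fun x => f x ^+ 2).
set b := Ex (fun x => f x * g x); set c := Ex (fun x => g x ^+ 2).
have a0 : 0 <= a by apply: Ex_ge0 => x; exact: sqr_ge0.
have c0 : 0 <= c by apply: Ex_ge0 => x; exact: sqr_ge0.
have H t : 0 <= a - 2 * t * b + t ^+ 2 * c.
  have := Ex_sqrB f2 (L2Z t g2).
  have -> : Ex (fun x => f x * (t * g x)) = t * b.
    by rewrite -ExZ ?(L2_mul f2 g2)//; apply: eq_Ex => x; ring.
  have -> : Ex (fun x => (t * g x) ^+ 2) = t ^+ 2 * c.
    by rewrite -ExZ ?(L2_sq g2)//; apply: eq_Ex => x; ring.
  rewrite -/a mulrA => <-; apply: Ex_ge0 => x; exact: sqr_ge0.
have [c00|cn0] := eqVneq c 0.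
  have [->|bn0] := eqVneq b 0; first by rewrite expr0n /= mulr_ge0.
  have := H ((a + 1) / (2 * b)); rewrite c00 mulr0 addr0.
  rewrite (_ : 2 * ((a + 1) / (2 * b)) * b = a + 1); last by field.
  lra.
have cp : 0 < c by rewrite lt_def cn0.
have := H (b / c).
rewrite (_ : a - 2 * (b / c) * b + (b / c) ^+ 2 * c = (a * c - b ^+ 2) / c);
  last by field.
by rewrite pmulr_lge0 ?invr_gt0 // subr_ge0.
Qed.

Lemma Cauchy_Schwarz_norm f g : L2 f -> L2 g ->
  `|Ex (fun x => f x * g x)| <=
  Num.sqrt (Ex (fun x => f x ^+ 2)) * Num.sqrt (Ex (fun x => g x ^+ 2)).
Proof.
move=> f2 g2; rewrite -sqrtrM; last by apply: Ex_ge0 => x; exact: sqr_ge0.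
by rewrite -sqrtr_sqr ler_wsqrtr // Cauchy_Schwarz.
Qed.

End Expectation.

Section Moments.
Context d (T : measurableType d) (R : realType) (mu : probability T R).
Implicit Types f g : T -> R.

Definition mom f :=
  measurable_fun setT f /\ forall k, intg mu (fun x => `|f x| ^+ k).

Lemma mom_cst c : mom (fun _ => c).
Proof. by split => [|k]; [exact: measurable_cst | exact: intg_cst]. Qed.

Lemma momX_intg f k : mom f -> intg mu (fun x => f x ^+ k).
Proof.
move=> [mf fk]; apply: le_intg (fk k); first exact: measurable_funX.
by move=> x; rewrite normrX.
Qed.

Lemma mom_intg f : mom f -> intg mu f.
Proof. by move=> /(momX_intg 1); apply: eq_intg => x; rewrite expr1. Qed.

Lemma mom_L2 f : mom f -> L2 mu f.
Proof. by move=> mf; split; [case: mf | exact: momX_intg]. Qed.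

Lemma le_mom f g : measurable_fun setT f -> (forall x, `|f x| <= g x) ->
  mom g -> mom f.
Proof.
move=> mf fg [mg gk]; split => // k; apply: le_intg (gk k).
  by apply: measurable_funX; exact: measurableT_comp.
move=> x; rewrite normrX normr_id; apply: lerXn2r; rewrite ?nnegrE //.
exact: le_trans (ler_norm _).
Qed.

Lemma exprD_le (a b : R) k : 0 <= a -> 0 <= b ->
  (a + b) ^+ k <= 2 ^+ k * (a ^+ k + b ^+ k).
Proof.
move=> a0 b0; wlog ab : a b a0 b0 / a <= b => [H|].
  by have [/H->//|/ltW/H] := leP a b; rewrite (addrC b) (addrC (b ^+ k)); apply.
apply: (@le_trans _ _ ((2 * b) ^+ k)).
  by apply: lerXn2r; rewrite ?nnegrE ?addr_ge0 ?mulr_ge0 //; lra.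
by rewrite exprMn ler_pM2l ?exprn_gt0 // lerDr exprn_ge0.
Qed.

Lemma momD f g : mom f -> mom g -> mom (fun x => f x + g x).
Proof.
move=> [mf fk] [mg gk]; split => [|k]; first exact: measurable_funD.
apply: (@le_intg _ _ _ _ _ (fun x => 2 ^+ k * (`|f x| ^+ k + `|g x| ^+ k))).
- by apply: measurable_funX; apply: measurableT_comp => //; exact: measurable_funD.
- move=> x; rewrite ger0_norm ?exprn_ge0 //.
  apply: (le_trans _ (exprD_le _ _ _)) => //.
  by apply: lerXn2r; rewrite ?nnegrE ?addr_ge0 // ler_normD.
- by apply/intgZ/intgD.
Qed.

Lemma momM f g : mom f -> mom g -> mom (fun x => f x * g x).
Proof.
move=> [mf fk] [mg gk]; split => [|k]; first exact: measurable_funM.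
apply: (@le_intg _ _ _ _ _ (fun x => `|f x| ^+ (k * 2) + `|g x| ^+ (k * 2))).
- by apply: measurable_funX; apply: measurableT_comp => //; exact: measurable_funM.
- move=> x; rewrite ger0_norm ?exprn_ge0 // normrM exprMn !exprM.
  have := sqr_ge0 (`|f x| ^+ k - `|g x| ^+ k).
  have : 0 <= `|f x| ^+ k by rewrite exprn_ge0.
  have : 0 <= `|g x| ^+ k by rewrite exprn_ge0.
  nra.
- exact: intgD.
Qed.

Lemma momZ c f : mom f -> mom (fun x => c * f x).
Proof. by apply: momM; exact: mom_cst. Qed.

Lemma mom_norm f : mom f -> mom (fun x => `|f x|).
Proof.
move=> [mf fk]; split=> [|k]; first exact: measurableT_comp.
by apply: eq_intg (fk k) => x; rewrite normr_id.
Qed.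

Lemma momX f k : mom f -> mom (fun x => f x ^+ k).
Proof.
move=> mf; elim: k => [|k IH].
  by under eq_fun do rewrite expr0; exact: mom_cst.
by under eq_fun do rewrite exprS; exact: momM.
Qed.

Lemma mom_sum (I : Type) (s : seq I) (Q : pred I) (F : I -> T -> R) :
  (forall i, Q i -> mom (F i)) -> mom (fun x => \sum_(i <- s | Q i) F i x).
Proof.
move=> iF; elim: s => [|i s IH].
  by under eq_fun do rewrite big_nil; exact: mom_cst.
under eq_fun do rewrite big_cons.
case: (boolP (Q i)) => Qi; last exact: IH.
by apply: momD => //; exact: iF.
Qed.

Lemma mom_poly (p : {poly R}) f : mom f -> mom (fun x => p.[f x]).
Proof.
move=> mf; under eq_fun do rewrite horner_coef.
by apply: mom_sum => i _; apply: momZ; exact: momX.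
Qed.

End Moments.

(** * Transfer between equal laws *)

Section SameLaw.
Context d (T : measurableType d) (R : realType) (P : probability T R).
Context d' (T' : measurableType d') (Q : probability T' R).
Context d'' (S : measurableType d'').

(** Tested on nonnegative measurable functions rather than on sets: this is the form in which
    Tonelli and changes of density deliver an equality of laws, and no image measure has to be
    formed. *)
Definition same_law (Y : T -> S) (Z : T' -> S) :=
  forall F : S -> \bar R, measurable_fun setT F -> (forall s, (0 <= F s)%E) ->
  (\int[P]_x F (Y x) = \int[Q]_z F (Z z))%E.

Variables (Y : T -> S) (Z : T' -> S).
Hypotheses (mY : measurable_fun setT Y) (mZ : measurable_fun setT Z).
Hypothesis YZ : same_law Y Z.
Implicit Type f : S -> R.

Lemma intg_same_law f : measurable_fun setT f -> intg Q (fun z => f (Z z)) ->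
  intg P (fun x => f (Y x)).
Proof.
move=> mf fi; apply/integrableP; split.
  by apply/measurable_EFinP; exact: (measurableT_comp mf mY).
move/integrableP: fi => [_].
rewrite -(YZ (F := fun s => `|(f s)%:E|%E)) //.
by apply: measurableT_comp => //; exact/measurable_EFinP.
Qed.

Lemma ge0_Ex_same_law f : measurable_fun setT f -> (forall s, 0 <= f s) ->
  Ex P (fun x => f (Y x)) = Ex Q (fun z => f (Z z)).
Proof.
move=> mf f0; rewrite /Ex /Rintegral; congr fine.
by rewrite -(YZ (F := EFin \o f)) //; exact/measurable_EFinP.
Qed.

Lemma Ex_same_law f : measurable_fun setT f -> intg Q (fun z => f (Z z)) ->
  Ex P (fun x => f (Y x)) = Ex Q (fun z => f (Z z)).
Proof.
move=> mf fi.
(* A difference of two nonnegative functions, to each of which the nonnegative case applies. *)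
have fe z : f z = (`|f z| + f z) - `|f z| by ring.
have ni := intg_norm fi; have si := intgD ni fi.
have mn : measurable_fun setT (fun s => `|f s|) by exact: measurableT_comp.
have ms : measurable_fun setT (fun s => `|f s| + f s) by exact: measurable_funD.
rewrite (eq_Ex _ (fun z => fe (Z z))) ExB //.
rewrite -(ge0_Ex_same_law ms); last first.
  by move=> x; have := ler_norm (- f x); rewrite normrN; lra.
rewrite -(ge0_Ex_same_law mn) // -ExB; last 2 first.
- exact: (intg_same_law ms).
- exact: (intg_same_law mn).
by apply: eq_Ex => x /=; exact: fe.
Qed.

Lemma L2_same_law f : measurable_fun setT f -> L2 Q (fun z => f (Z z)) ->
  L2 P (fun x => f (Y x)).
Proof.
move=> mf [_ f2]; split; first exact: (measurableT_comp mf mY).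
by apply: (intg_same_law (f := fun s => f s ^+ 2)) => //; exact: measurable_funX.
Qed.

Lemma mom_same_law f : measurable_fun setT f -> mom Q (fun z => f (Z z)) ->
  mom P (fun x => f (Y x)).
Proof.
move=> mf [_ fk]; split=> [|k]; first exact: (measurableT_comp mf mY).
apply: (intg_same_law (f := fun s => `|f s| ^+ k)) => //.
by apply: measurable_funX; exact: measurableT_comp.
Qed.

End SameLaw.

Section DensityLaw.
Context d (T : measurableType d) (R : realType) (P : probability T R).
Context d' (S : measurableType d') (Q : probability S R).
Variables (Y : T -> S) (D : S -> R).
Hypotheses (mY : measurable_fun setT Y) (D0 : forall s, 0 <= D s).
Hypothesis lawD : forall F : S -> \bar R, measurable_fun setT F ->
  (forall s, (0 <= F s)%E) ->
  (\int[P]_x F (Y x) = \int[Q]_s (F s * (D s)%:E))%E.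
Implicit Type h : S -> R.

Lemma intg_density h : measurable_fun setT h -> intg Q (fun s => h s * D s) ->
  intg P (fun x => h (Y x)).
Proof.
move=> mh hi; apply/integrableP; split.
  by apply/measurable_EFinP; exact: (measurableT_comp mh mY).
rewrite (lawD (F := fun s => `|(h s)%:E|%E)) //; last first.
  by apply: measurableT_comp => //; exact/measurable_EFinP.
move/integrableP: hi => [_]; apply: le_lt_trans.
rewrite le_eqVlt; apply/orP; left; apply/eqP.
by apply: eq_integral => y _ /=; rewrite normrM (ger0_norm (D0 _)).
Qed.

Lemma ge0_Ex_density h : measurable_fun setT h -> (forall s, 0 <= h s) ->
  Ex P (fun x => h (Y x)) = Ex Q (fun s => h s * D s).
Proof.
move=> mh h0; rewrite /Ex /Rintegral; congr fine.
by rewrite (lawD (F := EFin \o h)) //; exact/measurable_EFinP.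
Qed.

Lemma Ex_density h : measurable_fun setT h -> intg Q (fun s => h s * D s) ->
  Ex P (fun x => h (Y x)) = Ex Q (fun s => h s * D s).
Proof.
move=> mf fi.
have ni : intg Q (fun y => `|h y| * D y).
  by apply: eq_intg (intg_norm fi) => y; rewrite normrM (ger0_norm (D0 _)).
have si : intg Q (fun y => (`|h y| + h y) * D y).
  by apply: eq_intg (intgD ni fi) => y; rewrite mulrDl.
have mn : measurable_fun setT (fun s => `|h s|) by exact: measurableT_comp.
have ms : measurable_fun setT (fun s => `|h s| + h s) by exact: measurable_funD.
transitivity (Ex P (fun x => (`|h (Y x)| + h (Y x)) - `|h (Y x)|)).
  by apply: eq_Ex => x; ring.
rewrite ExB; [|exact: (intg_density ms)|exact: (intg_density mn)].
rewrite (ge0_Ex_density ms); last first.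
  by move=> x; have := ler_norm (- h x); rewrite normrN; lra.
by rewrite (ge0_Ex_density mn) // -ExB //; apply: eq_Ex => x; ring.
Qed.

End DensityLaw.

(** * Gaussian densities and integration by parts *)

Section Affine.
Context {R : realType}.
Notation leb := (@lebesgue_measure R).
Implicit Types F : R -> \bar R.

(** The image of Lebesgue measure under the affine map, multiplied by [s], agrees with Lebesgue
    measure on half-open intervals, and these determine it. *)
Lemma lebesgue_affine (m s : R) F : 0 < s -> measurable_fun setT F ->
  (forall y, (0 <= F y)%E) ->
  (\int[leb]_x (F (m + s * x)%R * s%:E) = \int[leb]_y F y)%E.
Proof.
move=> s0 mF F0.
pose phi : measurableTypeR R -> measurableTypeR R := fun x : R => m + s * x.
have mphi : measurable_fun setT phi.
  by apply: measurable_funD => //; exact: measurable_funM.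
pose k : {nonneg R} := NngNum (ltW s0).
pose push := (pushforward leb phi : {measure set (measurableTypeR R) -> \bar R}).
pose nu := (mscale k (push mphi) : {measure set (measurableTypeR R) -> \bar R}).
have nuE A : measurable A -> leb A = nu A.
  apply: lebesgue_measure_unique => _ [[a b] _ <-].
  have pre : phi @^-1` `]a, b]%classic = `](a - m) / s, (b - m) / s]%classic.
    apply/seteqP; split => x /=; rewrite in_itv /= in_itv /=
      ltr_pdivrMr // ler_pdivlMr // ltrBlDl lerBrDl (mulrC x) //.
  change (leb `]a, b]%classic = (s%:E * leb (phi @^-1` `]a, b]%classic))%E).
  rewrite pre.
  rewrite !lebesgue_measure_itv /= !lte_fin ltr_pM2r ?invr_gt0 // ltrD2r.
  case: ifP => _; last by rewrite mule0.
  rewrite -!EFinB -EFinM; congr EFin; field; exact: lt0r_neq0.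
rewrite [RHS](eq_measure_integral nu); last first.
  by move=> A mA _; first [exact: nuE | exact/esym/nuE].
rewrite ge0_integral_mscale //= ge0_integral_pushforward //.
rewrite preimage_setT ge0_integralZr //; last 2 first.
- exact: measurableT_comp.
- by rewrite lee_fin ltW.
by rewrite muleC.
Qed.

(** The Radon-Nikodym derivative of the normal law and [normal_pdf] have the same integral over
    every measurable set, hence agree almost everywhere. *)
Lemma normal_density (m s : R) F : s != 0 -> measurable_fun setT F ->
  (forall y, (0 <= F y)%E) ->
  (\int[normal_prob m s]_x F x = \int[leb]_x (F x * (normal_pdf m s x)%:E))%E.
Proof.
move=> s0 mF F0; have dom := normal_prob_dominates m s.
rewrite -(Radon_Nikodym_SigmaFinite.change_of_variables dom) //.
have rni := Radon_Nikodym_SigmaFinite.f_integrable dom.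
have mpdf : measurable_fun setT (EFin \o normal_pdf m s).
  by apply/measurable_EFinP; exact: measurable_normal_pdf.
apply: ae_eq_integral => //.
- by apply: emeasurable_funM => //; exact: measurable_int rni.
- exact: emeasurable_funM.
- apply: ae_eqe_mul2l; apply: integral_ae_eq => //.
  by move=> E _ mE; rewrite -Radon_Nikodym_SigmaFinite.f_integral.
Qed.

Lemma gauss_density F : measurable_fun setT F -> (forall y, (0 <= F y)%E) ->
  (\int[@std_gauss R]_x F x = \int[leb]_x (F x * (normal_pdf 0 1 x)%:E))%E.
Proof. by move=> mF F0; exact: (@normal_density 0 1 F (oner_neq0 R)). Qed.

Lemma measurable_affine (m s : R) : measurable_fun setT (fun x : R => m + s * x).
Proof. by apply: measurable_funD => //; exact: measurable_funM. Qed.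

Lemma normal_peak_scale (s : R) : 0 < s -> normal_peak s = s^-1 * normal_peak 1.
Proof.
move=> s0; rewrite /normal_peak -invfM; congr (_^-1).
by rewrite expr1n mul1r -mulrnAr sqrtrM ?sqr_ge0 // sqrtr_sqr gtr0_norm.
Qed.

Lemma normal_affine (m s : R) F : 0 < s -> measurable_fun setT F ->
  (forall y, (0 <= F y)%E) ->
  (\int[@std_gauss R]_x F (m + s * x)%R = \int[normal_prob m s]_y F y)%E.
Proof.
move=> s0 mF F0; have sn := lt0r_neq0 s0.
have mFa : measurable_fun setT (fun x => F (m + s * x)%R).
  by apply: measurableT_comp => //; exact: measurable_affine.
have mpdf : measurable_fun setT (EFin \o normal_pdf m s).
  by apply/measurable_EFinP; exact: measurable_normal_pdf.
rewrite (gauss_density mFa (fun x => F0 _)).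
have ND := @normal_density m s F sn mF F0.
rewrite ND.
have L := @lebesgue_affine m s (fun y => F y * (normal_pdf m s y)%:E)%E s0
  (emeasurable_funM mF mpdf).
rewrite -L; last by move=> y; rewrite mule_ge0 // lee_fin normal_pdf_ge0.
apply: eq_integral => x _; rewrite -muleA -EFinM; congr (_ * _%:E)%E.
rewrite !normal_pdfE ?oner_neq0 // /normal_fun.
rewrite [RHS]mulrAC; congr (_ * expR _); last by field.
by rewrite (normal_peak_scale s0) mulrAC mulVf ?mul1r.
Qed.

(** The density of the normal law of mean [m] and standard deviation [s] relative to the standard
    normal law. *)
Definition gauss_ratio (m s x : R) : R :=
  s^-1 * expR (x ^+ 2 / 2 - (x - m) ^+ 2 / (2 * s ^+ 2)).

Lemma gauss_ratio_ge0 (m s x : R) : 0 < s -> 0 <= gauss_ratio m s x.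
Proof. by move=> s0; rewrite mulr_ge0 ?expR_ge0 // invr_ge0 ltW. Qed.

Lemma measurable_gauss_ratio (m s : R) : measurable_fun setT (gauss_ratio m s).
Proof.
by rewrite /gauss_ratio; mfun.
Qed.

Lemma gauss_affine (m s : R) F : 0 < s -> measurable_fun setT F ->
  (forall y, (0 <= F y)%E) ->
  (\int[@std_gauss R]_x F (m + s * x)%R =
   \int[@std_gauss R]_y (F y * (gauss_ratio m s y)%:E))%E.
Proof.
move=> s0 mF F0; have sn := lt0r_neq0 s0; rewrite (normal_affine m s0 mF F0).
have mr : measurable_fun setT (EFin \o gauss_ratio m s).
  by apply/measurable_EFinP; exact: measurable_gauss_ratio.
rewrite (@normal_density m s F sn mF F0).
rewrite [RHS]gauss_density; last 2 first.
- exact: (emeasurable_funM mF mr).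
- by move=> y; rewrite mule_ge0 // lee_fin gauss_ratio_ge0.
apply: eq_integral => x _; rewrite -muleA -EFinM; congr (_ * _%:E)%E.
rewrite !normal_pdfE ?oner_neq0 // /normal_fun.
rewrite /gauss_ratio [RHS]mulrACA -expRD; congr (_ * expR _); last by field.
exact: normal_peak_scale.
Qed.

Lemma gauss_ratio_int (m s : R) : 0 < s ->
  intg (@std_gauss R) (gauss_ratio m s) /\ Ex (@std_gauss R) (gauss_ratio m s) = 1.
Proof.
move=> s0.
have := @gauss_affine m s (fun _ => 1%E) s0 (measurable_cst _) (fun=> lee01).
rewrite integral_cst //= mul1e probability_setT.
under eq_integral do rewrite mul1e; move=> h; split.
  apply: ge0_intg => [|x|]; first exact: measurable_gauss_ratio.
    exact: gauss_ratio_ge0.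
  by rewrite -h ltry.
by rewrite /Ex /Rintegral -h.
Qed.

(* Completing the square in the exponent. *)
Lemma gauss_exp_quad (a b : R) : a < 1 / 2 ->
  intg (@std_gauss R) (fun x => expR (a * x ^+ 2 + b * x)) /\
  Ex (@std_gauss R) (fun x => expR (a * x ^+ 2 + b * x)) =
    (Num.sqrt (1 - 2 * a))^-1 * expR (b ^+ 2 / (2 * (1 - 2 * a))).
Proof.
move=> a2; set q := 1 - 2 * a; have q0 : 0 < q by rewrite /q; lra.
set s := (Num.sqrt q)^-1; have s0 : 0 < s by rewrite invr_gt0 sqrtr_gt0.
have s2 : s ^+ 2 = q^-1 by rewrite exprVn sqr_sqrtr // ltW.
set c := s * expR (b ^+ 2 / (2 * q)).
have E x : expR (a * x ^+ 2 + b * x) = c * gauss_ratio (b / q) s x.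
  rewrite /c /gauss_ratio [RHS]mulrACA divff ?lt0r_neq0 // mul1r -expRD.
  congr expR; rewrite s2 /q; field; rewrite -/q ?lt0r_neq0 //.
have [i e] := gauss_ratio_int (b / q) s0.
have fE : (fun x => expR (a * x ^+ 2 + b * x)) = (fun x => c * gauss_ratio (b / q) s x).
  exact/funext.
by rewrite fE; split; [exact: intgZ | rewrite ExZ // e mulr1].
Qed.

End Affine.

Section Stein.
Context {R : realType}.
Notation G := (@std_gauss R).

Lemma mom_gauss : mom G (fun x : R => x).
Proof.
split => [|[|k]]; first exact: measurable_id.
  by under eq_fun do rewrite expr0; exact: intg_cst.
have q0 : (0 : R) < 1 / 2 by lra.
have e1 := (gauss_exp_quad 1 q0).1; have e2 := (gauss_exp_quad (- 1) q0).1.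
apply: (le_intg _ _ (intgZ (k.+1%:R ^+ k.+1) (intgD e1 e2))).
  by apply: measurable_funX; exact: normr_measurable.
move=> x; rewrite ger0_norm ?exprn_ge0 // !mul0r !add0r mul1r mulN1r.
have k0 : (0 : R) < k.+1%:R by [].
(* Raised to the power [k + 1], this bounds the moment by a multiple of
   [exp |x| <= exp x + exp (- x)]. *)
have H : `|x| <= k.+1%:R * expR (`|x| / k.+1%:R).
  rewrite -ler_pdivrMl //; apply: le_trans (expR_ge1Dx _).
  by rewrite [leLHS]mulrC lerDr ler01.
apply: (@le_trans _ _ (k.+1%:R ^+ k.+1 * expR `|x|)).
  apply: le_trans (lerXn2r _ _ _ H) _; rewrite ?nnegrE ?mulr_ge0 ?expR_ge0 //.
  rewrite exprMn ler_pM2l ?exprn_gt0 // -expRM_natl.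
  by rewrite mulrCA divff ?mulr1 ?lt0r_neq0.
rewrite ler_pM2l ?exprn_gt0 //; case: (ler0P x) => _;
  by rewrite ?lerDr ?lerDl expR_ge0.
Qed.

Lemma intg_expR_norm (c : R) : intg G (fun x : R => expR (c * `|x|)).
Proof.
have q0 : (0 : R) < 1 / 2 by lra.
have e1 := (gauss_exp_quad c q0).1; have e2 := (gauss_exp_quad (- c) q0).1.
apply: (le_intg _ _ (intgD e1 e2)).
  apply: (measurableT_comp (@measurable_expR _)).
  by apply: measurable_funM => //; exact: normr_measurable.
move=> x; rewrite ger0_norm ?expR_ge0 // !mul0r !add0r.
by case: (ler0P x) => _; rewrite ?mulrN ?mulNr ?lerDr ?lerDl expR_ge0.
Qed.

Lemma L2_expR_norm (c : R) : L2 G (fun x : R => expR (c * `|x|)).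
Proof.
have i := intg_expR_norm (2 * c); split.
  exact: intg_measurable (intg_expR_norm c).
by apply: eq_intg i => x; rewrite -expRM_natl mulrA.
Qed.

Lemma Ex_gauss_affine (m s : R) (f : R -> R) : 0 < s -> measurable_fun setT f ->
  intg G (fun y => f y * gauss_ratio m s y) ->
  intg G (fun x => f (m + s * x)) /\
  Ex G (fun x => f (m + s * x)) = Ex G (fun y => f y * gauss_ratio m s y).
Proof.
move=> s0 mf fi; have r0 y := gauss_ratio_ge0 m y s0.
have ma := measurable_affine m s.
have law F := gauss_affine m s0 (F := F).
by split; [exact: (intg_density (P := G) (Q := G) ma r0 law mf fi) |
  exact: (Ex_density (P := G) (Q := G) ma r0 law mf fi)].
Qed.

Lemma expR_taylor1 (u : R) : `|expR u - 1 - u| <= u ^+ 2 * expR `|u|.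
Proof.
have e0 := expR_gt0 u; have e1 := expR_ge1Dx u; have e2 := expR_ge1Dx (- u).
have em : expR (- u) * expR u = 1 by rewrite -expRD addNr expR0.
rewrite ger0_norm; last by lra.
(* Equivalent to [(1 - u) exp u <= 1], that is, to [1 - u <= exp (- u)]. *)
have h : expR u - 1 - u <= u * (expR u - 1) by nra.
apply: (le_trans h); case: (ler0P u) => u0; last by nra.
have e3 : 1 <= expR (- u) by rewrite -expR0 ler_expR; lra.
nra.
Qed.

Lemma poly_taylor1 (p : {poly R}) (b x : R) : `|b| <= 1 ->
  `|p.[x + b] - p.[x] - b * p^`().[x]| <=
  b ^+ 2 * \sum_(i < size p) `|p^`N(i).[x]|.
Proof.
move=> b1; case: (ltnP 1 (size p)) => sp; last first.
  have -> : p.[x + b] - p.[x] - b * p^`().[x] = 0.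
    by rewrite (size1_polyC sp) derivC !hornerE ?mulr0 subrr ?subr0.
  by rewrite normr0 mulr_ge0 ?sqr_ge0 // sumr_ge0.
have -> : p.[x + b] = \sum_(i < size p) p^`N(i).[x] * b ^+ i.
  by rewrite nderiv_taylor //; exact: mulrC.
move: sp; case sE: (size p) => [|[|n]] // _.
rewrite !big_ord_recl /= nderivn0 nderivn1 expr0 expr1 mulr1.
rewrite (_ : _ - b * _ = \sum_(i < n) p^`N(i.+2).[x] * b ^+ i.+2); last first.
  rewrite /bump /=; under eq_bigr do rewrite !add1n.
  by rewrite [b * _]mulrC; ring.
apply: le_trans (ler_norm_sum _ _ _) _.
apply: (@le_trans _ _ (b ^+ 2 * \sum_(i < n) `|p^`N(i.+2).[x]|)); last first.
  rewrite ler_wpM2l ?sqr_ge0 // addrA lerDr addr_ge0 //.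
rewrite mulr_sumr; apply: ler_sum => i _.
rewrite normrM mulrC normrX ler_wpM2r // -addn2 exprD real_normK ?num_real //.
by rewrite ler_piMl ?sqr_ge0 ?exprn_ile1.
Qed.

Lemma norm_Ex_lin_le (f g h q : R -> R) (b : R) :
  intg G f -> intg G g -> intg G h -> intg G q ->
  (forall x, `|f x - g x - b * h x| <= q x) ->
  `|Ex G f - Ex G g - b * Ex G h| <= Ex G q.
Proof.
move=> fi gi hi qi H.
have i1 := intgB fi gi; have i2 := intgZ b hi; have i3 := intgB i1 i2.
rewrite -(ExZ _ hi) -(ExB fi gi) -(ExB i1 i2).
apply: le_trans (le_norm_Ex i3) _; apply: le_Ex => //; exact: intg_norm.
Qed.

(* Both sides are the derivative at [b = 0] of [E p(x + b)], computed before
   and after shifting the Gaussian density. *)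
Lemma stein (p : {poly R}) :
  Ex G (fun x => x * p.[x]) = Ex G (fun x => p^`().[x]).
Proof.
have momp q : mom G (fun x : R => q.[x]) by exact: mom_poly mom_gauss.
(* [q1] and [q2] are integrable majorants, up to the factor [b^2], of the second-order remainders of
   [p(x + b)] and of [p(y)] times the shifted density. The two first-order expansions of the same
   expectation therefore differ by O(b^2), and dividing by [b] gives [est]. *)
pose q1 (x : R) := \sum_(i < size p) `|p^`N(i).[x]|.
have q1i : intg G q1 by apply: intg_sum => i _; exact/intg_norm/mom_intg.
pose q2 (x : R) := `|p.[x]| * ((`|x| + 1) ^+ 2 * expR (`|x| + 1) + 1).
have q2i : intg G q2.
  have m1 : mom G (fun x : R => `|p.[x]| * (`|x| + 1) ^+ 2).
    apply: momM; first exact/mom_norm/momp.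
    apply: momX; apply: momD; last exact: mom_cst.
    exact: mom_norm mom_gauss.
  have i1 := L2_mul (L2Z (expR 1) (mom_L2 m1)) (L2_expR_norm 1).
  apply: eq_intg (intgD i1 (intg_norm (mom_intg (momp p)))) => x.
  by rewrite /q2 expRD mul1r; ring.
have xpi : intg G (fun x => x * p.[x]) by apply: mom_intg; exact: momM mom_gauss _.
have pi := mom_intg (momp p); have p'i := mom_intg (momp p^`()).
set D := LHS; set D' := RHS.
have est b : 0 < b -> b <= 1 -> `|D' - D| <= b * (Ex G q1 + Ex G q2).
  move=> b0 b1.
  have ratioE y : gauss_ratio b 1 y = expR (b * y - b ^+ 2 / 2).
    by rewrite /gauss_ratio invr1 mul1r expr1n mulr1; congr expR; field.
  have pw y : `|p.[y] * gauss_ratio b 1 y - p.[y] - b * (y * p.[y])| <=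
      b ^+ 2 * q2 y.
    rewrite ratioE; set u := b * y - b ^+ 2 / 2.
    rewrite [X in `|X|](_ : _ = p.[y] * ((expR u - 1 - u) - b ^+ 2 / 2)); last first.
      by rewrite /u; ring.
    rewrite normrM /q2 mulrCA ler_wpM2l //.
    apply: le_trans (ler_normB _ _) _.
    have ub : `|u| <= b * (`|y| + 1).
      rewrite /u; apply: le_trans (ler_normB _ _) _.
      rewrite normrM (ger0_norm (ltW b0)) mulrDr lerD2l mulr1.
      rewrite ger0_norm ?divr_ge0 ?sqr_ge0 //; nra.
    have ub2 : `|u| <= `|y| + 1.
      by apply: le_trans ub _; rewrite ler_piMl // addr_ge0.
    rewrite mulrDr; apply: lerD; last first.
      by rewrite ger0_norm ?divr_ge0 ?sqr_ge0 //; nra.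
    apply: le_trans (expR_taylor1 u) _; rewrite mulrA.
    apply: ler_pM; rewrite ?sqr_ge0 ?expR_ge0 //; last by rewrite ler_expR.
    by rewrite -exprMn -real_normK ?num_real // lerXn2r ?nnegrE ?mulr_ge0 ?addr_ge0 // ltW.
  have mr : intg G (fun y => p.[y] * gauss_ratio b 1 y).
    have ii := intgD (intgZ (b ^+ 2) q2i) (intgD (intg_norm pi) (intg_norm (intgZ b xpi))).
    apply: le_intg ii => [|y].
      apply: measurable_funM; first by case: (momp p).
      exact: measurable_gauss_ratio.
    have := pw y; set A := _ * gauss_ratio b 1 y; set B := p.[y]; set C := b * _.
    move=> h; have := ler_normD (A - B - C) (B + C); rewrite (_ : _ + (B + C) = A); last by ring.
    have := ler_normD B C; move: h; set z1 := `|A - B - C|; lra.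
  have [si sE] := Ex_gauss_affine ltr01 (proj1 (momp p)) mr.
  have fi := mom_intg (mom_poly p (momD (mom_cst G b) (momZ 1 mom_gauss))).
  have e1 : `|Ex G (fun x => p.[b + 1 * x]) - Ex G (fun x => p.[x]) - b * D'| <= b ^+ 2 * Ex G q1.
    rewrite /D' -(ExZ _ q1i); apply: norm_Ex_lin_le => //; first exact: intgZ.
    by move=> x; rewrite mul1r [b + x]addrC poly_taylor1 // ger0_norm // ltW.
  have e2 : `|Ex G (fun y => p.[y] * gauss_ratio b 1 y) - Ex G (fun x => p.[x]) - b * D| <= b ^+ 2 * Ex G q2.
    by rewrite /D -(ExZ _ q2i); apply: norm_Ex_lin_le => //; exact: intgZ.
  rewrite -(ler_pM2l b0) -{1}(ger0_norm (ltW b0)) -normrM.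
  move: e1 e2; rewrite sE; set a := Ex G _; set a' := Ex G _.
  rewrite !ler_norml => /andP[? ?] /andP[? ?]; apply/andP; split; nra.
apply/esym/eqP; rewrite -subr_eq0 -normr_le0; apply/ler_addgt0Pl => e e0.
set K := Ex G q1 + Ex G q2 in est.
have K0 : 0 <= K.
  apply: addr_ge0; apply: Ex_ge0 => x; first exact: sumr_ge0.
  by rewrite mulr_ge0 // addr_ge0 // mulr_ge0 ?sqr_ge0 ?expR_ge0.
have K1 : 0 < K + 1 by lra.
pose b := Num.min 1 (e / (K + 1)).
have b0 : 0 < b by rewrite lt_min ltr01 divr_gt0.
apply: (le_trans (est b b0 _)); first by rewrite ge_min lexx.
rewrite addr0; apply: (@le_trans _ _ (e / (K + 1) * K)).
  by rewrite ler_wpM2r // ge_min lexx orbT.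
by rewrite mulrAC ler_pdivrMr // ler_wpM2l ?ltW //; lra.
Qed.

End Stein.

(** * Hermite polynomials *)

Section Hermite.
Context {R : realType}.
Notation G := (@std_gauss R).

(** The recursion is the one produced by differentiating [He_k(x) exp(- x^2 / 2)], up to sign;
    [hermiteE] rests on this. *)
Fixpoint He (k : nat) : {poly R} :=
  if k is k'.+1 then 'X * He k' - (He k')^`() else 1.

Lemma derivHe k : (He k.+1)^`() = k.+1%:R *: He k.
Proof.
have d1 : (1 : {poly R})^`() = 0 by rewrite -polyC1 derivC.
elim: k => [|k IH]; first by rewrite /= d1 subr0 mulr1 derivX scale1r.
rewrite [He k.+2]/= derivB derivM derivX mul1r -/(He k.+1) IH derivZ.
rewrite -scalerAr -addrA -scalerBr (_ : 'X * He k - _ = He k.+1) //.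
by rewrite -[X in X + _ = _]scale1r -scalerDl nat1r.
Qed.

Lemma HeS k : He k.+1 = 'X * He k - k%:R *: He k.-1.
Proof.
case: k => [|k]; first by rewrite /= -polyC1 derivC scale0r.
by rewrite [LHS]/= -/(He k.+1) derivHe.
Qed.

Lemma hermiteE k (x : R) :
  hermite k x = (Num.sqrt (k`!%:R))^-1 * (He k).[x].
Proof.
rewrite /hermite.
pose q : {poly R} := (- 2^-1) *: 'X^2.
have qE x0 : q.[x0] = - (x0 ^+ 2) / 2 by rewrite hornerZ hornerXn mulNr mulrC mulNr.
have q'E x0 : q^`().[x0] = - x0.
  by rewrite derivZ derivXn /= !hornerE; field.
clearbody q.
have -> : derive1n k (fun t : R => expR (- (t ^+ 2) / 2)) =
    (fun x => (-1) ^+ k * (He k).[x] * expR q.[x]).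
  elim: k => [|k IH].
    apply/funext => t /=; have -> : (1 : {poly R}).[t] = 1 by rewrite hornerE.
    by rewrite qE mulr1 mul1r.
  rewrite /= IH; apply/funext => t; rewrite derive1E.
  have d1 : is_derive t 1 (expR \o horner q) (expR q.[t] * q^`().[t]).
    exact: is_derive1_comp.
  have d2 : is_derive t 1 (horner ((-1) ^+ k *: He k)) (((-1) ^+ k *: He k)^`()).[t].
    exact: is_derive_poly.
  have d3 := is_deriveM d2 d1.
  rewrite (_ : (fun x => _) = horner ((-1) ^+ k *: He k) * (expR \o horner q)); last first.
    by apply/funext => z; rewrite fctE /= (hornerZ _ (He k)).
  rewrite (@derive_val _ _ _ _ _ _ _ d3) /= /GRing.scale /= q'E derivZ !hornerZ.
  rewrite hornerD hornerN (hornerM 'X (He k)) hornerX exprS.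
  have key (a b c e y : R) : a * b * (e * - y) + e * (a * c) = -1 * a * (y * b - c) * e.
    by ring.
  exact: key.
have e1 : (-1) ^+ k * (-1) ^+ k = 1 :> R.
  by rewrite -exprD addnn -muln2 exprM sqrr_sign.
have e2 : expR (x ^+ 2 / 2) * expR q.[x] = 1.
  by rewrite -expRD qE mulNr addrN expR0.
move: e1 e2; set s := (-1) ^+ k; set a := (Num.sqrt _)^-1; set b := expR _.
set c := expR _ => e1 e2.
transitivity ((s * s) * (b * c) * (a * (He k).[x])); first by ring.
by rewrite e1 e2 !mul1r.
Qed.

Definition hn (k : nat) (x : R) : R := (Num.sqrt (k`!%:R))^-1 * (He k).[x].

Lemma hermite_hn k : @hermite R k = hn k.
Proof. by apply/funext => x; exact: hermiteE. Qed.

Lemma mom_hn k : mom G (hn k).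
Proof. by apply: momZ; exact: mom_poly mom_gauss. Qed.

Lemma L2_hn k : L2 G (hn k).
Proof. exact: mom_L2 (mom_hn k). Qed.

End Hermite.

(** * Orthogonality of the Hermite polynomials *)

Section ProductProbability.
Context d1 d2 (T1 : measurableType d1) (T2 : measurableType d2) (R : realType).
Variables (P1 : probability T1 R) (P2 : probability T2 R).

Definition prodP : set (T1 * T2) -> \bar R := (P1 \x P2)%E.

HB.instance Definition _ := Measure.on prodP.

Lemma prodP_setT : prodP setT = 1%E.
Proof.
rewrite /prodP -setXTT (product_measure1E P1 P2 measurableT measurableT).
by rewrite [X in (X * _)%E](probability_setT P1) [X in (_ * X)%E](probability_setT P2) mule1.
Qed.

HB.instance Definition _ := Measure_isProbability.Build _ _ R prodP prodP_setT.

Lemma prodP_setX A B : measurable A -> measurable B ->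
  prodP (A `*` B) = (P1 A * P2 B)%E.
Proof. by move=> mA mB; rewrite /prodP product_measure1E. Qed.

Lemma prodP_tonelli1 (F : T1 * T2 -> \bar R) : measurable_fun setT F ->
  (forall z, (0 <= F z)%E) ->
  (\int[prodP]_z F z = \int[P1]_x \int[P2]_y F (x, y))%E.
Proof. by move=> mF F0; exact: (fubini_tonelli1 _ mF F0). Qed.

Lemma prodP_tonelli2 (F : T1 * T2 -> \bar R) : measurable_fun setT F ->
  (forall z, (0 <= F z)%E) ->
  (\int[prodP]_z F z = \int[P2]_y \int[P1]_x F (x, y))%E.
Proof. by move=> mF F0; exact: (fubini_tonelli2 _ mF F0). Qed.

Lemma Ex_prodP1 (f : T1 * T2 -> R) : intg prodP f ->
  (forall x, intg P2 (fun y => f (x, y))) ->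
  Ex prodP f = Ex P1 (fun x => Ex P2 (fun y => f (x, y))).
Proof.
move=> fi fx; rewrite {1}/Ex /Rintegral.
have := integral12_prod_meas1 (f := EFin \o f) fi.
rewrite -/prodP => <-; rewrite [in RHS]/Ex /Rintegral; congr fine.
by apply: eq_integral => x _; rewrite /fubini_F /= -(ExE (fx x)).
Qed.

Lemma Ex_prodP2 (f : T1 * T2 -> R) : intg prodP f ->
  (forall y, intg P1 (fun x => f (x, y))) ->
  Ex prodP f = Ex P2 (fun y => Ex P1 (fun x => f (x, y))).
Proof.
move=> fi fy; rewrite {1}/Ex /Rintegral.
have := integral21_prod_meas1 (f := EFin \o f) fi.
rewrite -/prodP => <-; rewrite [in RHS]/Ex /Rintegral; congr fine.
by apply: eq_integral => y _; rewrite /fubini_G /= -(ExE (fy y)).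
Qed.

Lemma same_law_fst : same_law prodP P1 fst id.
Proof.
move=> F mF F0; rewrite prodP_tonelli1 //; last exact: measurableT_comp.
by apply: eq_integral => x _; rewrite /= integral_cst //= probability_setT mule1.
Qed.

Lemma same_law_snd : same_law prodP P2 snd id.
Proof.
move=> F mF F0; rewrite prodP_tonelli2 //; last exact: measurableT_comp.
by apply: eq_integral => x _; rewrite /= integral_cst //= probability_setT mule1.
Qed.

Lemma intg_prodM (f : T1 -> R) (g : T2 -> R) : intg P1 f -> intg P2 g ->
  intg prodP (fun z => f z.1 * g z.2).
Proof.
move=> fi gi; have mf := intg_measurable fi; have mg := intg_measurable gi.
have m1 : measurable_fun setT (fun z : T1 * T2 => f z.1).
  exact: (measurableT_comp mf measurable_fst).
have m2 : measurable_fun setT (fun z : T1 * T2 => g z.2).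
  exact: (measurableT_comp mg measurable_snd).
apply/integrableP; split; first by apply/measurable_EFinP; exact: measurable_funM.
rewrite prodP_tonelli1 //; last first.
  by apply: measurableT_comp => //; apply/measurable_EFinP; exact: measurable_funM.
under eq_integral => x _.
  under eq_integral => y _ do rewrite /= normrM EFinM.
  rewrite ge0_integralZl //; last first.
    by apply/measurable_EFinP; exact: measurableT_comp.
  rewrite (ExE (intg_norm gi)) -EFinM.
  over.
have /= := intgZ (Ex P2 (fun y => `|g y|)) (intg_norm fi).
move=> /integrableP [_]; apply: le_lt_trans; apply: ge0_le_integral => //.
- by move=> x _; rewrite lee_fin mulr_ge0 // Ex_ge0.
- by apply/measurable_EFinP; apply: measurable_funM => //; exact: measurableT_comp.
- apply: measurableT_comp => //.
  by apply/measurable_EFinP; apply: measurable_funM => //; exact: measurableT_comp.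
- by move=> x _; rewrite /= lee_fin mulrC ler_norm.
Qed.

Lemma Ex_prodM (f : T1 -> R) (g : T2 -> R) : intg P1 f -> intg P2 g ->
  Ex prodP (fun z => f z.1 * g z.2) = Ex P1 f * Ex P2 g.
Proof.
move=> fi gi; rewrite Ex_prodP1 /=; last 2 first.
- exact: intg_prodM.
- by move=> x; exact: intgZ.
rewrite mulrC -ExZ //; apply: eq_Ex => x; rewrite ExZ //; exact: mulrC.
Qed.

Lemma L2_prodM (f : T1 -> R) (g : T2 -> R) : L2 P1 f -> L2 P2 g ->
  L2 prodP (fun z => f z.1 * g z.2).
Proof.
move=> [mf f2] [mg g2]; split.
  apply: measurable_funM.
    exact: (measurableT_comp mf measurable_fst).
  exact: (measurableT_comp mg measurable_snd).
by apply: eq_intg (intg_prodM f2 g2) => z /=; rewrite exprMn.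
Qed.

End ProductProbability.

Section GaussianPair.
Context {R : realType}.
Notation G := (@std_gauss R).
Notation G2 := (prodP G G).

Lemma mom_fst : mom G2 (fun z : R * R => z.1).
Proof.
have m1 : measurable_fun setT (@fst (measurableTypeR R) (measurableTypeR R)) by exact: measurable_fst.
exact: (mom_same_law m1 (@same_law_fst _ _ _ _ _ G G) (f := fun x => x) (proj1 mom_gauss) mom_gauss).
Qed.

Lemma mom_snd : mom G2 (fun z : R * R => z.2).
Proof.
have m1 : measurable_fun setT (@snd (measurableTypeR R) (measurableTypeR R)) by exact: measurable_snd.
exact: (mom_same_law m1 (@same_law_snd _ _ _ _ _ G G) (f := fun x => x) (proj1 mom_gauss) mom_gauss).
Qed.

Lemma horner_one (x : R) : (1 : {poly R}).[x] = 1.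
Proof. by rewrite hornerE. Qed.

Let hE := (hornerM, hornerX, hornerC, hornerD, hornerN, hornerZ, horner_one).

Section Gram.
Variables (c e : R).
Hypothesis ce1 : c ^+ 2 + e ^+ 2 = 1.
Let U (z : R * R) := c * z.1 + e * z.2.

Let mU : mom G2 U.
Proof. by apply: momD; apply: momZ; [exact: mom_fst | exact: mom_snd]. Qed.

Let mpq (p q r : {poly R}) : intg G2 (fun z => r.[z.2] * (p.[z.1] * q.[U z])).
Proof.
by apply: mom_intg; apply: momM; [|apply: momM]; apply: mom_poly;
  [exact: mom_snd | exact: mom_fst | exact: mU].
Qed.

Let mpq1 (p q : {poly R}) : intg G2 (fun z => p.[z.1] * q.[U z]).
Proof. by apply: eq_intg (mpq p q 1) => z; rewrite !hE ?mul1r. Qed.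

Let B (p q : {poly R}) := Ex G2 (fun z => p.[z.1] * q.[U z]).

Let stein_fst p q : Ex G2 (fun z => z.1 * (p.[z.1] * q.[U z])) =
  B p^`() q + c * B p q^`().
Proof.
have i0 : intg G2 (fun z => z.1 * (p.[z.1] * q.[U z])).
  by apply: eq_intg (mpq1 ('X * p) q) => z; rewrite !hE mulrA.
have i1 := intgD (mpq1 p^`() q) (intgZ c (mpq1 p q^`())).
rewrite /B -ExZ // -ExD //; last exact: intgZ.
pose r t := p * (q \Po (c *: 'X + (e * t)%:P)).
have rE t s : p.[s] * q.[U (s, t)] = (r t).[s].
  by rewrite /r hornerM horner_comp !hE.
have r'E t s : p^`().[s] * q.[U (s, t)] + c * (p.[s] * q^`().[U (s, t)]) = (r t)^`().[s].
  have d : (c *: 'X + (e * t)%:P)^`() = c%:P.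
    by rewrite derivD derivZ derivX derivC addr0 alg_polyC.
  rewrite /r derivM deriv_comp d !hE !horner_comp !hE /U /=; ring.
have ip (p1 : {poly R}) : intg G (fun x => p1.[x]).
  exact/mom_intg/mom_poly/mom_gauss.
rewrite (Ex_prodP2 i0) /=; last first.
  move=> t; apply: eq_intg (ip ('X * r t)) => s.
  by rewrite hornerM hornerX -rE.
rewrite (Ex_prodP2 i1) /=; last first.
  by move=> t; apply: eq_intg (ip (r t)^`()) => s; rewrite -r'E.
apply: eq_Ex => t.
transitivity (Ex G (fun x => x * (r t).[x])).
  by apply: eq_Ex => s; rewrite -rE.
by rewrite stein; apply: eq_Ex => s; rewrite -r'E.
Qed.

Let stein_snd q : Ex G2 (fun z => z.2 * q.[U z]) = e * B 1 q^`().
Proof.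
have i0 : intg G2 (fun z => z.2 * q.[U z]).
  by apply: eq_intg (mpq 1 q 'X) => z; rewrite !hE ?mul1r.
have i1 := intgZ e (mpq1 1 q^`()).
rewrite /B -ExZ //.
pose r s := q \Po (e *: 'X + (c * s)%:P).
have rE t s : q.[U (s, t)] = (r s).[t].
  by rewrite /r horner_comp !hE addrC.
have r'E t s : e * (1.[s] * q^`().[U (s, t)]) = (r s)^`().[t].
  have d : (e *: 'X + (c * s)%:P)^`() = e%:P.
    by rewrite derivD derivZ derivX derivC addr0 alg_polyC.
  rewrite /r deriv_comp d !hE !horner_comp !hE /U /= [c * s + _]addrC; ring.
have ip (p1 : {poly R}) : intg G (fun x => p1.[x]).
  exact/mom_intg/mom_poly/mom_gauss.
rewrite (Ex_prodP1 i0) /=; last first.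
  move=> s; apply: eq_intg (ip ('X * r s)) => t.
  by rewrite hornerM hornerX -rE.
rewrite (Ex_prodP1 i1) /=; last first.
  by move=> s; apply: eq_intg (ip (r s)^`()) => t; rewrite -r'E.
apply: eq_Ex => s.
transitivity (Ex G (fun x => x * (r s).[x])).
  by apply: eq_Ex => t; rewrite -rE.
by rewrite stein; apply: eq_Ex => t; rewrite -r'E.
Qed.

Let BZr a p q : B p (a *: q) = a * B p q.
Proof.
by rewrite /B -ExZ //; apply: eq_Ex => z; rewrite hornerZ mulrCA.
Qed.

Let B_He1 k : B 1 (He k.+1) = 0.
Proof.
have -> : B 1 (He k.+1) =
    Ex G2 (fun z => U z * (He k).[U z]) - Ex G2 (fun z => (He k)^`().[U z]).
  rewrite -ExB; last 2 first.
  - by apply: eq_intg (mpq1 1 ('X * He k)) => z; rewrite !hE ?mul1r.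
  - by apply: eq_intg (mpq1 1 (He k)^`()) => z; rewrite !hE ?mul1r.
  by apply: eq_Ex => z; rewrite /= !hE ?mul1r.
have -> : Ex G2 (fun z => (He k)^`().[U z]) = B 1 (He k)^`().
  by apply: eq_Ex => z; rewrite !hE ?mul1r.
have i1 : intg G2 (fun z => z.1 * (He k).[U z]).
  by apply: eq_intg (mpq1 'X (He k)) => z; rewrite !hE.
have i2 : intg G2 (fun z => z.2 * (He k).[U z]).
  by apply: eq_intg (mpq 1 (He k) 'X) => z; rewrite !hE ?mul1r.
have -> : Ex G2 (fun z => U z * (He k).[U z]) =
    c * Ex G2 (fun z => z.1 * (He k).[U z]) + e * Ex G2 (fun z => z.2 * (He k).[U z]).
  rewrite -!ExZ // -ExD; [|exact: intgZ|exact: intgZ].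
  by apply: eq_Ex => z; rewrite /U; ring.
rewrite stein_snd.
have -> : Ex G2 (fun z => z.1 * (He k).[U z]) = c * B 1 (He k)^`().
  have := stein_fst 1 (He k); rewrite -polyC1 derivC polyC1.
  have -> : B 0 (He k) = 0.
    rewrite -[RHS](Ex_cst G2 0); apply: eq_Ex => z; by rewrite horner0 mul0r.
  rewrite add0r => <-; apply: eq_Ex => z; by rewrite !hE ?mul1r.
rewrite !mulrA -!expr2 -mulrDl ce1; ring.
Qed.

Let B_HeS j q : B (He j.+1) q = c * B (He j) q^`().
Proof.
have -> : B (He j.+1) q = Ex G2 (fun z => z.1 * ((He j).[z.1] * q.[U z])) - B (He j)^`() q.
  rewrite /B -ExB //; last first.
    by apply: eq_intg (mpq1 ('X * He j) q) => z; rewrite !hE mulrA.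
  by apply: eq_Ex => z; rewrite /= !hE; ring.
by rewrite stein_fst; ring.
Qed.

(** Integration by parts in the first variable lowers [He (j + 1)] to [He j], differentiates the
    other factor and yields one factor [c]. Both indices thus descend together until one is 0; a
    remaining [He] of positive degree has mean 0, which is where [c^2 + e^2 = 1] enters. *)
Lemma He_gram j k : Ex G2 (fun z => (He j).[z.1] * (He k).[c * z.1 + e * z.2]) =
  (j == k)%:R * j`!%:R * c ^+ j.
Proof.
rewrite -/(B _ _); elim: j k => [|j IH] [|k].
- rewrite eqxx fact0 expr0 !mulr1 -[RHS](Ex_cst G2); apply: eq_Ex => z.
  by rewrite /= !hE mul1r.
- by rewrite [B _ _]B_He1 !mul0r.
- rewrite B_HeS /= -polyC1 derivC mul0r mul0r.
  rewrite (_ : B _ _ = 0) ?mulr0 // -[RHS](Ex_cst G2 0); apply: eq_Ex => z.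
  by rewrite horner0 mulr0.
- rewrite B_HeS derivHe BZr IH eqSS factS exprS natrM.
  by have [->|_] := eqVneq j k; rewrite ?mul0r ?mulr0 //; ring.
Qed.

Lemma hn_gram j k : Ex G2 (fun z => hn j z.1 * hn k (c * z.1 + e * z.2)) =
  (j == k)%:R * c ^+ j.
Proof.
transitivity (Ex G2 (fun z => (Num.sqrt j`!%:R)^-1 * (Num.sqrt k`!%:R)^-1 *
    ((He j).[z.1] * (He k).[U z]))); first by apply: eq_Ex => z; rewrite /hn /U; ring.
rewrite ExZ // He_gram; have [<-|_] := eqVneq j k; last by rewrite !mul0r mulr0.
rewrite !mul1r mulrA -invfM -expr2 sqr_sqrtr // mulVf ?mul1r //.
Qed.

End Gram.

(** The case [c = 1], [e = 0] of [hn_gram]. *)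
Lemma hn_orth j k : Ex G (fun x => hn j x * hn k x) = (j == k)%:R.
Proof.
have ce : (1 : R) ^+ 2 + 0 ^+ 2 = 1 by rewrite expr1n expr0n addr0.
have := hn_gram ce j k; rewrite expr1n mulr1 => <-.
have m1 : measurable_fun setT (@fst (measurableTypeR R) (measurableTypeR R)) by exact: measurable_fst.
have i := mom_intg (momM (mom_hn j) (@mom_hn R k)).
have := Ex_same_law m1 (@same_law_fst _ _ _ _ _ G G) (intg_measurable i) i.
by move=> <-; apply: eq_Ex => z; rewrite mul1r mul0r addr0.
Qed.

End GaussianPair.

(** * The Mehler kernel *)

Section Mehler.
Context {R : realType}.
Notation G := (@std_gauss R).
Notation G2 := (prodP G G).
Notation RG := (measurableTypeR R).

Section Kernel.
Variable c : R.
Hypothesis c1 : `|c| < 1.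
Let e := Num.sqrt (1 - c ^+ 2).

Let c21 : c ^+ 2 < 1.
Proof. by rewrite -(real_normK (num_real c)) expr_lt1. Qed.

Lemma mehler_e_gt0 : 0 < e.
Proof. by rewrite sqrtr_gt0 subr_gt0. Qed.
Let e0 := mehler_e_gt0.

Let e2 : e ^+ 2 = 1 - c ^+ 2.
Proof. by rewrite sqr_sqrtr // subr_ge0 ltW. Qed.

(** The density of the law of [(xi, c xi + e eta)] relative to the law of the independent pair
    [(xi, eta)]. *)
Definition mehler (z : RG * RG) : R := gauss_ratio (c * z.1) e z.2.

Lemma mehler_ge0 z : 0 <= mehler z.
Proof. exact: gauss_ratio_ge0. Qed.

Lemma measurable_mehler : measurable_fun setT mehler.
Proof. by rewrite /mehler /gauss_ratio; mfun. Qed.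

Lemma mehler_sym s t : mehler (s, t) = mehler (t, s).
Proof.
rewrite /mehler /gauss_ratio /=; congr (_ * expR _); rewrite e2; field.
by rewrite lt0r_neq0 // subr_gt0.
Qed.

Let phi (z : RG * RG) : RG * RG := (z.1, c * z.1 + e * z.2).

Let mphi : measurable_fun setT phi.
Proof. by rewrite /phi; mfun. Qed.

Lemma mehler_law (F : RG * RG -> \bar R) : measurable_fun setT F ->
  (forall z, (0 <= F z)%E) ->
  (\int[G2]_z F (phi z) = \int[G2]_z (F z * (mehler z)%:E))%E.
Proof.
move=> mF F0.
have mm : measurable_fun setT (EFin \o mehler).
  by apply/measurable_EFinP; exact: measurable_mehler.
have mFm : measurable_fun setT (fun z => F z * (mehler z)%:E)%E.
  exact: emeasurable_funM.
have mFp : measurable_fun setT (F \o phi) by exact: measurableT_comp.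
rewrite (prodP_tonelli1 G G mFp (fun z => F0 _)).
rewrite (prodP_tonelli1 G G mFm); last by move=> z; rewrite mule_ge0 // lee_fin mehler_ge0.
apply: eq_integral => s _.
rewrite -(gauss_affine (c * s) e0 (F := fun y => F (s, y))) //.
by apply: (measurableT_comp mF); exact: measurable_pair1.
Qed.

Lemma Ex_mehler (h : RG * RG -> R) : measurable_fun setT h ->
  intg G2 (fun z => h z * mehler z) ->
  Ex G2 (fun z => h (z.1, c * z.1 + e * z.2)) = Ex G2 (fun z => h z * mehler z).
Proof.
move=> mh hi.
exact: (Ex_density (P := G2) (Q := G2) mphi mehler_ge0 mehler_law mh hi).
Qed.

(** The constants of the iterated Gaussian integral of [mehler^2]: the integral over [t] has
    [1 - 2 a = Q] and leaves [exp (th s^2)], whose own integral is finite because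
    [1 - 2 th = 1 / Q > 0]. The two square roots cancel and only [1 / e^2] remains. *)
Let Q := (1 + c ^+ 2) / e ^+ 2.
Let Q0 : 0 < Q.
Proof. by rewrite divr_gt0 ?exprn_gt0 // ltr_pwDl ?sqr_ge0. Qed.

Let th := c ^+ 2 / (1 + c ^+ 2).
Let th2 : 1 - 2 * th = Q^-1.
Proof.
rewrite /th /Q e2; field.
by rewrite !lt0r_neq0 ?subr_gt0 // ltr_pwDl ?sqr_ge0.
Qed.

Let mehler_sq_fiber s :
  intg G (fun t => mehler (s, t) ^+ 2) /\
  Ex G (fun t => mehler (s, t) ^+ 2) =
    (e ^+ 2)^-1 * (Num.sqrt Q)^-1 * expR (th * s ^+ 2 + 0 * s).
Proof.
pose a := 1 - (e ^+ 2)^-1; pose b := 2 * c * s / e ^+ 2.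
have e2p : 0 < e ^+ 2 by rewrite exprn_gt0.
have aQ : 1 - 2 * a = Q.
  rewrite /a /Q; apply: (mulIf (lt0r_neq0 e2p)); rewrite divfK ?lt0r_neq0 //.
  rewrite mulrBl mul1r mulrBr mulrBl mulr1 -mulrA mulVf ?lt0r_neq0 // e2; ring.
have a2 : a < 1 / 2 by have := Q0; rewrite -aQ; lra.
have [i E] := gauss_exp_quad b a2; rewrite aQ in E.
pose k := (e ^+ 2)^-1 * expR (- (c ^+ 2 * s ^+ 2 / e ^+ 2)).
have mE t : mehler (s, t) ^+ 2 = k * expR (a * t ^+ 2 + b * t).
  rewrite /mehler /gauss_ratio /= exprMn exprVn -expRM_natl /k -mulrA -expRD.
  congr (_ * expR _); rewrite /a /b; field; exact: lt0r_neq0.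
have fE : (fun t => mehler (s, t) ^+ 2) = (fun t => k * expR (a * t ^+ 2 + b * t)).
  exact/funext.
rewrite fE; split; first exact: intgZ.
rewrite ExZ // E /k mul0r addr0 [LHS]mulrACA; congr (_ * _).
rewrite -expRD; congr expR.
rewrite /b /th /Q; move: e2p; rewrite e2 => e2p; field.
by rewrite !lt0r_neq0 // ltr_pwDl ?sqr_ge0.
Qed.

Lemma L2_mehler : L2 G2 mehler /\ Ex G2 (fun z => mehler z ^+ 2) = (1 - c ^+ 2)^-1.
Proof.
have th1 : th < 1 / 2 by have : 0 < Q^-1 by [rewrite invr_gt0]; rewrite -th2; lra.
have [i E] := gauss_exp_quad 0 th1.
have mm : measurable_fun setT (fun z => mehler z ^+ 2).
  by apply: measurable_funX; exact: measurable_mehler.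
have val : (\int[G2]_z (mehler z ^+ 2)%:E = ((1 - c ^+ 2)^-1)%:E)%E.
  rewrite (prodP_tonelli1 G G (F := fun z => (mehler z ^+ 2)%:E)); last 2 first.
  - exact/measurable_EFinP.
  - by move=> z; rewrite lee_fin sqr_ge0.
  under eq_integral => s _ do
    rewrite (ExE (mehler_sq_fiber s).1) (mehler_sq_fiber s).2.
  rewrite (ExE (intgZ _ i)) ExZ // E th2 expr0n /= mul0r expR0 mulr1.
  rewrite sqrtrV ?(ltW Q0) // invrK -mulrA mulVf ?mulr1 ?e2 //.
  by rewrite gt_eqF // sqrtr_gt0.
have i2 : intg G2 (fun z => mehler z ^+ 2).
  by apply: ge0_intg => //; [move=> z; exact: sqr_ge0 | rewrite val ltry].
split; first by split; [exact: measurable_mehler | exact: i2].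
by have := ExE i2; rewrite val => -[].
Qed.

(** The truncated series [S] satisfies [E (mehler S) = E S^2 = sum_(k < m) c^(2 k)], so [E (mehler -
    S)^2 = 1 / (1 - c^2) - sum_(k < m) c^(2 k) = c^(2 m) / (1 - c^2)]. Cauchy-Schwarz against
    [f(z1) g(z2)] finishes; convergence of the Mehler series is a consequence, not an input. *)
Lemma mehler_bound (f g : R -> R) (m : nat) : L2 G f -> L2 G g ->
  `|Ex G2 (fun z => f z.1 * g (c * z.1 + e * z.2)) -
    \sum_(k < m) c ^+ k * zeta k f * zeta k g| <=
  `|c| ^+ m / e * (Num.sqrt (Ex G (fun x => f x ^+ 2)) *
                   Num.sqrt (Ex G (fun x => g x ^+ 2))).
Proof.
move=> f2 g2; have [M2 EM] := L2_mehler.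
have fg2 : L2 G2 (fun z => f z.1 * g z.2) by exact: L2_prodM.
have h2 k : L2 G2 (fun z => hn k z.1 * hn k z.2) by apply: L2_prodM; exact: L2_hn.
pose S z := \sum_(k < m) c ^+ k * (hn k z.1 * hn k z.2).
have S2 : L2 G2 S by apply: L2_sum => k _; apply: L2Z; exact: h2.
have -> : Ex G2 (fun z => f z.1 * g (c * z.1 + e * z.2)) =
    Ex G2 (fun z => f z.1 * g z.2 * mehler z).
  apply: (Ex_mehler (h := fun z => f z.1 * g z.2)); first exact: L2_meas fg2.
  exact: L2_mul.
have -> : \sum_(k < m) c ^+ k * zeta k f * zeta k g =
    Ex G2 (fun z => f z.1 * g z.2 * S z).
  rewrite (_ : (fun z => _) = (fun z => \sum_(k < m) c ^+ k *
      ((f z.1 * hn k z.1) * (g z.2 * hn k z.2)))); last first.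
    apply/funext => z; rewrite /S mulr_sumr; apply: eq_bigr => k _; ring.
  have fk k : intg G (fun x => f x * hn k x) by apply: L2_mul => //; exact: L2_hn.
  have gk k : intg G (fun x => g x * hn k x) by apply: L2_mul => //; exact: L2_hn.
  have fgk k := intg_prodM (fk k) (gk k).
  rewrite Ex_sum; last by move=> k _; exact: (intgZ _ (fgk k)).
  apply: eq_bigr => k _; rewrite (ExZ _ (fgk k)).
  by rewrite (Ex_prodM (fk k) (gk k)) -mulrA /zeta !hermite_hn.
rewrite -ExB; [|exact: L2_mul|exact: L2_mul].
have r2 := L2B M2 S2.
have -> : Ex G2 (fun x => f x.1 * g x.2 * mehler x - f x.1 * g x.2 * S x) =
    Ex G2 (fun x => f x.1 * g x.2 * (mehler x - S x)).
  by apply: eq_Ex => z; rewrite mulrBr.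
apply: le_trans (Cauchy_Schwarz_norm fg2 r2) _.
rewrite mulrC ler_pM ?sqrtr_ge0 //; last first.
  rewrite -sqrtrM; last by apply: Ex_ge0 => x; exact: sqr_ge0.
  rewrite -(Ex_prodM (L2_sq f2) (L2_sq g2)) ler_wsqrtr // le_eqVlt.
  by apply/orP; left; apply/eqP/eq_Ex => z; rewrite exprMn.
(* [mehler] is a density, so this is the mean of [S] at the correlated pair, computed termwise by
   [hn_gram]. *)
have MS : Ex G2 (fun z => mehler z * S z) = \sum_(k < m) c ^+ (k * 2).
  rewrite (_ : (fun z => _) = (fun z => \sum_(k < m) c ^+ k *
      ((hn k z.1 * hn k z.2) * mehler z))); last first.
    apply/funext => z; rewrite /S mulr_sumr; apply: eq_bigr => k _; ring.
  rewrite Ex_sum; last by move=> k _; apply: intgZ; exact: L2_mul.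
  apply: eq_bigr => k _; rewrite ExZ; last exact: L2_mul.
  rewrite -(Ex_mehler (h := fun z => hn k z.1 * hn k z.2)); last 2 first.
  - exact: L2_meas (h2 k).
  - exact: L2_mul.
  rewrite (hn_gram _ k k) ?eqxx ?mul1r -?exprD ?addnn ?muln2 //.
  by rewrite e2 addrC subrK.
have SS : Ex G2 (fun z => S z ^+ 2) = \sum_(k < m) c ^+ (k * 2).
  rewrite (_ : (fun z => _) = (fun z => \sum_(k < m) c ^+ k *
      (hn k z.1 * hn k z.2 * S z))); last first.
    by apply/funext => z; rewrite expr2 {1}/S mulr_suml; apply: eq_bigr => k _; ring.
  rewrite Ex_sum; last by move=> k _; apply: intgZ; exact: L2_mul.
  apply: eq_bigr => k _; rewrite ExZ; last exact: L2_mul.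
  rewrite muln2 -addnn exprD; congr (_ * _).
  rewrite (_ : (fun z => _) = (fun z => \sum_(j < m) c ^+ j *
      ((hn k z.1 * hn j z.1) * (hn k z.2 * hn j z.2)))); last first.
    apply/funext => z; rewrite /S mulr_sumr; apply: eq_bigr => j _; ring.
  have hk j : intg G (fun x => hn k x * hn j x) by apply: L2_mul; exact: L2_hn.
  have hkj j := intg_prodM (hk j) (hk j).
  rewrite Ex_sum; last by move=> j _; exact: (intgZ _ (hkj j)).
  rewrite (bigD1 k) //= big1 ?addr0; last first.
    move=> j jk; rewrite (ExZ _ (hkj j)) (Ex_prodM (hk j) (hk j)).
    by rewrite !hn_orth eq_sym (negbTE (jk : (j != k :> nat))) !mul0r mulr0.
  by rewrite (ExZ _ (hkj k)) (Ex_prodM (hk k) (hk k)) !hn_orth eqxx !mulr1.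
rewrite Ex_sqrB // EM MS SS.
have -> : (1 - c ^+ 2)^-1 - 2 * (\sum_(k < m) c ^+ (k * 2)) + \sum_(k < m) c ^+ (k * 2) =
    (`|c| ^+ m / e) ^+ 2.
  rewrite exprMn exprVn e2 -exprM mulnC exprM real_normK ?num_real //.
  have H : (1 - c ^+ 2) * \sum_(k < m) c ^+ (k * 2) = 1 - c ^+ 2 ^+ m.
    rewrite -[X in X - c ^+ 2 ^+ m](expr1n _ m) subrXX; congr (_ * _).
    by apply: eq_bigr => k _; rewrite expr1n mul1r mulnC exprM.
  have d0 : 1 - c ^+ 2 != 0 by rewrite gt_eqF // subr_gt0.
  apply: (mulfI d0); rewrite mulrCA divff // mulr1 mulrDr mulrBr divff //.
  rewrite mulrCA H; ring.
by rewrite sqrtr_sqr ger0_norm // divr_ge0 ?exprn_ge0 // ltW.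
Qed.

End Kernel.
End Mehler.

(** * Completeness of the Hermite polynomials and rotation invariance *)

Section Mehler2.
Context {R : realType}.
Notation G := (@std_gauss R).
Notation G2 := (prodP G G).
Notation RG := (measurableTypeR R).

(** With all coefficients of [f] zero, [mehler_bound] bounds the fixed left-hand side by a constant
    times [|c|^m] for every [m]. *)
Lemma mehler_orth (f g : R -> R) (c : R) : `|c| < 1 -> L2 G f -> L2 G g ->
  (forall k, zeta k f = 0) ->
  Ex G2 (fun z => f z.1 * g (c * z.1 + Num.sqrt (1 - c ^+ 2) * z.2)) = 0.
Proof.
move=> c1 f2 g2 z0; apply/eqP; rewrite -normr_le0.
set K := Num.sqrt (Ex G (fun x => f x ^+ 2)) * Num.sqrt (Ex G (fun x => g x ^+ 2)).
set e := Num.sqrt _; set x := `|_|.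
have H m : x <= `|c| ^+ m * (e^-1 * K).
  have := mehler_bound c1 m f2 g2; rewrite big1 ?subr0 -?/K -?mulrA //.
  by move=> k _; rewrite z0 mulr0 mul0r.
have cv : `|c| ^+ m * (e^-1 * K) @[m --> \oo] --> (0 : R).
  rewrite -[X in _ --> X](mul0r (e^-1 * K)); apply: cvgMr_tmp.
  by apply: cvg_expr; rewrite normr_id.
by rewrite -(cvg_lim _ cv) //; apply: limr_ge; [exact: cvgP cv | exact: nearW].
Qed.

Lemma gauss_set1 (a : R) : G [set a] = 0%E.
Proof.
have := normal_prob_dominates (0 : R) 1.
by move=> /null_content_dominatesP /(_ [set a]); apply => //; exact: lebesgue_measure_set1.
Qed.

Lemma L2_indic (A : set RG) : measurable A -> L2 G (\1_A : R -> R).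
Proof.
move=> mA; apply: (le_L2 (g := fun=> 1)); last exact: L2_cst.
  exact: measurable_indic.
by move=> x; rewrite indicE; case: (_ \in _); rewrite ?normr1 ?normr0.
Qed.

(** By [mehler_orth], [f(xi)] is orthogonal to the indicator of the ray taken at [c xi + e eta]. As
    [c] tends to 1 this point tends to [xi], and dominated convergence carries the orthogonality to
    the indicator at [xi]. *)
Lemma orth_ray (f : R -> R) (a : R) : L2 G f -> (forall k, zeta k f = 0) ->
  Ex G (fun s => f s * \1_(`]a, +oo[%classic : set R) s) = 0.
Proof.
move=> f2 z0; have fi := L2_intg f2; have mf := L2_meas f2.
have mray : measurable (`]a, +oo[%classic : set RG) by exact: measurable_itv.
have i2 := L2_indic mray.
pose c (n : nat) : R := 1 - n.+2%:R^-1.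
have c1 n : `|c n| < 1.
  have n0 : (0 : R) < n.+2%:R^-1 by rewrite invr_gt0.
  have n1 : (n.+2%:R : R)^-1 <= 1 by rewrite invf_le1 // ler1n.
  by rewrite /c; move: n0 n1; set q := _^-1 => n0 n1; rewrite ger0_norm; lra.
pose e n := Num.sqrt (1 - c n ^+ 2).
pose I (s : R) : R := \1_(`]a, +oo[%classic : set R) s.
have mI : measurable_fun setT (I : RG -> R) by exact: L2_meas i2.
pose F n (z : RG * RG) := (f z.1 * I (c n * z.1 + e n * z.2))%:E.
have f1 : intg G2 (fun z => f z.1).
  have m1 : measurable_fun setT (@fst RG RG) by exact: measurable_fst.
  exact: (intg_same_law m1 (@same_law_fst _ _ _ _ _ G G) mf fi).
have mf1 := intg_measurable f1.
have I1 s : `|I s| <= 1.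
  by rewrite /I indicE; case: (_ \in _); rewrite ?normr1 ?normr0.
have cc : c n @[n --> \oo] --> (1 : R).
  rewrite -[X in _ --> X]subr0; apply: cvgB; first exact: cvg_cst.
  have /= := @cvg_harmonic R; rewrite -[X in X -> _]cvg_shiftS; exact.
have ce : e n @[n --> \oo] --> (0 : R).
  have cc2 : c n ^+ 2 @[n --> \oo] --> (1 : R).
    by have := cvgM cc cc; rewrite mulr1; exact.
  have c0 : 1 - c n ^+ 2 @[n --> \oo] --> (0 : R).
    by rewrite -[X in _ --> X](subrr 1); apply: cvgB => //; exact: cvg_cst.
  have := cvg_comp _ _ c0 (@sqrt_continuous R 0); rewrite sqrtr0; exact.
have mF n : measurable_fun setT (F n).
  apply/measurable_EFinP; apply: measurable_funM => //.
  by apply: (measurableT_comp mI); mfun.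
have [] := @dominated_convergence _ _ _ G2 setT measurableT F
   (fun z => (f z.1 * I z.1)%:E) (fun z => `|f z.1|%:E) mF.
- apply/measurable_EFinP; apply: measurable_funM => //.
  by apply: (measurableT_comp mI); mfun.
(* The indicator of the ray is discontinuous only at [a], so pointwise convergence can fail only
   when the first coordinate equals [a], on a null set. *)
- have N0 : G2 ([set a] `*` setT) = 0%E.
    by rewrite prodP_setX // [X in (X * _)%E](gauss_set1 a) mul0e.
  exists ([set a] `*` setT); split => //; first exact: measurableX.
  move=> [s t] /= H; split => //; apply: contrapT => /eqP sa; apply: H => _.
  apply: cvg_near_cst.
  have cs : c n * s + e n * t @[n --> \oo] --> s.
    rewrite -[X in _ --> X]addr0 -[X in _ --> X + _](mul1r s) -[X in _ --> _ + X](mul0r t).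
    by apply: cvgD; apply: cvgMr_tmp.
  have IE (u : R) : I u = ((a < u)%R)%:R.
    by rewrite /I indicE mem_setE /= in_itv /= andbT.
  move: sa; rewrite neq_lt => /orP[sa|sa].
  + near=> n; rewrite /F /= !IE (ltNge a s) (ltW sa) ltNge.
    suff -> : c n * s + e n * t <= a by [].
    apply: ltW; near: n; exact: cvgr_lt cs _ sa.
  + near=> n; rewrite /F /= !IE sa.
    suff -> : a < c n * s + e n * t by [].
    near: n; exact: cvgr_gt cs _ sa.
- exact: intg_norm f1.
- apply: aeW => z n _; rewrite /F /= lee_fin normrM ler_piMr //.
move=> _ _ cvF.
have F0 n : (\int[G2]_z F n z = 0)%E.
  have /= E := mehler_orth (c1 n) f2 i2 z0.
  have := E; rewrite /Ex /Rintegral -[X in fine X]/(\int[G2]_z F n z)%E.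
  have iF : intg G2 (fun z => f z.1 * I (c n * z.1 + e n * z.2)).
    apply: le_intg (intg_norm f1) => [|z]; first by apply/measurable_EFinP; exact: mF.
    by rewrite normrM ler_piMr.
  by rewrite /F (ExE iF) /= => ->.
have : (\int[G2]_z (f z.1 * I z.1)%:E = 0)%E.
  rewrite -(cvg_lim _ cvF) //; under eq_fun do rewrite F0; exact: lim_cst.
have ifI : intg G (fun s => f s * I s).
  by apply: L2_mul.
have m1 : measurable_fun setT (@fst RG RG) by exact: measurable_fst.
have <- := Ex_same_law m1 (@same_law_fst _ _ _ _ _ G G) (intg_measurable ifI) ifI.
by rewrite /Ex /Rintegral => ->.
Unshelve. all: by end_near. Qed.

(** The sets over which [f] integrates to 0 contain the rays, by [orth_ray], hence the half-open
    intervals, and form a Dynkin system; so they are all the Borel sets and [f] vanishes almost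
    everywhere. *)
Lemma hermite_complete (f : R -> R) : L2 G f -> (forall k, zeta k f = 0) ->
  Ex G (fun x => f x ^+ 2) = 0.
Proof.
move=> f2 z0; have fi := L2_intg f2.
pose Q (S : set RG) := (\int[G]_(x in S) (f x)%:E = 0)%E.
have ray a : Q `]a, +oo[%classic.
  rewrite /Q integral_mkcond.
  have i : intg G (fun s => f s * \1_(`]a, +oo[%classic : set R) s).
    by apply: L2_mul => //; apply: L2_indic; exact: measurable_itv.
  transitivity (\int[G]_s (f s * \1_(`]a, +oo[%classic : set R) s)%:E)%E.
    apply: eq_integral => s _; rewrite patchE indicE.
    by case: (s \in _); rewrite ?mulr1 ?mulr0.
  by rewrite (ExE i) orth_ray.
have QT : Q setT.
  rewrite /Q (ExE fi) -[RHS]/(0%:E); congr EFin.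
  by have := z0 0%N; rewrite /zeta hermite_hn; under eq_Rintegral do
    rewrite /hn /= fact0 sqrtr1 invr1 mul1r horner_one mulr1.
have QD (A B : set RG) : measurable A -> measurable B -> A `<=` B -> Q A -> Q B -> Q (B `\` A).
  move=> mA mB AB QA QB; rewrite /Q.
  have dj : [disjoint A & B `\` A]%classic by apply/disj_setPS => x [Ax [_ nAx]]; exact: nAx Ax.
  have mfAB : measurable_fun (A `|` (B `\` A)) f.
    by apply: measurable_funTS; exact: (intg_measurable fi).
  have := integral_setU_EFin G mA (measurableD mB mA) mfAB dj.
  by rewrite setDUK // QB QA add0e => /esym.
have Qall S : measurable S -> Q S.
  have mE : @measurable _ RG = <<s @ocitv R >> by [].
  rewrite mE; apply: (dynkin_induction mE) => //.
  - exact: ocitvI.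
  - move=> _ [[a b] _ <-] /=.
    have [ab|ba] := ltP a b; last by rewrite /Q set_itv_ge ?integral_set0 // bnd_simp -leNgt.
    rewrite (_ : `]a, b]%classic = `]a, +oo[%classic `\` `]b, +oo[%classic).
      apply: QD => //; try exact: measurable_itv.
      by apply: subset_itvr; rewrite bnd_simp ltW.
    apply/seteqP; split => x /=; rewrite !in_itv /= !andbT.
      by move=> /andP[-> xb]; split=> //; rewrite ltNge xb.
    by move=> [-> /negP]; rewrite -leNgt => ->.
  - by move=> B mB QB; rewrite -setTD; exact: QD.
  - move=> F mF tF QF; rewrite /Q integral_bigcup //.
    + by rewrite eseries0 // => n _ _; exact: QF.
    + by apply: integrableS fi => //; exact: bigcupT_measurable.
have ae0 : ae_eq G setT (EFin \o f) (cst 0%E).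
  apply: integral_ae_eq => // E _ mE.
  rewrite integral0; exact: (Qall E mE).
rewrite /Ex /Rintegral (ae_eq_integral (cst 0%E)) //.
- by rewrite integral_cst // mul0e.
- by apply/measurable_EFinP; apply: measurable_funX; exact: (L2_meas f2).
- by apply: filterS ae0 => x /= h _; move: (h I) => [->]; rewrite expr0n.
Qed.

Lemma prodP_swap (F : RG * RG -> \bar R) : measurable_fun setT F ->
  (forall z, (0 <= F z)%E) -> (\int[G2]_z F (z.2, z.1) = \int[G2]_z F z)%E.
Proof.
move=> mF F0; rewrite [RHS](prodP_tonelli2 G G mF F0).
have ms : measurable_fun setT (fun z : RG * RG => (z.2, z.1)).
  by mfun.
have mFs : measurable_fun setT (fun z : RG * RG => F (z.2, z.1)).
  exact: (measurableT_comp mF ms).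
exact: (prodP_tonelli1 G G mFs (fun z => F0 _)).
Qed.

(* The density of [(xi, c xi + e eta)] is symmetric. *)
Lemma gauss_corr_swap (c : R) (F : RG * RG -> \bar R) : `|c| < 1 ->
  measurable_fun setT F -> (forall z, (0 <= F z)%E) ->
  let e := Num.sqrt (1 - c ^+ 2) in
  (\int[G2]_z F (c * z.1 + e * z.2, z.1)%R = \int[G2]_z F (z.1, c * z.1 + e * z.2)%R)%E.
Proof.
move=> c1 mF F0 e.
have ms : measurable_fun setT (fun z : RG * RG => (z.2, z.1)).
  by mfun.
have mFs : measurable_fun setT (fun z : RG * RG => F (z.2, z.1)).
  exact: (measurableT_comp mF ms).
have mm : measurable_fun setT (EFin \o mehler c).
  by apply/measurable_EFinP; exact: measurable_mehler.
have mFm : measurable_fun setT (fun z => F z * (mehler c z)%:E)%E.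
  exact: emeasurable_funM.
rewrite (mehler_law c1 mFs (fun z => F0 _)) (mehler_law c1 mF F0).
rewrite -(prodP_swap mFm); last by move=> z; rewrite mule_ge0 // lee_fin mehler_ge0.
by apply: eq_integral => -[s t] _ /=; rewrite mehler_sym.
Qed.

(** Exchange symmetry is applied to [H], which solves the second coordinate for [eta]. At
    [(xi, c xi + e eta)] it returns [F (xi, eta)], and at the exchanged pair
    [F (c xi + e eta, e xi - c eta)]. *)
Lemma householder_pos (c e : R) (F : RG * RG -> \bar R) : c ^+ 2 + e ^+ 2 = 1 -> 0 < e ->
  measurable_fun setT F -> (forall z, (0 <= F z)%E) ->
  (\int[G2]_z F (c * z.1 + e * z.2, e * z.1 - c * z.2)%R = \int[G2]_z F z)%E.
Proof.
move=> ce e0 mF F0.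
have c1 : `|c| < 1 by rewrite -(expr_lt1 (n := 2)) // real_normK ?num_real //; nra.
have eE : Num.sqrt (1 - c ^+ 2) = e.
  by rewrite -ce addrC addKr sqrtr_sqr gtr0_norm.
pose H (z : RG * RG) := F (z.1, (z.2 - c * z.1) / e).
have mH : measurable_fun setT H.
  by apply: (measurableT_comp mF); mfun.
have := gauss_corr_swap c1 mH (fun z => F0 _); rewrite /= eE /H /= => h.
transitivity (\int[G2]_z F (c * z.1 + e * z.2, (z.1 - c * (c * z.1 + e * z.2)) / e)%R)%E.
  apply: eq_integral => z _; congr (F (_, _)); apply: (mulIf (lt0r_neq0 e0)).
  rewrite divfK ?lt0r_neq0 //.
  transitivity (e ^+ 2 * z.1 - c * e * z.2); first by ring.
  by rewrite (_ : e ^+ 2 = 1 - c ^+ 2); [ring | rewrite -ce; ring].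
rewrite h; apply: eq_integral => -[s t] _ /=; congr (F (_, _)).
by rewrite addrC addKr mulrC mulKf ?lt0r_neq0.
Qed.

(* [H S H = diag(1, -1)] for [S] the swap and [H] the reflection at [pi / 4]. *)
Lemma gauss_reflect (F : RG * RG -> \bar R) :
  measurable_fun setT F -> (forall z, (0 <= F z)%E) ->
  (\int[G2]_z F (z.1, - z.2)%R = \int[G2]_z F z)%E.
Proof.
move=> mF F0; pose r : R := Num.sqrt (2^-1).
have r2 : r ^+ 2 = 2^-1 by rewrite sqr_sqrtr // invr_ge0.
have r0 : 0 < r by rewrite sqrtr_gt0 invr_gt0.
have rr : r ^+ 2 + r ^+ 2 = 1 by rewrite r2; field.
pose h (z : RG * RG) : RG * RG := (r * z.1 + r * z.2, r * z.1 - r * z.2).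
have mh : measurable_fun setT h by rewrite /h; mfun.
have ms : measurable_fun setT (fun z : RG * RG => (z.2, z.1)).
  by mfun.
have m1 : measurable_fun setT (fun z => F (h z)) by exact: measurableT_comp.
have m2 : measurable_fun setT (fun z : RG * RG => F (h (z.2, z.1))).
  exact: (measurableT_comp m1 ms).
rewrite -(householder_pos rr r0 mF F0) -(prodP_swap m1 (fun z => F0 _)).
rewrite -(householder_pos rr r0 m2 (fun z => F0 _)).
apply: eq_integral => -[s t] _ /=; rewrite /h /=; congr (F (_, _)).
  transitivity ((r ^+ 2 + r ^+ 2) * s); first by rewrite rr mul1r.
  ring.
transitivity (- ((r ^+ 2 + r ^+ 2) * t)); first by rewrite rr mul1r.
ring.
Qed.

(** A negative [e] is reduced to [- e] by flipping the second coordinate before and after the map;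
    if [e = 0], the sign of [c] forces [c = 1] and the map is itself a flip. *)
Lemma householder (c e : R) (F : RG * RG -> \bar R) : c ^+ 2 + e ^+ 2 = 1 -> 0 <= c ->
  measurable_fun setT F -> (forall z, (0 <= F z)%E) ->
  (\int[G2]_z F (c * z.1 + e * z.2, e * z.1 - c * z.2)%R = \int[G2]_z F z)%E.
Proof.
move=> ce c0 mF F0; have [e0|e0|e0] := ltgtP 0 e.
- exact: householder_pos.
- have mr : measurable_fun setT (fun z : RG * RG => (z.1, - z.2)).
    by mfun.
  have mFr : measurable_fun setT (fun z : RG * RG => F (z.1, - z.2)).
    exact: (measurableT_comp mF mr).
  have ce' : c ^+ 2 + (- e) ^+ 2 = 1 by rewrite sqrrN.
  have e0' : 0 < - e by rewrite oppr_gt0.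
  have mG : measurable_fun setT (fun z : RG * RG =>
      F (c * z.1 + e * z.2, e * z.1 - c * z.2)).
    by apply: (measurableT_comp mF); mfun.
  rewrite -(gauss_reflect mG (fun z => F0 _)) -(gauss_reflect mF F0).
  rewrite -(householder_pos ce' e0' mFr (fun z => F0 _)).
  apply: eq_integral => -[s t] _ /=; congr (F (_, _)); ring.
- move: ce; rewrite -e0 expr0n addr0 => /eqP; rewrite sqrf_eq1 => /orP[|] /eqP c1.
    rewrite c1 -(gauss_reflect mF F0).
    apply: eq_integral => -[s t] _ /=; congr (F (_, _)); ring.
  by move: c0; rewrite c1 lerNr oppr0 ler10.
Qed.

End Mehler2.

(** * Independent sigma-algebras *)

Section Independence.
Context d (T : measurableType d) (R : realType) (P : probability T R).
Implicit Types (A B : set T) (H : set (set T)).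

Lemma g_sigma_setI H : setI_closed <<s H >>.
Proof.
move=> A B sA sB; exact: (@measurableI _ (g_sigma_algebraType H) A B).
Qed.

Lemma g_sigma_sub H : H `<=` measurable -> <<s H >> `<=` measurable.
Proof. by move=> Hm; apply: smallest_sub => //; exact: sigma_algebra_measurable. Qed.

(** For fixed [B], both sides are finite measures in [A] that agree on a pi-system. *)
Lemma indep_pi_ext H B : H `<=` measurable -> setI_closed H -> H setT ->
  measurable B -> (forall A, H A -> P (A `&` B) = (P A * P B)%E) ->
  forall A, <<s H >> A -> P (A `&` B) = (P A * P B)%E.
Proof.
move=> Hm HI HT mB HB A sA.
have pB : P B \is a fin_num by exact: fin_num_measure.
have pB0 : 0 <= fine (P B) by exact: fine_ge0.
pose m1 := (mrestr P mB : {measure set T -> \bar R}).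
pose m2 := (mscale (NngNum pB0) P : {measure set T -> \bar R}).
have E : m1 A = m2 A.
  apply: (g_sigma_algebra_measure_unique H Hm (fun=> setT)) => //.
  - by rewrite bigcup_const.
  - move=> C HC; change (P (C `&` B) = ((fine (P B))%:E * P C)%E).
    by rewrite fineK // muleC; exact: HB.
  - by move=> k; rewrite /m1 /= /mrestr setTI ltey_eq pB.
have {}E : P (A `&` B) = ((fine (P B))%:E * P A)%E by exact: E.
by rewrite E fineK // muleC.
Qed.

Section Family.
Variables (I : finType) (F : I -> set (set T)).
Hypotheses (FT : forall i, F i setT) (FI : forall i, setI_closed (F i)).
Hypothesis Fm : forall i, F i `<=` measurable.
Hypothesis indF : independent_algebras P F.

Definition union_of (J : {set I}) : set (set T) := \bigcup_(i in [set i | i \in J]) F i.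

Let pi (J : {set I}) : set (set T) := [set A | exists E : I -> set T,
  (forall i, i \in J -> F i (E i)) /\ A = \bigcap_(i in [set i | i \in J]) E i].

Let mpi J : pi J `<=` measurable.
Proof.
move=> _ [E [FE ->]]; apply: fin_bigcap_measurable; first exact: finite_finset.
by move=> i /= iJ; apply: Fm; exact: FE.
Qed.

Let piI J : setI_closed (pi J).
Proof.
move=> _ _ [E [FE ->]] [E' [FE' ->]]; exists (fun i => E i `&` E' i); split.
  by move=> i iJ; apply: FI; [exact: FE|exact: FE'].
apply/seteqP; split => [x [h1 h2] i iJ|x h]; first by split; [exact: h1|exact: h2].
by split=> i iJ; have [] := h i iJ.
Qed.

Let piT J : pi J setT.
Proof. by exists (fun=> setT); split => //; rewrite bigcapT. Qed.

Let union_pi J : union_of J `<=` pi J.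
Proof.
move=> A [i /= iJ FA]; exists (fun k => if k == i then A else setT); split.
  by move=> k kJ; case: eqP => [->|_].
apply/seteqP; split => [x Ax k kJ|x /(_ i iJ)]; first by case: eqP.
by rewrite eqxx.
Qed.

Let indep_pi (J1 J2 : {set I}) A B : [disjoint J1 & J2]%B -> pi J1 A -> pi J2 B ->
  P (A `&` B) = (P A * P B)%E.
Proof.
move=> dJ [E [FE ->]] [E' [FE' ->]].
pose D i := if i \in J1 then E i else E' i.
have nJ i : i \in J2 -> i \in J1 = false.
  by move=> i2; apply: (disjointFl dJ).
have -> : \bigcap_(i in [set i | i \in J1]) E i `&`
    \bigcap_(i in [set i | i \in J2]) E' i =
    \bigcap_(i in [set i | i \in J1 :|: J2]) D i.
  apply/seteqP; split => [x [h1 h2] i|x h].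
    rewrite /= inE /D => /orP[iJ|iJ]; first by rewrite iJ; exact: h1.
    by rewrite nJ //; exact: h2.
  split=> i /= iJ; have := h i; rewrite /= inE iJ ?orbT /D.
    by rewrite iJ; exact.
  by rewrite nJ //; exact.
rewrite (indF (E := D)); last first.
  move=> i; rewrite inE /D; case: ifP => [i1 _|_ /= i2]; first exact: FE.
  exact: FE'.
rewrite (indF FE) (indF FE') (eq_bigl [predU J1 & J2]); last by move=> i; rewrite !inE.
rewrite bigU //=; congr (_ * _)%E; apply: eq_bigr => i iJ; rewrite /D ?iJ //.
by rewrite nJ.
Qed.

Lemma union_of_measurable J : union_of J `<=` measurable.
Proof. by move=> A [i _ FA]; exact: Fm FA. Qed.

(** Intersections of one event per index form a pi-system generating the sigma-algebra of a block.
    The product formula holds on these pi-systems by independence and is extended in one argument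
    after the other. *)
Lemma indep_union (J1 J2 : {set I}) A B : [disjoint J1 & J2]%B ->
  <<s union_of J1 >> A -> <<s union_of J2 >> B -> P (A `&` B) = (P A * P B)%E.
Proof.
move=> dJ sA sB.
have sub J : <<s union_of J >> `<=` <<s pi J >>.
  apply: smallest_sub; first exact: smallest_sigma_algebra.
  by apply: (subset_trans (@union_pi J)); exact: sub_sigma_algebra.
have mA : measurable A by apply: g_sigma_sub (sub _ _ sA); exact: mpi.
have H1 C : <<s pi J2 >> C -> forall D, <<s pi J1 >> D -> P (D `&` C) = (P D * P C)%E.
  move=> sC; have mC : measurable C by apply: g_sigma_sub sC; exact: mpi.
  apply: indep_pi_ext => // D pD.
  rewrite setIC muleC; apply: (indep_pi_ext (H := pi J2)) sC => // [|C' pC'].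
    exact: mpi pD.
  by rewrite setIC muleC; exact: (indep_pi dJ).
exact: (H1 B (sub _ _ sB) A (sub _ _ sA)).
Qed.

End Family.

(** * Tonelli for two independent sigma-algebras on one space *)

Section Diagonal.
Variables (H1 H2 : set (set T)).
Hypotheses (H1m : H1 `<=` measurable) (H2m : H2 `<=` measurable).
Hypothesis ind : forall A B, <<s H1 >> A -> <<s H2 >> B ->
  P (A `&` B) = (P A * P B)%E.
Notation T1 := (g_sigma_algebraType H1).
Notation T2 := (g_sigma_algebraType H2).

Let mid1 : measurable_fun [set: T] (id : T -> T1).
Proof. by move=> _ A mA; rewrite setTI; exact: (g_sigma_sub H1m). Qed.

Let mid2 : measurable_fun [set: T] (id : T -> T2).
Proof. by move=> _ A mA; rewrite setTI; exact: (g_sigma_sub H2m). Qed.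

Lemma g_sigma_measurable_fun d' (S : measurableType d') (f : T -> S) :
  measurable_fun [set: T1] f -> measurable_fun [set: T] f.
Proof. by move=> mf; exact: (measurableT_comp mf mid1). Qed.

Let Q1 : set T1 -> \bar R := pushforward P (id : T -> T1).
HB.instance Definition _ := Measure.copy Q1 (measure_function_pushforward__canonical__measure_function_Measure P mid1).
Let Q1T : Q1 setT = 1%E.
Proof. by rewrite /Q1 /pushforward preimage_setT probability_setT. Qed.
HB.instance Definition _ := Measure_isProbability.Build _ _ R Q1 Q1T.

Let Q2 : set T2 -> \bar R := pushforward P (id : T -> T2).
HB.instance Definition _ := Measure.copy Q2 (measure_function_pushforward__canonical__measure_function_Measure P mid2).
Let Q2T : Q2 setT = 1%E.
Proof. by rewrite /Q2 /pushforward preimage_setT probability_setT. Qed.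
HB.instance Definition _ := Measure_isProbability.Build _ _ R Q2 Q2T.

Let lawQ1 : same_law P Q1 (id : T -> T1) id.
Proof.
move=> F mF F0; rewrite /Q1 [RHS](ge0_integral_pushforward mid1) //.
Qed.

Let lawQ2 : same_law P Q2 (id : T -> T2) id.
Proof.
move=> F mF F0; rewrite /Q2 [RHS](ge0_integral_pushforward mid2) //.
Qed.

(** When each factor carries its own sub-sigma-algebra, independence says exactly that the diagonal
    map sends [P] to the product of its two restrictions. An expression in two independent blocks of
    variables becomes a function on [T1 * T2], and Tonelli applies without coordinates for the
    blocks. *)
Let diag (x : T) : T1 * T2 := (x, x).

Let mdiag : measurable_fun setT diag.
Proof. by apply/measurable_fun_pairP; split; [exact: mid1 | exact: mid2]. Qed.

Let law_diag : same_law P (prodP Q1 Q2) diag id.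
Proof.
move=> F mF F0.
pose push := (pushforward P diag : {measure set (T1 * T2) -> \bar R}).
pose m := push mdiag.
have mE X : measurable X -> prodP Q1 Q2 X = m X.
  apply: product_measure_unique => A B mA mB; rewrite /m /push /= /pushforward.
  by rewrite (_ : diag @^-1` (A `*` B) = A `&` B) //; exact: ind.
rewrite (eq_measure_integral m); last by move=> A mA _; exact: mE.
by rewrite [RHS](ge0_integral_pushforward mdiag).
Qed.

Lemma indep_tonelli (F : T1 * T2 -> \bar R) : measurable_fun setT F ->
  (forall z, (0 <= F z)%E) ->
  (\int[P]_x F (x, x) = \int[P]_x \int[P]_y F (x, y))%E.
Proof.
move=> mF F0; rewrite (law_diag mF F0) (prodP_tonelli1 Q1 Q2 mF F0).
have mG : measurable_fun [set: T1] (fun x => \int[Q2]_y F (x, y))%E.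
  exact: measurable_fun_fubini_tonelli_F.
rewrite -(lawQ1 mG); last by move=> x; apply: integral_ge0 => y _; exact: F0.
apply: eq_integral => x _; rewrite -(lawQ2 (F := fun y => F (x, y))) //.
exact: (measurableT_comp mF (measurable_pair1 _)).
Qed.

Lemma indep_measurable_integral (F : T1 * T2 -> \bar R) : measurable_fun setT F ->
  (forall z, (0 <= F z)%E) ->
  measurable_fun [set: T1] (fun x => \int[P]_y F (x, y))%E.
Proof.
move=> mF F0.
have mG : measurable_fun [set: T1] (fun x => \int[Q2]_y F (x, y))%E.
  exact: measurable_fun_fubini_tonelli_F.
apply: eq_measurable_fun mG => x _; rewrite -(lawQ2 (F := fun y => F (x, y))) //.
exact: (measurableT_comp mF (measurable_pair1 _)).
Qed.

Lemma indep_ExM (f g : T -> R) : measurable_fun [set: T1] f ->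
  measurable_fun [set: T2] g -> intg P f -> intg P g ->
  intg P (fun x => f x * g x) /\
  Ex P (fun x => f x * g x) = Ex P f * Ex P g.
Proof.
move=> mf mg fi gi.
have fi1 : intg Q1 f.
  exact: (intg_same_law (P := Q1) (Q := P) (Y := id : T1 -> T1) (Z := id : T -> T1)
    (@measurable_id _ T1 setT) (fun F mF F0 => esym (lawQ1 mF F0)) mf fi).
have gi2 : intg Q2 g.
  exact: (intg_same_law (P := Q2) (Q := P) (Y := id : T2 -> T2) (Z := id : T -> T2)
    (@measurable_id _ T2 setT) (fun F mF F0 => esym (lawQ2 mF F0)) mg gi).
have i := intg_prodM fi1 gi2.
have mfg := intg_measurable i.
split; first exact: (intg_same_law mdiag law_diag mfg i).
have := Ex_same_law mdiag law_diag mfg i; rewrite /= => ->.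
rewrite (Ex_prodM fi1 gi2).
by rewrite -(Ex_same_law mid1 lawQ1 mf fi1) -(Ex_same_law mid2 lawQ2 mg gi2).
Qed.

End Diagonal.
End Independence.

Section IidFamily.
Context d (T : measurableType d) (R : realType) (P : probability T R).
Variables (I : finType) (law : set R -> \bar R) (Y : I -> T -> R).
Hypothesis iidY : iid P law Y.

Definition coord_algebra (i : I) := sigma_algebra_of (fun _ : unit => Y i).
Definition coords (J : {set I}) : set (set T) := union_of coord_algebra J.

Lemma iid_meas i : measurable_fun setT (Y i).
Proof. by case: iidY. Qed.

Lemma coord_algebra_measurable i : coord_algebra i `<=` measurable.
Proof.
apply: g_sigma_sub => _ [_ _ [B mB <-]]; rewrite setTI -[X in measurable X]setTI.
exact: iid_meas.
Qed.

Lemma coords_measurable J : coords J `<=` measurable.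
Proof. by apply: union_of_measurable => i; exact: coord_algebra_measurable. Qed.

Lemma coords_indep (J1 J2 : {set I}) (A B : set T) : [disjoint J1 & J2]%B ->
  <<s coords J1 >> A -> <<s coords J2 >> B -> P (A `&` B) = (P A * P B)%E.
Proof.
apply: indep_union.
- by move=> i; apply: (@measurableT _ (g_sigma_algebraType _)).
- by move=> i; exact: g_sigma_setI.
- by move=> i; exact: coord_algebra_measurable.
- by case: iidY.
Qed.

Lemma coords_meas (J : {set I}) j : j \in J ->
  measurable_fun [set: g_sigma_algebraType (coords J)] (Y j).
Proof.
move=> jJ _ B mB; apply: sub_sigma_algebra; exists j => //.
by apply: sub_sigma_algebra; exists tt => //; exists B.
Qed.

Lemma coords_fun (J : {set I}) d' (S : measurableType d') (f : T -> S) :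
  measurable_fun [set: g_sigma_algebraType (coords J)] f -> measurable_fun setT f.
Proof. by apply: g_sigma_measurable_fun; exact: coords_measurable. Qed.

Lemma coords_ExM (J1 J2 : {set I}) (f g : T -> R) : [disjoint J1 & J2]%B ->
  measurable_fun [set: g_sigma_algebraType (coords J1)] f ->
  measurable_fun [set: g_sigma_algebraType (coords J2)] g ->
  intg P f -> intg P g ->
  intg P (fun x => f x * g x) /\
  Ex P (fun x => f x * g x) = Ex P f * Ex P g.
Proof.
move=> dJ mf mg; apply: (indep_ExM (coords_measurable (J := J1))
  (coords_measurable (J := J2))) => // A B; exact: coords_indep.
Qed.

Lemma coords_tonelli (J1 J2 : {set I})
  (F : g_sigma_algebraType (coords J1) * g_sigma_algebraType (coords J2) -> \bar R) :
  [disjoint J1 & J2]%B -> measurable_fun setT F -> (forall z, (0 <= F z)%E) ->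
  (\int[P]_x F (x, x) = \int[P]_x \int[P]_y F (x, y))%E.
Proof.
move=> dJ mF F0; apply: (indep_tonelli (coords_measurable (J := J1))
  (coords_measurable (J := J2))) => // A B; exact: coords_indep.
Qed.

End IidFamily.

(** * The joint law of two linear forms *)

Section ThreeGaussians.
Context {R : realType}.
Notation G := (@std_gauss R).
Notation G2 := (prodP G G).
Notation RG := (measurableTypeR R).
Notation G3 := (prodP G2 G).
Implicit Type K : (RG * RG) * RG -> \bar R.

Lemma perm12 K : measurable_fun setT K -> (forall z, (0 <= K z)%E) ->
  (\int[G3]_z K ((z.1.2, z.1.1), z.2) = \int[G3]_z K z)%E.
Proof.
move=> mK K0.
have mp : measurable_fun setT (fun z : (RG * RG) * RG => ((z.1.2, z.1.1), z.2)).
  by mfun.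
have mKp : measurable_fun setT (fun z : (RG * RG) * RG => K ((z.1.2, z.1.1), z.2)).
  exact: (measurableT_comp mK mp).
rewrite (prodP_tonelli2 G2 G mKp (fun z => K0 _)) (prodP_tonelli2 G2 G mK K0).
apply: eq_integral => t _.
have mKt : measurable_fun setT (fun z : RG * RG => K (z, t)).
  exact: (measurableT_comp mK (measurable_pair2 _)).
by rewrite -(prodP_swap mKt (fun z => K0 _)).
Qed.

Lemma perm23 K : measurable_fun setT K -> (forall z, (0 <= K z)%E) ->
  (\int[G3]_z K ((z.1.1, z.2), z.1.2) = \int[G3]_z K z)%E.
Proof.
move=> mK K0.
have mp : measurable_fun setT (fun z : (RG * RG) * RG => ((z.1.1, z.2), z.1.2)).
  by mfun.
have mKp : measurable_fun setT (fun z : (RG * RG) * RG => K ((z.1.1, z.2), z.1.2)).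
  exact: (measurableT_comp mK mp).
have unfold3 L : measurable_fun setT L -> (forall z, (0 <= L z)%E) ->
    (\int[G3]_z L z = \int[G]_s \int[G2]_z L ((s, z.1), z.2))%E.
  move=> mL L0; rewrite (prodP_tonelli1 G2 G mL L0).
  have mI : measurable_fun setT (fun z : RG * RG => \int[G]_y L (z, y))%E.
    exact: measurable_fun_fubini_tonelli_F.
  rewrite (prodP_tonelli1 G G mI); last by move=> z; apply: integral_ge0 => y _; exact: L0.
  apply: eq_integral => s _.
  have ms : measurable_fun setT (fun z : RG * RG => ((s : RG, z.1), z.2)).
    by mfun.
  have mLs : measurable_fun setT (fun z : RG * RG => L ((s, z.1), z.2)).
    exact: (measurableT_comp mL ms).
  by rewrite (prodP_tonelli1 G G mLs (fun z => L0 _)).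
rewrite (unfold3 _ mKp (fun z => K0 _)) (unfold3 _ mK K0).
apply: eq_integral => s _.
have ms : measurable_fun setT (fun z : RG * RG => ((s : RG, z.1), z.2)).
  by mfun.
have mKs : measurable_fun setT (fun z : RG * RG => K ((s, z.1), z.2)).
  exact: (measurableT_comp mK ms).
by rewrite -(prodP_swap mKs (fun z => K0 _)).
Qed.

Lemma rot12 (c e : R) K : c ^+ 2 + e ^+ 2 = 1 -> 0 <= c ->
  measurable_fun setT K -> (forall z, (0 <= K z)%E) ->
  (\int[G3]_z K ((c * z.1.1 + e * z.1.2, e * z.1.1 - c * z.1.2)%R, z.2) =
   \int[G3]_z K z)%E.
Proof.
move=> ce c0 mK K0.
have mp : measurable_fun setT (fun z : (RG * RG) * RG =>
    ((c * z.1.1 + e * z.1.2 : RG, e * z.1.1 - c * z.1.2 : RG), z.2)).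
  by mfun.
have mKp : measurable_fun setT (fun z : (RG * RG) * RG =>
    K ((c * z.1.1 + e * z.1.2, e * z.1.1 - c * z.1.2), z.2)).
  exact: (measurableT_comp mK mp).
rewrite (prodP_tonelli2 G2 G mKp (fun z => K0 _)) (prodP_tonelli2 G2 G mK K0).
apply: eq_integral => t _.
have mKt : measurable_fun setT (fun z : RG * RG => K (z, t)).
  exact: (measurableT_comp mK (measurable_pair2 _)).
by rewrite -(householder ce c0 mKt (fun z => K0 _)).
Qed.

Lemma polar (x y : R) : 0 <= x -> exists c e, [/\ c ^+ 2 + e ^+ 2 = 1, 0 <= c,
  x = Num.sqrt (x ^+ 2 + y ^+ 2) * c & y = Num.sqrt (x ^+ 2 + y ^+ 2) * e].
Proof.
move=> x0; set r := Num.sqrt _; have q0 : 0 <= x ^+ 2 + y ^+ 2 by rewrite addr_ge0 ?sqr_ge0.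
have r2 : r ^+ 2 = x ^+ 2 + y ^+ 2 by rewrite sqr_sqrtr.
have [r0|rn] := eqVneq r 0.
  exists 1, 0; rewrite expr1n expr0n addr0 r0 !mul0r; split => //.
    by apply/eqP; rewrite -sqrf_eq0; apply/eqP; move: r2; rewrite r0 expr0n /=; nra.
  by apply/eqP; rewrite -sqrf_eq0; apply/eqP; move: r2; rewrite r0 expr0n /=; nra.
exists (x / r), (y / r); split.
- by rewrite !exprMn !exprVn -mulrDl r2 divff // -r2 sqrf_eq0.
- by rewrite divr_ge0 // sqrtr_ge0.
- by rewrite mulrCA divff ?mulr1.
- by rewrite mulrCA divff ?mulr1.
Qed.

(** Two forms in three independent Gaussians are brought back to triangular shape in two. A first
    reflection in the plane of the variables 1 and 3 clears [a] from the first form and leaves [be']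
    and [ka] in the second; another merges [ka] and [ga] into one coefficient. The third variable
    then drops out. *)
Lemma three_to_two (al be ga a b : R) : 0 <= al -> 0 <= ga ->
  exists al' be' ga', [/\ 0 <= al' /\ 0 <= ga',
    al' ^+ 2 = al ^+ 2 + a ^+ 2, al' * be' = al * be + a * b,
    be' ^+ 2 + ga' ^+ 2 = be ^+ 2 + ga ^+ 2 + b ^+ 2 &
    forall F : RG * RG -> \bar R, measurable_fun setT F -> (forall z, (0 <= F z)%E) ->
    (\int[G]_t \int[G2]_z F (al * z.1 + a * t, be * z.1 + ga * z.2 + b * t)%R =
     \int[G2]_z F (al' * z.1, be' * z.1 + ga' * z.2)%R)%E].
Proof.
move=> al0 ga0; have [c [e [ce c0 alE aE]]] := polar a al0.
set r := Num.sqrt _ in alE aE.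
pose be' := be * c + b * e; pose ka := be * e - b * c.
have [c2 [e2 [ce2 c20 gaE kaE]]] := polar ka ga0.
set r2 := Num.sqrt _ in gaE kaE.
exists r, be', r2; split; rewrite ?sqrtr_ge0 //.
- by rewrite sqr_sqrtr // addr_ge0 ?sqr_ge0.
- by rewrite /be' {1}alE {1}aE; ring.
- rewrite /r2 sqr_sqrtr ?addr_ge0 ?sqr_ge0 // /be' /ka.
  rewrite (_ : _ + _ = (c ^+ 2 + e ^+ 2) * (be ^+ 2 + b ^+ 2) + ga ^+ 2); last by ring.
  by rewrite ce; ring.
move=> F mF F0.
have mlin (p q u v w x : R) : measurable_fun setT (fun z : (RG * RG) * RG =>
    (p * z.1.1 + q * z.1.2 + u * z.2 : RG, v * z.1.1 + w * z.1.2 + x * z.2 : RG)).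
  by mfun.
pose K (p q u v w x : R) (z : (RG * RG) * RG) :=
  F (p * z.1.1 + q * z.1.2 + u * z.2, v * z.1.1 + w * z.1.2 + x * z.2).
have mK p q u v w x : measurable_fun setT (K p q u v w x).
  exact: (measurableT_comp mF (mlin _ _ _ _ _ _)).
have K0 p q u v w x z : (0 <= K p q u v w x z)%E by exact: F0.
have P12 p q u v w x : (\int[G3]_z K p q u v w x z = \int[G3]_z K q p u w v x z)%E.
  rewrite -(perm12 (mK q p u w v x) (K0 _ _ _ _ _ _)).
  by apply: eq_integral => z _; rewrite /K /=; congr (F (_, _)); ring.
have P23 p q u v w x : (\int[G3]_z K p q u v w x z = \int[G3]_z K p u q v x w z)%E.
  rewrite -(perm23 (mK p u q v x w) (K0 _ _ _ _ _ _)).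
  by apply: eq_integral => z _; rewrite /K /=; congr (F (_, _)); ring.
transitivity (\int[G3]_z K al 0%R a be ga b z)%E.
  rewrite (prodP_tonelli2 G2 G (mK _ _ _ _ _ _) (K0 _ _ _ _ _ _)).
  apply: eq_integral => t _; apply: eq_integral => z _; rewrite /K /=.
  by congr (F (_, _)); ring.
rewrite P23 -(rot12 ce c0 (mK _ _ _ _ _ _) (K0 _ _ _ _ _ _)).
transitivity (\int[G3]_z K r 0%R 0%R be' ka ga z)%E.
  apply: eq_integral => z _; rewrite /K /=; congr (F (_, _)).
    rewrite {1}alE {1}aE; transitivity (r * ((c ^+ 2 + e ^+ 2) * z.1.1)); first by ring.
    by rewrite ce; ring.
  by rewrite /be' /ka; ring.
rewrite P12 P23 P12.
rewrite -(rot12 ce2 c20 (mK _ _ _ _ _ _) (K0 _ _ _ _ _ _)).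
transitivity (\int[G3]_z K 0%R 0%R r r2 0%R be' z)%E.
  apply: eq_integral => z _; rewrite /K /=; congr (F (_, _)); first by ring.
  rewrite {1}gaE {1}kaE; transitivity (r2 * ((c2 ^+ 2 + e2 ^+ 2) * z.1.1) + be' * z.2); first by ring.
  by rewrite ce2; ring.
rewrite P23 P12 (prodP_tonelli1 G2 G (mK _ _ _ _ _ _) (K0 _ _ _ _ _ _)).
apply: eq_integral => z _; rewrite /K /=.
have -> : (fun y : RG => F ((r * z.1 + 0 * z.2 + 0 * y)%R, (be' * z.1 + r2 * z.2 + 0 * y)%R)) =
    cst (F ((r * z.1)%R, (be' * z.1 + r2 * z.2)%R)).
  by apply/funext => y; congr (F (_, _)); ring.
by rewrite integral_cst //= probability_setT mule1.
Qed.

End ThreeGaussians.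

Section LinearForms.
Context d (T : measurableType d) (R : realType) (P : probability T R).
Notation G := (@std_gauss R).
Notation G2 := (prodP G G).
Notation RG := (measurableTypeR R).
Variables (I : finType) (Y : I -> T -> R).
Hypothesis iidY : iid P (centered_gauss 1) Y.

Lemma coord_law i : same_law P G (Y i : T -> RG) id.
Proof.
move=> F mF F0; case: (iidY) => mY lY _.
pose Yi : T -> RG := Y i.
have mYi : measurable_fun setT Yi by exact: mY.
pose push := measure_function_pushforward__canonical__measure_function_Measure P mYi.
transitivity (\int[push]_y F y)%E.
  by rewrite [RHS](ge0_integral_pushforward mYi).
apply: eq_measure_integral => A mA _.
have := lY i A mA; rewrite /centered_gauss oner_eq0; exact.
Qed.

Definition lin_form (s : seq I) (a : I -> R) (x : T) := \sum_(i <- s) a i * Y i x.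

Lemma lin_form_coords (J : {set I}) s a : {subset s <= J} ->
  measurable_fun [set: g_sigma_algebraType (coords Y J)] (lin_form s a).
Proof.
elim: s => [|i s IH] sJ.
  by rewrite /lin_form; under eq_fun do rewrite big_nil; exact: measurable_cst.
rewrite /lin_form; under eq_fun do rewrite big_cons.
apply: measurable_funD; last by apply: IH => j js; apply: sJ; rewrite inE js orbT.
apply: measurable_funM => //; apply: coords_meas; apply: sJ; exact: mem_head.
Qed.

Lemma lin_form_meas s a : measurable_fun setT (lin_form s a).
Proof.
have sJ : {subset s <= [set: I]%SET} by move=> i; rewrite inE.
exact: (coords_fun iidY (lin_form_coords a sJ)).
Qed.

(** A Cholesky factorization of the covariance matrix of the two forms, built one coordinate at a
    time: the new coordinate is frozen by independence, the induction hypothesis treats the others,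
    and [three_to_two] absorbs it. *)
Lemma joint_law s (a b : I -> R) : uniq s -> exists al be ga, [/\ 0 <= al /\ 0 <= ga,
   al ^+ 2 = \sum_(i <- s) a i ^+ 2, al * be = \sum_(i <- s) a i * b i,
   be ^+ 2 + ga ^+ 2 = \sum_(i <- s) b i ^+ 2 &
   same_law P G2 (fun x => (lin_form s a x : RG, lin_form s b x : RG))
     (fun z : RG * RG => (al * z.1 : RG, be * z.1 + ga * z.2 : RG))].
Proof.
elim: s => [|i s IH] /=.
  move=> _; exists 0, 0, 0; rewrite !big_nil !mul0r expr0n addr0; split => // F mF F0.
  under eq_integral do rewrite /lin_form !big_nil.
  rewrite integral_cst //; under [RHS]eq_integral do rewrite !mul0r addr0.
  by rewrite integral_cst //= !probability_setT.
move=> /andP[is_ us]; have [al [be [ga [[al0 ga0] alE abE bgE lawS]]]] := IH us.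
have [al' [be' [ga' [[? ?] alE' abE' bgE' H]]]] := three_to_two be (a i) (b i) al0 ga0.
exists al', be', ga'; rewrite !big_cons; split=> //.
- by rewrite alE' alE addrC.
- by rewrite abE' abE addrC.
- by rewrite bgE' bgE addrC.
move=> F mF F0; rewrite -(H F mF F0).
have dj : [disjoint [set i]%SET & [set j in s]%SET]%B.
  by rewrite disjoints1 inE.
have sJ : {subset s <= [set j in s]} by move=> j; rewrite inE.
pose FF (z : g_sigma_algebraType (coords Y [set i]) *
             g_sigma_algebraType (coords Y [set j in s])) :=
  F (lin_form s a z.2 + a i * Y i z.1, lin_form s b z.2 + b i * Y i z.1).
have mFF : measurable_fun setT FF.
  apply: (measurableT_comp mF); apply/measurable_fun_pairP.
  have m1 : measurable_fun setT (fun z : g_sigma_algebraType (coords Y [set i]) *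
      g_sigma_algebraType (coords Y [set j in s]) => Y i z.1).
    by apply: (measurableT_comp _ measurable_fst); apply: coords_meas; rewrite inE.
  have m2 q : measurable_fun setT (fun z : g_sigma_algebraType (coords Y [set i]) *
      g_sigma_algebraType (coords Y [set j in s]) => lin_form s q z.2).
    by apply: (measurableT_comp _ measurable_snd); exact: lin_form_coords.
  by split => /=; apply: measurable_funD => //; apply: measurable_funM.
transitivity (\int[P]_x FF (x, x))%E.
  by apply: eq_integral => x _; rewrite /FF /lin_form /= !big_cons;
    congr (F (_, _)); rewrite addrC.
rewrite (coords_tonelli iidY dj mFF (fun z => F0 _)).
pose HH (t : RG) := (\int[G2]_z F (al * z.1 + a i * t, be * z.1 + ga * z.2 + b i * t)%R)%E.
transitivity (\int[P]_x HH (Y i x))%E.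
  apply: eq_integral => x _; rewrite /HH /FF /=.
  pose F' (z : RG * RG) := F (z.1 + a i * Y i x, z.2 + b i * Y i x).
  have mF' : measurable_fun setT F'.
    by apply: (measurableT_comp mF); mfun.
  exact: (lawS F' mF' (fun z => F0 _)).
have mHH : measurable_fun setT HH.
  pose L (p : RG * (RG * RG)) := F (al * p.2.1 + a i * p.1, be * p.2.1 + ga * p.2.2 + b i * p.1).
  have mL : measurable_fun setT L.
    by apply: (measurableT_comp mF); mfun.
  exact: (measurable_fun_fubini_tonelli_F (m2 := G2) L mL (fun z => F0 _)).
by rewrite (coord_law i mHH) // => t; apply: integral_ge0.
Qed.

End LinearForms.

Lemma sqr_sum_le (R : realType) (n : nat) (x : 'I_n -> R) :
  (\sum_i x i) ^+ 2 <= n%:R * \sum_i x i ^+ 2.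
Proof.
have -> : n%:R * (\sum_i x i ^+ 2) = \sum_i \sum_j (x i ^+ 2 + x j ^+ 2) / 2.
  have E i : \sum_j (x i ^+ 2 + x j ^+ 2) / 2 = (n%:R * x i ^+ 2 + \sum_j x j ^+ 2) / 2.
    by rewrite -mulr_suml big_split /= sumr_const card_ord -(mulr_natl (x i ^+ 2) n).
  rewrite [RHS](eq_bigr _ (fun i _ => E i)) -mulr_suml big_split /= -mulr_sumr.
  by rewrite sumr_const card_ord -(mulr_natl (\sum_j _) n); field.
rewrite expr2 mulr_suml; apply: ler_sum => i _; rewrite mulr_sumr.
apply: ler_sum => j _; have := sqr_ge0 (x i - x j); rewrite sqrrB; lra.
Qed.

Lemma sum_pow4_le (R : realType) (n : nat) (x : 'I_n -> R) :
  (\sum_i x i) ^+ 4 <= n%:R ^+ 3 * \sum_i x i ^+ 4.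
Proof.
have h1 := sqr_sum_le x; have h2 := sqr_sum_le (fun i => x i ^+ 2).
have -> : \sum_i x i ^+ 4 = \sum_i (x i ^+ 2) ^+ 2.
  by apply: eq_bigr => i _; rewrite -exprM.
have -> : (\sum_i x i) ^+ 4 = ((\sum_i x i) ^+ 2) ^+ 2 by rewrite -exprM.
apply: (@le_trans _ _ ((n%:R * \sum_i x i ^+ 2) ^+ 2)).
  by rewrite lerXn2r ?nnegrE ?sqr_ge0 ?mulr_ge0 ?sumr_ge0 // => i _; exact: sqr_ge0.
rewrite exprMn (exprSr n%:R 2) -mulrA; apply: ler_wpM2l; last exact: h2.
exact: exprn_ge0.
Qed.

Lemma sum_sqr_le_sqr_sum (R : realType) (n : nat) (x : 'I_n -> R) :
  (forall i, 0 <= x i) -> \sum_i x i ^+ 2 <= (\sum_i x i) ^+ 2.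
Proof.
move=> x0; rewrite [leRHS]expr2 mulr_suml; apply: ler_sum => i _.
rewrite expr2 ler_wpM2l // (bigD1 i) //= lerDl; exact: sumr_ge0.
Qed.

(** * Hypercontractivity *)

Section Bonami.
Context d (T : measurableType d) (R : realType) (P : probability T R).
Notation G := (@std_gauss R).
Notation RG := (measurableTypeR R).
Variables (I : finType) (Y : I -> T -> R).
Hypothesis iidY : iid P (centered_gauss 1) Y.

Lemma hnS k (y : R) :
  y * hn k y = Num.sqrt k.+1%:R * hn k.+1 y + Num.sqrt k%:R * hn k.-1 y.
Proof.
have sn (n : nat) : Num.sqrt n.+1%:R != 0 :> R by rewrite lt0r_neq0 // sqrtr_gt0.
have sf (n : nat) : Num.sqrt (n`!%:R) != 0 :> R.
  by rewrite lt0r_neq0 // sqrtr_gt0 ltr0n fact_gt0.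
have key : y * (He k).[y] = (He k.+1).[y] + k%:R * (He k.-1).[y].
  by rewrite HeS hornerD hornerN hornerZ hornerM hornerX; ring.
have fS (n : nat) : Num.sqrt (n.+1`!%:R) = Num.sqrt n.+1%:R * Num.sqrt (n`!%:R) :> R.
  by rewrite factS natrM sqrtrM.
rewrite /hn fS invfM; case: k key => [|k] key.
  rewrite sqrtr0 mul0r addr0 mulrCA key mul0r addr0.
  by rewrite !mulrA mulfV // mul1r.
rewrite mulrCA key /= fS.
set a := Num.sqrt k.+1%:R; set b := Num.sqrt _; set c := Num.sqrt _.
have -> : k.+1%:R = a ^+ 2 by rewrite sqr_sqrtr.
by field; rewrite sf !sn.
Qed.

(** Polynomials of total degree at most [M] in the coordinates in [s], expanded in Hermite
    polynomials of the first coordinate with coefficients in the remaining ones. This is the shape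
    on which the induction of [bonami] runs. *)
Fixpoint gpol (s : seq I) (M : nat) (f : T -> R) : Prop :=
  if s is i :: s' then
    exists A : nat -> T -> R, (forall k, (k <= M)%N -> gpol s' (M - k) (A k)) /\
      forall x, f x = \sum_(k < M.+1) A k x * hn k (Y i x)
  else exists c, forall x, f x = c.

Lemma gpol_ext s M f g : (forall x, f x = g x) -> gpol s M f -> gpol s M g.
Proof. by move=> /funext ->. Qed.

Lemma gpol_cst s M c : gpol s M (fun=> c).
Proof.
elim: s M c => [|i s IH] M c /=; first by exists c.
exists (fun k _ => if k == 0%N then c else 0); split.
  by move=> [|k] _ /=; exact: IH.
move=> x; rewrite big_ord_recl big1 /= ?addr0; last by move=> k _; rewrite mul0r.
by rewrite /hn /= fact0 sqrtr1 invr1 mul1r horner_one mulr1.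
Qed.

Lemma gpolD s M f g : gpol s M f -> gpol s M g -> gpol s M (fun x => f x + g x).
Proof.
elim: s M f g => [|i s IH] M f g /=.
  by move=> [a fa] [b gb]; exists (a + b) => x; rewrite fa gb.
move=> [A [pA fA]] [B [pB gB]]; exists (fun k x => A k x + B k x); split.
  by move=> k kM; apply: IH; [exact: pA|exact: pB].
by move=> x; rewrite fA gB -big_split /=; apply: eq_bigr => k _; rewrite mulrDl.
Qed.

Lemma gpolZ s M c f : gpol s M f -> gpol s M (fun x => c * f x).
Proof.
elim: s M f => [|i s IH] M f /=; first by move=> [a fa]; exists (c * a) => x; rewrite fa.
move=> [A [pA fA]]; exists (fun k x => c * A k x); split.
  by move=> k kM; apply: IH; exact: pA.
by move=> x; rewrite fA mulr_sumr; apply: eq_bigr => k _; rewrite mulrA.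
Qed.

Lemma gpol_mono s M N f : (M <= N)%N -> gpol s M f -> gpol s N f.
Proof.
elim: s M N f => [|i s IH] M N f MN //=; move=> [A [pA fA]].
exists (fun k x => if (k <= M)%N then A k x else 0); split.
  move=> k kN; case: leqP => kM; last exact: gpol_cst.
  by apply: IH (pA k kM); exact: leq_sub2r.
move=> x; rewrite fA (big_ord_widen N.+1 (fun k => A k x * hn k (Y i x))) // big_mkcond /=.
by apply: eq_bigr => k _; rewrite ltnS; case: ifP => // _; rewrite mul0r.
Qed.

Lemma gpol_sum (J : Type) (r : seq J) s M (F : J -> T -> R) :
  (forall j, gpol s M (F j)) -> gpol s M (fun x => \sum_(j <- r) F j x).
Proof.
move=> pF; elim: r => [|j r IH].
  by under [X in gpol _ _ X]eq_fun do rewrite big_nil; exact: gpol_cst.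
under [X in gpol _ _ X]eq_fun do rewrite big_cons; exact: gpolD.
Qed.

Lemma gpol_mulY s M f j : j \in s -> gpol s M f -> gpol s M.+1 (fun x => Y j x * f x).
Proof.
elim: s M f => [|i s IH] M f //=; rewrite inE => /predU1P[->|js] [A [pA fA]].
  (* [A] extended by zero beyond [M]. By [hnS], multiplication by the coordinate sends degree [k] to
     [k + 1] and [k - 1], so the new coefficient of degree [k] collects [B (k - 1)] and
     [B (k + 1)]. *)
  pose B k := (if (k <= M)%N then A k else fun=> 0).
  have Bz k x : (M < k)%N -> B k x = 0 by rewrite /B ltnNge => /negbTE ->.
  have pB k : gpol s (M - k) (B k).
    by rewrite /B; case: leqP => kM; [exact: pA | exact: gpol_cst].
  exists (fun k x => (if k is k'.+1 then Num.sqrt k'.+1%:R * B k' x else 0) +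
                     Num.sqrt k.+1%:R * B k.+1 x); split.
    move=> k kM; apply: gpolD; last first.
      by apply: gpolZ; apply: gpol_mono (pB k.+1); lia.
    case: k kM => [|k] kM; first exact: gpol_cst.
    by apply: gpolZ; apply: gpol_mono (pB k); lia.
  move=> x; rewrite fA mulr_sumr.
  under [RHS]eq_bigr do rewrite mulrDl.
  rewrite big_split /= [X in _ = X + _]big_ord_recl /= mul0r add0r.
  under [X in _ = X + _]eq_bigr do rewrite /bump /= add1n.
  have -> : \sum_(k < M.+2) Num.sqrt k.+1%:R * B k.+1 x * hn k (Y i x) =
      \sum_(k < M.+1) Num.sqrt k%:R * B k x * hn k.-1 (Y i x).
    rewrite big_ord_recr /= Bz // mulr0 mul0r addr0.
    rewrite big_ord_recr /= Bz // mulr0 mul0r addr0.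
    by rewrite [RHS]big_ord_recl sqrtr0 !mul0r add0r.
  rewrite -big_split /=; apply: eq_bigr => k _.
  have -> : B k = A k by rewrite /B -ltnS ltn_ord.
  rewrite mulrCA hnS; ring.
exists (fun k x => if (k <= M)%N then Y j x * A k x else 0); split.
  move=> k kM; case: leqP => kM'; last exact: gpol_cst.
  by rewrite subSn //; apply: IH => //; exact: pA.
move=> x; rewrite fA mulr_sumr [RHS]big_ord_recr /= ltnn mul0r addr0.
by apply: eq_bigr => k _; rewrite -ltnS ltn_ord mulrA.
Qed.

Lemma gpol_lin s M a f : gpol s M f ->
  gpol s M.+1 (fun x => lin_form Y s a x * f x).
Proof.
move=> pf; rewrite /lin_form.
have H r : {subset r <= s} -> gpol s M.+1 (fun x => (\sum_(i <- r) a i * Y i x) * f x).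
  elim: r => [|i r IH] rs.
    by under [X in gpol _ _ X]eq_fun do rewrite big_nil mul0r; exact: gpol_cst.
  under [X in gpol _ _ X]eq_fun do rewrite big_cons mulrDl -mulrA.
  apply: gpolD; last by apply: IH => j jr; apply: rs; rewrite inE jr orbT.
  by apply: gpolZ; apply: gpol_mulY pf; apply: rs; exact: mem_head.
exact: H.
Qed.

Lemma gpol_He s a k : gpol s k (fun x => (He k).[lin_form Y s a x]).
Proof.
have H n : gpol s n (fun x => (He n).[lin_form Y s a x]) /\
           gpol s n.+1 (fun x => (He n.+1).[lin_form Y s a x]).
  elim: n => [|n [IH1 IH2]].
    split; first by apply: gpol_ext (gpol_cst s 0 1) => x; rewrite horner_one.
    apply: gpol_ext (gpol_lin a (gpol_cst s 0 1)) => x.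
    by rewrite HeS scale0r subr0 hornerM hornerX horner_one.
  split=> //; have p2 := gpolZ (- n.+1%:R) (gpol_mono (leqW (leqW (leqnn n))) IH1).
  apply: gpol_ext (gpolD (gpol_lin a IH2) p2) => x.
  rewrite [in RHS]HeS -[n.+1.-1]/n; move: (He n.+1) (He n) => p q.
  by rewrite hornerD hornerN hornerM hornerX hornerZ mulNr.
by have [] := H k.
Qed.

Lemma gpol_hn s a k : gpol s k (fun x => hn k (lin_form Y s a x)).
Proof. exact: gpolZ (gpol_He s a k). Qed.

Lemma mom_coord i : mom P (Y i).
Proof.
have mYi : measurable_fun setT (Y i : T -> RG) by exact: iid_meas iidY i.
exact: (mom_same_law mYi (coord_law iidY i) (f := fun x => x) (proj1 mom_gauss) mom_gauss).
Qed.

Lemma Ex_coord i (f : R -> R) : intg G f ->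
  intg P (fun x => f (Y i x)) /\ Ex P (fun x => f (Y i x)) = Ex G f.
Proof.
move=> fi; have mYi : measurable_fun setT (Y i : T -> RG) by exact: iid_meas iidY i.
have mf := intg_measurable fi.
by split; [exact: (intg_same_law mYi (coord_law iidY i) mf fi) |
  exact: (Ex_same_law mYi (coord_law iidY i) mf fi)].
Qed.

Lemma gpol_mom s M f : gpol s M f -> mom P f.
Proof.
elim: s M f => [|i s IH] M f /=; first by move=> [c /funext ->]; exact: mom_cst.
move=> [A [pA /funext ->]]; apply: mom_sum => k _; apply: momM.
  by apply: IH (pA k _); rewrite -ltnS.
by apply: momZ; apply: mom_poly; exact: mom_coord.
Qed.

Lemma gpol_coords (J : {set I}) s M f : {subset s <= J} -> gpol s M f ->
  measurable_fun [set: g_sigma_algebraType (coords Y J)] f.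
Proof.
elim: s M f => [|i s IH] M f sJ /=.
  by move=> [c /funext ->]; exact: measurable_cst.
move=> [A [pA /funext ->]]; apply: measurable_sum => k; apply: measurable_funM.
  apply: IH (pA k _) => [j js|]; last by rewrite -ltnS.
  by apply: sJ; rewrite inE js orbT.
have mYi : measurable_fun [set: g_sigma_algebraType (coords Y J)] (Y i : T -> RG).
  by apply: coords_meas; apply: sJ; exact: mem_head.
exact: (measurableT_comp (proj1 (mom_hn k)) mYi).
Qed.

Section Step.
Variables (i : I) (s : seq I).
Hypothesis is_ : i \notin s.

(* The coefficients are functions of the coordinates in [s], hence independent
   of [Y i]. *)
Lemma gpol_indep (A : T -> R) (h : R -> R) :
  mom P A -> measurable_fun [set: g_sigma_algebraType (coords Y [set j in s]%SET)] A ->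
  mom G h ->
  intg P (fun x => A x * h (Y i x)) /\
  Ex P (fun x => A x * h (Y i x)) = Ex P A * Ex G h.
Proof.
move=> mA cA mh; have hi := mom_intg mh; have [ih Eh] := Ex_coord i hi.
rewrite -Eh; apply: (coords_ExM iidY (J1 := [set j in s]%SET) (J2 := [set i]%SET)) => //.
- by rewrite disjoint_sym disjoints1 inE.
- have mYi : measurable_fun [set: g_sigma_algebraType (coords Y [set i]%SET)] (Y i : T -> RG).
    by apply: coords_meas; rewrite inE.
  exact: (measurableT_comp (proj1 mh) mYi).
- exact: mom_intg.
Qed.

End Step.

(** The 4 absorbs the cross term, where 8 must become 2 after gaining at least one factor; the rest
    absorbs the constant [3 M^3] and the fourth moments of the [hn k] in the term [E B^4]. In
    [bonami] it is taken at a fixed [Mx], so that all subproblems of smaller degree share it. *)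
Definition bonami_cst (M : nat) : R :=
  4 + 3 * M%:R ^+ 3 * \sum_(k < M.+1) Ex G (fun x => hn k x ^+ 4).

Lemma hn4_ge0 k : 0 <= Ex G (fun x : R => hn k x ^+ 4).
Proof. by apply: Ex_ge0 => x; rewrite (exprM _ 2 2) sqr_ge0. Qed.

Lemma bonami_cst_ge4 M : 4 <= bonami_cst M.
Proof. by rewrite lerDl mulr_ge0 ?sumr_ge0 // => k _; exact: hn4_ge0. Qed.

(* Expand in the last variable, [f = A0 + B]: then
   [E f^4 <= E A0^4 + 8 E A0^2 B^2 + 3 E B^4] since [E A0^3 B = 0], and each
   further degree in that variable gains a factor [1 / bonami_cst]. *)
Lemma bonami Mx s M f : uniq s -> (M <= Mx)%N -> gpol s M f ->
  Ex P (fun x => f x ^+ 4) <= bonami_cst Mx ^+ (2 * M) * Ex P (fun x => f x ^+ 2) ^+ 2.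
Proof.
set D := bonami_cst Mx; have D4 : 4 <= D := bonami_cst_ge4 Mx.
have D0 : 0 < D by lra.
elim: s M f => [|i s IH] M f /=.
  move=> _ _ [c /funext ->]; rewrite !Ex_cst -exprM -[leLHS]mul1r.
  rewrite ler_wpM2r ?(exprM _ 2 2) ?sqr_ge0 // exprn_ege1 //; lra.
move=> /andP[is_ us] MMx [A [pA fA]].
have sJ : {subset s <= [set j in s]%SET} by move=> j; rewrite inE.
have mA k : (k <= M)%N -> mom P (A k) by move=> kM; exact: gpol_mom (pA k kM).
have cA k : (k <= M)%N -> measurable_fun
    [set: g_sigma_algebraType (coords Y [set j in s]%SET)] (A k).
  by move=> kM; exact: gpol_coords sJ (pA k kM).
pose a k := Ex P (fun x => A k x ^+ 2).
have a0 k : 0 <= a k by apply: Ex_ge0 => x; exact: sqr_ge0.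
pose B x := \sum_(k < M) A k.+1 x * hn k.+1 (Y i x).
have fE x : f x = A 0%N x + B x.
  rewrite fA big_ord_recl /= /hn /= fact0 sqrtr1 invr1 mul1r horner_one mulr1.
  by congr (_ + _); apply: eq_bigr => k _; rewrite /bump add1n.
have mh k : mom P (fun x => hn k (Y i x)).
  by apply: momZ; apply: mom_poly; exact: mom_coord.
have mB : mom P B by apply: mom_sum => k _; apply: momM => //; exact: mA.
have mA0 := mA 0%N (leq0n _); have cA0 := cA 0%N (leq0n _).
have EA k : (k <= M)%N -> Ex P (fun x => A k x ^+ 4) <= D ^+ (2 * (M - k)) * a k ^+ 2.
  by move=> kM; apply: IH => //; [lia | exact: pA].
(* Every term of [B] carries some [hn k] of positive degree in [Y i], of mean 0 and independent of
   the coefficients. *)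
have E3 : Ex P (fun x => A 0%N x ^+ 3 * B x) = 0.
  rewrite (eq_Ex P (g := fun x => \sum_(k < M) (A 0%N x ^+ 3 * A k.+1 x) * hn k.+1 (Y i x))); last first.
    by move=> x; rewrite /B mulr_sumr; apply: eq_bigr => k _; rewrite mulrA.
  have H (k : 'I_M) : intg P (fun x => (A 0%N x ^+ 3 * A k.+1 x) * hn k.+1 (Y i x)) /\
     Ex P (fun x => (A 0%N x ^+ 3 * A k.+1 x) * hn k.+1 (Y i x)) = 0.
    have kM : (k.+1 <= M)%N by [].
    have [ii ->] := gpol_indep is_ (momM (momX 3 mA0) (mA _ kM))
      (measurable_funM (measurable_funX 3 cA0) (cA _ kM)) (mom_hn k.+1).
    split=> //; rewrite (_ : Ex G _ = 0) ?mulr0 //.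
    transitivity (Ex G (fun x => hn k.+1 x * hn 0 x)); last by rewrite hn_orth.
    apply: eq_Ex => x.
    by rewrite [hn 0 x]/hn /= fact0 sqrtr1 invr1 mul1r horner_one mulr1.
  by rewrite Ex_sum ?big1 // => k _; have [] := H k.
have E22 : Ex P (fun x => A 0%N x ^+ 2 * B x ^+ 2) =
    \sum_(k < M) Ex P (fun x => A 0%N x ^+ 2 * A k.+1 x ^+ 2).
  pose t (k l : 'I_M) x := (A 0%N x ^+ 2 * (A k.+1 x * A l.+1 x)) * (hn k.+1 (Y i x) * hn l.+1 (Y i x)).
  have H (k l : 'I_M) : intg P (t k l) /\ Ex P (t k l) =
      Ex P (fun x => A 0%N x ^+ 2 * (A k.+1 x * A l.+1 x)) * (k == l)%:R.
    have kM : (k.+1 <= M)%N by []. have lM : (l.+1 <= M)%N by [].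
    have [ii ee] := gpol_indep is_ (momM (momX 2 mA0) (momM (mA _ kM) (mA _ lM)))
      (measurable_funM (measurable_funX 2 cA0) (measurable_funM (cA _ kM) (cA _ lM)))
      (momM (mom_hn k.+1) (mom_hn l.+1)).
    split; first exact: ii.
    by rewrite [LHS]ee hn_orth eqSS.
  rewrite (eq_Ex P (g := fun x => \sum_(k < M) \sum_(l < M) t k l x)); last first.
    move=> x; rewrite expr2 [X in _ * (X * _)]/B mulr_suml mulr_sumr; apply: eq_bigr => k _.
    rewrite /B mulr_sumr mulr_sumr; apply: eq_bigr => l _; rewrite /t; ring.
  rewrite Ex_sum; last by move=> k _; apply: intg_sum => l _; have [] := H k l.
  apply: eq_bigr => k _; rewrite Ex_sum; last by move=> l _; have [] := H k l.
  rewrite (bigD1 k) //= big1 ?addr0; last first.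
    by move=> l lk; rewrite (H k l).2 eq_sym (negbTE lk) mulr0.
  by rewrite (H k k).2 eqxx mulr1; apply: eq_Ex => x; rewrite -expr2.
have E2 : Ex P (fun x => f x ^+ 2) = a 0%N + \sum_(k < M) a k.+1.
  have H (k l : 'I_M.+1) : intg P (fun x => (A k x * A l x) * (hn k (Y i x) * hn l (Y i x))) /\
     Ex P (fun x => (A k x * A l x) * (hn k (Y i x) * hn l (Y i x))) =
     Ex P (fun x => A k x * A l x) * (k == l)%:R.
    have kM : (k <= M)%N by rewrite -ltnS. have lM : (l <= M)%N by rewrite -ltnS.
    have [ii ee] := gpol_indep is_ (momM (mA _ kM) (mA _ lM))
      (measurable_funM (cA _ kM) (cA _ lM)) (momM (mom_hn k) (mom_hn l)).
    split; first exact: ii.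
    by rewrite [LHS]ee hn_orth.
  rewrite (eq_Ex P (g := fun x => \sum_(k < M.+1) \sum_(l < M.+1)
      (A k x * A l x) * (hn k (Y i x) * hn l (Y i x)))); last first.
    move=> x; rewrite fA expr2 mulr_suml; apply: eq_bigr => k _.
    rewrite mulr_sumr; apply: eq_bigr => l _; ring.
  rewrite Ex_sum; last by move=> k _; apply: intg_sum => l _; have [] := H k l.
  transitivity (\sum_(k < M.+1) a k); last by rewrite big_ord_recl.
  apply: eq_bigr => k _; rewrite Ex_sum; last by move=> l _; have [] := H k l.
  rewrite (bigD1 k) //= big1 ?addr0; last first.
    by move=> l lk; rewrite (H k l).2 eq_sym (negbTE lk) mulr0.
  by rewrite (H k k).2 eqxx mulr1; apply: eq_Ex => x; rewrite -expr2.
pose c := \sum_(k < Mx.+1) Ex G (fun x : R => hn k x ^+ 4).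
have c_ge0 : 0 <= c by apply: sumr_ge0 => k _; exact: hn4_ge0.
have E4 : Ex P (fun x => B x ^+ 4) <=
    \sum_(k < M) Mx%:R ^+ 3 * c * Ex P (fun x => A k.+1 x ^+ 4).
  have H (k : 'I_M) : intg P (fun x => A k.+1 x ^+ 4 * hn k.+1 (Y i x) ^+ 4) /\
     Ex P (fun x => A k.+1 x ^+ 4 * hn k.+1 (Y i x) ^+ 4) =
     Ex P (fun x => A k.+1 x ^+ 4) * Ex G (fun x => hn k.+1 x ^+ 4).
    have kM : (k.+1 <= M)%N by [].
    exact: (gpol_indep is_ (momX 4 (mA _ kM)) (measurable_funX 4 (cA _ kM)) (momX 4 (mom_hn k.+1))).
  have iS : intg P (fun x => \sum_(k < M) A k.+1 x ^+ 4 * hn k.+1 (Y i x) ^+ 4).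
    by apply: intg_sum => k _; have [] := H k.
  apply: (@le_trans _ _ (Ex P (fun x => M%:R ^+ 3 * \sum_(k < M) A k.+1 x ^+ 4 * hn k.+1 (Y i x) ^+ 4))).
    apply: le_Ex; [exact: momX_intg | exact: intgZ |] => x.
    apply: le_trans (sum_pow4_le _) _; rewrite ler_wpM2l ?exprn_ge0 //.
    by apply: ler_sum => k _; rewrite exprMn.
  rewrite ExZ // Ex_sum; last by move=> k _; have [] := H k.
  rewrite mulr_sumr; apply: ler_sum => k _; rewrite (H k).2 mulrCA [leRHS]mulrC.
  rewrite ler_wpM2l //; first by apply: Ex_ge0 => x; rewrite (exprM _ 2 2) sqr_ge0.
  apply: ler_pM; rewrite ?exprn_ge0 ?hn4_ge0 //.
    by rewrite lerXn2r ?nnegrE ?ler_nat.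
  have kMx : (k.+1 < Mx.+1)%N by have := ltn_ord k; lia.
  rewrite /c (bigD1 (Ordinal kMx)) //= lerDl; apply: sumr_ge0 => l _; exact: hn4_ge0.
(* Cauchy-Schwarz and the induction hypothesis; the exponent [2 M - k] is the mean of [2 M] and
   [2 (M - k)]. *)
have CS k : (k <= M)%N -> Ex P (fun x => A 0%N x ^+ 2 * A k x ^+ 2) <=
    D ^+ (2 * M - k) * a 0%N * a k.
  move=> kM.
  have := Cauchy_Schwarz (mom_L2 (momX 2 mA0)) (mom_L2 (momX 2 (mA _ kM))).
  have -> : Ex P (fun x => (A 0%N x ^+ 2) ^+ 2) = Ex P (fun x => A 0%N x ^+ 4).
    by apply: eq_Ex => x; rewrite -exprM.
  have -> : Ex P (fun x => (A k x ^+ 2) ^+ 2) = Ex P (fun x => A k x ^+ 4).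
    by apply: eq_Ex => x; rewrite -exprM.
  move=> h; have e0 : 0 <= Ex P (fun x => A 0%N x ^+ 2 * A k x ^+ 2).
    by apply: Ex_ge0 => x; rewrite mulr_ge0 ?sqr_ge0.
  rewrite -(ler_pXn2r (n := 2)) ?nnegrE ?mulr_ge0 ?exprn_ge0 // ?(ltW D0) //.
  apply: (le_trans h); rewrite exprMn exprMn -exprM.
  have -> : ((2 * M - k) * 2 = 2 * (M - 0) + 2 * (M - k))%N by lia.
  rewrite exprD -[leRHS]mulrA mulrACA; apply: ler_pM => //.
  - by apply: Ex_ge0 => x; rewrite (exprM _ 2 2) sqr_ge0.
  - by apply: Ex_ge0 => x; rewrite (exprM _ 2 2) sqr_ge0.
  - exact: EA.
  - exact: EA.
(* [4 A0 B^3 <= 2 A0^2 B^2 + 2 B^4] raises the binomial coefficients 6 and 1 to 8 and 3. *)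
have up : Ex P (fun x => f x ^+ 4) <= Ex P (fun x => A 0%N x ^+ 4) +
    8 * Ex P (fun x => A 0%N x ^+ 2 * B x ^+ 2) + 3 * Ex P (fun x => B x ^+ 4).
  have i1 := mom_intg (momX 4 mA0); have i2 := mom_intg (momM (momX 2 mA0) (momX 2 mB)).
  have i3 := mom_intg (momX 4 mB); have i4 := mom_intg (momM (momX 3 mA0) mB).
  have i5 := intgD i1 (intgZ 4 i4); have i6 := intgD i5 (intgZ 8 i2).
  apply: (@le_trans _ _ (Ex P (fun x => A 0%N x ^+ 4 + 4 * (A 0%N x ^+ 3 * B x) +
      8 * (A 0%N x ^+ 2 * B x ^+ 2) + 3 * B x ^+ 4))).
    apply: le_Ex; first by apply: eq_intg (momX_intg 4 (momD mA0 mB)) => x; rewrite fE.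
      by apply: intgD => //; exact: intgZ.
    move=> x; rewrite fE; have := sqr_ge0 (B x * (A 0%N x - B x)); nra.
  rewrite ExD ?(intgZ 3 i3) // ExD ?(intgZ 8 i2) // ExD ?(intgZ 4 i4) //.
  by rewrite (ExZ _ i4) (ExZ _ i2) (ExZ _ i3) E3 mulr0 addr0.
apply: (le_trans up); rewrite E2.
set S := \sum_(k < M) a k.+1; have S0 : 0 <= S by apply: sumr_ge0.
have h1 : Ex P (fun x => A 0%N x ^+ 4) <= D ^+ (2 * M) * a 0%N ^+ 2.
  by have := EA 0%N (leq0n _); rewrite subn0.
have h2 : 8 * Ex P (fun x => A 0%N x ^+ 2 * B x ^+ 2) <= D ^+ (2 * M) * (2 * a 0%N * S).
  rewrite E22 mulr_sumr /S mulr_sumr mulr_sumr; apply: ler_sum => k _.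
  have kM : (k.+1 <= M)%N by [].
  apply: le_trans (ler_wpM2l _ (CS _ kM)) _ => //.
  rewrite [leRHS](_ : _ = (2 * D ^+ (2 * M)) * a 0%N * a k.+1); last by ring.
  rewrite !mulrA ler_wpM2r // ler_wpM2r //.
  have k2 : (k.+1 <= 2 * M)%N by clear -kM; lia.
  have q0 : 0 < D ^+ (2 * M - k.+1) by rewrite exprn_gt0.
  have q1 : D <= D ^+ k.+1 by rewrite ler_eXnr //; lra.
  have q2 := ler_wpM2l (ltW q0) (le_trans D4 q1).
  have E2M : D ^+ (2 * M) = D ^+ (2 * M - k.+1) * D ^+ k.+1 by rewrite -exprD subnK.
  by rewrite E2M; lra.
have h3 : 3 * Ex P (fun x => B x ^+ 4) <= D ^+ (2 * M) * S ^+ 2.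
  apply: (@le_trans _ _ (D ^+ (2 * M) * \sum_(k < M) a k.+1 ^+ 2)); last first.
    rewrite ler_wpM2l ?exprn_ge0 ?(ltW D0) //; exact: sum_sqr_le_sqr_sum.
  apply: (@le_trans _ _ (3 * \sum_(k < M) Mx%:R ^+ 3 * c * Ex P (fun x => A k.+1 x ^+ 4))).
    by rewrite ler_wpM2l.
  rewrite mulr_sumr [leRHS]mulr_sumr; apply: ler_sum => k _; have kM : (k.+1 <= M)%N by [].
  rewrite mulrA; apply: (@le_trans _ _ (D * (D ^+ (2 * (M - k.+1)) * a k.+1 ^+ 2))).
    apply: ler_pM => //; [|by apply: Ex_ge0 => x; rewrite (exprM _ 2 2) sqr_ge0| |exact: EA].
      by rewrite !mulr_ge0 ?exprn_ge0.
    by rewrite /D /bonami_cst -/c mulrA lerDr.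
  rewrite mulrA -exprS ler_wpM2r ?sqr_ge0 //; apply: ler_weXn2l; first by lra.
  by clear -kM; lia.
apply: le_trans (lerD (lerD h1 h2) h3) _.
by rewrite -!mulrDr ler_wpM2l ?exprn_ge0 ?(ltW D0) //; rewrite sqrrD; lra.
Qed.

End Bonami.

Lemma Cauchy_Schwarz_sum (R : realFieldType) (J : Type) (r : seq J) (Q : pred J) (x y : J -> R) :
  (\sum_(j <- r | Q j) x j * y j) ^+ 2 <=
  (\sum_(j <- r | Q j) x j ^+ 2) * (\sum_(j <- r | Q j) y j ^+ 2).
Proof.
elim: r => [|j r IH]; first by rewrite !big_nil expr2 !mulr0.
rewrite !big_cons; case: ifP => // _.
move: IH; set A := \sum_(j <- r | Q j) x j ^+ 2; set B := \sum_(j <- r | Q j) y j ^+ 2.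
set C := \sum_(j <- r | Q j) x j * y j => IH.
have A0 : 0 <= A by apply: sumr_ge0 => i _; exact: sqr_ge0.
have B0 : 0 <= B by apply: sumr_ge0 => i _; exact: sqr_ge0.
have [B00|Bn0] := eqVneq B 0.
  have C0 : C = 0.
    by apply/eqP; rewrite -sqrf_eq0 eq_le sqr_ge0 andbT; rewrite B00 mulr0 in IH.
  rewrite C0 B00 !addr0 exprMn ler_wpM2r ?sqr_ge0 // lerDl //.
have Bp : 0 < B by rewrite lt_neqAle eq_sym Bn0.
have key : 2 * (x j * y j) * C <= x j ^+ 2 * B + y j ^+ 2 * A.
  have h := sqr_ge0 (x j * B - y j * C).
  have h2 := ler_wpM2l (sqr_ge0 (y j)) IH.
  rewrite -(ler_pM2r Bp); nra.
by rewrite sqrrD; lra.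
Qed.

Lemma Cauchy_Schwarz_sum2 (R : realFieldType) (J : finType) (x y : J -> J -> R) :
  (\sum_i \sum_j x i j * y i j) ^+ 2 <=
  (\sum_i \sum_j x i j ^+ 2) * (\sum_i \sum_j y i j ^+ 2).
Proof. by rewrite !pair_big /=; exact: Cauchy_Schwarz_sum. Qed.

(** * Covariances of functions of linear forms *)

Section Covariance.
Context d (T : measurableType d) (R : realType) (P : probability T R).
Notation G := (@std_gauss R).
Notation G2 := (prodP G G).
Notation RG := (measurableTypeR R).
Variables (I : finType) (Y : I -> T -> R).
Hypothesis iidY : iid P (centered_gauss 1) Y.
Variable s : seq I.
Hypothesis us : uniq s.
Implicit Types a b : I -> R.

Definition ip a b : R := \sum_(i <- s) a i * b i.
Notation lin := (lin_form Y s).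

(** In [joint_law], unit norms force [al = 1] and [be = ip a b], and [ga] is then the nonnegative
    root of [1 - be^2]. *)
Lemma pair_law a b : ip a a = 1 -> ip b b = 1 ->
  same_law P G2 (fun x => (lin a x : RG, lin b x : RG))
    (fun z : RG * RG => (z.1 : RG, ip a b * z.1 + Num.sqrt (1 - ip a b ^+ 2) * z.2 : RG)).
Proof.
move=> a1 b1; have [al [be [ga [[al0 ga0] al2 albe bega law]]]] := joint_law iidY a b us.
have sq c : \sum_(i <- s) c i ^+ 2 = ip c c by apply: eq_bigr => i _; rewrite expr2.
rewrite sq a1 in al2; rewrite sq b1 in bega.
have al1 : al = 1 by apply: (pexpIrn (n := 2)); rewrite ?nnegrE // al2 expr1n.
have beE : be = ip a b by move: albe; rewrite al1 mul1r.
have gaE : ga = Num.sqrt (1 - ip a b ^+ 2).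
  by rewrite -beE -bega addrAC subrr add0r sqrtr_sqr ger0_norm.
move=> F mF F0; rewrite law // -beE gaE -beE al1.
by apply: eq_integral => z _; rewrite mul1r.
Qed.

Lemma lin_law a : ip a a = 1 -> same_law P G (fun x => lin a x : RG) (fun z : RG => z).
Proof.
move=> a1 F mF F0; have := pair_law a1 a1.
move/(_ (fun z => F z.1) (measurableT_comp mF measurable_fst) (fun z => F0 _)) => /= ->.
exact: (same_law_fst G G mF F0).
Qed.

Let mlin a : measurable_fun setT (fun x => lin a x : RG) := lin_form_meas iidY s a.

Lemma L2_lin a f : ip a a = 1 -> L2 G f -> L2 P (fun x => f (lin a x)).
Proof. by move=> a1 f2; exact: (L2_same_law (mlin a) (lin_law a1) (L2_meas f2) f2). Qed.

Lemma intg_lin a f : ip a a = 1 -> intg G f -> intg P (fun x => f (lin a x)).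
Proof.
move=> a1 fi.
exact: (intg_same_law (mlin a) (lin_law a1) (intg_measurable fi) fi).
Qed.

Lemma Ex_lin a f : ip a a = 1 -> intg G f -> Ex P (fun x => f (lin a x)) = Ex G f.
Proof.
move=> a1 fi; exact: (Ex_same_law (mlin a) (lin_law a1) (intg_measurable fi) fi).
Qed.

Lemma cov_bound a b f g m : ip a a = 1 -> ip b b = 1 -> `|ip a b| < 1 ->
  L2 G f -> L2 G g ->
  `|Ex P (fun x => f (lin a x) * g (lin b x)) -
    \sum_(k < m) ip a b ^+ k * zeta k f * zeta k g| <=
  `|ip a b| ^+ m / Num.sqrt (1 - ip a b ^+ 2) *
    (Num.sqrt (Ex G (fun x => f x ^+ 2)) * Num.sqrt (Ex G (fun x => g x ^+ 2))).
Proof.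
move=> a1 b1 r1 f2 g2; have := mehler_bound r1 m f2 g2.
have mY : measurable_fun setT (fun x => (lin a x : RG, lin b x : RG)).
  by apply/measurable_fun_pairP; split; exact: mlin.
have fgm : measurable_fun setT (fun z : RG * RG => f z.1 * g z.2).
  apply: measurable_funM; [exact: (measurableT_comp (L2_meas f2) measurable_fst) |
    exact: (measurableT_comp (L2_meas g2) measurable_snd)].
have [mf f2'] := L2_lin a1 f2; have [mg g2'] := L2_lin b1 g2.
have law := pair_law a1 b1.
pose phi (z : RG * RG) : RG * RG := (z.1, ip a b * z.1 + Num.sqrt (1 - ip a b ^+ 2) * z.2).
have mphi : measurable_fun setT phi.
  apply/measurable_fun_pairP; split; first exact: measurable_fst.
  apply: measurable_funD; apply: measurable_funM;
    first [exact: measurable_cst | exact: measurable_fst | exact: measurable_snd].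
have fi : intg G2 (fun z => f (phi z).1 * g (phi z).2).
  have rev : same_law G2 P phi (fun x => (lin a x : RG, lin b x : RG)).
    by move=> F mF F0; rewrite -(law F mF F0).
  apply: (intg_same_law mphi rev fgm (f := fun z : RG * RG => f z.1 * g z.2)).
  exact: L2_mul.
rewrite -(Ex_same_law mY law fgm fi) //.
Qed.

Lemma zetaE k f : zeta k f = Ex G (fun x => f x * hn k x).
Proof. by rewrite /zeta hermite_hn. Qed.

Lemma zeta_hn k j : zeta k (hn j) = (j == k)%:R :> R.
Proof. by rewrite zetaE hn_orth. Qed.

Lemma le_geo_eq0 (c C x : R) m0 : `|c| < 1 ->
  (forall m, (m0 <= m)%N -> `|x| <= C * `|c| ^+ m) -> x = 0.
Proof.
move=> c1 H; apply/eqP; rewrite -normr_eq0 eq_le normr_ge0 andbT.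
apply/ler_addgt0Pr => e e0; rewrite add0r.
have c1' : `| `|c| | < 1 by rewrite normr_id.
have lim : (fun m => C * `|c| ^+ m) @ \oo --> (0 : R).
  by rewrite -[X in _ --> X](mulr0 C); apply: cvgM; [exact: cvg_cst | exact: cvg_expr].
have /cvgr0_norm_lt /(_ e e0) [M _ HM] := lim.
have := HM (maxn M m0) (leq_maxl _ _) => /= h.
apply: (le_trans (H _ (leq_maxr M m0))); apply: (le_trans (ler_norm _)); exact: ltW.
Qed.

(** For every truncation [m > k] the sum in [cov_bound] is the single term on the right, while the
    error decays geometrically in [m]; hence it is 0. *)
Lemma cov_hn a b k g : ip a a = 1 -> ip b b = 1 -> `|ip a b| < 1 -> L2 G g ->
  Ex P (fun x => hn k (lin a x) * g (lin b x)) = ip a b ^+ k * zeta k g.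
Proof.
move=> a1 b1 r1 g2; apply/eqP; rewrite -subr_eq0; apply/eqP.
pose K := Num.sqrt (Ex G (fun x => hn k x ^+ 2)) * Num.sqrt (Ex G (fun x => g x ^+ 2)).
apply: (@le_geo_eq0 (ip a b) ((Num.sqrt (1 - ip a b ^+ 2))^-1 * K) _ k.+1) => // m km.
have := cov_bound m a1 b1 r1 (L2_hn k) g2.
rewrite (bigD1 (Ordinal km)) //= big1 ?addr0 => [|i ik]; last first.
  by rewrite zeta_hn -(inj_eq val_inj) /= in ik *; rewrite eq_sym (negbTE ik) mulr0 mul0r.
by rewrite zeta_hn eqxx mulr1 -mulrA [leRHS]mulrC -mulrA [X in _ <= X]mulrC -!mulrA.
Qed.

Section Family.
Variables (J : finType) (a : J -> I -> R).
Hypotheses (a1 : forall j, ip (a j) (a j) = 1)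
  (ar : forall i j, i != j -> `|ip (a i) (a j)| < 1).
Implicit Types (v : J -> R) (f g : R -> R).
Notation rho i j := (ip (a i) (a j)).

Definition combo f v x := \sum_j v j * f (lin (a j) x).
Definition gramq k v := \sum_i \sum_j v i * v j * rho i j ^+ k.

Lemma L2_combo f v : L2 G f -> L2 P (combo f v).
Proof. by move=> f2; apply: L2_sum => j _; apply: L2Z; exact: L2_lin. Qed.

Lemma cov_hn_family k g i j : L2 G g ->
  Ex P (fun x => hn k (lin (a i) x) * g (lin (a j) x)) = rho i j ^+ k * zeta k g.
Proof.
move=> g2; have [->|ij] := eqVneq i j; last by apply: cov_hn => //; exact: ar.
have hg : intg G (fun x => hn k x * g x) by apply: L2_mul => //; exact: L2_hn.
have E := Ex_lin (f := fun x => hn k x * g x) (a1 j) hg.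
by rewrite a1 expr1n mul1r zetaE [LHS]E ExMC.
Qed.

Lemma Ex_combo2 f g v : L2 G f -> L2 G g ->
  Ex P (fun x => combo f v x * combo g v x) =
  \sum_i \sum_j v i * v j * Ex P (fun x => f (lin (a i) x) * g (lin (a j) x)).
Proof.
move=> f2 g2.
have fg i j : intg P (fun x => f (lin (a i) x) * g (lin (a j) x)).
  by apply: L2_mul; exact: L2_lin.
transitivity (Ex P (fun x => \sum_i \sum_j (v i * v j) * (f (lin (a i) x) * g (lin (a j) x)))).
  apply: eq_Ex => x; rewrite /combo mulr_suml; apply: eq_bigr => i _.
  by rewrite mulr_sumr; apply: eq_bigr => j _; rewrite mulrACA.
have ii i j : intg P (fun x => (v i * v j) * (f (lin (a i) x) * g (lin (a j) x))).
  exact: (intgZ _ (fg i j)).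
rewrite Ex_sum => [|i _]; last by apply: intg_sum => j _; exact: ii.
apply: eq_bigr => i _; rewrite Ex_sum => [|j _]; last exact: ii.
by apply: eq_bigr => j _; exact: (ExZ _ (fg i j)).
Qed.

Lemma Ex_combo_hn k g v : L2 G g ->
  Ex P (fun x => combo (hn k) v x * combo g v x) = zeta k g * gramq k v.
Proof.
move=> g2; rewrite Ex_combo2 //; last exact: L2_hn.
rewrite /gramq mulr_sumr; apply: eq_bigr => i _; rewrite mulr_sumr; apply: eq_bigr => j _.
by rewrite cov_hn_family // [RHS]mulrC mulrA.
Qed.

Lemma gramq_ge0 k v : 0 <= gramq k v.
Proof.
have := Ex_combo_hn k v (L2_hn k); rewrite zeta_hn eqxx mul1r => <-.
by apply: Ex_ge0 => x; rewrite -expr2 sqr_ge0.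
Qed.

Definition trunc m f (y : R) := \sum_(k < m) zeta k f * hn k y.

Lemma L2_trunc m f : L2 G (trunc m f).
Proof. by apply: L2_sum => k _; apply: L2Z; exact: L2_hn. Qed.

Lemma combo_trunc m f v x : combo (trunc m f) v x = \sum_(k < m) zeta k f * combo (hn k) v x.
Proof.
rewrite /combo; under eq_bigr do rewrite /trunc mulr_sumr.
rewrite exchange_big /=; apply: eq_bigr => k _; rewrite mulr_sumr.
by apply: eq_bigr => j _; rewrite mulrCA.
Qed.

Lemma Ex_combo_trunc m f g v : L2 G g ->
  Ex P (fun x => combo (trunc m f) v x * combo g v x) =
  \sum_(k < m) zeta k f * zeta k g * gramq k v.
Proof.
move=> g2.
have hg k : intg P (fun x => combo (hn k) v x * combo g v x).
  by apply: L2_mul; apply: L2_combo => //; exact: L2_hn.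
transitivity (Ex P (fun x => \sum_(k < m) zeta k f * (combo (hn k) v x * combo g v x))).
  apply: eq_Ex => x; rewrite combo_trunc mulr_suml; apply: eq_bigr => k _.
  by rewrite mulrA.
rewrite Ex_sum => [|k _]; last exact: (intgZ _ (hg k)).
by apply: eq_bigr => k _; rewrite (ExZ _ (hg k)) Ex_combo_hn // mulrA.
Qed.

Lemma zeta_trunc m f k : (k < m)%N -> zeta k (trunc m f) = zeta k f.
Proof.
move=> km; have hh j : intg G (fun x => hn j x * hn k x).
  by apply: L2_mul; exact: L2_hn.
rewrite zetaE; transitivity (Ex G (fun x => \sum_(j < m) zeta j f * (hn j x * hn k x))).
  by apply: eq_Ex => x; rewrite mulr_suml; apply: eq_bigr => j _; rewrite mulrA.
rewrite Ex_sum => [|j _]; last exact: (intgZ _ (hh j)).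
rewrite (bigD1 (Ordinal km)) //= big1 ?addr0 => [|j jk].
  by rewrite (ExZ _ (hh k)) hn_orth eqxx mulr1.
rewrite (ExZ _ (hh j)) hn_orth; rewrite -(inj_eq val_inj) /= in jk.
by rewrite (negbTE jk) mulr0.
Qed.

Lemma Ex_combo_trunc_sq m f v :
  Ex P (fun x => combo (trunc m f) v x ^+ 2) = \sum_(k < m) zeta k f ^+ 2 * gramq k v.
Proof.
transitivity (Ex P (fun x => combo (trunc m f) v x * combo (trunc m f) v x)).
  by apply: eq_Ex => x; rewrite expr2.
rewrite Ex_combo_trunc; last exact: L2_trunc.
by apply: eq_bigr => k _; rewrite zeta_trunc // expr2.
Qed.

(** The combination of the truncations is the orthogonal projection of [combo f v] as far as these
    moments can see: its mean product with [combo f v] equals its own mean square. *)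
Lemma combo_bessel m f v : L2 G f ->
  \sum_(k < m) zeta k f ^+ 2 * gramq k v <= Ex P (fun x => combo f v x ^+ 2).
Proof.
move=> f2; have t2 := L2_combo v (L2_trunc m f); have c2 := L2_combo v f2.
have : 0 <= Ex P (fun x => (combo (trunc m f) v x - combo f v x) ^+ 2).
  by apply: Ex_ge0 => x; exact: sqr_ge0.
rewrite (Ex_sqrB t2 c2) Ex_combo_trunc_sq Ex_combo_trunc //.
under [X in _ - 2 * X]eq_bigr do rewrite -expr2.
by lra.
Qed.

(** On the diagonal the remainder after [m] degrees is at most [E f^2]. Off the diagonal it is at
    most [sqrt 2 |rho|^m E f^2], since [|rho| <= 1 / sqrt 2] gives [1 / sqrt (1 - rho^2) <= sqrt 2];
    Cauchy-Schwarz over pairs of indices then brings in the Frobenius bound [h]. *)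
Lemma combo_upper m f v (h : R) : L2 G f -> 0 <= h ->
  (forall i j, i != j -> `|rho i j| <= (Num.sqrt 2)^-1) ->
  \sum_i \sum_(j | j != i) rho i j ^+ (2 * m) <= h ^+ 2 ->
  Ex P (fun x => combo f v x ^+ 2) <= \sum_(k < m) zeta k f ^+ 2 * gramq k v
    + Ex G (fun x => f x ^+ 2) * (1 + Num.sqrt 2 * h) * \sum_j v j ^+ 2.
Proof.
move=> f2 h0 r2 rh; set F := Ex G _; set V := \sum_j v j ^+ 2.
have F0 : 0 <= F by apply: Ex_ge0 => x; exact: sqr_ge0.
pose c i j := Ex P (fun x => f (lin (a i) x) * f (lin (a j) x)).
pose q i j := \sum_(k < m) rho i j ^+ k * zeta k f * zeta k f.
have s2 : 0 < Num.sqrt 2 :> R by rewrite sqrtr_gt0.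
have s22 : Num.sqrt 2 ^+ 2 = 2 :> R by rewrite sqr_sqrtr.
have off i j : j != i -> `|c i j - q i j| <= Num.sqrt 2 * F * `|rho i j| ^+ m.
  move=> ji; have ij : i != j by rewrite eq_sym.
  have := cov_bound m (a1 i) (a1 j) (ar ij) f2 f2.
  rewrite -/(c i j) -/(q i j) -expr2 sqr_sqrtr // => H; apply: le_trans H _.
  have r2' : rho i j ^+ 2 <= 2^-1.
    rewrite -(real_normK (num_real (rho i j))) -s22 -exprVn.
    by rewrite lerXn2r ?nnegrE ?invr_ge0 ?(ltW s2) ?r2.
  have : (Num.sqrt (1 - rho i j ^+ 2))^-1 <= Num.sqrt 2.
    rewrite -[leRHS]invrK lef_pV2 ?posrE ?sqrtr_gt0 ?invr_gt0 //; last by lra.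
    by rewrite -sqrtrV // ler_wsqrtr //; lra.
  move=> H; by rewrite [leRHS]mulrAC ler_wpM2r // [leLHS]mulrC ler_wpM2r ?exprn_ge0.
have diag i : c i i - q i i <= F.
  have ff : intg G (fun x => f x * f x) by exact: L2_mul.
  have -> : c i i = F.
    rewrite /c (Ex_lin (f := fun x => f x * f x) (a1 i) ff).
    by apply: eq_Ex => x; rewrite expr2.
  rewrite lerBlDr lerDl; apply: sumr_ge0 => k _.
  by rewrite a1 expr1n mul1r -expr2 sqr_ge0.
have -> : Ex P (fun x => combo f v x ^+ 2) = \sum_i \sum_j v i * v j * c i j.
  by rewrite -Ex_combo2 //; apply: eq_Ex => x; rewrite expr2.
have -> : \sum_(k < m) zeta k f ^+ 2 * gramq k v = \sum_i \sum_j v i * v j * q i j.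
  rewrite /gramq /q; under eq_bigr do rewrite mulr_sumr.
  rewrite exchange_big /=; apply: eq_bigr => i _.
  under eq_bigr do rewrite mulr_sumr.
  rewrite exchange_big /=; apply: eq_bigr => j _.
  by rewrite mulr_sumr; apply: eq_bigr => k _; ring.
rewrite -lerBlDl -sumrB.
pose o i j := if j != i then `|rho i j| ^+ m else 0.
have up : \sum_i (\sum_j v i * v j * c i j - \sum_j v i * v j * q i j) <=
   F * V + Num.sqrt 2 * F * \sum_i \sum_j `|v i * v j| * o i j.
  rewrite /V !mulr_sumr -big_split /=; apply: ler_sum => i _.
  rewrite -sumrB (bigD1 i) //= [X in _ <= _ + X]mulr_sumr; apply: lerD.
    rewrite -mulrBr -expr2 mulrC ler_wpM2r ?sqr_ge0 //.
  rewrite [leRHS](bigD1 i) //= {1}/o eqxx /= !mulr0 add0r; apply: ler_sum => j ji.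
  rewrite /o ji -mulrBr; apply: (le_trans (ler_norm _)); rewrite normrM mulrCA.
  by rewrite ler_wpM2l // off.
apply: (le_trans up); rewrite [leRHS](_ : _ = F * V + Num.sqrt 2 * F * (h * V)); last by ring.
rewrite lerD2l ler_wpM2l ?mulr_ge0 ?(ltW s2) //.
have V0 : 0 <= V by apply: sumr_ge0 => j _; exact: sqr_ge0.
have CS := Cauchy_Schwarz_sum2 (fun i j => `|v i * v j|) o.
rewrite -(ler_pXn2r (n := 2)) ?nnegrE ?mulr_ge0 //; last first.
  apply: sumr_ge0 => i _; apply: sumr_ge0 => j _; apply: mulr_ge0 => //.
  by rewrite /o; case: ifP => // _; rewrite exprn_ge0.
apply: (le_trans CS); rewrite exprMn mulrC; apply: ler_pM.
- by apply: sumr_ge0 => i _; apply: sumr_ge0 => j _; exact: sqr_ge0.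
- by apply: sumr_ge0 => i _; apply: sumr_ge0 => j _; exact: sqr_ge0.
- apply: le_trans rh; apply: ler_sum => i _; rewrite [leRHS]big_mkcond /=.
  apply: ler_sum => j _; rewrite /o; case: ifP => _; last by rewrite expr0n.
  by rewrite -exprM mulnC exprM (real_normK (num_real _)) -exprM.
- rewrite expr2 /V mulr_suml; apply: ler_sum => i _; rewrite mulr_sumr.
  by apply: ler_sum => j _; rewrite (real_normK (num_real _)) exprMn.
Qed.

End Family.
End Covariance.

(** * Small balls and the rank of random matrices *)

Section Indicators.
Context d (T : measurableType d) (R : realType) (P : probability T R).

Lemma indic_meas (A : set T) : measurable A -> measurable_fun setT (\1_A : T -> R).
Proof. by move=> mA; exact: measurable_indic. Qed.

Lemma intg_indic (A : set T) : measurable A -> intg P (\1_A : T -> R).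
Proof.
move=> mA; apply: (le_intg (indic_meas mA) (g := fun=> 1)) => [x|]; last exact: intg_cst.
by rewrite indicE normr_nat; case: (x \in A); rewrite /= ?ler01.
Qed.

Lemma Ex_indic (A : set T) : measurable A -> Ex P (\1_A : T -> R) = fine (P A).
Proof. by move=> mA; rewrite /Ex /Rintegral integral_indic // setIT. Qed.

Lemma fineP (A : set T) : measurable A -> (fine (P A))%:E = P A.
Proof. by move=> mA; rewrite fineK // fin_num_measure. Qed.

Lemma measurable_neq0 (f : T -> R) : measurable_fun setT f -> measurable [set x | f x != 0].
Proof.
move=> mf; have -> : [set x | f x != 0] = setT `&` f @^-1` (~` [set 0]).
  by rewrite setTI; apply/seteqP; split => x /= /eqP.
by apply: mf => //; apply: measurableC; exact: measurable_set1.
Qed.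

Lemma measurable_neq0_nat (f : T -> R) : measurable_fun setT f ->
  measurable_fun setT (fun x => (f x != 0)%:R : R).
Proof.
move=> mf; rewrite (_ : (fun x => _) = \1_[set x | f x != 0] :> (T -> R)).
  exact: indic_meas (measurable_neq0 mf).
by apply/funext => x; rewrite indicE; congr (nat_of_bool _)%:R; apply/idP/idP; rewrite inE.
Qed.

(** Written as [f (f^2)^(-1)]: real powers are measurable, and both sides are 0 where [f]
    vanishes. *)
Lemma measurable_inv (f : T -> R) : measurable_fun setT f -> measurable_fun setT (fun x => (f x)^-1).
Proof.
move=> mf; have -> : (fun x => (f x)^-1) = (fun x => f x * (f x ^+ 2) `^ (-1)).
  apply/funext => x; rewrite powR_inv1 ?sqr_ge0 // expr2 invfM mulrA.
  by have [->|f0] := eqVneq (f x) 0; [rewrite invr0 mulr0 | rewrite divff // mul1r].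
apply: measurable_funM => //; apply: (measurableT_comp (measurable_powR (-1))).
exact: measurable_funX.
Qed.

End Indicators.

Section SmallBall.
Context d (T : measurableType d) (R : realType) (P : probability T R).
Notation G := (@std_gauss R).
Variables (I : finType) (Y : I -> T -> R).
Hypothesis iidY : iid P (centered_gauss 1) Y.
Variables (s : seq I) (J : finType) (a : J -> I -> R).
Hypotheses (us : uniq s) (a1 : forall j, ip s (a j) (a j) = 1)
  (ar : forall i j, i != j -> `|ip s (a i) (a j)| <= (Num.sqrt 2)^-1).
Notation rho i j := (ip s (a i) (a j)).

Let ar1 i j : i != j -> `|rho i j| < 1.
Proof.
move=> ij; apply: (le_lt_trans (ar ij)); rewrite invf_lt1 ?sqrtr_gt0 //.
by rewrite -[ltLHS]sqrtr1 ltr_sqrt // ltr1n.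
Qed.

Definition offdiag k := \sum_i \sum_(j | j != i) rho i j ^+ (2 * k).

Lemma offdiag_mono k k' : (k <= k')%N -> offdiag k' <= offdiag k.
Proof.
move=> kk; apply: ler_sum => i _; apply: ler_sum => j ji.
rewrite !exprM ler_wiXn2l ?sqr_ge0 // -(real_normK (num_real _)) exprn_ile1 //.
by apply: ltW; apply: ar1; rewrite eq_sym.
Qed.

(** The Frobenius norm of the off-diagonal part is at most [h] and dominates its operator norm. *)
Lemma gramq_lower k (h : R) v : 0 <= h -> offdiag k <= h ^+ 2 ->
  (1 - h) * \sum_j v j ^+ 2 <= gramq s a k v.
Proof.
move=> h0 oh; set V := \sum_j v j ^+ 2.
have V0 : 0 <= V by apply: sumr_ge0 => j _; exact: sqr_ge0.
pose o i j := if j != i then rho i j ^+ k else 0.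
have -> : gramq s a k v = V + \sum_i \sum_j (v i * v j) * o i j.
  rewrite /gramq /V -big_split /=; apply: eq_bigr => i _.
  rewrite (bigD1 i) //= a1 expr1n mulr1 -expr2; congr (_ + _).
  rewrite [RHS](bigD1 i) //= {1}/o eqxx mulr0 add0r; apply: eq_bigr => j ji.
  by rewrite /o ji.
rewrite mulrBl mul1r lerD2l -lerN2 opprK; apply: (le_trans (ler_norm _)); rewrite normrN.
have CS := Cauchy_Schwarz_sum2 (fun i j => v i * v j) o.
rewrite -(ler_pXn2r (n := 2)) ?nnegrE ?mulr_ge0 // (real_normK (num_real _)).
apply: (le_trans CS); rewrite exprMn mulrC; apply: ler_pM.
- by apply: sumr_ge0 => i _; apply: sumr_ge0 => j _; exact: sqr_ge0.
- by apply: sumr_ge0 => i _; apply: sumr_ge0 => j _; exact: sqr_ge0.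
- apply: le_trans oh; apply: ler_sum => i _; rewrite [leRHS]big_mkcond /=.
  apply: ler_sum => j _; rewrite /o; case: ifP => _; last by rewrite expr0n.
  by rewrite mulnC exprM.
- rewrite expr2 /V mulr_suml; apply: ler_sum => i _; rewrite mulr_sumr.
  by apply: ler_sum => j _; rewrite exprMn.
Qed.

Lemma gpol_trunc M f v : gpol Y s M (combo Y s a (trunc M.+1 f) v).
Proof.
apply: gpol_sum => j; apply: gpolZ; apply: gpol_sum => k; apply: gpolZ.
by apply: gpol_mono (gpol_hn Y s (a j) k); rewrite -ltnS.
Qed.

(** The value [1 / (B^2 D)] that Paley-Zygmund gives from [E F^2 <= B E p^2] and
    [E p^4 <= D (E p^2)^2]. It depends only on [f] and [M], not on the vectors, their number or the
    dimension. *)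
Definition ball_prob (M : nat) (f : R -> R) : R :=
  ((1 + 4 * Ex G (fun x => f x ^+ 2) / zeta M f ^+ 2) ^+ 2 * bonami_cst R M ^+ (2 * M))^-1.

Lemma ball_prob_gt0 M f : 0 < ball_prob M f.
Proof.
rewrite invr_gt0 mulr_gt0 ?exprn_gt0 //; last first.
  by apply: lt_le_trans (bonami_cst_ge4 R M).
apply: ltr_wpDr => //; rewrite !mulr_ge0 ?invr_ge0 ?sqr_ge0 //.
by apply: Ex_ge0 => x; exact: sqr_ge0.
Qed.

(* Paley-Zygmund for the low-degree part [p] of [F]: [E (F p) = E p^2], while
   [E F^2 <= B E p^2] and [E p^4 <= D (E p^2)^2]. *)
Lemma small_ball M f v : L2 G f -> zeta M f != 0 -> offdiag M <= 4^-1 ->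
  (exists j, v j != 0) ->
  ball_prob M f <= fine (P [set x | combo Y s a f v x != 0]).
Proof.
move=> f2 zM oM [j0 vj0].
have f2' := L2_combo iidY us a1 v f2.
have h2 : (4^-1 : R) = (2^-1) ^+ 2 by lra.
have V0 : 0 < \sum_j v j ^+ 2.
  rewrite (bigD1 j0) //= ltr_wpDr ?exprn_even_gt0 // sumr_ge0 // => j _; exact: sqr_ge0.
set V := \sum_j _ in V0.
set F := combo Y s a f v in f2' *; pose p := combo Y s a (trunc M.+1 f) v.
have p2 : L2 P p := L2_combo iidY us a1 v (L2_trunc M.+1 f).
have p4 : mom P p := gpol_mom iidY (gpol_trunc M f v).
pose A := Ex P (fun x => p x ^+ 2).
have AE : A = \sum_(k < M.+1) zeta k f ^+ 2 * gramq s a k v.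
  exact: (Ex_combo_trunc_sq iidY us a1 ar1).
have AFp : Ex P (fun x => F x * p x) = A.
  have E := Ex_combo_trunc iidY us a1 ar1 M.+1 f v f2.
  rewrite ExMC [LHS]E AE; apply: eq_bigr => k _; by rewrite [in RHS]expr2.
have zM2 : 0 < zeta M f ^+ 2 by rewrite exprn_even_gt0.
(* Only the term of degree [M] is kept; [gramq_lower] with [h = 1/2] bounds its Gram form below. *)
have lowA : zeta M f ^+ 2 * (2^-1 * V) <= A.
  rewrite AE big_ord_recr /=; apply: ler_wpDl.
    apply: sumr_ge0 => k _; apply: mulr_ge0; rewrite ?sqr_ge0 //.
    exact: (gramq_ge0 iidY us a1 ar1).
  rewrite ler_wpM2l ?(ltW zM2) //.
  have := @gramq_lower M (2^-1) v; rewrite -h2 => /(_ _ oM) H.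
  by apply: le_trans (H _) => //; rewrite ler_wpM2r ?(ltW V0) //; lra.
have A0 : 0 < A by apply: lt_le_trans lowA; rewrite mulr_gt0 // mulr_gt0 // invr_gt0.
set f0 := Ex G (fun x => f x ^+ 2); have f00 : 0 <= f0 by apply: Ex_ge0 => x; exact: sqr_ge0.
pose B := 1 + 4 * f0 / zeta M f ^+ 2.
have B0 : 0 < B by rewrite ltr_wpDr // !mulr_ge0 ?invr_ge0 ?sqr_ge0.
(* [combo_upper] with [h = 1/2] leaves an excess of at most [2 f0 V], and [lowA] gives
   [V <= 2 A / zeta_M^2]; this is the 4 in [B]. *)
have FB : Ex P (fun x => F x ^+ 2) <= B * A.
  have oM1 : \sum_i \sum_(j | j != i) rho i j ^+ (2 * M.+1) <= (2^-1) ^+ 2.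
    by rewrite -h2; exact: le_trans (offdiag_mono (leqnSn M)) oM.
  have h0 : 0 <= 2^-1 :> R by [].
  have := combo_upper iidY us a1 ar1 v f2 h0 ar oM1.
  rewrite -AE => H; apply: (le_trans H); rewrite /B mulrDl mul1r lerD2l.
  have s22 : Num.sqrt 2 <= 2 :> R.
    by rewrite -[leRHS](ger0_norm (x := 2)) // -sqrtr_sqr ler_wsqrtr //; lra.
  apply: (@le_trans _ _ (f0 * 2 * V)).
    by rewrite ler_wpM2r ?(ltW V0) // ler_wpM2l //; lra.
  have : 4 * f0 / zeta M f ^+ 2 * (zeta M f ^+ 2 * (2^-1 * V)) <= 4 * f0 / zeta M f ^+ 2 * A.
    by rewrite ler_wpM2l // !mulr_ge0 ?invr_ge0 ?sqr_ge0.
  have -> : 4 * f0 / zeta M f ^+ 2 * (zeta M f ^+ 2 * (2^-1 * V)) = f0 * 2 * V.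
    by field.
  by [].
set N := [set x | F x != 0].
have mN : measurable N by exact: measurable_neq0 (L2_meas f2').
have iN : measurable_fun setT (\1_N : T -> R) := indic_meas mN.
have e2 : L2 P (\1_N : T -> R).
  split=> //; apply: eq_intg (intg_indic P mN) => x.
  by rewrite indicE; case: (_ \in _); rewrite ?expr1n ?expr0n.
have pe2 : L2 P (fun x => p x * \1_N x).
  apply: (le_L2 (g := fun x => `|p x|)); first by exact: (measurable_funM (L2_meas p2) iN).
    move=> x; rewrite normrM ler_piMr // indicE normr_nat.
    by case: (_ \in _); rewrite /= ?ler01.
  exact: mom_L2 (mom_norm p4).
pose X := Ex P (fun x => p x ^+ 2 * \1_N x).
(* Since [F] vanishes off [N], the indicator of [N] can be attached to [p] in [A = E (F p)] before
   applying Cauchy-Schwarz. *)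
have CS1 : A ^+ 2 <= B * A * X.
  have := Cauchy_Schwarz f2' pe2.
  have -> : Ex P (fun x => F x * (p x * \1_N x)) = A.
    rewrite -AFp; apply: eq_Ex => x; rewrite indicE.
    have [xN|xN] := boolP (x \in N); first by rewrite mulr1.
    have -> : F x = 0 by apply/eqP/negPn/negP => F0; rewrite mem_set in xN.
    by rewrite !mul0r.
  have -> : Ex P (fun x => (p x * \1_N x) ^+ 2) = X.
    apply: eq_Ex => x; rewrite exprMn indicE; congr (_ * _).
    by case: (_ \in _); rewrite ?expr1n ?expr0n.
  move=> H; apply: (le_trans H); apply: ler_wpM2r => //.
  by apply: Ex_ge0 => x; rewrite mulr_ge0 ?sqr_ge0 ?indicE.
have CS2 : X ^+ 2 <= Ex P (fun x => p x ^+ 4) * fine (P N).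
  have := Cauchy_Schwarz (mom_L2 (momX 2 p4)) e2.
  have -> : Ex P (fun x => (p x ^+ 2) ^+ 2) = Ex P (fun x => p x ^+ 4).
    by apply: eq_Ex => x; rewrite -exprM.
  have -> : Ex P (fun x => (\1_N x : R) ^+ 2) = fine (P N).
    rewrite -(Ex_indic P mN); apply: eq_Ex => x.
    by rewrite indicE; case: (_ \in _); rewrite ?expr1n ?expr0n.
  by [].
have Bon := bonami iidY us (leqnn M) (gpol_trunc M f v).
set D := _ ^+ _ in Bon; have D0 : 0 < D.
  by rewrite exprn_gt0 //; apply: lt_le_trans (bonami_cst_ge4 R M).
have AX : A <= B * X by rewrite -(ler_pM2l A0) -expr2 mulrCA mulrA.
have X0 : 0 <= X by apply: Ex_ge0 => x; rewrite mulr_ge0 ?sqr_ge0 ?indicE.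
have pN0 : 0 <= fine (P N) by rewrite fine_ge0.
have AX2 : A ^+ 2 <= B ^+ 2 * X ^+ 2 by rewrite -exprMn lerXn2r ?nnegrE ?mulr_ge0 ?(ltW B0) ?(ltW A0).
have Dp : 0 < bonami_cst R M by apply: lt_le_trans (bonami_cst_ge4 R M).
rewrite /ball_prob -/f0 -/B -/D -[leLHS]mul1r ler_pdivrMr ?mulr_gt0 ?exprn_gt0 //.
rewrite -(ler_pM2l (exprn_gt0 2 A0)) mulr1; apply: (le_trans AX2).
apply: (@le_trans _ _ (B ^+ 2 * (D * A ^+ 2 * fine (P N)))).
  rewrite ler_wpM2l ?sqr_ge0 //; apply: (le_trans CS2); rewrite ler_wpM2r //.
by rewrite [leLHS](_ : _ = A ^+ 2 * (fine (P N) * (B ^+ 2 * D))) //; ring.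
Qed.

End SmallBall.

(** * Measurability of inverse and rank *)

Section MatrixMeasurability.
Context d (T : measurableType d) (R : realType).

Definition mmx m n (A : T -> 'M[R]_(m, n)) :=
  forall i j, measurable_fun setT (fun x => A x i j).

Lemma mmx_cst m n (A : 'M[R]_(m, n)) : mmx (fun=> A).
Proof. by move=> i j; exact: measurable_cst. Qed.

Lemma mmx_mul m n p (A : T -> 'M[R]_(m, n)) (B : T -> 'M[R]_(n, p)) :
  mmx A -> mmx B -> mmx (fun x => A x *m B x).
Proof.
move=> mA mB i j; under eq_fun do rewrite mxE.
by apply: measurable_sum => k; apply: measurable_funM; [exact: mA|exact: mB].
Qed.

Lemma mmxD m n (A B : T -> 'M[R]_(m, n)) : mmx A -> mmx B -> mmx (fun x => A x + B x).
Proof.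
by move=> mA mB i j; under eq_fun do rewrite mxE; apply: measurable_funD; [exact: mA|exact: mB].
Qed.

Lemma mmx_tr m n (A : T -> 'M[R]_(m, n)) : mmx A -> mmx (fun x => (A x)^T).
Proof. by move=> mA i j; under eq_fun do rewrite mxE; exact: mA. Qed.

Lemma mmx_map m n (f : R -> R) (A : T -> 'M[R]_(m, n)) :
  measurable_fun setT f -> mmx A -> mmx (fun x => map_mx f (A x)).
Proof.
by move=> mf mA i j; under eq_fun do rewrite mxE; exact: (measurableT_comp mf (mA i j)).
Qed.

Lemma mmx_det n (A : T -> 'M[R]_n) : mmx A -> measurable_fun setT (fun x => \det (A x)).
Proof.
move=> mA; apply: measurable_sum => s; apply: measurable_funM; first exact: measurable_cst.
by apply: measurable_prod => i _; exact: mA.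
Qed.

Lemma mmx_inv n (A : T -> 'M[R]_n) : mmx A -> mmx (fun x => invmx (A x)).
Proof.
move=> mA i j; have md := mmx_det mA.
have -> : (fun x => invmx (A x) i j) = (fun x => if \det (A x) == 0 then A x i j
    else (\det (A x))^-1 * cofactor (A x) j i).
  apply/funext => x; rewrite /invmx unitmxE unitfE.
  by case: eqP => //= _; rewrite !mxE.
apply: measurable_fun_ifT; first by apply: measurable_fun_eqr => //; exact: measurable_cst.
  exact: mA.
apply: measurable_funM; first exact: measurable_inv.
apply: measurable_funM; first exact: measurable_cst.
by apply: mmx_det => k l; under eq_fun do rewrite !mxE; exact: mA.
Qed.

(** The rank is at least [k] exactly when some minor of size at least [k] is nonzero. Written as the
    nonvanishing of a sum of squared minors, this makes the rank a measurable function of the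
    entries. Row and column selections with repetitions are allowed; their minors are 0. *)
Lemma rank_minor m n (A : 'M[R]_(m, n)) k : (k <= \rank A)%N =
  (\sum_(j < n.+1 | (k <= j)%N) \sum_(f : {ffun 'I_j -> 'I_m}) \sum_(g : {ffun 'I_j -> 'I_n})
     \det (mxsub f g A) ^+ 2 != 0).
Proof.
have s0 j : 0 <= \sum_(f : {ffun 'I_j -> 'I_m}) \sum_(g : {ffun 'I_j -> 'I_n})
     \det (mxsub f g A) ^+ 2.
  by apply: sumr_ge0 => f _; apply: sumr_ge0 => g _; exact: sqr_ge0.
apply/idP/idP => [kA|].
  have rn : (\rank A < n.+1)%N by rewrite ltnS rank_leq_col.
  set r := \rank A in kA rn *.
  have [f [g fg]] : exists (f : {ffun 'I_r -> 'I_m}) (g : {ffun 'I_r -> 'I_n}),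
      \det (mxsub f g A) != 0.
    have fB : row_full (rowsub (maxrankfun A) A)^T.
      by rewrite /row_full mxrank_tr; exact: maxrowsub_free.
    exists (maxrankfun A), (fullrankfun fB).
    have := fullrowsub_unit fB; rewrite -trmx_mxsub unitmx_tr unitmxE unitfE.
    by rewrite -mxsub_comp.
  rewrite gt_eqF // (bigD1 (Ordinal rn)) //= ltr_pwDl ?sumr_ge0 //; last first.
    by move=> j _; exact: s0.
  rewrite (bigD1 f) //= ltr_pwDl //; last first.
    by apply: sumr_ge0 => f' _; apply: sumr_ge0 => g' _; exact: sqr_ge0.
  rewrite (bigD1 g) //= ltr_pwDl ?exprn_even_gt0 //.
  by apply: sumr_ge0 => g' _; exact: sqr_ge0.
apply: contraNT; rewrite -ltnNge => Ak; rewrite big1 // => j kj.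
rewrite big1 // => f _; rewrite big1 // => g _.
apply/eqP; rewrite sqrf_eq0; apply: contraTT (leq_trans Ak kj) => det0.
rewrite -leqNgt; have <- : \rank (mxsub f g A) = j.
  by apply/eqP; rewrite -/(row_free _) row_free_unit unitmxE unitfE.
have -> : mxsub f g A = rowsub f (colsub g A) by rewrite -mxsub_comp.
apply: (leq_trans (mxrankS (rowsub_sub _ _))).
by rewrite -mxrank_tr trmx_mxsub -(mxrank_tr A); exact: mxrankS (rowsub_sub _ _).
Qed.

Lemma mmx_rank m n (A : T -> 'M[R]_(m, n)) : mmx A ->
  measurable_fun setT (fun x => (\rank (A x))%:R : R).
Proof.
move=> mA; have -> : (fun x => (\rank (A x))%:R : R) =
    (fun x => \sum_(k < n) (k.+1 <= \rank (A x))%N%:R).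
  apply/funext => x; have := rank_leq_col (A x); move: (\rank _) => r rn.
  rewrite -(big_mkord xpredT (fun k => (k.+1 <= r)%N%:R)) (big_cat_nat _ (n := r)) //=.
  rewrite [X in _ + X]big1_seq ?addr0; last first.
    by move=> k; rewrite mem_index_iota /= => /andP[rk _]; rewrite ltnNge rk.
  rewrite big_nat (eq_bigr (fun=> 1)) => [|k /andP[_ ->]] //.
  by rewrite -big_nat sumr_const_nat subn0.
apply: measurable_sum => k; under eq_fun do rewrite rank_minor.
apply: measurable_neq0_nat; under eq_fun do rewrite big_mkcond.
apply: measurable_sum => j; case: (leqP k.+1 j) => _; last exact: measurable_cst.
apply: measurable_sum => f; apply: measurable_sum => g; apply: measurable_funX.
by apply: mmx_det => i i'; under eq_fun do rewrite mxE; exact: mA.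
Qed.

End MatrixMeasurability.

(** * Rank of a matrix with independent rows *)

Section RandomRank.
Context d (T : measurableType d) (R : realType) (P : probability T R).
Variables (law : set R -> \bar R) (N n : nat) (K : finType) (Y : 'I_N * K -> T -> R).
Hypothesis iidY : iid P law Y.
Variables (Z : T -> 'M[R]_(N, n)) (p : R).
Hypotheses (p0 : 0 <= p)
  (mZ : forall a j, measurable_fun
    [set: g_sigma_algebraType (coords Y [set ij : 'I_N * K | ij.1 == a]%SET)] (fun x => Z x a j))
  (small : forall a (u : 'cV[R]_n), u != 0 ->
    p <= fine (P [set x | (Z x *m u) a 0 != 0])).

(** Rows are zeroed rather than removed: [past a] keeps the rows before [a] and [rowp a] only row
    [a], so that all matrices keep one format and adding a row is matrix addition. *)
Let past (a : nat) (A : 'M[R]_(N, n)) : 'M[R]_(N, n) :=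
  \matrix_(i, j) ((i < a)%N%:R * A i j).
Let rowp (a : 'I_N) (A : 'M[R]_(N, n)) : 'M[R]_(N, n) :=
  \matrix_(i, j) ((i == a)%:R * A i j).

Lemma coords_mono (J1 J2 : {set 'I_N * K}) d' (S : measurableType d') (f : T -> S) :
  J1 \subset J2 -> measurable_fun [set: g_sigma_algebraType (coords Y J1)] f ->
  measurable_fun [set: g_sigma_algebraType (coords Y J2)] f.
Proof.
move=> J12 mf _ B mB; have := mf measurableT B mB.
apply: sub_sigma_algebra2 => A [i Ji Ai]; exists i => //.
by apply: (fintype.subsetP J12); exact: Ji.
Qed.

Let mZT : mmx Z.
Proof. move=> a j; exact: (coords_fun iidY (@mZ a j)). Qed.

Let rank_step (a : 'I_N) (A B : 'M[R]_(N, n)) (u : 'cV[R]_n) :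
  (\rank (past a A) <= \rank (past a A + rowp a B)%R)%N /\
  (past a A *m u = 0 -> (B *m u) a 0 != 0 ->
   (\rank (past a A) < \rank (past a A + rowp a B)%R)%N).
Proof.
set C := (X in (_ <= \rank X)%N).
have sub : (past a A <= C)%MS.
  apply/row_subP => i; have [->|ia] := eqVneq i a.
    suff -> : row a (past a A) = 0 by exact: sub0mx.
    by apply/rowP => j; rewrite !mxE ltnn mul0r.
  suff -> : row i (past a A) = row i C by exact: row_sub.
  by apply/rowP => j; rewrite !mxE (negbTE ia) mul0r addr0.
split=> [|Au Bu]; first exact: mxrankS.
apply: rank_ltmx; rewrite ltmxE sub; apply: contra Bu => /submxP [E CE].
have : C *m u = 0 by rewrite /C CE -mulmxA Au mulmx0.
move/matrixP/(_ a 0); rewrite mulmxDl Au add0r mxE => H.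
apply/eqP; rewrite mxE; rewrite [RHS]mxE in H; rewrite -[RHS]H.
by apply: eq_bigr => j _; rewrite !mxE eqxx mul1r.
Qed.

Let rk a x : R := (\rank (past a (Z x)))%:R.

Let pastS (a : 'I_N) A : past a.+1 A = past a A + rowp a A.
Proof.
apply/matrixP => i j; rewrite !mxE -mulrDl -natrD; congr (_%:R * _).
by rewrite ltnS leq_eqVlt -(inj_eq val_inj); case: ltngtP.
Qed.

Let mrk a : measurable_fun setT (rk a).
Proof.
apply: mmx_rank => i j; under eq_fun do rewrite mxE.
by apply: measurable_funM; [exact: measurable_cst | exact: mZT].
Qed.

Let irk a : intg P (rk a).
Proof.
apply: (le_intg (mrk a) (g := fun=> n%:R)) => [x|]; last exact: intg_cst.
by rewrite ger0_norm // ler_nat rank_leq_col.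
Qed.

Let defect (a : nat) := [set x | (\rank (past a (Z x)) < n)%N].

Let mdefect a : measurable (defect a).
Proof.
have -> : defect a = [set x | rk a x - n%:R != 0].
  apply/seteqP; split=> x /=; rewrite /defect /= subr_eq0 eqr_nat => H.
    by rewrite neq_ltn H.
  by rewrite ltn_neqAle H rank_leq_col.
by apply: measurable_neq0; apply: measurable_funB; [exact: mrk|exact: measurable_cst].
Qed.

(** The rows before [a] are frozen by Tonelli. While their rank is below [n], they annihilate some
    nonzero [u]; row [a] is independent of them, so with probability at least [p] it does not
    annihilate [u] and then raises the rank. *)
Let step (a : 'I_N) : p * fine (P (defect a)) <= Ex P (fun x => rk a.+1 x - rk a x).
Proof.
pose J1 : {set 'I_N * K} := [set ij : 'I_N * K | (ij.1 < a)%N]%SET.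
pose J2 : {set 'I_N * K} := [set ij : 'I_N * K | ij.1 == a]%SET.
have dJ : [disjoint J1 & J2]%B.
  rewrite finset.disjoints_subset; apply/fintype.subsetP => ij; rewrite !inE => ia.
  by apply: contraTN ia => /eqP ->; rewrite ltnn.
pose g (z : g_sigma_algebraType (coords Y J1) * g_sigma_algebraType (coords Y J2)) : R :=
  (\rank (past a (Z z.1) + rowp a (Z z.2))%R)%:R - (\rank (past a (Z z.1)))%:R.
have g0 z : 0 <= g z by rewrite subr_ge0 ler_nat; have [] := rank_step a (Z z.1) (Z z.2) 0.
have m1 : mmx (fun z : g_sigma_algebraType (coords Y J1) * g_sigma_algebraType (coords Y J2) =>
    past a (Z z.1)).
  move=> i j; under eq_fun do rewrite mxE.
  have [ia|ia] := boolP (i < a)%N; last by under eq_fun do rewrite mul0r; exact: measurable_cst.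
  apply: measurable_funM; first exact: measurable_cst.
  have mi : measurable_fun [set: g_sigma_algebraType (coords Y J1)] (fun x => Z x i j).
    apply: coords_mono (@mZ i j); apply/fintype.subsetP => ij; rewrite !inE => /eqP ->; exact: ia.
  exact: (measurableT_comp mi measurable_fst).
have m2 : mmx (fun z : g_sigma_algebraType (coords Y J1) * g_sigma_algebraType (coords Y J2) =>
    rowp a (Z z.2)).
  move=> i j; under eq_fun do rewrite mxE.
  have [->|ia] := eqVneq i a; last by under eq_fun do rewrite mul0r; exact: measurable_cst.
  apply: measurable_funM; first exact: measurable_cst.
  exact: (measurableT_comp (@mZ a j) measurable_snd).
have mg : measurable_fun setT (EFin \o g).
  apply/measurable_EFinP; apply: measurable_funB; apply: mmx_rank => //.
  exact: mmxD.
have g0' z : (0 <= (EFin \o g) z)%E by rewrite lee_fin.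
have tone := coords_tonelli iidY dJ mg g0'.
have iD : intg P (fun x => rk a.+1 x - rk a x) by apply: intgB; exact: irk.
rewrite -lee_fin -(ExE iD).
have -> : (\int[P]_x (rk a.+1 x - rk a x)%:E = \int[P]_x (EFin \o g) (x, x))%E.
  by apply: eq_integral => x _; rewrite /g /rk /= pastS.
rewrite tone -(Ex_indic P (mdefect a)) -(ExZ p (intg_indic P (mdefect a))).
rewrite -ExE; last exact: intgZ (intg_indic P (mdefect a)).
have mI : measurable_fun [set: T] (fun x => \int[P]_y (EFin \o g) (x, y))%E.
  apply: (coords_fun iidY (J := J1)).
  exact: (indep_measurable_integral P (coords_measurable iidY (J := J2)) mg g0').
apply: ge0_le_integral => //.
- by move=> x _; rewrite lee_fin mulr_ge0 // indicE.
- apply/measurable_EFinP; apply: measurable_funM; first exact: measurable_cst.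
  exact: indic_meas (mdefect a).
move=> x _; rewrite indicE; have [xd|xd] := boolP (x \in defect a); last first.
  by rewrite mulr0; apply: integral_ge0 => y _; rewrite lee_fin.
rewrite mulr1; rewrite inE /defect /= in xd.
have [j uj] : exists j, col j (cokermx (past a (Z x))) != 0.
  apply/existsP; rewrite -negb_forall; apply: contraTN xd => /forallP H.
  rewrite -leqNgt -subn_eq0 -mxrank_coker mxrank_eq0; apply/eqP/matrixP => i j.
  by have /eqP/matrixP/(_ i 0) := H j; rewrite !mxE.
set u := col j _ in uj.
have Au : past a (Z x) *m u = 0 by rewrite /u colE mulmxA mulmx_coker mul0mx.
have mS : measurable [set y | (Z y *m u) a 0 != 0].
  by apply: measurable_neq0; apply: mmx_mul (mmx_cst _) _ _.
apply: (@le_trans _ _ (P [set y | (Z y *m u) a 0 != 0])).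
  by rewrite -(fineP P mS) lee_fin; exact: small.
rewrite -[X in P X]setIT -integral_indic //; apply: ge0_le_integral => //.
- by apply/measurable_EFinP; exact: indic_meas.
- apply/measurable_EFinP; apply: measurable_funB; apply: mmx_rank.
    apply: (mmxD (A := fun=> past a (Z x)) (B := fun y => rowp a (Z y))).
      exact: mmx_cst.
    move=> i i'; under eq_fun do rewrite mxE.
    by apply: measurable_funM; [exact: measurable_cst | exact: mZT].
  exact: (mmx_cst (past a (Z x))).
move=> y _; rewrite lee_fin indicE; have [yS|_] := boolP (_ \in _); last exact: g0.
rewrite inE /= in yS; rewrite /g /= lerBrDr -(natrD _ 1) ler_nat add1n.
by have [_ H] := rank_step a (Z x) (Z y) u; exact: H.
Qed.

(** A final defect means a defect at every step, so each of the [N] expected increments is at least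
    [p] times its probability; the increments telescope to at most [n]. *)
Lemma rank_defect : measurable [set x | (\rank (Z x) < n)%N] /\
  N%:R * p * fine (P [set x | (\rank (Z x) < n)%N]) <= n%:R.
Proof.
have ZN A : past N A = A by apply/matrixP => i j; rewrite mxE ltn_ord mul1r.
have -> : [set x | (\rank (Z x) < n)%N] = defect N.
  by apply/seteqP; split=> x; rewrite /defect /= ZN.
split=> //.
have mono (a : 'I_N) : fine (P (defect N)) <= fine (P (defect a)).
  rewrite fine_le ?fin_num_measure //; apply: le_measure; rewrite ?inE // => x.
  rewrite /defect /= ZN; apply: leq_ltn_trans; apply: mxrankS.
  have -> : past a (Z x) = diag_mx (\row_i (i < a)%N%:R) *m Z x.
    by apply/matrixP => i j; rewrite mul_diag_mx !mxE.
  exact: submxMl.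
apply: (@le_trans _ _ (\sum_(a < N) Ex P (fun x => rk a.+1 x - rk a x))).
  rewrite -mulrA mulr_natl -[X in _ *+ X]card_ord -sumr_const; apply: ler_sum => a _.
  by apply: le_trans (step a); rewrite ler_wpM2l.
rewrite -Ex_sum => [|a _]; last by apply: intgB; exact: irk.
rewrite -[leRHS](Ex_cst P); apply: le_Ex; last 2 first.
- exact: intg_cst.
- move=> x; rewrite -(big_mkord xpredT (fun a => rk a.+1 x - rk a x)) telescope_sumr //.
  by rewrite lerBlDr ler_wpDr // ler_nat rank_leq_col.
by apply: intg_sum => a _; apply: intgB; exact: irk.
Qed.

End RandomRank.

(** * Concentration of the random kernel *)

Section Activation.
Context {R : realType}.
Notation G := (@std_gauss R).
Variables (sigma : R -> R) (C : R).
Hypotheses (ms : measurable_fun setT sigma) (C0 : 0 <= C)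
  (sg : forall t, `|sigma t| <= C * (1 + `|t|) `^ C).

Lemma growth_expR t : `|sigma t| <= C * expR (C * `|t|).
Proof.
apply: (le_trans (sg t)); rewrite ler_wpM2l // mulrC expRM.
by apply: ge0_ler_powR; rewrite ?nnegrE ?addr_ge0 ?expR_ge0 // expR_ge1Dx.
Qed.

Lemma mom_sigma : mom G sigma.
Proof.
apply: (@le_mom _ _ R G sigma (fun t => C * expR (C * `|t|)) ms growth_expR).
apply: momZ; split; first exact: intg_measurable (intg_expR_norm C).
move=> k; apply: eq_intg (intg_expR_norm (k%:R * C)) => x.
by rewrite [`|expR _|]ger0_norm ?expR_ge0 // -expRM_natl mulrA.
Qed.

(** The exponent 1/8 is small enough for [psi^2], of order [exp (t^2 / 4)] up to [sigma^4], to be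
    integrable against the Gaussian density. *)
Definition psi t := sigma t ^+ 2 * expR (t ^+ 2 / 8).

Lemma psi_ge0 t : 0 <= psi t.
Proof. by rewrite mulr_ge0 ?sqr_ge0 ?expR_ge0. Qed.

Lemma L2_psi : L2 G psi.
Proof.
have mpsi : measurable_fun setT psi.
  apply: measurable_funM; first exact: measurable_funX.
  apply: (measurableT_comp (@measurable_expR _)); apply: measurable_funM.
    exact: measurable_funX.
  exact: measurable_cst.
split=> //.
have q1 (c y : R) : 4 * (c * y) + 2 * (y ^+ 2 / 8) = 1 / 4 * y ^+ 2 + 4 * c * y by field.
have q2 (c y : R) : 4 * (c * - y) + 2 * (y ^+ 2 / 8) = 1 / 4 * y ^+ 2 + - (4 * c) * y by field.
have a2 : (1 / 4 : R) < 1 / 2 by lra.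
have e1 := (gauss_exp_quad (4 * C) a2).1; have e2 := (gauss_exp_quad (- (4 * C)) a2).1.
apply: (@le_intg _ _ R G _ (fun t => C ^+ 4 * (expR (1 / 4 * t ^+ 2 + 4 * C * t) + expR (1 / 4 * t ^+ 2 + - (4 * C) * t)))).
- exact: measurable_funX.
- move=> t; rewrite ger0_norm ?sqr_ge0 // /psi exprMn -expRM_natl -exprM.
  have h4 : sigma t ^+ 4 <= C ^+ 4 * expR (4 * (C * `|t|)).
    rewrite expRM_natl -exprMn (exprM _ 2 2) [leRHS](exprM _ 2 2).
    rewrite -(real_normK (num_real (sigma t))) lerXn2r ?nnegrE ?sqr_ge0 //.
    rewrite lerXn2r ?nnegrE ?mulr_ge0 ?expR_ge0 //; exact: growth_expR.
  apply: (@le_trans _ _ (C ^+ 4 * expR (4 * (C * `|t|)) * expR (2 * (t ^+ 2 / 8)))).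
    by rewrite ler_wpM2r ?expR_ge0.
  rewrite -mulrA ler_wpM2l ?exprn_ge0 // -expRD.
  have [t0|t0] := leP 0 t.
    by rewrite (ger0_norm t0) q1 lerDl expR_ge0.
  by rewrite (ltr0_norm t0) q2 lerDr expR_ge0.
- exact: (intgZ _ (intgD e1 e2)).
Qed.

(* Truncation at [t ^ 2 = 8 ln M], beyond which [expR (t ^ 2 / 8) >= M]. *)
Lemma sigma_sq_le (M t : R) : 1 <= ln M -> 0 < M ->
  sigma t ^+ 2 <= C ^+ 2 * 16 `^ C * ln M `^ C + M^-1 * psi t.
Proof.
move=> l1 M0; have l0 : 0 <= ln M by lra.
have q0 : 0 <= C ^+ 2 * 16 `^ C * ln M `^ C.
  by rewrite !mulr_ge0 ?sqr_ge0 ?powR_ge0.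
have [t8|t8] := leP (t ^+ 2) (8 * ln M).
  apply: ler_wpDr; first by rewrite mulr_ge0 ?psi_ge0 // invr_ge0 ltW.
  rewrite -mulrA -powRM // -(real_normK (num_real (sigma t))).
  apply: (@le_trans _ _ ((C * (1 + `|t|) `^ C) ^+ 2)).
    by rewrite lerXn2r ?nnegrE ?mulr_ge0 ?powR_ge0.
  rewrite exprMn ler_wpM2l ?sqr_ge0 // [leLHS]expr2 -powRM ?addr_ge0 //.
  apply: ge0_ler_powR; rewrite ?nnegrE ?mulr_ge0 ?addr_ge0 //.
  (* With [1 <= ln M] this gives [(1 + |t|)^2 <= 16 ln M], the origin of the constant 16. *)
  have t2 : `|t| ^+ 2 <= 8 * ln M by rewrite (real_normK (num_real t)).
  have := sqr_ge0 (`|t| - 1); move: t2 l1 (normr_ge0 t); set a := `|t|; set b := ln M.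
  rewrite expr2 sqrrB; nra.
apply: ler_wpDl => //; rewrite mulrC ler_pdivlMr // /psi ler_wpM2l ?sqr_ge0 //.
rewrite -[leLHS](lnK (x := M)) ?posrE // ler_expR; lra.
Qed.

End Activation.

Section AverageVariance.
Context d (T : measurableType d) (R : realType) (P : probability T R).

Lemma average_variance (N : nat) (xi : 'I_N -> T -> R) (mu V : R) : (0 < N)%N ->
  (forall a, L2 P (xi a)) -> (forall a, Ex P (xi a) = mu) ->
  (forall a b, a != b -> Ex P (fun x => xi a x * xi b x) = mu ^+ 2) ->
  (forall a, Ex P (fun x => xi a x ^+ 2) <= V) ->
  Ex P (fun x => (N%:R^-1 * \sum_a xi a x - mu) ^+ 2) <= N%:R^-1 * V.
Proof.
move=> N0 x2 xm xx xV; have Nr : 0 < N%:R :> R by rewrite ltr0n.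
have i2 a b : intg P (fun x => (xi a x - mu) * (xi b x - mu)).
  by apply: L2_mul; apply: L2B => //; exact: L2_cst.
have E2 a b : Ex P (fun x => (xi a x - mu) * (xi b x - mu)) =
    Ex P (fun x => xi a x * xi b x) - mu ^+ 2.
  have ab := L2_mul (x2 a) (x2 b); have ia := L2_intg (x2 a); have ib := L2_intg (x2 b).
  transitivity (Ex P (fun x => xi a x * xi b x + ((- mu) * xi a x + ((- mu) * xi b x + mu ^+ 2)))).
    by apply: eq_Ex => x; ring.
  have ia' := intgZ (- mu) ia; have ib' := intgZ (- mu) ib.
  have ic := intg_cst P (mu ^+ 2).
  rewrite (ExD ab (intgD ia' (intgD ib' ic))) (ExD ia' (intgD ib' ic)) (ExD ib' ic).
  by rewrite (ExZ _ ia) (ExZ _ ib) Ex_cst !xm; ring.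
have -> : Ex P (fun x => (N%:R^-1 * \sum_a xi a x - mu) ^+ 2) =
    N%:R^-1 ^+ 2 * \sum_a \sum_b Ex P (fun x => (xi a x - mu) * (xi b x - mu)).
  transitivity (Ex P (fun x => N%:R^-1 ^+ 2 * \sum_a \sum_b (xi a x - mu) * (xi b x - mu))).
    apply: eq_Ex => x.
    have -> : \sum_a \sum_b (xi a x - mu) * (xi b x - mu) = (\sum_a (xi a x - mu)) ^+ 2.
      by rewrite expr2 mulr_suml; apply: eq_bigr => a _; rewrite mulr_sumr.
    rewrite sumrB sumr_const card_ord -exprMn mulrBr; congr ((_ - _) ^+ 2).
    by rewrite -[mu *+ N]mulr_natl mulrA mulVf ?mul1r // lt0r_neq0.
  rewrite ExZ; last by apply: intg_sum => a _; apply: intg_sum => b _.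
  congr (_ * _); rewrite Ex_sum => [|a _]; last by apply: intg_sum => b _.
  by apply: eq_bigr => a _; rewrite Ex_sum.
rewrite expr2 -mulrA ler_wpM2l ?invr_ge0 // ler_pdivrMl //.
rewrite mulr_natl -[X in _ *+ X]card_ord -sumr_const; apply: ler_sum => a _.
rewrite (bigD1 a) //= big1 ?addr0 => [|b ba]; last first.
  by rewrite E2 xx ?subrr // eq_sym.
rewrite E2 lerBlDr; apply: ler_wpDr; first exact: sqr_ge0.
by have := xV a; under eq_Ex do rewrite expr2.
Qed.

End AverageVariance.

Lemma dotE (R : realType) d (u v : 'cV[R]_d) : dot u v = \sum_i u i 0 * v i 0.
Proof. by rewrite /dot mxE; apply: eq_bigr => i _; rewrite mxE. Qed.

Lemma dotC (R : realType) d (u v : 'cV[R]_d) : dot u v = dot v u.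
Proof. by rewrite !dotE; apply: eq_bigr => i _; rewrite mulrC. Qed.

Section Concentration.
Context d0 (T : measurableType d0) (R : realType) (P : probability T R).
Notation G := (@std_gauss R).
Notation G2 := (prodP G G).
Variables (N d : nat) (W : T -> 'M[R]_(N, d)).
Hypothesis iidW : iid P (centered_gauss 1) (entries W).
Variables (sigma : R -> R) (C : R).
Hypotheses (ms : measurable_fun setT sigma) (C0 : 0 <= C)
  (sg : forall t, `|sigma t| <= C * (1 + `|t|) `^ C).

Definition row_seq (a : 'I_N) : seq ('I_N * 'I_d) := [seq (a, j) | j <- enum 'I_d].
Definition row_coef (u : 'cV[R]_d) (ij : 'I_N * 'I_d) : R := u ij.2 0.

Lemma row_seq_uniq a : uniq (row_seq a).
Proof. by rewrite map_inj_uniq ?enum_uniq // => i j []. Qed.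

Lemma row_seq_sub a : {subset row_seq a <= [set ij : 'I_N * 'I_d | ij.1 == a]%SET}.
Proof. by move=> ij /mapP[j _ ->]; rewrite inE. Qed.

Lemma row_ip a u v : ip (row_seq a) (row_coef u) (row_coef v) = dot u v.
Proof. by rewrite /ip big_map big_enum dotE. Qed.

Lemma row_lin a u x : lin_form (entries W) (row_seq a) (row_coef u) x = (W x *m u) a 0.
Proof.
by rewrite /lin_form big_map big_enum mxE; apply: eq_bigr => j _; rewrite mulrC.
Qed.

(** The mean of one summand of the random kernel at two unit vectors with inner product [r]; see
    [kap_law]. *)
Definition kap (r : R) : R :=
  Ex G2 (fun z => sigma z.1 * sigma (r * z.1 + Num.sqrt (1 - r ^+ 2) * z.2)).

Let m2 := mom_sigma ms C0 sg.
Let s2 := mom_L2 m2.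

Lemma row_mom a u : dot u u = 1 -> mom P (fun x => sigma ((W x *m u) a 0)).
Proof.
move=> u1; have mW : measurable_fun setT (fun x => lin_form (entries W) (row_seq a) (row_coef u) x : measurableTypeR R).
  exact: (lin_form_meas iidW (row_seq a) (row_coef u)).
have law : same_law P G (fun x => lin_form (entries W) (row_seq a) (row_coef u) x : measurableTypeR R)
    (fun z : measurableTypeR R => z).
  by apply: (lin_law iidW (row_seq_uniq a)); rewrite row_ip.
have := mom_same_law mW law (proj1 m2) m2.
by under [X in mom P X]eq_fun do rewrite row_lin.
Qed.

Lemma kap_law a u v : dot u u = 1 -> dot v v = 1 ->
  Ex P (fun x => sigma ((W x *m u) a 0) * sigma ((W x *m v) a 0)) = kap (dot u v).
Proof.
move=> u1 v1; have us := row_seq_uniq a.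
have law := pair_law iidW us (a := row_coef u) (b := row_coef v).
rewrite !row_ip in law; have {}law := law u1 v1.
pose Y x : measurableTypeR R * measurableTypeR R :=
  (lin_form (entries W) (row_seq a) (row_coef u) x, lin_form (entries W) (row_seq a) (row_coef v) x).
have mY : measurable_fun setT Y.
  by apply/measurable_fun_pairP; split; exact: (lin_form_meas iidW).
pose phi (z : measurableTypeR R * measurableTypeR R) : measurableTypeR R * measurableTypeR R :=
  (z.1, dot u v * z.1 + Num.sqrt (1 - dot u v ^+ 2) * z.2).
have mphi : measurable_fun setT phi.
  apply/measurable_fun_pairP; split; first exact: measurable_fst.
  apply: measurable_funD; apply: measurable_funM;
    first [exact: measurable_cst | exact: measurable_fst | exact: measurable_snd].
have mF : measurable_fun setT (fun z : measurableTypeR R * measurableTypeR R => sigma z.1 * sigma z.2).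
  by apply: measurable_funM; [exact: (measurableT_comp ms measurable_fst) |
    exact: (measurableT_comp ms measurable_snd)].
have rev : same_law G2 P phi Y by move=> F mF' F0; rewrite -(law F mF' F0).
have i1 : intg P (fun x => sigma (Y x).1 * sigma (Y x).2).
  have := mom_intg (momM (row_mom a u1) (row_mom a v1)).
  by apply: eq_intg => x; rewrite /Y /= !row_lin.
have E := Ex_same_law mphi rev mF i1.
rewrite /kap [RHS]E; apply: eq_Ex => x; by rewrite /Y /= !row_lin.
Qed.

(** Bounds [E (psi(s) sigma(t)^2)] for any two standard Gaussian variables, whatever their joint
    law, by [2 a b <= a^2 + b^2]. *)
Definition psi_cst := (Ex G (fun t => psi sigma t ^+ 2) + Ex G (fun t => sigma t ^+ 4)) / 2.

Variables (n : nat) (xs : 'I_n -> 'cV[R]_d) (u : 'cV[R]_d) (v : 'I_n -> R).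
Hypotheses (xs1 : forall j, dot (xs j) (xs j) = 1) (u1 : dot u u = 1) (N0 : (0 < N)%N).

Let feat a x := \sum_j v j * sigma ((W x *m xs j) a 0).
Let xi a x := sigma ((W x *m u) a 0) * feat a x.

Let mfeat a : mom P (feat a).
Proof. by apply: mom_sum => j _; apply: momZ; exact: row_mom. Qed.

Let mxi a : mom P (xi a).
Proof. by apply: momM => //; exact: row_mom. Qed.

(** Replacing [sigma(u)^2] by the constant [L] preserves the sharp second moment [q] of the feature.
    Only the remainder pays the factor [n] of a crude Cauchy-Schwarz bound, and it comes divided by
    [M], later taken to be [N]. *)
Lemma row_second_moment (L q M : R) a : 0 < M ->
  (forall t, sigma t ^+ 2 <= L + M^-1 * psi sigma t) -> 0 <= L ->
  Ex P (fun x => feat a x ^+ 2) <= q ->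
  Ex P (fun x => xi a x ^+ 2) <= L * q + M^-1 * n%:R * psi_cst * \sum_j v j ^+ 2.
Proof.
move=> M0 sL L0 Fq; set V := \sum_j v j ^+ 2.
have V0 : 0 <= V by apply: sumr_ge0 => j _; exact: sqr_ge0.
have us := row_seq_uniq a.
have lin f w : dot w w = 1 -> intg G f ->
    intg P (fun x => f ((W x *m w) a 0)) /\ Ex P (fun x => f ((W x *m w) a 0)) = Ex G f.
  move=> w1 fi; have w1' : ip (row_seq a) (row_coef w) (row_coef w) = 1 by rewrite row_ip.
  have i := intg_lin iidW us w1' fi; have e := Ex_lin iidW us w1' fi.
  split; first by apply: eq_intg i => x; rewrite row_lin.
  by rewrite -e; apply: eq_Ex => x; rewrite row_lin.
have [p2i p2e] := lin _ _ u1 (L2_sq (L2_psi ms C0 sg)).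
have s4 j := lin _ _ (xs1 j) (momX_intg 4 m2).
have F2 := momX_intg 2 (mfeat a).
have i4 j : intg P (fun x => psi sigma ((W x *m u) a 0) ^+ 2 + sigma ((W x *m xs j) a 0) ^+ 4).
  exact: intgD p2i (s4 j).1.
have iS : intg P (fun x => \sum_(j < n) (psi sigma ((W x *m u) a 0) ^+ 2 + sigma ((W x *m xs j) a 0) ^+ 4)).
  by apply: intg_sum => j _; exact: i4.
have k1 := intgZ L F2; have k2 := intgZ (M^-1 * V / 2) iS.
apply: (@le_trans _ _ (Ex P (fun x => L * feat a x ^+ 2 + (M^-1 * V / 2) *
    \sum_(j < n) (psi sigma ((W x *m u) a 0) ^+ 2 + sigma ((W x *m xs j) a 0) ^+ 4)))).
  apply: le_Ex; [exact: momX_intg | exact: (intgD k1 k2) |] => x.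
  rewrite /xi exprMn; set s0 := (W x *m u) a 0.
  apply: (le_trans (ler_wpM2r (sqr_ge0 _) (sL s0))); rewrite mulrDl lerD2l.
  rewrite -[leLHS]mulrA -[X in _ <= X * _]mulrA -[leRHS]mulrA ler_wpM2l ?invr_ge0 ?(ltW M0) //.
  apply: (@le_trans _ _ (psi sigma s0 * (V * \sum_j sigma ((W x *m xs j) a 0) ^+ 2))).
    rewrite ler_wpM2l ?psi_ge0 //; exact: Cauchy_Schwarz_sum.
  rewrite mulrCA -[leRHS]mulrA ler_wpM2l // mulr_sumr mulr_sumr; apply: ler_sum => j _.
  set t := sigma _; have := sqr_ge0 (psi sigma s0 - t ^+ 2).
  rewrite sqrrB -exprM; lra.
rewrite (ExD k1 k2) (ExZ _ F2) (ExZ _ iS); apply: lerD; first by rewrite ler_wpM2l.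
rewrite Ex_sum => [|j _]; last exact: i4.
under eq_bigr => j _ do rewrite (ExD p2i (s4 j).1) p2e (s4 j).2.
rewrite sumr_const card_ord -[X in _ * X]mulr_natl /psi_cst.
set A := _ + _; by rewrite [leRHS](_ : _ = M^-1 * V / 2 * (n%:R * A)) //; field; rewrite lt0r_neq0.
Qed.

Let mean := \sum_j v j * kap (dot u (xs j)).

Let kerE x : \sum_j v j * (rf_kernel sigma (W x) u (xs j) - kap (dot u (xs j))) =
  N%:R^-1 * \sum_a xi a x - mean.
Proof.
under eq_bigr do rewrite mulrBr.
rewrite sumrB; congr (_ - _).
transitivity (\sum_j \sum_a N%:R^-1 * (v j * (sigma ((W x *m u) a 0) * sigma ((W x *m xs j) a 0)))).
  apply: eq_bigr => j _; rewrite /rf_kernel dotE mulrCA mulr_sumr mulr_sumr.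
  by apply: eq_bigr => a _; rewrite !mxE.
rewrite exchange_big /= mulr_sumr; apply: eq_bigr => a _.
rewrite /xi /feat mulr_sumr mulr_sumr; apply: eq_bigr => j _.
by rewrite [v j * (_ * _)]mulrCA.
Qed.

Let row_fun a w : dot w w = 1 -> measurable_fun
  [set: g_sigma_algebraType (coords (entries W) [set ij : 'I_N * 'I_d | ij.1 == a]%SET)]
  (fun x => sigma ((W x *m w) a 0)).
Proof.
move=> w1; have -> : (fun x => sigma ((W x *m w) a 0)) =
    (fun x => sigma (lin_form (entries W) (row_seq a) (row_coef w) x)).
  by apply/funext => x; rewrite row_lin.
apply: (measurableT_comp ms); apply: lin_form_coords; exact: row_seq_sub.
Qed.

(** The kernel error along [v] is the centered average of the row variables [xi a]. Distinct rows
    use disjoint sets of entries of [W], hence are independent, and [average_variance] gains the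
    factor [1 / N]. *)
Lemma kernel_concentration (L q M : R) : 0 < M ->
  (forall t, sigma t ^+ 2 <= L + M^-1 * psi sigma t) -> 0 <= L ->
  (forall a, Ex P (fun x => (\sum_j v j * sigma ((W x *m xs j) a 0)) ^+ 2) <= q) ->
  let f x := (\sum_j v j * (rf_kernel sigma (W x) u (xs j) - kap (dot u (xs j)))) ^+ 2 in
  intg P f /\ Ex P f <= N%:R^-1 * (L * q + M^-1 * n%:R * psi_cst * \sum_j v j ^+ 2).
Proof.
move=> M0 sL L0 Fq f; have fE x : f x = (N%:R^-1 * \sum_a xi a x - mean) ^+ 2.
  by rewrite /f kerE.
have mf : mom P (fun x => N%:R^-1 * \sum_a xi a x - mean).
  apply: momD; last exact: mom_cst.
  by apply: momZ; apply: mom_sum => a _.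
split; first by apply: eq_intg (momX_intg 2 mf) => x; rewrite fE.
rewrite (eq_Ex P fE); apply: average_variance => //.
- by move=> a; exact: mom_L2.
- move=> a; have kk j : intg P (fun x => sigma ((W x *m u) a 0) * sigma ((W x *m xs j) a 0)).
    by apply: mom_intg; apply: momM; exact: row_mom.
  transitivity (Ex P (fun x => \sum_j v j * (sigma ((W x *m u) a 0) * sigma ((W x *m xs j) a 0)))).
    by apply: eq_Ex => x; rewrite /xi /feat mulr_sumr; apply: eq_bigr => j _; rewrite mulrCA.
  rewrite Ex_sum => [|j _]; last exact: (intgZ _ (kk j)).
  by apply: eq_bigr => j _; rewrite (ExZ _ (kk j)) kap_law.
- move=> a b ab.
  have Exi c : Ex P (xi c) = mean.
    have kk j : intg P (fun x => sigma ((W x *m u) c 0) * sigma ((W x *m xs j) c 0)).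
      by apply: mom_intg; apply: momM; exact: row_mom.
    transitivity (Ex P (fun x => \sum_j v j * (sigma ((W x *m u) c 0) * sigma ((W x *m xs j) c 0)))).
      by apply: eq_Ex => x; rewrite /xi /feat mulr_sumr; apply: eq_bigr => j _; rewrite mulrCA.
    rewrite Ex_sum => [|j _]; last exact: (intgZ _ (kk j)).
    by apply: eq_bigr => j _; rewrite (ExZ _ (kk j)) kap_law.
  have cxi c : measurable_fun
      [set: g_sigma_algebraType (coords (entries W) [set ij : 'I_N * 'I_d | ij.1 == c]%SET)] (xi c).
    apply: measurable_funM; first exact: row_fun.
    apply: measurable_sum => j; apply: measurable_funM; first exact: measurable_cst.
    exact: row_fun.
  have dab : [disjoint [set ij : 'I_N * 'I_d | ij.1 == a]%SET & [set ij : 'I_N * 'I_d | ij.1 == b]%SET]%B.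
    rewrite finset.disjoints_subset; apply/fintype.subsetP => ij; rewrite !inE => /eqP ->.
    exact: ab.
  have [_ ->] := coords_ExM iidW dab (cxi a) (cxi b) (mom_intg (mxi a)) (mom_intg (mxi b)).
  by rewrite !Exi expr2.
- by move=> a; apply: row_second_moment M0 sL L0 (Fq a).
Qed.

End Concentration.

(** * The polynomial kernel *)

Section DotAlgebra.
Context {R : realType}.

Lemma dotDl d (u v w : 'cV[R]_d) : dot (u + v) w = dot u w + dot v w.
Proof. by rewrite !dotE -big_split; apply: eq_bigr => i _; rewrite mxE mulrDl. Qed.

Lemma dotNl d (u w : 'cV[R]_d) : dot (- u) w = - dot u w.
Proof. by rewrite !dotE -sumrN; apply: eq_bigr => i _; rewrite mxE mulNr. Qed.

Lemma dotDr d (u v w : 'cV[R]_d) : dot w (u + v) = dot w u + dot w v.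
Proof. by rewrite dotC dotDl !(dotC w). Qed.

Lemma dotNr d (u w : 'cV[R]_d) : dot w (- u) = - dot w u.
Proof. by rewrite dotC dotNl dotC. Qed.

Lemma dotZr d c (u w : 'cV[R]_d) : dot w (c *: u) = c * dot w u.
Proof. by rewrite !dotE mulr_sumr; apply: eq_bigr => i _; rewrite mxE mulrCA. Qed.

Lemma dot_ge0 d (u : 'cV[R]_d) : 0 <= dot u u.
Proof. by rewrite dotE; apply: sumr_ge0 => i _; rewrite -expr2 sqr_ge0. Qed.

Lemma dot_eq0 d (u : 'cV[R]_d) : dot u u = 0 -> u = 0.
Proof.
rewrite dotE => /eqP; rewrite psumr_eq0 => [/allP H|i _]; last by rewrite -expr2 sqr_ge0.
apply/matrixP => i j; rewrite !mxE !ord1; apply/eqP.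
by have := H i (mem_index_enum i); rewrite /= mulf_eq0 orbb.
Qed.

Lemma dot_mulmx m n (A : 'M[R]_(m, n)) u v : dot u (A *m v) = dot (A^T *m u) v.
Proof. by rewrite /dot trmx_mul trmxK mulmxA. Qed.

Lemma dot_CS d (u v : 'cV[R]_d) : dot u v ^+ 2 <= dot u u * dot v v.
Proof.
rewrite !dotE; have := Cauchy_Schwarz_sum (index_enum 'I_d) xpredT (fun i => u i 0) (fun i => v i 0).
by under [X in _ <= X * _]eq_bigr do rewrite expr2; under [X in _ <= _ * X]eq_bigr do rewrite expr2.
Qed.

Lemma dot_young d (t : R) (u v : 'cV[R]_d) : 0 < t ->
  2 * dot u v <= t * dot u u + t^-1 * dot v v.
Proof.
move=> t0; rewrite !dotE !mulr_sumr -big_split /=; apply: ler_sum => i _.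
set a := u i 0; set b := v i 0; have := sqr_ge0 (t * a - b).
rewrite -(ler_pM2l t0) mulrDr [t * (t^-1 * _)]mulrA divff ?lt0r_neq0 // mul1r sqrrB.
by rewrite exprMn; lra.
Qed.

Lemma unitmx_inj n (A : 'M[R]_n) : (forall u : 'cV[R]_n, A *m u = 0 -> u = 0) -> A \in unitmx.
Proof.
move=> inj; rewrite -row_full_unit -cokermx_eq0; apply/eqP/matrixP => i j.
have := inj (col j (cokermx A)); rewrite colE mulmxA mulmx_coker mul0mx => /(_ erefl).
by rewrite -colE => /matrixP/(_ i 0); rewrite !mxE.
Qed.

Lemma frob_sqr m n (A : 'M[R]_(m, n)) : frob A ^+ 2 = \sum_i \sum_j A i j ^+ 2.
Proof.
by rewrite sqr_sqrtr //; apply: sumr_ge0 => i _; apply: sumr_ge0 => j _; exact: sqr_ge0.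
Qed.

Lemma frob_col_sqr d (u : 'cV[R]_d) : frob u ^+ 2 = dot u u.
Proof.
rewrite frob_sqr dotE; apply: eq_bigr => i _.
by rewrite big_ord1 expr2.
Qed.

End DotAlgebra.

Section GramForms.
Context {R : realType}.
Variables (d n : nat) (xs : 'I_n -> 'cV[R]_d) (x : 'cV[R]_d).
Hypotheses (xs1 : forall i, dot (xs i) (xs i) = 1) (x1 : dot x x = 1)
  (xsr : forall i j, i != j -> `|dot (xs i) (xs j)| <= (Num.sqrt 2)^-1)
  (xr : forall i, `|dot x (xs i)| <= (Num.sqrt 2)^-1).

Definition gq m (ys : 'I_m -> 'cV[R]_d) k (v : 'I_m -> R) :=
  \sum_i \sum_j v i * v j * dot (ys i) (ys j) ^+ k.

(** With [x] put in front of [xs] and [-1] in front of [v], the form [gq] of degree [k] becomes the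
    mean square of [sum_i v_i h_k(beta . x_i) - h_k(beta . x)], a prediction error for [h_k]. *)
Definition ext (T : Type) (a : T) (f : 'I_n -> T) (k : 'I_n.+1) : T :=
  if unlift ord0 k is Some i then f i else a.

Lemma ext1 k : dot (ext x xs k) (ext x xs k) = 1.
Proof. by rewrite /ext; case: unliftP. Qed.

Lemma extr i j : i != j -> `|dot (ext x xs i) (ext x xs j)| <= (Num.sqrt 2)^-1.
Proof.
rewrite /ext; case: unliftP => [i' ->|->]; case: unliftP => [j' ->|->] //.
- by rewrite (inj_eq lift_inj) => /xsr.
- by move=> _; rewrite dotC.
Qed.

Lemma ext0 T (a : T) f : ext a f ord0 = a.
Proof. by rewrite /ext unlift_none. Qed.

Lemma extS T (a : T) f i : ext a f (lift ord0 i) = f i.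
Proof. by rewrite /ext liftK. Qed.

Lemma gq_ext k v : gq (ext x xs) k (ext (-1) v) =
  1 - 2 * (\sum_i v i * dot x (xs i) ^+ k) + gq xs k v.
Proof.
rewrite /gq big_ord_recl big_ord_recl !ext0 x1 expr1n.
under eq_bigr do rewrite !extS.
under [X in _ + X]eq_bigr => i _.
  rewrite big_ord_recl !ext0 !extS.
  under eq_bigr do rewrite !extS.
  over.
rewrite big_split /=; set A := \sum_i _; set B := \sum_i _; set D := \sum_i _.
set E := \sum_i v i * _.
have -> : A = - E by rewrite /A /E -sumrN; apply: eq_bigr => i _; ring.
have -> : B = - E.
  by rewrite /B /E -sumrN; apply: eq_bigr => i _; rewrite (dotC (xs i)); ring.
by ring.
Qed.

Definition cross k := \sum_i dot x (xs i) ^+ (2 * k).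
Definition off k := \sum_i \sum_(j | j != i) dot (xs i) (xs j) ^+ (2 * k).

Lemma r_lt1 : (Num.sqrt 2)^-1 < 1 :> R.
Proof.
by rewrite invf_lt1 ?sqrtr_gt0 // -[ltLHS]sqrtr1 ltr_sqrt // ltr1n.
Qed.

Lemma r_sqr : (Num.sqrt 2)^-1 ^+ 2 = 2^-1 :> R.
Proof. by rewrite exprVn sqr_sqrtr. Qed.

Lemma cross_mono k k' : (k <= k')%N -> cross k' <= cross k.
Proof.
move=> kk; apply: ler_sum => i _; rewrite !exprM ler_wiXn2l ?sqr_ge0 //.
rewrite -(real_normK (num_real _)) exprn_ile1 //.
by apply: ltW; exact: le_lt_trans (xr i) r_lt1.
Qed.

Lemma cross_ge0 k : 0 <= cross k.
Proof. by apply: sumr_ge0 => i _; rewrite exprM exprn_ge0 ?sqr_ge0. Qed.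

Lemma off_ge0 k : 0 <= off k.
Proof. by apply: sumr_ge0 => i _; apply: sumr_ge0 => j _; rewrite exprM exprn_ge0 ?sqr_ge0. Qed.

(* Minimize [e V - 2 b + 1] over [V] and [b] with [b ^ 2 <= V S]. *)
Lemma gq_ext_lower k v (e S : R) : 0 < e -> cross k <= S ->
  e * (\sum_i v i ^+ 2) <= gq xs k v ->
  1 - S / e <= gq (ext x xs) k (ext (-1) v).
Proof.
move=> e0 cS gV; rewrite gq_ext; set V := \sum_i v i ^+ 2 in gV *.
set b := \sum_i _; have V0 : 0 <= V by apply: sumr_ge0 => i _; exact: sqr_ge0.
have bV : b ^+ 2 <= V * S.
  apply: (le_trans (Cauchy_Schwarz_sum _ _ _ _)); rewrite ler_wpM2l //.
  by apply: le_trans cS; apply: ler_sum => i _; rewrite mulnC exprM.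
suff : 2 * b <= e * V + S / e by lra.
have S0 : 0 <= S := le_trans (cross_ge0 k) cS.
rewrite -(ler_pM2r e0) -[leLHS]mulrA.
have -> : (e * V + S / e) * e = e * V * e + S by field; rewrite lt0r_neq0.
have h : 0 <= e * V * e + S by rewrite addr_ge0 // !mulr_ge0 // ltW.
apply: (le_trans (ler_norm _)); rewrite -(ler_pXn2r (n := 2)) ?nnegrE //.
rewrite (real_normK (num_real _)).
have -> : (2 * (b * e)) ^+ 2 = 4 * e ^+ 2 * b ^+ 2 by ring.
apply: (@le_trans _ _ (4 * e ^+ 2 * (V * S))).
  by rewrite ler_wpM2l // mulr_ge0 ?sqr_ge0.
have := sqr_ge0 (e * V * e - S); rewrite -subr_ge0 => H; rewrite -subr_ge0.
by apply: le_trans H _; rewrite le_eqVlt; apply/orP; left; apply/eqP; ring.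
Qed.

Lemma hadamard_gram (X : 'M[R]_(d, n)) i j : (forall i, xs i = col i X) ->
  (X^T *m X) i j = dot (xs i) (xs j).
Proof.
by move=> xX; rewrite dotE !xX mxE; apply: eq_bigr => r _; rewrite !mxE.
Qed.

Lemma off_frob (X : 'M[R]_(d, n)) k : (forall i, xs i = col i X) ->
  frob (hadamard_pow (X^T *m X) k - 1%:M) ^+ 2 = off k.
Proof.
move=> xX; rewrite frob_sqr; apply: eq_bigr => i _.
have E j : (hadamard_pow (X^T *m X) k - 1%:M) i j = dot (xs i) (xs j) ^+ k - (i == j)%:R.
  by rewrite /hadamard_pow !mxE -(hadamard_gram _ _ xX) mxE.
rewrite (bigD1 i) //= E eqxx xs1 expr1n subrr expr0n add0r.
by apply: eq_bigr => j ji; rewrite E eq_sym (negbTE ji) subr0 mulnC exprM.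
Qed.

Lemma cross_frob (X : 'M[R]_(d, n)) k : (forall i, xs i = col i X) ->
  frob (hadamard_pow (X^T *m x) k) ^+ 2 = cross k.
Proof.
move=> xX; rewrite frob_sqr; apply: eq_bigr => i _.
rewrite big_ord1 /hadamard_pow mxE mulnC exprM; congr ((_ ^+ _) ^+ _).
by rewrite dotC dotE xX mxE; apply: eq_bigr => r _; rewrite !mxE.
Qed.

Section PolyKernel.
Variables (zs : nat -> R) (F0 c : R) (l : nat) (lambda : R).
Variables (K : 'M[R]_n) (k : 'cV[R]_n).
Hypotheses (c0 : 0 < c) (lambda0 : 0 <= lambda)
  (cE : c = F0 - \sum_(q < l.+1) zs q ^+ 2)
  (KE : forall i j, K i j = \sum_(q < l.+1) zs q ^+ 2 * dot (xs i) (xs j) ^+ q + c * (i == j)%:R)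
  (kE : forall i, k i 0 = \sum_(q < l.+1) zs q ^+ 2 * dot x (xs i) ^+ q)
  (gq0 : forall q v, 0 <= gq xs q v)
  (gqx0 : forall q v, 0 <= gq (ext x xs) q v).
Let Kl := lambda%:M + K.

Lemma poly_kernel_form (u : 'cV[R]_n) : dot u (K *m u) =
  \sum_(q < l.+1) zs q ^+ 2 * gq xs q (fun i => u i 0) + c * dot u u.
Proof.
rewrite dotE; under eq_bigr => i _.
  rewrite mxE mulr_sumr; under eq_bigr do rewrite KE mulrDl mulrDr.
  rewrite big_split /=; over.
rewrite big_split /=; congr (_ + _); last first.
  rewrite dotE mulr_sumr; apply: eq_bigr => i _; rewrite (bigD1 i) //= big1 => [|j ji].
    by rewrite eqxx mulr1 addr0 mulrCA.
  by rewrite eq_sym (negbTE ji) mulr0 mul0r mulr0.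
rewrite /gq; under [RHS]eq_bigr do rewrite mulr_sumr.
rewrite [RHS]exchange_big /=; apply: eq_bigr => i _.
under [RHS]eq_bigr do rewrite mulr_sumr.
rewrite [RHS]exchange_big /=; apply: eq_bigr => j _.
by rewrite mulr_suml mulr_sumr; apply: eq_bigr => q _; ring.
Qed.

Lemma low_form_ge0 (v : 'I_n -> R) : 0 <= \sum_(q < l.+1) zs q ^+ 2 * gq xs q v.
Proof. by apply: sumr_ge0 => q _; rewrite mulr_ge0 ?sqr_ge0. Qed.

Lemma Kl_form (u : 'cV[R]_n) : dot u (Kl *m u) =
  lambda * dot u u + dot u (K *m u).
Proof. by rewrite /Kl mulmxDl dotDr mul_scalar_mx dotZr. Qed.

Lemma Kl_form_ge (u : 'cV[R]_n) : c * dot u u <= dot u (Kl *m u).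
Proof.
rewrite Kl_form poly_kernel_form; have := low_form_ge0 (fun i => u i 0).
by have := mulr_ge0 lambda0 (dot_ge0 u); lra.
Qed.

Lemma Kl_unit : Kl \in unitmx.
Proof.
apply: unitmx_inj => u Ku; apply: dot_eq0; apply/eqP; rewrite eq_le dot_ge0 andbT.
have := Kl_form_ge u; rewrite Ku; have -> : dot u 0 = 0 :> R.
  by rewrite dotE big1 // => i _; rewrite mxE mulr0.
by rewrite pmulr_rle0.
Qed.

Lemma Kl_sym : Kl^T = Kl.
Proof.
apply/matrixP => i j; rewrite !mxE !KE eq_sym; congr (_ + (_ + _)).
  by apply: eq_bigr => q _; rewrite dotC.
Qed.

Definition vl := invmx Kl *m k.
Definition zl := invmx Kl *m vl.

Lemma Kl_vl : Kl *m vl = k.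
Proof. by rewrite /vl mulKVmx // Kl_unit. Qed.

Lemma Kl_zl : Kl *m zl = vl.
Proof. by rewrite /zl mulKVmx // Kl_unit. Qed.

Lemma variance_vl : (k^T *m (invmx Kl *m invmx Kl) *m k) 0 0 = dot vl vl.
Proof.
have inv_sym : (invmx Kl)^T = invmx Kl by rewrite trmx_inv Kl_sym.
by rewrite /dot /vl trmx_mul inv_sym !mulmxA.
Qed.

(** The Gram forms of the bordered sample at [vl], weighted by [zs^2], are nonnegative and sum to
    [F0 - c - 2 vl.k + vl.(K vl) - c |vl|^2]. Since [vl.k = lambda |vl|^2 + vl.(K vl)], this leaves
    [c |vl|^2 <= F0], uniformly in [n] and [lambda]. *)
Lemma vl_bound : dot vl vl <= F0 / c.
Proof.
have kv : dot vl k = lambda * dot vl vl + dot vl (K *m vl) by rewrite -Kl_form Kl_vl.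
have ge0 : 0 <= \sum_(q < l.+1) zs q ^+ 2 * gq (ext x xs) q (ext (-1) (fun i => vl i 0)).
  by apply: sumr_ge0 => q _; rewrite mulr_ge0 ?sqr_ge0.
have E : \sum_(q < l.+1) zs q ^+ 2 * gq (ext x xs) q (ext (-1) (fun i => vl i 0)) =
    F0 - c - 2 * dot vl k + (dot vl (K *m vl) - c * dot vl vl).
  under eq_bigr do rewrite gq_ext mulrDr mulrBr mulr1.
  rewrite big_split sumrB /=; rewrite poly_kernel_form addrK; congr (_ - _ + _).
    by rewrite cE; ring.
  rewrite dotE mulr_sumr; under eq_bigr do rewrite mulrCA mulr_sumr.
  rewrite -[LHS]mulr_sumr -[RHS]mulr_sumr exchange_big /=; congr (_ * _).
  apply: eq_bigr => i _; rewrite kE mulr_sumr; apply: eq_bigr => q _; ring.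
rewrite ler_pdivlMr // mulrC.
have := low_form_ge0 (fun i => vl i 0).
have := poly_kernel_form vl; have := mulr_ge0 lambda0 (dot_ge0 vl).
have := mulr_ge0 (ltW c0) (dot_ge0 vl).
move: c0 ge0 kv; rewrite E.
set V := dot vl vl; set B := dot vl (K *m vl); set D := dot vl k; set S := \sum_(q < _) _.
by move=> c0' g1 g2 g3 g4 g5 g6; move: c0' g1 g2 g3 g4 g5 g6; lra.
Qed.

(** [Kl] dominates [c] times the identity and maps [zl] to [vl]. *)
Lemma zl_bound : dot zl zl <= dot vl vl / c ^+ 2.
Proof.
have h := Kl_form_ge zl; rewrite Kl_zl in h; have CS := dot_CS zl vl.
have z0 := dot_ge0 zl; have v0 := dot_ge0 vl.
have cz : 0 <= c * dot zl zl by rewrite mulr_ge0 // ltW.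
have h2 : (c * dot zl zl) ^+ 2 <= dot zl zl * dot vl vl.
  by apply: le_trans CS; rewrite lerXn2r ?nnegrE //; exact: le_trans h.
rewrite ler_pdivlMr ?exprn_gt0 //; have [z00|zn0] := eqVneq (dot zl zl) 0.
  by rewrite z00 mul0r.
have zp : 0 < dot zl zl by rewrite lt_neqAle eq_sym zn0.
by rewrite -(ler_pM2l zp); apply: le_trans h2; rewrite exprMn; lra.
Qed.

Lemma zl_k : dot zl k = dot vl vl.
Proof. by rewrite -Kl_vl dot_mulmx Kl_sym Kl_zl. Qed.

(** No bound on [vN] is known, so [|vN|^2] must appear with coefficient exactly 1, as it does in the
    loss; every error is expressed through [vl], [zl] and [D] instead. *)
Lemma perturbation (A : 'M[R]_n) (vN kN : 'cV[R]_n) (t : R) : 0 < t ->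
  A^T = A -> A *m vN = kN ->
  forall D, D = dot zl (kN - k) ^+ 2 + dot ((Kl - A) *m zl) ((Kl - A) *m zl) ->
  dot vl vl <= dot vN vN + t * dot vl vl + t + t^-1 * D.
Proof.
move=> t0 As AN D; set dl := (Kl - A) *m zl; set b := dot zl (kN - k) => DE0.
have dE : dl = vl - A *m zl by rewrite /dl mulmxBl Kl_zl.
have e1 : dot vl vl + b = dot (vl - dl) vN.
  rewrite dE opprB addrCA subrr addr0 -[in RHS]As -dot_mulmx AN /b dotDr dotNr zl_k.
  by rewrite addrC subrK.
have y1 : 2 * dot vl vN <= dot vl vl + dot vN vN.
  by have := dot_young vl vN (ltr01 : 0 < 1 :> R); rewrite invr1 !mul1r.
have y2 : 2 * dot vN (- dl) <= t * dot vN vN + t^-1 * dot dl dl.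
  have E : dot (- dl) (- dl) = dot dl dl by rewrite dotNl dotNr opprK.
  by have := dot_young vN (- dl) t0; rewrite E.
have y3 : - (2 * b) <= t + t^-1 * b ^+ 2.
  have E : t * (t + t^-1 * b ^+ 2) = t ^+ 2 + b ^+ 2 by field; rewrite lt0r_neq0.
  by rewrite -(ler_pM2l t0) E; have := sqr_ge0 (t + b); rewrite sqrrD; lra.
rewrite dotDl -[dot (- dl) vN]dotC in e1.
have DE : t^-1 * D = t^-1 * b ^+ 2 + t^-1 * dot dl dl by rewrite DE0 mulrDr.
have v0 := dot_ge0 vl; have D0 : 0 <= t^-1 * D.
  by rewrite mulr_ge0 ?invr_ge0 ?(ltW t0) // DE0 addr_ge0 ?sqr_ge0 ?dot_ge0.
have main : dot vl vl <= (1 + t) * dot vN vN + t + t^-1 * D by rewrite DE; lra.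
(* Young's inequality produced [(1 + t) |vN|^2]; multiplying the goal by [1 + t] transfers the
   excess to [t |vl|^2], which [vl_bound] controls. *)
have t1 : 0 < 1 + t by lra.
rewrite -(ler_pM2l t1) [leRHS](_ : _ = (1 + t) * dot vN vN + t + t^-1 * D +
  (t * (t^-1 * D) + t ^+ 2 + t * dot vl vl + t ^+ 2 * dot vl vl)); last by ring.
rewrite mulrDl mul1r; have := mulr_ge0 (ltW t0) D0; have := sqr_ge0 t.
have := mulr_ge0 (sqr_ge0 t) v0; lra.
Qed.

Variable kap : R -> R.
Hypotheses (kap1 : kap 1 = F0) (kapE : forall r, `|r| <= (Num.sqrt 2)^-1 ->
  `|kap r - \sum_(q < l.+1) zs q ^+ 2 * r ^+ q| <= Num.sqrt 2 * `|r| ^+ l.+1 * F0).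

Let kapsq r : `|r| <= (Num.sqrt 2)^-1 ->
  (\sum_(q < l.+1) zs q ^+ 2 * r ^+ q - kap r) ^+ 2 <= 2 * F0 ^+ 2 * r ^+ (2 * l.+1).
Proof.
move=> r1; rewrite -(real_normK (num_real _)) distrC.
apply: (@le_trans _ _ ((Num.sqrt 2 * `|r| ^+ l.+1 * F0) ^+ 2)).
  by rewrite lerXn2r ?nnegrE ?kapE //; exact: le_trans (kapE r1).
rewrite !exprMn sqr_sqrtr // -exprM mulnC exprM (real_normK (num_real _)) -exprM.
by rewrite le_eqVlt; apply/orP; left; apply/eqP; ring.
Qed.

(* [kN] and [A] are the random kernels; their means are given by [kap]. *)
Lemma perturbation_split (A : 'M[R]_n) (kN : 'cV[R]_n) :
  forall rnd, rnd = (\sum_j zl j 0 * (kN j 0 - kap (dot x (xs j)))) ^+ 2 +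
    \sum_i (\sum_j zl j 0 * (A i j - lambda * (i == j)%:R - kap (dot (xs i) (xs j)))) ^+ 2 ->
  dot zl (kN - k) ^+ 2 + dot ((Kl - A) *m zl) ((Kl - A) *m zl) <=
  2 * rnd + 4 * F0 ^+ 2 * dot zl zl * (off l.+1 + cross l.+1).
Proof.
move=> rnd rndE; pose Z := dot zl zl; have ZE : Z = \sum_j zl j 0 ^+ 2.
  by rewrite /Z dotE; apply: eq_bigr => j _; rewrite expr2.
have Z0 : 0 <= Z := dot_ge0 zl.
have two (a b : R) : (a + b) ^+ 2 <= 2 * a ^+ 2 + 2 * b ^+ 2.
  by have := sqr_ge0 (a - b); rewrite sqrrB sqrrD; lra.
have two' (a b : R) : (a - b) ^+ 2 <= 2 * a ^+ 2 + 2 * b ^+ 2.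
  by have := sqr_ge0 (a + b); rewrite sqrrB sqrrD; lra.
have p1 : dot zl (kN - k) ^+ 2 <=
    2 * (\sum_j zl j 0 * (kN j 0 - kap (dot x (xs j)))) ^+ 2 +
    2 * (Z * (2 * F0 ^+ 2 * cross l.+1)).
  have -> : dot zl (kN - k) = \sum_j zl j 0 * (kN j 0 - kap (dot x (xs j))) -
      \sum_j zl j 0 * (k j 0 - kap (dot x (xs j))).
    by rewrite dotE -sumrB; apply: eq_bigr => j _; rewrite !mxE; ring.
  apply: (le_trans (two' _ _)); rewrite lerD2l ler_wpM2l //.
  apply: (le_trans (Cauchy_Schwarz_sum _ _ _ _)); rewrite -ZE ler_wpM2l //.
  rewrite /cross mulr_sumr; apply: ler_sum => j _; rewrite kE; exact: kapsq.
have p2 i : ((Kl - A) *m zl) i 0 ^+ 2 <=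
    2 * (\sum_j zl j 0 * (A i j - lambda * (i == j)%:R - kap (dot (xs i) (xs j)))) ^+ 2 +
    2 * (Z * (2 * F0 ^+ 2 * \sum_(j | j != i) dot (xs i) (xs j) ^+ (2 * l.+1))).
  have -> : ((Kl - A) *m zl) i 0 = \sum_j zl j 0 * (K i j - kap (dot (xs i) (xs j))) -
     \sum_j zl j 0 * (A i j - lambda * (i == j)%:R - kap (dot (xs i) (xs j))).
    rewrite mxE -sumrB; apply: eq_bigr => j _; rewrite !mxE -mulr_natr; ring.
  apply: (le_trans (two' _ _)); rewrite [leLHS]addrC lerD2l ler_wpM2l //.
  apply: (le_trans (Cauchy_Schwarz_sum _ _ _ _)); rewrite -ZE ler_wpM2l //.
  (* The diagonal contributes nothing, because [K i i = F0 = kap 1]; only the entries summed in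
     [off] remain. *)
  rewrite (bigD1 i) //= KE xs1 kap1 eqxx mulr1.
  have -> : \sum_(q < l.+1) zs q ^+ 2 * 1 ^+ q + c - F0 = 0.
    by under eq_bigr do rewrite expr1n mulr1; rewrite cE; ring.
  rewrite expr0n add0r mulr_sumr; apply: ler_sum => j ji.
  rewrite KE eq_sym (negbTE ji) mulr0 addr0; apply: kapsq; apply: xsr.
  by rewrite eq_sym.
have p3 : dot ((Kl - A) *m zl) ((Kl - A) *m zl) <=
    2 * \sum_i (\sum_j zl j 0 * (A i j - lambda * (i == j)%:R - kap (dot (xs i) (xs j)))) ^+ 2
    + 2 * (Z * (2 * F0 ^+ 2 * off l.+1)).
  rewrite dotE /off !mulr_sumr -big_split /=; apply: ler_sum => i _.
  by rewrite -expr2; exact: p2.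
apply: (le_trans (lerD p1 p3)); rewrite rndE -/Z.
by rewrite le_eqVlt; apply/orP; left; apply/eqP; ring.
Qed.

End PolyKernel.
End GramForms.

(** * Measurability of the loss *)

Section KernelMeasurability.
Context d0 (S : measurableType d0) (R : realType).
Variables (sigma tau : R -> R) (ms : measurable_fun setT sigma) (mt : measurable_fun setT tau).
Variables (N d n l : nat) (X : 'M[R]_(d, n)) (lambda : R).

Lemma dot_meas m (u v : S -> 'cV[R]_m) : mmx u -> mmx v ->
  measurable_fun setT (fun s => dot (u s) (v s)).
Proof.
move=> mu mv; under eq_fun do rewrite dotE.
by apply: measurable_sum => i; apply: measurable_funM; [exact: mu|exact: mv].
Qed.

Lemma rf_kernel_meas (w : S -> 'M[R]_(N, d)) (u v : S -> 'cV[R]_d) : mmx w -> mmx u -> mmx v ->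
  measurable_fun setT (fun s => rf_kernel sigma (w s) (u s) (v s)).
Proof.
move=> mw mu mv; apply: measurable_funM; first exact: measurable_cst.
by apply: dot_meas; apply: mmx_map => //; exact: mmx_mul.
Qed.

Lemma rf_kernel_mx_meas (w : S -> 'M[R]_(N, d)) : mmx w ->
  mmx (fun s => rf_kernel_mx sigma (w s) X).
Proof.
move=> mw i j; under eq_fun do rewrite mxE.
by apply: rf_kernel_meas => //; exact: mmx_cst.
Qed.

Lemma rf_kernel_row_meas (w : S -> 'M[R]_(N, d)) (u : S -> 'cV[R]_d) : mmx w -> mmx u ->
  mmx (fun s => rf_kernel_row sigma (w s) (u s) X).
Proof.
move=> mw mu i j; under eq_fun do rewrite mxE.
by apply: rf_kernel_meas => //; exact: mmx_cst.
Qed.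

Lemma rf_gram_meas (w : S -> 'M[R]_(N, d)) : mmx w ->
  mmx (fun s => rf_kernel_mx sigma (w s) X + lambda%:M).
Proof. by move=> mw; apply: mmxD; [exact: rf_kernel_mx_meas | exact: mmx_cst]. Qed.

Lemma rf_predictor_meas (w : S -> 'M[R]_(N, d)) (y : S -> 'cV[R]_n) (u : S -> 'cV[R]_d) :
  mmx w -> mmx y -> mmx u ->
  measurable_fun setT (fun s => rf_predictor sigma lambda (w s) X (y s) (u s)).
Proof.
move=> mw my mu; apply: mmx_mul => //; apply: mmx_mul; first exact: rf_kernel_row_meas.
by apply: mmx_inv; exact: rf_gram_meas.
Qed.

Lemma poly_kernel_col_meas (u : S -> 'cV[R]_d) : mmx u ->
  mmx (fun s => poly_kernel_col sigma l X (u s)).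
Proof.
move=> mu i j; under eq_fun do rewrite mxE; apply: measurable_fun_ifT.
(* Equality of vectors is tested by the squared norm of their difference, a measurable real
   function. *)
- have -> : (fun s => col i X == u s) = (fun s => dot (col i X + (-1) *: u s) (col i X + (-1) *: u s) == 0).
    apply/funext => s; rewrite scaleN1r -subr_eq0; apply/eqP/eqP => [->|/dot_eq0 //].
    by rewrite dotE big1 // => r _; rewrite mxE mul0r.
  apply: measurable_fun_eqr; last exact: measurable_cst.
  have mv : mmx (fun s => col i X + (-1) *: u s).
    apply: mmxD; first exact: mmx_cst.
    move=> r c; under eq_fun do rewrite mxE.
    by apply: measurable_funM; [exact: measurable_cst | exact: mu].
  exact: dot_meas.
- exact: measurable_cst.
- apply: measurable_sum => q; apply: measurable_funM; first exact: measurable_cst.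
  by apply: measurable_funX; apply: dot_meas => //; exact: mmx_cst.
Qed.

Lemma variance_term_meas (u : S -> 'cV[R]_d) : mmx u ->
  measurable_fun setT (fun s => variance_term sigma l lambda X (u s)).
Proof.
move=> mu; have mk := poly_kernel_col_meas mu.
by apply: mmx_mul => //; apply: mmx_mul; [exact: mmx_tr | exact: mmx_cst].
Qed.

Definition sq_loss (w : 'M[R]_(N, d)) (b : 'cV[R]_d) (e : 'cV[R]_n) (u : 'cV[R]_d) : R :=
  `|rf_predictor sigma lambda w X (map_mx tau (X^T *m b) + e) u - tau (dot b u)| ^+ 2.

Lemma sq_loss_meas (w : S -> 'M[R]_(N, d)) (b : S -> 'cV[R]_d) (e : S -> 'cV[R]_n)
    (u : S -> 'cV[R]_d) : mmx w -> mmx b -> mmx e -> mmx u ->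
  measurable_fun setT (fun s => sq_loss (w s) (b s) (e s) (u s)).
Proof.
move=> mw mb me mu; apply: measurable_funX; apply: measurableT_comp => //.
apply: measurable_funB; last first.
  by apply: (measurableT_comp mt); exact: dot_meas.
apply: rf_predictor_meas => //; apply: mmxD => //; apply: mmx_map => //.
by apply: mmx_mul => //; exact: mmx_cst.
Qed.

(** The quantity [rnd] of [perturbation_split] as a function of the weights and the test point. The
    mean [kap] is a parameter so that [overlap], whose measurability is established, can be
    inserted. *)
Definition fluctuation (kap : R -> R) (w : 'M[R]_(N, d)) (u : 'cV[R]_d) : R :=
  let z := zl lambda (poly_kernel_mx sigma l X) (poly_kernel_col sigma l X u) in
  (\sum_j z j 0 * (rf_kernel sigma w u (col j X) - kap (dot u (col j X)))) ^+ 2 +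
  \sum_i (\sum_j z j 0 * (rf_kernel sigma w (col i X) (col j X) - kap (dot (col i X) (col j X)))) ^+ 2.

Lemma fluctuation_ge0 kap w u : 0 <= fluctuation kap w u.
Proof. by rewrite addr_ge0 ?sqr_ge0 // sumr_ge0 // => i _; exact: sqr_ge0. Qed.

Lemma fluctuation_meas kap (w : S -> 'M[R]_(N, d)) (u : S -> 'cV[R]_d) : measurable_fun setT kap -> mmx w -> mmx u ->
  measurable_fun setT (fun s => fluctuation kap (w s) (u s)).
Proof.
move=> mk mw mu.
have mz : mmx (fun s => zl lambda (poly_kernel_mx sigma l X) (poly_kernel_col sigma l X (u s))).
  apply: mmx_mul; first exact: mmx_cst.
  by apply: mmx_mul; [exact: mmx_cst | exact: poly_kernel_col_meas].
apply: measurable_funD.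
  apply: measurable_funX; apply: measurable_sum => j; apply: measurable_funM; first exact: mz.
  apply: measurable_funB; first by apply: rf_kernel_meas => //; exact: mmx_cst.
  by apply: (measurableT_comp mk); apply: dot_meas => //; exact: mmx_cst.
apply: measurable_sum => i; apply: measurable_funX; apply: measurable_sum => j.
apply: measurable_funM; first exact: mz.
apply: measurable_funB; last exact: measurable_cst.
by apply: rf_kernel_meas => //; exact: mmx_cst.
Qed.

End KernelMeasurability.

(** * Bias and noise *)

Section Norms.
Context d (T : measurableType d) (R : realType) (mu : probability T R).

Lemma Lnorm2E (f : T -> R) : L2 mu f ->
  ('N[mu]_(2%:E)[EFin \o f])%E = (Num.sqrt (Ex mu (fun x => f x ^+ 2)))%:E.
Proof.
move=> f2; rewrite unlock /=.
have -> : (\int[mu]_x (`|(f x)%:E| `^ 2))%E = (Ex mu (fun x => f x ^+ 2))%:E.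
  rewrite -(ExE (L2_sq f2)); apply: eq_integral => x _.
  by rewrite abse_EFin poweR_EFin powR_mulrn // (real_normK (num_real _)).
by rewrite poweR_EFin powR12_sqrt //; apply: Ex_ge0 => x; exact: sqr_ge0.
Qed.

Lemma Lfun2_L2 (f : T -> R) : f \in Lfun mu 2%:E -> L2 mu f.
Proof.
move=> fL; split; last exact: Lfun2_integrable_sqr.
by move: fL; rewrite inE => /andP[]; rewrite inE.
Qed.

Lemma Lfun4_L2 (f : T -> R) : f \in Lfun mu 4%:E -> L2 mu f.
Proof.
move=> fL; have mf : measurable_fun setT f by move: fL; rewrite inE => /andP[]; rewrite inE.
have f4 : intg mu (fun x => `|f x| `^ 4) by apply: Lfun_integrable => //; rewrite ler1n.
split=> //; apply: (le_intg (g := fun x => 1 + `|f x| `^ 4)).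
- exact: measurable_funX.
- move=> x; rewrite powR_mulrn // ger0_norm ?sqr_ge0 // (exprM _ 2 2) (real_normK (num_real _)).
  set a := f x ^+ 2; have := sqr_ge0 (a - 2^-1); rewrite sqrrB; lra.
- exact: intgD (intg_cst _ _) f4.
Qed.

End Norms.

Section Tail.
Context {R : realType}.
Notation G := (@std_gauss R).
Variables (l : nat) (tau g : R -> R).
Hypotheses (t2 : L2 G tau) (tailP : is_hermite_tail l tau g).

Let g2 : L2 G g := Lfun2_L2 (proj1 tailP).
Let S m (x : R) := \sum_(l.+1 <= k < m) zeta k tau * hermite k x.

Let S2 m : L2 G (S m).
Proof. by apply: L2_sum => k _; apply: L2Z; rewrite hermite_hn; exact: L2_hn. Qed.

Let ES m : Ex G (fun x => S m x ^+ 2) = \sum_(l.+1 <= k < m) zeta k tau ^+ 2.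
Proof.
have hh k j : intg G (fun x => hn k x * hn j x) by apply: L2_mul; exact: L2_hn.
pose s := index_iota l.+1 m; have us : uniq s by exact: iota_uniq.
transitivity (Ex G (fun x => \sum_(k <- s) \sum_(j <- s) (zeta k tau * zeta j tau) * (hn k x * hn j x))).
  apply: eq_Ex => x; rewrite expr2 /S mulr_suml; apply: eq_bigr => k _.
  by rewrite mulr_sumr; apply: eq_bigr => j _; rewrite !hermite_hn; ring.
rewrite Ex_sum => [|k _]; last by apply: intg_sum => j _; exact: (intgZ _ (hh k j)).
rewrite big_seq [RHS]big_seq; apply: eq_bigr => k ks.
rewrite Ex_sum => [|j _]; last exact: (intgZ _ (hh k j)).
rewrite (bigD1_seq k) //= big1 ?addr0 => [|j jk].
  by rewrite (ExZ _ (hh k k)) hn_orth eqxx mulr1 -expr2.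
by rewrite (ExZ _ (hh k j)) hn_orth eq_sym (negbTE jk) mulr0.
Qed.

(** The partial sums tend to [g] in L^2, so their squared norms tend to that of [g]; by
    orthonormality these are the partial sums of the squared coefficients. *)
Lemma tail_cvg : (fun m => \sum_(l.+1 <= k < m) zeta k tau ^+ 2) @ \oo -->
  Ex G (fun x => g x ^+ 2).
Proof.
pose e m := Num.sqrt (Ex G (fun x => (g x - S m x) ^+ 2)).
have D2 m : L2 G (fun x => g x - S m x) by exact: L2B.
have e0 : e @ \oo --> (0 : R).
  have := proj2 tailP.
  have -> : (fun m => 'N[G]_(2%:E)[EFin \o (fun x => g x - \sum_(l.+1 <= k < m) zeta k tau * hermite k x)%R])%E =
      (fun m => (e m)%:E).
    by apply/funext => m; exact: (Lnorm2E (D2 m)).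
  by move/fine_cvgP => [_].
set T := Ex G _; have T0 : 0 <= T by apply: Ex_ge0 => x; exact: sqr_ge0.
have bound m : `|T - \sum_(l.+1 <= k < m) zeta k tau ^+ 2| <= 2 * Num.sqrt T * e m + e m ^+ 2.
  rewrite -ES; set D := fun x => g x - S m x.
  have Dg := L2_mul (D2 m) g2; have DD := L2_sq (D2 m).
  have -> : T - Ex G (fun x => S m x ^+ 2) = 2 * Ex G (fun x => D x * g x) - Ex G (fun x => D x ^+ 2).
    rewrite /T -(ExB (L2_sq g2) (L2_sq (S2 m))) -(ExZ 2 Dg) -(ExB (intgZ 2 Dg) DD).
    by apply: eq_Ex => x; rewrite /D; ring.
  apply: (le_trans (ler_normB _ _)); apply: lerD.
    rewrite normrM ger0_norm // -mulrA ler_wpM2l // mulrC.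
    exact: (Cauchy_Schwarz_norm (D2 m) g2).
  rewrite ger0_norm; last by apply: Ex_ge0 => x; exact: sqr_ge0.
  by rewrite /e sqr_sqrtr //; apply: Ex_ge0 => x; exact: sqr_ge0.
apply/cvgrPdist_le => eps eps0.
have lim : (fun m => 2 * Num.sqrt T * e m + e m ^+ 2) @ \oo --> (0 : R).
  have -> : (fun m => 2 * Num.sqrt T * e m + e m ^+ 2) = (fun m => 2 * Num.sqrt T * e m + e m * e m).
    by apply/funext => m; rewrite expr2.
  rewrite -[X in _ --> X](_ : 2 * Num.sqrt T * 0 + 0 * 0 = 0); last by rewrite !mulr0 addr0.
  by apply: cvgD; apply: cvgM => //; exact: cvg_cst.
have /cvgr0_norm_le /(_ eps eps0) [M _ HM] := lim.
exists M => // m mM; apply: (le_trans (bound m)); apply: (le_trans (ler_norm _)).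
exact: HM.
Qed.

Lemma tail_limit (b s : R) :
  (forall m, (\sum_(l.+1 <= k < m) zeta k tau ^+ 2) * s <= b) ->
  Ex G (fun x => g x ^+ 2) * s <= b.
Proof.
move=> H; have c : (fun m => (\sum_(l.+1 <= k < m) zeta k tau ^+ 2) * s) @ \oo -->
  Ex G (fun x => g x ^+ 2) * s by apply: cvgMl; exact: tail_cvg.
rewrite -(cvg_lim (@Rhausdorff R) c); apply: limr_le; first by apply/cvg_ex; eexists; exact: c.
by near=> m; exact: H.
Unshelve. all: by end_near.
Qed.

End Tail.

Section Teacher.
Context d0 (T : measurableType d0) (R : realType) (P : probability T R).
Notation G := (@std_gauss R).
Variables (d : nat) (beta : T -> 'cV[R]_d).
Hypothesis iidb : iid P (centered_gauss 1) (entries beta).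

Definition col_seq : seq ('I_d * 'I_1) := [seq (j, ord0) | j <- enum 'I_d].
Definition col_coef (u : 'cV[R]_d) (ij : 'I_d * 'I_1) : R := u ij.1 0.

Lemma col_seq_uniq : uniq col_seq.
Proof. by rewrite map_inj_uniq ?enum_uniq // => i j []. Qed.

Lemma col_ip u v : ip col_seq (col_coef u) (col_coef v) = dot u v.
Proof. by rewrite /ip big_map big_enum dotE. Qed.

Lemma col_lin u x : lin_form (entries beta) col_seq (col_coef u) x = dot (beta x) u.
Proof.
by rewrite /lin_form big_map big_enum dotE; apply: eq_bigr => j _; rewrite mulrC.
Qed.

Lemma L2_teacher f u : dot u u = 1 -> L2 G f -> L2 P (fun x => f (dot (beta x) u)).
Proof.
move=> u1 f2; have u1' : ip col_seq (col_coef u) (col_coef u) = 1 by rewrite col_ip.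
have := L2_lin iidb col_seq_uniq u1' f2.
by under [X in L2 P X]eq_fun do rewrite col_lin.
Qed.

Lemma Ex_teacher f u : dot u u = 1 -> intg G f -> Ex P (fun x => f (dot (beta x) u)) = Ex G f.
Proof.
move=> u1 fi; have u1' : ip col_seq (col_coef u) (col_coef u) = 1 by rewrite col_ip.
have E := Ex_lin iidb col_seq_uniq u1' fi.
by rewrite -E; apply: eq_Ex => x; rewrite col_lin.
Qed.

Variables (m : nat) (ys : 'I_m -> 'cV[R]_d).
Hypotheses (ys1 : forall i, dot (ys i) (ys i) = 1)
  (ysr : forall i j, i != j -> `|dot (ys i) (ys j)| <= (Num.sqrt 2)^-1).

Let a1 j : ip col_seq (col_coef (ys j)) (col_coef (ys j)) = 1.
Proof. by rewrite col_ip. Qed.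

Let ar i j : i != j -> `|ip col_seq (col_coef (ys i)) (col_coef (ys j))| < 1.
Proof. by move=> ij; rewrite col_ip; apply: le_lt_trans (ysr ij) r_lt1. Qed.

Let gqE k v : gramq col_seq (fun j => col_coef (ys j)) k v = gq ys k v.
Proof. by apply: eq_bigr => i _; apply: eq_bigr => j _; rewrite col_ip. Qed.

Lemma gq_ge0 k v : 0 <= gq ys k v.
Proof. by rewrite -gqE; exact: (gramq_ge0 iidb col_seq_uniq a1 ar). Qed.

Lemma teacher_bessel f v q : L2 G f -> \sum_(k < q) zeta k f ^+ 2 * gq ys k v <=
  Ex P (fun x => (\sum_j v j * f (dot (beta x) (ys j))) ^+ 2).
Proof.
move=> f2; have := combo_bessel iidb col_seq_uniq a1 ar q v f2.
under eq_bigr do rewrite gqE.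
move=> H; apply: (le_trans H); rewrite le_eqVlt; apply/orP; left; apply/eqP.
by apply: eq_Ex => x; congr (_ ^+ 2); apply: eq_bigr => j _; rewrite col_lin.
Qed.

End Teacher.

Section Bias.
Context d0 (T : measurableType d0) (R : realType) (P : probability T R).
Notation G := (@std_gauss R).
Variables (d n : nat) (beta : T -> 'cV[R]_d).
Hypothesis iidb : iid P (centered_gauss 1) (entries beta).
Variables (xs : 'I_n -> 'cV[R]_d) (u : 'cV[R]_d).
Hypotheses (xs1 : forall i, dot (xs i) (xs i) = 1) (u1 : dot u u = 1)
  (xsr : forall i j, i != j -> `|dot (xs i) (xs j)| <= (Num.sqrt 2)^-1)
  (ur : forall i, `|dot u (xs i)| <= (Num.sqrt 2)^-1).
Variables (l : nat) (tau g : R -> R).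
Hypotheses (t2 : L2 G tau) (tailP : is_hermite_tail l tau g).

Definition bias (v : 'I_n -> R) (b : 'cV[R]_d) : R :=
  \sum_i v i * tau (dot b (xs i)) - tau (dot b u).

Lemma bias_ext v b : bias v b = \sum_i ext (-1) v i * tau (dot b (ext u xs i)).
Proof.
rewrite big_ord_recl !ext0 mulN1r addrC; congr (_ + _).
by apply: eq_bigr => i _; rewrite !extS.
Qed.

Lemma L2_bias v : L2 P (fun x => bias v (beta x)).
Proof.
apply: L2B; last exact: (L2_teacher iidb).
by apply: L2_sum => i _; apply: L2Z; exact: (L2_teacher iidb).
Qed.

Lemma bias_lower (eta : R) v : 0 <= eta -> eta < 1 -> off xs l.+1 <= eta ^+ 2 ->
  Ex G (fun x => g x ^+ 2) * (1 - cross xs u l.+1 / (1 - eta)) <=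
  Ex P (fun x => bias v (beta x) ^+ 2).
Proof.
(* Working with partial sums reduces the claim to a finite Bessel inequality, so the bias itself
   never has to be expanded as an infinite series. *)
move=> e0 e1 oe; apply: (tail_limit tailP) => m.
have y1 := ext1 xs1 u1; have yr := extr xsr ur.
have B := teacher_bessel iidb y1 yr (ext (-1) v) m t2.
under eq_Ex do rewrite bias_ext.
apply: le_trans B; have [lm|ml] := leqP l.+1 m; last first.
  rewrite big_geq ?(ltnW ml) // mul0r; apply: sumr_ge0 => k _.
  by rewrite mulr_ge0 ?sqr_ge0 ?(gq_ge0 iidb).
rewrite -(big_mkord xpredT (fun k => zeta k tau ^+ 2 * gq (ext u xs) k (ext (-1) v))).
rewrite [leRHS](big_cat_nat _ (n := l.+1)) //=; apply: ler_wpDl.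
  by apply: sumr_ge0 => k _; rewrite mulr_ge0 ?sqr_ge0 ?(gq_ge0 iidb).
rewrite mulr_suml [leLHS]big_nat [leRHS]big_nat; apply: ler_sum => k /andP[lk _].
rewrite ler_wpM2l ?sqr_ge0 //; apply: (gq_ext_lower u1); first by rewrite subr_gt0.
  exact: (cross_mono ur lk).
have h1 j : ip (col_seq d) (col_coef (xs j)) (col_coef (xs j)) = 1 by rewrite col_ip.
have hr i j : i != j -> `|ip (col_seq d) (col_coef (xs i)) (col_coef (xs j))| <= (Num.sqrt 2)^-1.
  by move=> ij; rewrite col_ip; exact: xsr.
have oE q : offdiag (col_seq d) (fun j => col_coef (xs j)) q = off xs q.
  by apply: eq_bigr => i _; apply: eq_bigr => j _; rewrite col_ip.
have gE : gramq (col_seq d) (fun j => col_coef (xs j)) k v = gq xs k v.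
  by apply: eq_bigr => i _; apply: eq_bigr => j _; rewrite col_ip.
rewrite -gE; apply: (gramq_lower h1) => //.
by apply: le_trans (offdiag_mono hr lk) _; rewrite oE.
Qed.

End Bias.

Section Noise.
Context d0 (T : measurableType d0) (R : realType) (P : probability T R).
Notation G := (@std_gauss R).
Variables (n : nat) (eps : T -> 'cV[R]_n) (s : R).
Hypotheses (s0 : 0 <= s) (iide : iid P (centered_gauss s) (entries eps)).

(** The representation as [s * z] covers [s = 0] as well, where the prescribed law is the Dirac mass
    at 0. *)
Lemma noise_law ij : same_law P G (fun x => entries eps ij x : measurableTypeR R)
  (fun z : measurableTypeR R => s * z : measurableTypeR R).
Proof.
move=> F mF F0; case: (iide) => mY law _.
pose Yi : T -> measurableTypeR R := entries eps ij.
have mYi : measurable_fun setT Yi by exact: mY.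
pose push := measure_function_pushforward__canonical__measure_function_Measure P mYi.
transitivity (\int[push]_y F y)%E.
  by rewrite [RHS](ge0_integral_pushforward mYi).
have [s00|sn0] := eqVneq s 0.
  pose dr := @dirac _ (measurableTypeR R) (0 : measurableTypeR R) R.
  transitivity (\int[dr]_y F y)%E.
    apply: eq_measure_integral => A mA _.
    by have := law ij A mA; rewrite /centered_gauss s00 eqxx; exact.
  transitivity (\int[G]_z (cst (F (0%R : measurableTypeR R))) z)%E.
    rewrite [LHS](integral_dirac _ _ mF) // diracT mul1e.
    transitivity (F (0%R : measurableTypeR R) * G setT)%E.
      by rewrite [X in (_ * X)%E](probability_setT G) mule1.
    by symmetry; exact: (integral_cst G measurableT).
  by apply: eq_integral => z _; rewrite s00 mul0r.
have sp : 0 < s by rewrite lt_neqAle eq_sym sn0.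
transitivity (\int[normal_prob 0 s]_y F y)%E.
  apply: eq_measure_integral => A mA _.
  by have := law ij A mA; rewrite /centered_gauss (negbTE sn0); exact.
rewrite -(normal_affine 0 sp mF F0).
by apply: eq_integral => z _; rewrite add0r.
Qed.

Lemma noise_mom ij : mom P (entries eps ij).
Proof.
have mY : measurable_fun setT (fun x => entries eps ij x : measurableTypeR R) := iid_meas iide ij.
exact: (mom_same_law mY (noise_law ij) (f := fun z => z) (proj1 mom_gauss) (momZ s mom_gauss)).
Qed.

Lemma noise_Ex ij : Ex P (entries eps ij) = 0.
Proof.
have mY : measurable_fun setT (fun x => entries eps ij x : measurableTypeR R) := iid_meas iide ij.
have gi : intg G (fun z : measurableTypeR R => z) := mom_intg mom_gauss.
have E := Ex_same_law mY (noise_law ij) (f := fun z => z) (proj1 mom_gauss) (intgZ s gi).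
rewrite [LHS]E (ExZ s gi) (_ : Ex G _ = 0) ?mulr0 //.
(* The Gaussian mean is read off from orthonormality, as [hn 1 z = z] and [hn 0 z = 1]. *)
transitivity (Ex G (fun z => hn 1 z * hn 0 z)); last by rewrite hn_orth.
apply: eq_Ex => z; rewrite /hn /= fact0 sqrtr1 invr1 !mul1r horner_one mulr1.
by rewrite derivC subr0 mulr1 hornerX.
Qed.

Lemma noise_sq ij : Ex P (fun x => entries eps ij x ^+ 2) = s ^+ 2.
Proof.
have mY : measurable_fun setT (fun x => entries eps ij x : measurableTypeR R) := iid_meas iide ij.
have m2 : measurable_fun setT (fun z : measurableTypeR R => z ^+ 2 : R).
  by apply: measurable_funX; exact: measurable_id.
have gi : intg G (fun z : measurableTypeR R => z ^+ 2) := momX_intg 2 mom_gauss.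
have gi' : intg G (fun z : measurableTypeR R => (s * z) ^+ 2).
  by apply: eq_intg (intgZ (s ^+ 2) gi) => z; rewrite exprMn.
have E := Ex_same_law mY (noise_law ij) (f := fun z => z ^+ 2) m2 gi'.
rewrite [LHS]E; transitivity (Ex G (fun z => s ^+ 2 * z ^+ 2)).
  by apply: eq_Ex => z; rewrite exprMn.
rewrite (ExZ _ gi) (_ : Ex G _ = 1) ?mulr1 //.
transitivity (Ex G (fun z => hn 1 z * hn 1 z)); last by rewrite hn_orth.
have f1 : 1`! = 1%N by [].
apply: eq_Ex => z; rewrite /hn f1 sqrtr1 invr1 !mul1r /=.
by rewrite derivC subr0 mulr1 hornerX expr2.
Qed.

Lemma noise_combo (v : 'cV[R]_n) :
  mom P (fun x => dot v (eps x)) /\ Ex P (fun x => dot v (eps x)) = 0 /\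
  Ex P (fun x => dot v (eps x) ^+ 2) = s ^+ 2 * dot v v.
Proof.
have vE x : dot v (eps x) = \sum_i v i 0 * entries eps (i, ord0) x by rewrite dotE.
have ei i : intg P (entries eps i) := mom_intg (noise_mom i).
split; last split.
- under [X in mom P X]eq_fun do rewrite vE.
  by apply: mom_sum => i _; apply: momZ; exact: noise_mom.
- rewrite (eq_Ex P vE) Ex_sum => [|i _]; last exact: (intgZ _ (ei _)).
  by rewrite big1 // => i _; rewrite (ExZ _ (ei _)) noise_Ex mulr0.
have ii i j : intg P (fun x => entries eps i x * entries eps j x).
  exact: mom_intg (momM (noise_mom i) (noise_mom j)).
transitivity (Ex P (fun x => \sum_i \sum_j (v i 0 * v j 0) *
    (entries eps (i, ord0) x * entries eps (j, ord0) x))).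
  apply: eq_Ex => x; rewrite vE expr2 mulr_suml; apply: eq_bigr => i _.
  by rewrite mulr_sumr; apply: eq_bigr => j _; ring.
rewrite Ex_sum => [|i _]; last by apply: intg_sum => j _; exact: (intgZ _ (ii _ _)).
rewrite dotE mulr_sumr; apply: eq_bigr => i _.
rewrite Ex_sum => [|j _]; last exact: (intgZ _ (ii _ _)).
rewrite (bigD1 i) //= big1 ?addr0 => [|j ji].
  rewrite (ExZ _ (ii _ _)) mulrC; congr (_ * _); rewrite -(noise_sq (i, ord0)).
  by apply: eq_Ex => x; rewrite expr2.
rewrite (ExZ _ (ii _ _)).
have dij : [disjoint [set (i, ord0)]%SET & [set (j, ord0 : 'I_1)]%SET]%B.
  by rewrite finset.disjoints1 !inE xpair_eqE eq_sym (negbTE ji).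
have mi (k : 'I_n * 'I_1) : measurable_fun [set: g_sigma_algebraType (coords (entries eps) [set k]%SET)] (entries eps k).
  by apply: coords_meas; rewrite inE.
have [_ ->] := coords_ExM iide dij (mi _) (mi _) (ei _) (ei _).
by rewrite !noise_Ex mulr0 mulr0.
Qed.

End Noise.

(** * The lower bound at a fixed size *)

Section Blocks.
Context d0 (Om : measurableType d0) (R : realType) (P : probability Om R).
Variables (I : finType) (F : I -> set (set Om)).
Hypotheses (FT : forall i, F i setT) (FI : forall i, setI_closed (F i)).
Hypothesis Fm : forall i, F i `<=` measurable.
Hypothesis indF : independent_algebras P F.
Implicit Types J : {set I}.
Notation alg J := (g_sigma_algebraType (union_of F J)).

Lemma block_meas J (K : Type) (Y : K -> Om -> R) i k : i \in J ->
  F i = sigma_algebra_of Y -> measurable_fun [set: alg J] (Y k).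
Proof.
move=> iJ FE _ B mB; apply: sub_sigma_algebra; exists i => //; rewrite FE.
by apply: sub_sigma_algebra; exists k => //; exists B.
Qed.

Lemma block_sub J : union_of F J `<=` measurable.
Proof. exact: union_of_measurable. Qed.

Lemma block_tonelli J1 J2 (f : alg J1 * alg J2 -> \bar R) : [disjoint J1 & J2]%B ->
  measurable_fun setT f -> (forall z, (0 <= f z)%E) ->
  (\int[P]_x f (x, x) = \int[P]_x \int[P]_y f (x, y))%E.
Proof.
move=> dJ mf f0; apply: (indep_tonelli (block_sub (J := J1)) (block_sub (J := J2))) => //.
by move=> A B; exact: (indep_union FT FI Fm indF dJ).
Qed.

Lemma block_integral J1 J2 (f : alg J1 * alg J2 -> \bar R) :
  measurable_fun setT f -> (forall z, (0 <= f z)%E) ->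
  measurable_fun [set: Om] (fun x => \int[P]_y f (x, y))%E.
Proof.
move=> mf f0; have m := indep_measurable_integral P (block_sub (J := J2)) mf f0.
exact: (g_sigma_measurable_fun (block_sub (J := J1)) m).
Qed.

Lemma block_ExM J1 J2 (f g : Om -> R) : [disjoint J1 & J2]%B ->
  measurable_fun [set: alg J1] f -> measurable_fun [set: alg J2] g ->
  intg P f -> intg P g -> intg P (fun x => f x * g x) /\
  Ex P (fun x => f x * g x) = Ex P f * Ex P g.
Proof.
move=> dJ mf mg; apply: (indep_ExM (block_sub (J := J1)) (block_sub (J := J2))) => //.
by move=> A B; exact: (indep_union FT FI Fm indF dJ).
Qed.

End Blocks.

Lemma integral_cstP d0 (Om : measurableType d0) (R : realType) (P : probability Om R) (r : R) :
  (\int[P]_o r%:E = r%:E)%E.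
Proof.
transitivity (r%:E * P setT)%E; first exact: (integral_cst P measurableT).
by rewrite [X in (_ * X)%E](probability_setT P) mule1.
Qed.

(** * The mean kernel as a function of the inner product *)

Section Overlap.
Context {R : realType}.
Notation G := (@std_gauss R).
Notation G2 := (prodP G G).
Variables (sigma : R -> R) (C : R) (l : nat).
Hypotheses (ms : measurable_fun setT sigma) (C0 : 0 <= C)
  (sg : forall t, `|sigma t| <= C * (1 + `|t|) `^ C).
Let s2 : L2 G sigma := mom_L2 (mom_sigma ms C0 sg).

Lemma gauss_norm2 : gauss_norm 2 sigma ^+ 2 = Ex G (fun x => sigma x ^+ 2).
Proof.
rewrite /gauss_norm (Lnorm2E s2) /= sqr_sqrtr //.
by apply: Ex_ge0 => x; exact: sqr_ge0.
Qed.

Lemma kap_one : kap sigma 1 = gauss_norm 2 sigma ^+ 2.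
Proof.
rewrite gauss_norm2 /kap.
have m2 : measurable_fun setT (fun y : measurableTypeR R => sigma y ^+ 2) by exact: measurable_funX.
have E := Ex_same_law (measurable_fst : measurable_fun setT (fst : measurableTypeR R * measurableTypeR R -> _))
  (same_law_fst G G) m2 (L2_sq s2).
rewrite -[RHS]E; apply: eq_Ex => z.
by rewrite expr1n subrr sqrtr0 mul0r addr0 mul1r expr2.
Qed.

Lemma kap_approx r : `|r| <= (Num.sqrt 2)^-1 ->
  `|kap sigma r - \sum_(q < l.+1) zeta q sigma ^+ 2 * r ^+ q| <=
  Num.sqrt 2 * `|r| ^+ l.+1 * gauss_norm 2 sigma ^+ 2.
Proof.
move=> rr; have r1 := le_lt_trans rr r_lt1.
have := mehler_bound r1 l.+1 s2 s2.
rewrite -expr2 sqr_sqrtr; last by apply: Ex_ge0 => x; exact: sqr_ge0.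
rewrite -gauss_norm2 -/(kap sigma r).
have -> : \sum_(k < l.+1) r ^+ k * zeta k sigma * zeta k sigma =
    \sum_(q < l.+1) zeta q sigma ^+ 2 * r ^+ q.
  by apply: eq_bigr => q _; ring.
move=> H; apply: (le_trans H); rewrite ler_wpM2r ?sqr_ge0 // [leLHS]mulrC ler_wpM2r ?exprn_ge0 //.
have q2 : r ^+ 2 <= 2^-1.
  by rewrite -(real_normK (num_real r)) -(r_sqr (R := R)) lerXn2r ?nnegrE ?invr_ge0 ?sqrtr_ge0.
rewrite -[leRHS]invrK lef_pV2 ?posrE ?sqrtr_gt0 ?invr_gt0 ?sqrtr_gt0 //; last by lra.
by rewrite -sqrtrV // ler_wsqrtr //; lra.
Qed.

(* The junk value outside [`|r| <= 1 / sqrt 2] is the value at [r = 1]. *)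
Definition overlap r : R :=
  if `|r| <= (Num.sqrt 2)^-1 then kap sigma r else gauss_norm 2 sigma ^+ 2.

Lemma overlap_one : overlap 1 = gauss_norm 2 sigma ^+ 2.
Proof. by rewrite /overlap normr1 leNgt r_lt1. Qed.

Lemma overlapE r : r = 1 \/ `|r| <= (Num.sqrt 2)^-1 -> overlap r = kap sigma r.
Proof.
case=> [->|rr]; first by rewrite overlap_one kap_one.
by rewrite /overlap rr.
Qed.

Lemma overlap_approx r : `|r| <= (Num.sqrt 2)^-1 ->
  `|overlap r - \sum_(q < l.+1) zeta q sigma ^+ 2 * r ^+ q| <=
  Num.sqrt 2 * `|r| ^+ l.+1 * gauss_norm 2 sigma ^+ 2.
Proof. by move=> rr; rewrite /overlap rr; exact: kap_approx. Qed.

(** Where [|r| <= 1 / sqrt 2], [mehler_bound] exhibits [kap sigma] as a pointwise limit of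
    polynomials in [r]; elsewhere [overlap] is constant. *)
Lemma measurable_overlap : measurable_fun setT overlap.
Proof.
pose f m (r : R) : R := if `|r| <= (Num.sqrt 2)^-1
  then \sum_(k < m) r ^+ k * zeta k sigma * zeta k sigma else gauss_norm 2 sigma ^+ 2.
apply: (measurable_fun_cvg (h := f)).
- move=> m; apply: measurable_fun_ifT.
  + by apply: measurable_fun_ler; [exact: normr_measurable | exact: measurable_cst].
  + apply: measurable_sum => k; apply: measurable_funM; last exact: measurable_cst.
    by apply: measurable_funM; [exact: measurable_funX | exact: measurable_cst].
  + exact: measurable_cst.
move=> r _; rewrite /f /overlap; case: ifP => [rr|_]; last exact: cvg_cst.
have r1 := le_lt_trans rr r_lt1.
set K := (Num.sqrt (1 - r ^+ 2))^-1 * (Num.sqrt (Ex G (fun x => sigma x ^+ 2)) *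
  Num.sqrt (Ex G (fun x => sigma x ^+ 2))).
have lim : (fun m => `|r| ^+ m * K) @ \oo --> (0 : R).
  rewrite -[X in _ --> X](mul0r K); apply: cvgMl; apply: cvg_expr.
  by rewrite normr_id.
apply/cvgrPdist_le => eps eps0.
have /cvgr0_norm_le /(_ eps eps0) [M _ HM] := lim.
exists M => // m mM; have := mehler_bound r1 m s2 s2; rewrite -mulrA => H.
apply: (le_trans H); apply: (le_trans (ler_norm _)); exact: HM.
Qed.

End Overlap.

(** * Assembly of bias, noise and invertibility for one [n] *)

Section FixedSize.
Context d0 (Om : measurableType d0) (R : realType) (P : probability Om R).
Notation G := (@std_gauss R).
Variables (sigma tau g : R -> R) (C : R) (l : nat).
Hypotheses (ms : measurable_fun setT sigma) (C0 : 0 <= C)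
  (sg : forall t, `|sigma t| <= C * (1 + `|t|) `^ C)
  (t2 : L2 G tau) (tailP : is_hermite_tail l tau g).
Let c := sigma_tail_sq l sigma.
Hypothesis c0 : 0 < c.
Variables (N d n : nat) (X : 'M[R]_(d, n)) (s lambda : R).
Hypotheses (s0 : 0 <= s) (lambda0 : 0 <= lambda) (N0 : (0 < N)%N).
Variables (W : Om -> 'M[R]_(N, d)) (beta : Om -> 'cV[R]_d) (eps : Om -> 'cV[R]_n)
  (x : Om -> 'cV[R]_d).
Hypotheses (iidW : iid P (centered_gauss 1) (entries W))
  (iidb : iid P (centered_gauss 1) (entries beta))
  (iide : iid P (centered_gauss s) (entries eps))
  (xm : forall ij, measurable_fun setT (entries x ij)).
Let F := tnth [tuple sigma_algebra_of (entries W); sigma_algebra_of (entries beta);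
  sigma_algebra_of (entries eps); sigma_algebra_of (entries x)].
Hypothesis indep : independent_algebras P F.
Let xs i := col i X.
Hypotheses (xs1 : forall i, dot (xs i) (xs i) = 1)
  (xsr : forall i j, i != j -> `|dot (xs i) (xs j)| <= (Num.sqrt 2)^-1).

Definition admissible (u : 'cV[R]_d) : Prop :=
  dot u u = 1 /\ forall i, `|dot u (col i X)| <= (Num.sqrt 2)^-1.

Hypothesis x_adm : {ae P, forall o, admissible (x o)}.

Let o0 : 'I_4 := @Ordinal 4 0 isT.
Let o1 : 'I_4 := @Ordinal 4 1 isT.
Let o2 : 'I_4 := @Ordinal 4 2 isT.
Let o3 : 'I_4 := @Ordinal 4 3 isT.
Let F0 : F o0 = sigma_algebra_of (entries W). Proof. by []. Qed.
Let F1 : F o1 = sigma_algebra_of (entries beta). Proof. by []. Qed.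
Let F2 : F o2 = sigma_algebra_of (entries eps). Proof. by []. Qed.
Let F3 : F o3 = sigma_algebra_of (entries x). Proof. by []. Qed.

Let F_ind (Q : set (set Om) -> Prop) : Q (sigma_algebra_of (entries W)) ->
  Q (sigma_algebra_of (entries beta)) -> Q (sigma_algebra_of (entries eps)) ->
  Q (sigma_algebra_of (entries x)) -> forall i, Q (F i).
Proof.
move=> q0 q1 q2 q3 i; have : i = o0 \/ i = o1 \/ i = o2 \/ i = o3.
  case: i => [[|[|[|[|//]]]] h]; [left|right; left|right; right; left|right; right; right];
    exact: val_inj.
by case=> [->|[->|[->|->]]]; rewrite ?F0 ?F1 ?F2 ?F3.
Qed.

Let FT i : F i setT.
Proof. by apply: (F_ind (Q := fun A => A setT)); apply: (@measurableT _ (g_sigma_algebraType _)). Qed.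

Let FI i : setI_closed (F i).
Proof. by apply: (F_ind (Q := setI_closed)); exact: g_sigma_setI. Qed.

Let sa_sub (K : Type) (Y : K -> Om -> R) : (forall k, measurable_fun setT (Y k)) ->
  sigma_algebra_of Y `<=` measurable.
Proof.
move=> mY; apply: g_sigma_sub => _ [k _ [B mB <-]]; rewrite setTI -[X in measurable X]setTI.
exact: mY.
Qed.

Let Fm i : F i `<=` measurable.
Proof.
apply: (F_ind (Q := fun A => A `<=` measurable)); apply: sa_sub => // k;
  [exact: (iid_meas iidW)|exact: (iid_meas iidb)|exact: (iid_meas iide)].
Qed.

Notation alg J := (g_sigma_algebraType (union_of F J)).
Let mW (J : {set 'I_4}) : o0 \in J -> mmx (W : alg J -> _).
Proof. by move=> oJ i j; exact: (block_meas (Y := entries W) (i, j) oJ F0). Qed.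
Let mb (J : {set 'I_4}) : o1 \in J -> mmx (beta : alg J -> _).
Proof. by move=> oJ i j; exact: (block_meas (Y := entries beta) (i, j) oJ F1). Qed.
Let me (J : {set 'I_4}) : o2 \in J -> mmx (eps : alg J -> _).
Proof. by move=> oJ i j; exact: (block_meas (Y := entries eps) (i, j) oJ F2). Qed.
Let mx (J : {set 'I_4}) : o3 \in J -> mmx (x : alg J -> _).
Proof. by move=> oJ i j; exact: (block_meas (Y := entries x) (i, j) oJ F3). Qed.

Let mx' : mmx x. Proof. by move=> i j; exact: (xm (i, j)). Qed.

Let mmx1 (J1 J2 : {set 'I_4}) m k (A : alg J1 -> 'M[R]_(m, k)) : mmx A ->
  mmx (fun z : alg J1 * alg J2 => A z.1).
Proof. by move=> mA i j; exact: (measurableT_comp (mA i j) measurable_fst). Qed.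

Let mmx2 (J1 J2 : {set 'I_4}) m k (A : alg J2 -> 'M[R]_(m, k)) : mmx A ->
  mmx (fun z : alg J1 * alg J2 => A z.2).
Proof. by move=> mA i j; exact: (measurableT_comp (mA i j) measurable_snd). Qed.

Notation JW := [set o0]%SET.
Notation JR := [set o1; o2; o3]%SET.
Notation Jx := [set o3]%SET.
Notation Jbe := [set o1; o2]%SET.
Notation Jb := [set o1]%SET.
Notation Je := [set o2]%SET.

Let dWR : [disjoint JW & JR]%B. Proof. by rewrite disjoints1 !inE. Qed.
Let dxW : [disjoint Jx & JW]%B. Proof. by rewrite disjoints1 !inE. Qed.
Let dxbe : [disjoint Jx & Jbe]%B. Proof. by rewrite disjoints1 !inE. Qed.
Let dxb : [disjoint Jx & Jb]%B. Proof. by rewrite disjoints1 !inE. Qed.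
Let dbe : [disjoint Jb & Je]%B. Proof. by rewrite disjoints1 !inE. Qed.

Let W_W : o0 \in JW. Proof. by rewrite !inE. Qed.
Let b_R : o1 \in JR. Proof. by rewrite !inE. Qed.
Let e_R : o2 \in JR. Proof. by rewrite !inE. Qed.
Let x_R : o3 \in JR. Proof. by rewrite !inE. Qed.
Let x_x : o3 \in Jx. Proof. by rewrite !inE. Qed.
Let b_be : o1 \in Jbe. Proof. by rewrite !inE. Qed.
Let e_be : o2 \in Jbe. Proof. by rewrite !inE. Qed.

Let K := poly_kernel_mx sigma l X.
Let kp u := poly_kernel_col sigma l X u.
Let zs q := zeta q sigma.
Let S0 := gauss_norm 2 sigma ^+ 2.
Let T := Ex G (fun y => g y ^+ 2).
Let mt : measurable_fun setT tau := L2_meas t2.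
Let s2 : L2 G sigma := mom_L2 (mom_sigma ms C0 sg).

Let cE : c = S0 - \sum_(q < l.+1) zs q ^+ 2. Proof. by []. Qed.
Let S00 : 0 <= S0. Proof. exact: sqr_ge0. Qed.
Let T0 : 0 <= T. Proof. by apply: Ex_ge0 => y; exact: sqr_ge0. Qed.

Let far (u v : 'cV[R]_d) : dot u u = 1 -> `|dot v u| <= (Num.sqrt 2)^-1 -> (u == v) = false.
Proof.
move=> u1 uv; apply/negP => /eqP uv'; move: uv; rewrite -uv' u1 normr1.
by rewrite leNgt r_lt1.
Qed.

Let KE i j : K i j = \sum_(q < l.+1) zs q ^+ 2 * dot (xs i) (xs j) ^+ q + c * (i == j)%:R.
Proof.
rewrite /K mxE /poly_kernel; have [->|ij] := eqVneq i j.
  rewrite eqxx -/(xs j) xs1 mulr1; under eq_bigr do rewrite expr1n mulr1.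
  by rewrite cE addrC subrK.
rewrite far ?mulr0 ?addr0 //; first exact: xs1.
by apply: xsr; rewrite eq_sym.
Qed.

Let kE u : admissible u -> forall i, kp u i 0 = \sum_(q < l.+1) zs q ^+ 2 * dot u (xs i) ^+ q.
Proof.
move=> [u1 ur] i; have f : (col i X == u) = false by apply: far; [exact: xs1 | exact: ur].
by rewrite mxE /poly_kernel f; apply: eq_bigr => q _; rewrite dotC.
Qed.

Let gq0 q v : 0 <= gq xs q v := gq_ge0 iidb xs1 xsr q v.

Let gqx0 u : admissible u -> forall q v, 0 <= gq (ext u xs) q v.
Proof. by move=> [u1 ur] q v; exact: (gq_ge0 iidb (ext1 xs1 u1) (extr xsr ur)). Qed.

Let varE u : variance_term sigma l lambda X u = dot (vl lambda K (kp u)) (vl lambda K (kp u)).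
Proof. exact: (variance_vl lambda (kp u) KE). Qed.

Lemma variance_term_ge0 u : 0 <= variance_term sigma l lambda X u.
Proof. by rewrite varE; exact: dot_ge0. Qed.

Let vl_le u : admissible u -> dot (vl lambda K (kp u)) (vl lambda K (kp u)) <= S0 / c.
Proof. by move=> au; exact: (vl_bound au.1 c0 lambda0 cE KE (kE au) gq0 (gqx0 au)). Qed.

Let zl_le u : admissible u -> dot (zl lambda K (kp u)) (zl lambda K (kp u)) <= S0 / c ^+ 3.
Proof.
move=> au; apply: (le_trans (zl_bound (kp u) c0 lambda0 KE gq0)).
rewrite [leRHS](_ : _ = S0 / c / c ^+ 2); last by field; rewrite lt0r_neq0.
by rewrite ler_wpM2r ?invr_ge0 ?sqr_ge0 // vl_le.
Qed.

Lemma variance_integral_le :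
  ('E_P[fun o => variance_term sigma l lambda X (x o)] <= (S0 / c)%:E)%E.
Proof.
rewrite unlock; apply: (@le_trans _ _ (\int[P]_o (S0 / c)%:E)%E); last first.
  by rewrite integral_cstP.
apply: ae_ge0_le_integral => //.
- by move=> o _; rewrite lee_fin varE dot_ge0.
- by apply/measurable_EFinP; exact: variance_term_meas.
- by move=> o _; rewrite lee_fin divr_ge0 // ltW.
by apply: filterS x_adm => o ao _; rewrite lee_fin varE vl_le.
Qed.

Let gm : measurable_fun setT g := L2_meas (Lfun2_L2 (proj1 tailP)).

(** With [x] frozen, almost surely a unit vector, [dot beta x] is standard Gaussian. *)
Lemma tail_integral : ('E_P[fun o => (g (dot (beta o) (x o)) ^+ 2)%R] = T%:E)%E.
Proof.
rewrite unlock.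
pose f (z : alg Jx * alg Jb) : \bar R := (g (dot (beta z.2) (x z.1)) ^+ 2)%:E.
have mf : measurable_fun setT f.
  apply/measurable_EFinP; apply: measurable_funX; apply: (measurableT_comp gm).
  by apply: dot_meas; [apply: mmx2; apply: mb; rewrite !inE | apply: mmx1; apply: mx; rewrite !inE].
have f0 z : (0 <= f z)%E by rewrite lee_fin sqr_ge0.
rewrite (block_tonelli FT FI Fm indep dxb mf f0).
have -> : T%:E = (\int[P]_o T%:E)%E.
  by rewrite integral_cstP.
apply: ge0_ae_eq_integral => //.
- exact: (block_integral P Fm mf f0).
- by move=> o _; apply: integral_ge0 => y _; exact: f0.
apply: filterS x_adm => o [u1 _] _; rewrite /f /=.
have g2 := L2_sq (Lfun2_L2 (proj1 tailP)).
have L := L2_teacher iidb u1 (Lfun2_L2 (proj1 tailP)).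
by rewrite (ExE (L2_sq L)) (Ex_teacher iidb u1 g2).
Qed.

Let A (w : 'M[R]_(N, d)) := rf_kernel_mx sigma w X + lambda%:M.
Let kN (w : 'M[R]_(N, d)) (u : 'cV[R]_d) := (rf_kernel_row sigma w u X)^T.
(** The transpose makes the prediction equal to [vN . y] for every [w], including those with
    singular [A w]; symmetry and invertibility enter only in [pointwise]. *)
Let vN (w : 'M[R]_(N, d)) (u : 'cV[R]_d) := (invmx (A w))^T *m kN w u.

Let A_sym w : (A w)^T = A w.
Proof.
apply/matrixP => i j; rewrite !mxE /rf_kernel dotC; congr (_ + _).
by rewrite eq_sym.
Qed.

Let sq_loss_bias (w : 'M[R]_(N, d)) u b e : sq_loss sigma tau X lambda w b e u =
  (bias xs u tau (fun i => vN w u i 0) b + dot (vN w u) e) ^+ 2.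
Proof.
rewrite /sq_loss (real_normK (num_real _)); congr (_ ^+ 2).
have -> y : rf_predictor sigma lambda w X y u = dot (vN w u) y.
  by rewrite /rf_predictor /dot /vN /kN trmx_mul !trmxK.
rewrite dotDr /bias addrAC; congr (_ - _ + _); rewrite dotE; apply: eq_bigr => i _.
congr (_ * _); rewrite mxE; congr tau; rewrite dotE mxE; apply: eq_bigr => r _.
by rewrite /xs !mxE mulrC.
Qed.

Let inner w u : dot u u = 1 ->
  (\int[P]_o (sq_loss sigma tau X lambda w (beta o) (eps o) u)%:E =
  (Ex P (fun o => bias xs u tau (fun i => vN w u i 0) (beta o) ^+ 2) +
   s ^+ 2 * dot (vN w u) (vN w u))%:E)%E.
Proof.
move=> u1; set v := vN w u; set vf := fun i => v i 0.
have b2 := L2_bias iidb xs1 u1 t2 vf.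
have [em [e1 e2]] := noise_combo s0 iide v; have e2' := mom_L2 em.
have mbias : measurable_fun [set: alg Jb] (fun o => bias xs u tau vf (beta o)).
  have mbb : mmx (beta : alg Jb -> _) by apply: mb; rewrite !inE.
  apply: measurable_funB; last first.
    by apply: (measurableT_comp mt); apply: dot_meas => //; exact: mmx_cst.
  apply: measurable_sum => i; apply: measurable_funM; first exact: measurable_cst.
  by apply: (measurableT_comp mt); apply: dot_meas => //; exact: mmx_cst.
have meps : measurable_fun [set: alg Je] (fun o => dot v (eps o)).
  by apply: dot_meas; [exact: mmx_cst | apply: me; rewrite !inE].
have [_ bE] := block_ExM FT FI Fm indep dbe mbias meps (L2_intg b2) (mom_intg em).
have E o : sq_loss sigma tau X lambda w (beta o) (eps o) u =
  (bias xs u tau vf (beta o) + dot v (eps o)) ^+ 2 by exact: sq_loss_bias.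
under eq_integral do rewrite E.
rewrite (ExE (L2_sq (L2D b2 e2'))) (Ex_sqrD b2 e2') bE e1 !mulr0 addr0 e2.
by [].
Qed.

Variable eta : R.
Hypotheses (eta0 : 0 <= eta) (eta1 : eta <= 2^-1) (off_eta : off xs l.+1 <= eta ^+ 2).
Let eta_lt1 : eta < 1. Proof. by move: eta1; lra. Qed.
Let fluct : 'M[R]_(N, d) -> 'cV[R]_d -> R := fluctuation sigma l X lambda (overlap sigma).
(** [E1] collects what the test point costs through [cross]: the loss in the bias bound and the
    error in the mean of the kernel column. [E2] collects the parameter [t] of [perturbation] and
    the error [eta] of the training Gram matrix. The factor [S0 / c^3] bounds [|zl|^2]. *)
Let E1 t := T / (1 - eta) + s ^+ 2 * t^-1 * (4 * S0 ^+ 2 * (S0 / c ^+ 3)).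
Let E2 t := s ^+ 2 * (t * (S0 / c) + t + t^-1 * (4 * S0 ^+ 2 * (S0 / c ^+ 3) * eta ^+ 2)).

Let pointwise w u t : 0 < t -> admissible u -> A w \in unitmx ->
  T + s ^+ 2 * variance_term sigma l lambda X u <=
  Ex P (fun o => bias xs u tau (fun i => vN w u i 0) (beta o) ^+ 2) +
   s ^+ 2 * dot (vN w u) (vN w u) +
  (E1 t * cross xs u l.+1 + E2 t + s ^+ 2 * t^-1 * 2 * fluct w u).
Proof.
move=> t0 au Au; have [u1 ur] := au.
have B := bias_lower iidb xs1 u1 xsr ur t2 tailP (fun i => vN w u i 0) eta0 eta_lt1 off_eta.
rewrite -/T in B.
have AN : A w *m vN w u = kN w u.
  by rewrite /vN trmx_inv A_sym mulKVmx.
set z := zl lambda K (kp u); set kl := lambda%:M + K.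
have V := perturbation c0 lambda0 KE gq0 (k := kp u) t0 (A_sym w) AN erefl.
have Sp := perturbation_split xs1 xsr ur cE KE (kE au) (lambda := lambda) (overlap_one sigma)
  (overlap_approx l ms C0 sg) (A := A w) (kN := kN w u) erefl.
rewrite -/z -/kl in V Sp; rewrite varE.
set D := dot z _ ^+ 2 + _ in V Sp; set VV := dot (vl _ _ _) _ in V *.
have fE : (\sum_j z j 0 * (kN w u j 0 - overlap sigma (dot u (xs j)))) ^+ 2 +
    \sum_i (\sum_j z j 0 * (A w i j - lambda * (i == j)%:R - overlap sigma (dot (xs i) (xs j)))) ^+ 2
    = fluct w u.
  rewrite /fluct /fluctuation; congr (_ ^+ 2 + _).
    by apply: eq_bigr => j _; rewrite !mxE.
  apply: eq_bigr => i _; congr (_ ^+ 2); apply: eq_bigr => j _; rewrite !mxE.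
  by rewrite mulr_natr addrK.
rewrite fE in Sp.
have cr0 := cross_ge0 xs u l.+1; have of0 := off_ge0 xs l.+1.
have z0 := dot_ge0 z; have zle := zl_le au; rewrite -/z in zle.
have vle := vl_le au; rewrite -/VV in vle.
set cr := cross xs u l.+1 in B Sp cr0 *; set ofv := off xs l.+1 in Sp of0 *.
have Sp2 : D <= 2 * fluct w u + 4 * S0 ^+ 2 * (S0 / c ^+ 3) * (eta ^+ 2 + cr).
  apply: (le_trans Sp); rewrite lerD2l; apply: ler_pM => //.
  - by rewrite mulr_ge0 // mulr_ge0 // sqr_ge0.
  - by rewrite addr_ge0.
  - by rewrite ler_wpM2l // mulr_ge0 // sqr_ge0.
  - by rewrite lerD2r.
have ti : 0 <= t^-1 by rewrite invr_ge0 ltW.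
have Sp3 := ler_wpM2l ti Sp2.
have v2 : t * VV <= t * (S0 / c) by rewrite ler_wpM2l // ltW.
have VS : VV <= dot (vN w u) (vN w u) + t * (S0 / c) + t + t^-1 *
   (2 * fluct w u + 4 * S0 ^+ 2 * (S0 / c ^+ 3) * (eta ^+ 2 + cr)) by lra.
have VS2 := ler_wpM2l (sqr_ge0 s) VS.
have BE : T * (1 - cr / (1 - eta)) = T - T / (1 - eta) * cr by ring.
rewrite BE in B; rewrite /E1 /E2.
rewrite [X in _ <= _ + _ + X](_ : _ = T / (1 - eta) * cr + s ^+ 2 * (t * (S0 / c) + t + t^-1 *
   (2 * fluct w u + 4 * S0 ^+ 2 * (S0 / c ^+ 3) * (eta ^+ 2 + cr)))); last by ring.
by move: VS2; rewrite !mulrDr; lra.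
Qed.

Let gen (w : 'M[R]_(N, d)) := gen_error P sigma tau lambda X beta eps x w.
Let V := ('E_P[fun o => variance_term sigma l lambda X (x o)])%E.
Let Phi (w : 'M[R]_(N, d)) := (\int[P]_o (fluct w (x o))%:E)%E.
Let Cr := Ex P (fun o => cross xs (x o) l.+1).

Let cross_meas : measurable_fun setT (fun o => cross xs (x o) l.+1).
Proof.
apply: measurable_sum => i; apply: measurable_funX; apply: dot_meas => //; exact: mmx_cst.
Qed.

Lemma cross_intg : intg P (fun o => cross xs (x o) l.+1).
Proof.
apply: ge0_intg; [exact: cross_meas | by move=> o; exact: cross_ge0 |].
apply: (@le_lt_trans _ _ (\int[P]_o (n%:R : R)%:E)%E); last first.
  by rewrite integral_cstP ltry.
apply: ae_ge0_le_integral => //.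
- by move=> o _; rewrite lee_fin cross_ge0.
- exact/measurable_EFinP.
apply: filterS x_adm => o [_ ur] _; rewrite lee_fin /cross -[X in _ <= X%:R]card_ord -sumr_const.
apply: ler_sum => i _; rewrite exprM exprn_ile1 ?sqr_ge0 //.
rewrite -(real_normK (num_real _)) exprn_ile1 //; apply: ltW.
exact: le_lt_trans (ur i) r_lt1.
Qed.

Let gen_tonelli w : gen w =
  (\int[P]_o \int[P]_o' (sq_loss sigma tau X lambda w (beta o') (eps o') (x o))%:E)%E.
Proof.
rewrite /gen /gen_error unlock.
pose f (z : alg Jx * alg Jbe) : \bar R :=
  (sq_loss sigma tau X lambda w (beta z.2) (eps z.2) (x z.1))%:E.
have mf : measurable_fun setT f.
  apply/measurable_EFinP.
  exact: (sq_loss_meas ms mt X lambda (mmx_cst w) (mmx2 (mb b_be)) (mmx2 (me e_be)) (mmx1 (mx x_x))).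
have f0 z : (0 <= f z)%E by rewrite lee_fin exprn_ge0.
exact: (block_tonelli FT FI Fm indep dxbe mf f0).
Qed.

Let inner_meas (w : 'M[R]_(N, d)) : measurable_fun setT
  (fun o => \int[P]_o' (sq_loss sigma tau X lambda w (beta o') (eps o') (x o))%:E)%E.
Proof.
pose f (z : alg Jx * alg Jbe) : \bar R :=
  (sq_loss sigma tau X lambda w (beta z.2) (eps z.2) (x z.1))%:E.
have mf : measurable_fun setT f.
  apply/measurable_EFinP.
  exact: (sq_loss_meas ms mt X lambda (mmx_cst w) (mmx2 (mb b_be)) (mmx2 (me e_be)) (mmx1 (mx x_x))).
have f0 z : (0 <= f z)%E by rewrite lee_fin exprn_ge0.
exact: (block_integral P Fm mf f0).
Qed.

Let k0 : 0 <= S0 / c. Proof. by rewrite divr_ge0 // ltW. Qed.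
Let k3 : 0 <= S0 / c ^+ 3. Proof. by rewrite divr_ge0 // exprn_ge0 // ltW. Qed.
Let k4 : 0 <= 4 * S0 ^+ 2 * (S0 / c ^+ 3).
Proof. by apply: mulr_ge0 => //; apply: mulr_ge0 => //; exact: sqr_ge0. Qed.

Let E1_ge0 t : 0 < t -> 0 <= E1 t.
Proof.
move=> t0; apply: addr_ge0; first by rewrite divr_ge0 // subr_ge0 ltW.
by apply: mulr_ge0 => //; rewrite mulr_ge0 ?sqr_ge0 // invr_ge0 ltW.
Qed.

Let E2_ge0 t : 0 < t -> 0 <= E2 t.
Proof.
move=> t0; apply: mulr_ge0; first exact: sqr_ge0.
apply: addr_ge0; first by apply: addr_ge0; [apply: mulr_ge0 => //; exact: ltW | exact: ltW].
by apply: mulr_ge0; [rewrite invr_ge0 ltW | apply: mulr_ge0 => //; exact: sqr_ge0].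
Qed.

Let mfluct w : measurable_fun setT (fun o => fluct w (x o)).
Proof.
by apply: fluctuation_meas => //; exact: (measurable_overlap ms C0 sg).
Qed.

(** The errors are added on the right rather than subtracted on the left, so that only integrals of
    nonnegative functions occur, and [gen w] or [Phi w] may be infinite. *)
Let gen_lower w t : 0 < t -> A w \in unitmx ->
  (T%:E + (s ^+ 2)%:E * V <= gen w + ((E1 t * Cr + E2 t)%:E + (s ^+ 2 * t^-1 * 2)%:E * Phi w))%E.
Proof.
move=> t0 Au.
have h0 : 0 <= s ^+ 2 * t^-1 * 2 by rewrite !mulr_ge0 ?sqr_ge0 ?invr_ge0 // ltW.
have fl0 o : 0 <= fluct w (x o) by exact: fluctuation_ge0.
have mV : measurable_fun setT (fun o => variance_term sigma l lambda X (x o)).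
  exact: variance_term_meas.
have V0 o : 0 <= variance_term sigma l lambda X (x o) by rewrite varE dot_ge0.
have -> : (T%:E + (s ^+ 2)%:E * V)%E =
    (\int[P]_o (T + s ^+ 2 * variance_term sigma l lambda X (x o))%:E)%E.
  under [RHS]eq_integral do rewrite EFinD EFinM.
  rewrite ge0_integralD //; last 2 first.
  - by move=> o _; rewrite -EFinM lee_fin mulr_ge0 ?sqr_ge0.
  - apply: emeasurable_funM; first exact: measurable_cst.
    exact/measurable_EFinP.
  rewrite integral_cstP; congr (_ + _)%E.
  rewrite ge0_integralZl //; first by rewrite /V unlock.
  - exact/measurable_EFinP.
  - by move=> o _; rewrite lee_fin.
  - by rewrite lee_fin sqr_ge0.
pose inn o := (\int[P]_o' (sq_loss sigma tau X lambda w (beta o') (eps o') (x o))%:E)%E.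
have gE : gen w = (\int[P]_o inn o)%E := gen_tonelli w.
have innm : measurable_fun setT inn := inner_meas w.
have inn0 o : (0 <= inn o)%E by apply: integral_ge0 => y _; rewrite lee_fin exprn_ge0.
have innE o : admissible (x o) -> inn o =
  (Ex P (fun o' => bias xs (x o) tau (fun i => vN w (x o) i 0) (beta o') ^+ 2) +
   s ^+ 2 * dot (vN w (x o)) (vN w (x o)))%:E by move=> ao; exact: (inner w ao.1).
clearbody inn; rewrite gE.
have -> : (\int[P]_o inn o + ((E1 t * Cr + E2 t)%:E + (s ^+ 2 * t^-1 * 2)%:E * Phi w))%E =
    (\int[P]_o (inn o +
      ((E1 t * cross xs (x o) l.+1 + E2 t)%:E + (s ^+ 2 * t^-1 * 2)%:E * (fluct w (x o))%:E)))%E.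
  have i1 := intgZ (E1 t) cross_intg; have i2 := intg_cst P (E2 t).
  have l0 o : 0 <= E1 t * cross xs (x o) l.+1 + E2 t.
    by rewrite addr_ge0 ?E2_ge0 // mulr_ge0 ?E1_ge0 ?cross_ge0.
  have m1 : measurable_fun setT (fun o => (E1 t * cross xs (x o) l.+1 + E2 t)%:E).
    by apply/measurable_EFinP; exact: intg_measurable (intgD i1 i2).
  have m2 : measurable_fun setT (fun o => ((s ^+ 2 * t^-1 * 2)%:E * (fluct w (x o))%:E)%E).
    apply: emeasurable_funM; first exact: measurable_cst.
    exact/measurable_EFinP.
  rewrite ge0_integralD //; last 2 first.
  - by move=> o _; apply: adde_ge0; [rewrite lee_fin | rewrite -EFinM lee_fin mulr_ge0].
  - exact: emeasurable_funD.
  congr (_ + _)%E; rewrite ge0_integralD //; last 2 first.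
  - by move=> o _; rewrite lee_fin.
  - by move=> o _; rewrite -EFinM lee_fin mulr_ge0.
  rewrite (ExE (intgD i1 i2)) (ExD i1 i2) (ExZ _ cross_intg) Ex_cst; congr (_ + _)%E.
  rewrite ge0_integralZl //; [exact/measurable_EFinP|by move=> o _; rewrite lee_fin].
apply: ae_ge0_le_integral => //.
- by move=> o _; rewrite lee_fin addr_ge0 // mulr_ge0 ?sqr_ge0.
- apply/measurable_EFinP; apply: measurable_funD; first exact: measurable_cst.
  by apply: measurable_funM; first exact: measurable_cst.
- move=> o _; apply: adde_ge0; first exact: inn0.
  apply: adde_ge0; last by rewrite -EFinM lee_fin mulr_ge0.
  by rewrite lee_fin; apply: addr_ge0; [rewrite mulr_ge0 ?E1_ge0 ?cross_ge0 | exact: E2_ge0].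
- apply: emeasurable_funD; first exact: innm.
  apply: emeasurable_funD.
    apply/measurable_EFinP; apply: measurable_funD; last exact: measurable_cst.
    by apply: measurable_funM; first exact: measurable_cst.
  apply: emeasurable_funM; first exact: measurable_cst.
  exact/measurable_EFinP.
apply: filterS x_adm => o ao _; rewrite (innE _ ao) -EFinM -!EFinD lee_fin.
by apply: pointwise.
Qed.

Let gen_meas : measurable_fun setT (fun o => gen (W o)).
Proof.
pose f (z : alg JW * alg JR) : \bar R :=
  (sq_loss sigma tau X lambda (W z.1) (beta z.2) (eps z.2) (x z.2))%:E.
have mf : measurable_fun setT f.
  apply/measurable_EFinP.
  exact: (sq_loss_meas ms mt X lambda (mmx1 (mW W_W)) (mmx2 (mb b_R)) (mmx2 (me e_R)) (mmx2 (mx x_R))).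
have f0 z : (0 <= f z)%E by rewrite lee_fin exprn_ge0.
have := block_integral P Fm mf f0; rewrite /f /= /gen /gen_error.
by under [X in _ -> measurable_fun _ X]eq_fun do rewrite unlock.
Qed.

Variable M : nat.
Hypotheses (lM : (l < M)%N) (zM : zeta M sigma != 0).
Let Z o := map_mx sigma (W o *m X).
Let D := [set o | (\rank (Z o) < n)%N].

Let ZE o a j : Z o a j = sigma ((W o *m xs j) a 0).
Proof.
by rewrite /Z !mxE; congr sigma; apply: eq_bigr => r _; rewrite /xs !mxE.
Qed.

Let row1 (a : 'I_N) j : ip (row_seq d a) (row_coef (xs j)) (row_coef (xs j)) = 1.
Proof. by rewrite row_ip xs1. Qed.

Let rowr (a : 'I_N) i j : i != j -> `|ip (row_seq d a) (row_coef (xs i)) (row_coef (xs j))| <= (Num.sqrt 2)^-1.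
Proof. by move=> ij; rewrite row_ip; exact: xsr. Qed.

Let rowr1 (a : 'I_N) i j : i != j -> `|ip (row_seq d a) (row_coef (xs i)) (row_coef (xs j))| < 1.
Proof. by move=> ij; apply: le_lt_trans (rowr a ij) r_lt1. Qed.

Let row_off (a : 'I_N) q : offdiag (row_seq d a) (fun j => row_coef (xs j)) q = off xs q.
Proof. by apply: eq_bigr => i _; apply: eq_bigr => j _; rewrite row_ip. Qed.

Let row_combo (a : 'I_N) v o : combo (entries W) (row_seq d a) (fun j => row_coef (xs j)) sigma v o =
  \sum_j v j * sigma ((W o *m xs j) a 0).
Proof. by apply: eq_bigr => j _; rewrite row_lin. Qed.

Let singular : measurable D /\ N%:R * ball_prob M sigma * fine (P D) <= n%:R.
Proof.
apply: (rank_defect iidW (Z := Z)); first exact: ltW (ball_prob_gt0 M sigma).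
- move=> a j; have -> : (fun o => Z o a j) =
      (fun o => sigma (lin_form (entries W) (row_seq d a) (row_coef (xs j)) o)).
    by apply/funext => o; rewrite row_lin ZE.
  by apply: (measurableT_comp ms); apply: lin_form_coords; exact: row_seq_sub.
move=> a u un0.
have oM : offdiag (row_seq d a) (fun j => row_coef (xs j)) M <= 4^-1.
  apply: (le_trans (offdiag_mono (rowr a) lM)); rewrite row_off.
  by apply: (le_trans off_eta); move: eta0 eta1; nra.
have uj : exists j, u j 0 != 0.
  apply/existsP; rewrite -negb_forall; apply: contra un0 => /forallP H.
  by apply/eqP/matrixP => i j; rewrite !ord1 mxE; apply/eqP.
have := small_ball iidW (row_seq_uniq d a) (row1 a) (rowr a) s2 zM oM uj.
move=> H; apply: (le_trans H); rewrite le_eqVlt; apply/orP; left; apply/eqP.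
have E o : combo (entries W) (row_seq d a) (fun j => row_coef (xs j)) sigma (fun j => u j 0) o =
    (Z o *m u) a 0.
  by rewrite row_combo mxE; apply: eq_bigr => j _; rewrite ZE mulrC.
by congr (fine (P _)); apply/seteqP; split=> o /=; rewrite E.
Qed.

Let gram_unit o : ~ D o -> A (W o) \in unitmx.
Proof.
move=> nD; have rZ : row_full (Z o).
  by rewrite /row_full eqn_leq rank_leq_col leqNgt; apply/negP.
apply: unitmx_inj => u Au; have [B BZ] := row_fullP rZ.
suff Zu : Z o *m u = 0 by rewrite -[u]mul1mx -BZ -mulmxA Zu mulmx0.
apply: dot_eq0; have Nr : 0 < N%:R :> R by rewrite ltr0n.
have : dot u (A (W o) *m u) = N%:R^-1 * dot (Z o *m u) (Z o *m u) + lambda * dot u u.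
  rewrite /A mulmxDl dotDr mul_scalar_mx dotZr; congr (_ + _).
  have -> : rf_kernel_mx sigma (W o) X = N%:R^-1 *: ((Z o)^T *m Z o).
    apply/matrixP => i j; rewrite !mxE /rf_kernel dotE; congr (_ * _).
    by apply: eq_bigr => a _; rewrite [(_^T) _ _]mxE !ZE !mxE.
  by rewrite -scalemxAl dotZr -mulmxA dot_mulmx trmxK.
rewrite Au; have -> : dot u 0 = 0 :> R.
  by rewrite dotE big1 // => i _; rewrite mxE mulr0.
move/esym/eqP; rewrite paddr_eq0; last 2 first.
- by rewrite mulr_ge0 ?invr_ge0 ?dot_ge0.
- by rewrite mulr_ge0 ?dot_ge0.
by case/andP; rewrite mulf_eq0 invr_eq0 gt_eqF //= => /eqP.
Qed.

Variable L : R.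
Hypotheses (L0 : 0 <= L) (sL : forall y, sigma y ^+ 2 <= L + N%:R^-1 * psi sigma y).
(** [q0] bounds the second moment of one row of features along [zl]. [Vb] counts the [n] training
    rows and the test row of the kernel, each with the variance bound of [kernel_concentration] at
    [M = N]. *)
Let q0 := S0 / c ^+ 3 + S0 / c + 3 * S0 * (S0 / c ^+ 3).
Let Vb := n.+1%:R * (N%:R^-1 * (L * q0 + N%:R^-1 * n%:R * psi_cst sigma * (S0 / c ^+ 3))).

(** The low-degree part of the form is at most [zl . (Kl zl) = zl . vl], hence bounded independently
    of [n]; for a general vector it could be of order [n]. The high degrees contribute at most
    [S0 (1 + sqrt 2 eta) |zl|^2], by [combo_upper]. *)
Let feature_moment u (a : 'I_N) : admissible u ->
  Ex P (fun o => (\sum_j zl lambda K (kp u) j 0 * sigma ((W o *m xs j) a 0)) ^+ 2) <= q0.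
Proof.
move=> au; set z := zl lambda K (kp u).
have H := combo_upper iidW (row_seq_uniq d a) (row1 a) (@rowr1 a) (m := l.+1) (fun j => z j 0) s2 eta0 (rowr a).
rewrite -/(offdiag _ _ _) row_off in H; have {}H := H off_eta.
under eq_Ex do rewrite -(row_combo a (fun j => z j 0)).
apply: (le_trans H).
have zz : \sum_j z j 0 ^+ 2 = dot z z by rewrite dotE; apply: eq_bigr => j _; rewrite expr2.
have gE q : gramq (row_seq d a) (fun j => row_coef (xs j)) q (fun j => z j 0) = gq xs q (fun j => z j 0).
  by apply: eq_bigr => i _; apply: eq_bigr => j _; rewrite row_ip.
rewrite zz -(gauss_norm2 ms C0 sg) -/S0; under eq_bigr do rewrite gE.
have f1 := poly_kernel_form KE z; have f2 := Kl_form lambda K z.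
have f3 := Kl_zl (kp u) c0 lambda0 KE gq0; rewrite -/z in f3; rewrite f3 in f2.
have y := dot_young z (vl lambda K (kp u)) (ltr01 : 0 < 1 :> R); rewrite invr1 !mul1r in y.
have z1 := zl_le au; have v1 := vl_le au; rewrite -/z in z1.
have z2 := dot_ge0 z; have v2 := dot_ge0 (vl lambda K (kp u)).
have lz := mulr_ge0 lambda0 z2; have cz := mulr_ge0 (ltW c0) z2.
have a1 : \sum_(q < l.+1) zeta q sigma ^+ 2 * gq xs q (fun j => z j 0) <= S0 / c ^+ 3 + S0 / c.
  move: f1 f2 y z1 v1 z2 v2 lz cz; rewrite /zs.
  set aa := dot z (K *m z); set bb := dot z (vl _ _ _); set cc := dot z z; set dd := dot (vl _ _ _) _.
  set ee := \sum_(_ < _) _; set k3' := S0 / c ^+ 3; set k1' := S0 / c; lra.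
rewrite /q0; apply: lerD => //; rewrite [3 * S0]mulrC.
apply: ler_pM => //; first by rewrite mulr_ge0 // addr_ge0 // mulr_ge0 ?sqrtr_ge0.
rewrite ler_wpM2l //.
have s22 : Num.sqrt 2 <= 2 :> R.
  by rewrite -[leRHS](ger0_norm (x := 2)) // -sqrtr_sqr ler_wsqrtr //; lra.
have s20 : 0 <= Num.sqrt 2 :> R := sqrtr_ge0 2.
by move: s22 s20 eta0 eta1; nra.
Qed.

Let fluct_bound u : admissible u -> (\int[P]_o (fluct (W o) u)%:E <= Vb%:E)%E.
Proof.
move=> au; have [u1 ur] := au; set z := zl lambda K (kp u).
have Nr : 0 < N%:R :> R by rewrite ltr0n.
have kc w w1 := kernel_concentration iidW ms C0 sg (xs := xs) (u := w) (v := fun j => z j 0) xs1 w1 N0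
  Nr sL L0 (fun a => feature_moment a au).
pose e w o := (\sum_j z j 0 * (rf_kernel sigma (W o) w (xs j) - kap sigma (dot w (xs j)))) ^+ 2.
have fE o : fluct (W o) u = e u o + \sum_i e (xs i) o.
  rewrite /fluct /fluctuation -/K -/(kp u) -/z /e; congr (_ ^+ 2 + _).
    by apply: eq_bigr => j _; rewrite (overlapE ms C0 sg) //; right; exact: ur.
  apply: eq_bigr => i _; congr (_ ^+ 2); apply: eq_bigr => j _.
  rewrite (overlapE ms C0 sg) //; have [->|ij] := eqVneq i j; [left; exact: xs1 | right; exact: xsr].
have ie w : dot w w = 1 -> intg P (e w) by move=> w1; exact: (kc w w1).1.
have zz : \sum_j z j 0 ^+ 2 = dot z z by rewrite dotE; apply: eq_bigr => j _; rewrite expr2.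
have psi0 : 0 <= psi_cst sigma.
  apply: divr_ge0 => //; apply: addr_ge0; apply: Ex_ge0 => y; first exact: sqr_ge0.
  by rewrite (exprM _ 2 2) sqr_ge0.
pose v1 := N%:R^-1 * (L * q0 + N%:R^-1 * n%:R * psi_cst sigma * (S0 / c ^+ 3)).
have be w : dot w w = 1 -> Ex P (e w) <= v1.
  move=> w1; apply: (le_trans (kc w w1).2); rewrite zz ler_wpM2l ?invr_ge0 ?(ltW Nr) //.
  rewrite lerD2l ler_wpM2l ?zl_le // mulr_ge0 // mulr_ge0 // invr_ge0 ltW //.
have iS : intg P (fun o => \sum_i e (xs i) o) by apply: intg_sum => i _; exact: ie.
under eq_integral do rewrite fE.
rewrite (ExE (intgD (ie u u1) iS)) lee_fin (ExD (ie u u1) iS) Ex_sum => [|i _]; last exact: ie.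
rewrite /Vb -/v1 -addn1 natrD mulrDl mul1r addrC; apply: lerD; last exact: be.
rewrite mulr_natl -[X in _ *+ X]card_ord -sumr_const; apply: ler_sum => i _; exact: be.
Qed.

Let Phi_meas : measurable_fun setT (fun o => Phi (W o)).
Proof.
pose f (z : alg JW * alg JR) : \bar R := (fluct (W z.1) (x z.2))%:E.
have mf : measurable_fun setT f.
  apply/measurable_EFinP.
  exact: (fluctuation_meas ms l X lambda (measurable_overlap ms C0 sg) (mmx1 (mW W_W)) (mmx2 (mx x_R))).
have f0 z : (0 <= f z)%E by rewrite lee_fin fluctuation_ge0.
exact: (block_integral P Fm mf f0).
Qed.

(** [Phi] averages over the test point at fixed weights, [fluct_bound] over the weights at a fixed
    test point. Tonelli is used for both orders of the blocks, the two iterated integrals being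
    equal to the same integral over [Om]. *)
Let Phi_bound : (\int[P]_o Phi (W o) <= Vb%:E)%E.
Proof.
pose f (z : alg JW * alg JR) : \bar R := (fluct (W z.1) (x z.2))%:E.
have mf : measurable_fun setT f.
  apply/measurable_EFinP.
  exact: (fluctuation_meas ms l X lambda (measurable_overlap ms C0 sg) (mmx1 (mW W_W)) (mmx2 (mx x_R))).
have f0 z : (0 <= f z)%E by rewrite lee_fin fluctuation_ge0.
pose h (z : alg Jx * alg JW) : \bar R := (fluct (W z.2) (x z.1))%:E.
have mh : measurable_fun setT h.
  apply/measurable_EFinP.
  exact: (fluctuation_meas ms l X lambda (measurable_overlap ms C0 sg) (mmx2 (mW W_W)) (mmx1 (mx x_x))).
have h0 z : (0 <= h z)%E by rewrite lee_fin fluctuation_ge0.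
have E1' := block_tonelli FT FI Fm indep dWR mf f0.
have E2' := block_tonelli FT FI Fm indep dxW mh h0.
pose inn (o : Om) := (\int[P]_o' h (o, o'))%E.
have EE : (\int[P]_o Phi (W o) = \int[P]_o inn o)%E by rewrite -[RHS]E2' -[LHS]E1'.
have inn0 o : (0 <= inn o)%E by apply: integral_ge0 => y _; exact: h0.
have innm : measurable_fun setT inn by exact: (block_integral P Fm mh h0).
have inn_le o : admissible (x o) -> (inn o <= Vb%:E)%E.
  move=> ao; change (\int[P]_o' (fluct (W o') (x o))%:E <= Vb%:E)%E.
  exact: (fluct_bound ao).
rewrite EE; clearbody inn => {E1' E2' EE mf f0 mh h0}.
have Vb0 : 0 <= Vb.
  have psi0 : 0 <= psi_cst sigma.
    apply: divr_ge0 => //; apply: addr_ge0; apply: Ex_ge0 => y; first exact: sqr_ge0.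
    by rewrite (exprM _ 2 2) sqr_ge0.
  have N1 : 0 <= N%:R^-1 :> R by rewrite invr_ge0.
  have qq : 0 <= q0 by rewrite /q0; apply: addr_ge0; [apply: addr_ge0 | apply: mulr_ge0 => //; apply: mulr_ge0].
  apply: mulr_ge0 => //; apply: mulr_ge0 => //; apply: addr_ge0; first exact: mulr_ge0.
  by apply: mulr_ge0 => //; apply: mulr_ge0 => //; apply: mulr_ge0.
apply: (@le_trans _ _ (\int[P]_o Vb%:E)%E); last by rewrite integral_cstP.
move: Vb Vb0 inn_le => b b0 inn_le.
apply: (ae_ge0_le_integral measurableT (fun o _ => inn0 o) innm).
- by move=> o _; rewrite lee_fin.
- exact: measurable_cst.
by apply: filterS x_adm => o ao _; exact: inn_le.
Qed.

Definition gen_excess t a := E1 t * Cr + E2 t + s ^+ 2 * t^-1 * 2 * a.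
(** A union bound: the first term is for a singular Gram matrix, the second is Markov's inequality
    for [Phi (W o) > a]. *)
Definition bad_prob a := n%:R / (N%:R * ball_prob M sigma) + Vb / a.

Lemma fixed_size t a : 0 < t -> 0 < a ->
  ((1 - bad_prob a)%:E <= P [set o | (T%:E + (s ^+ 2)%:E * V <= gen (W o) + (gen_excess t a)%:E)%E])%E.
Proof.
move=> t0 a0; have [mD pD] := singular.
pose H := [set o | (a%:E < Phi (W o))%E].
have mH : measurable H.
  by rewrite -[H]setTI; apply: emeasurable_fun_o_infty => //; exact: Phi_meas.
have Phi0 w : (0 <= Phi w)%E by apply: integral_ge0 => o _; rewrite lee_fin fluctuation_ge0.
have pH : fine (P H) <= Vb / a.
  rewrite ler_pdivlMr // mulrC -lee_fin EFinM fineP //.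
  apply: (le_trans _ Phi_bound).
  have -> : (a%:E * P H = \int[P]_o (a%:E * (\1_H o)%:E))%E.
    rewrite ge0_integralZl //; first by rewrite integral_indic // setIT.
    - by apply/measurable_EFinP; exact: indic_meas.
    - by rewrite lee_fin ltW.
  apply: ge0_le_integral => //.
  - by move=> o _; rewrite -EFinM lee_fin mulr_ge0 // ltW.
  - apply: emeasurable_funM; first exact: measurable_cst.
    by apply/measurable_EFinP; exact: indic_meas.
  move=> o _; rewrite indicE; have [oH|_] := boolP (o \in H).
    by rewrite mule1; rewrite inE in oH; exact: ltW.
  by rewrite mule0.
pose Q := [set o | (T%:E + (s ^+ 2)%:E * V <= gen (W o) + (gen_excess t a)%:E)%E].
have mQ : measurable Q.
  rewrite -[Q]setTI; apply: measurable_lee => //.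
  by apply: emeasurable_funD => //; exact: gen_meas.
have sub : ~` (D `|` H) `<=` Q.
  move=> o /= nDH; have nD : ~ D o by move=> h; apply: nDH; left.
  have PhiW : (Phi (W o) <= a%:E)%E.
    by rewrite leNgt; apply/negP => h; apply: nDH; right.
  apply: (le_trans (gen_lower t0 (gram_unit nD))); apply: leeD2l.
  have -> : (gen_excess t a)%:E = ((E1 t * Cr + E2 t)%:E + (s ^+ 2 * t^-1 * 2)%:E * a%:E)%E by [].
  apply: leeD2l; apply: lee_wpmul2l => //.
  by rewrite lee_fin !mulr_ge0 ?sqr_ge0 ?invr_ge0 // ltW.
have mDH : measurable (D `|` H) by exact: measurableU.
apply: (@le_trans _ _ (P (~` (D `|` H)))); last first.
  by apply: le_measure; rewrite ?inE //; exact: measurableC.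
rewrite probability_setC // -(fineP P mDH) -EFinB lee_fin lerD2l lerN2.
have pU : fine (P (D `|` H)) <= fine (P D) + fine (P H).
  by rewrite -lee_fin EFinD !fineP //; exact: measureU2.
apply: (le_trans pU); rewrite /bad_prob; apply: lerD => //.
have b0 := ball_prob_gt0 M sigma.
by rewrite ler_pdivlMr ?mulr_gt0 ?ltr0n // mulrC.
Qed.

End FixedSize.

(** * Asymptotics *)

Section HighDegree.
Context {R : realType}.
Notation G := (@std_gauss R).
Variables (sigma : R -> R) (s2 : L2 G sigma) (l : nat).

Let Ex_trunc (g : R -> R) m : L2 G g ->
  Ex G (fun x => g x * trunc m sigma x) = \sum_(k < m) zeta k sigma * zeta k g.
Proof.
move=> g2; have gh k : intg G (fun x => g x * hn k x) by apply: L2_mul => //; exact: L2_hn.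
transitivity (Ex G (fun x => \sum_(k < m) zeta k sigma * (g x * hn k x))).
  by apply: eq_Ex => x; rewrite mulr_sumr; apply: eq_bigr => k _; rewrite mulrCA.
rewrite Ex_sum => [|k _]; last exact: (intgZ _ (gh k)).
by apply: eq_bigr => k _; rewrite (ExZ _ (gh k)) (zetaE k g).
Qed.

(** Otherwise all Hermite coefficients of [sigma] minus its truncation vanish; completeness makes
    its norm 0, whereas its squared norm is the gap in the hypothesis. *)
Lemma exists_high_degree : \sum_(k < l.+1) zeta k sigma ^+ 2 < Ex G (fun x => sigma x ^+ 2) ->
  exists2 M, (l < M)%N & zeta M sigma != 0.
Proof.
move=> tail0; apply: contrapT => H.
have z0 k : (l < k)%N -> zeta k sigma = 0.
  by move=> lk; apply/eqP/negPn/negP => zk; apply: H; exists k.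
have tr2 := L2_trunc l.+1 sigma.
pose f x := sigma x - trunc l.+1 sigma x.
have f2 : L2 G f by exact: L2B.
have zf k : zeta k f = 0.
  have i1 : intg G (fun x => sigma x * hn k x) by apply: L2_mul => //; exact: L2_hn.
  have i2 : intg G (fun x => trunc l.+1 sigma x * hn k x) by apply: L2_mul => //; exact: L2_hn.
  transitivity (zeta k sigma - zeta k (trunc l.+1 sigma)).
    by rewrite !zetaE -(ExB i1 i2); apply: eq_Ex => x; rewrite /f mulrBl.
  have [kl|lk] := ltnP k l.+1; first by rewrite zeta_trunc ?subrr.
  rewrite z0 // sub0r zetaE ExMC (Ex_trunc _ (L2_hn k)) big1 ?oppr0 // => j _.
  rewrite zeta_hn gtn_eqF ?mulr0 //; exact: leq_trans (ltn_ord j) lk.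
have := hermite_complete f2 zf; rewrite (Ex_sqrB s2 tr2) (Ex_trunc _ s2).
have -> : Ex G (fun x => trunc l.+1 sigma x ^+ 2) = \sum_(k < l.+1) zeta k sigma ^+ 2.
  transitivity (Ex G (fun x => trunc l.+1 sigma x * trunc l.+1 sigma x)).
    by apply: eq_Ex => x; rewrite expr2.
  by rewrite Ex_trunc //; apply: eq_bigr => k _; rewrite zeta_trunc // expr2.
under eq_bigr do rewrite -expr2; lra.
Qed.

End HighDegree.

(** * Choice of the parameters and their rates *)

Section Rates.
Context {R : realType}.

(** Each term of [bad_prob] is at most half of [1 / y], with [y = log^C(N)]. As [L] is a multiple of
    [y], [Vb <= 2 r y k0], and Markov's inequality asks for one more factor [y] in [a]; hence [a] is
    of order [r y^2 = n log^(2 C)(N) / N], which the growth condition sends to 0. *)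
Lemma bad_prob_le (sigma : R -> R) (C : R) (l N n M : nat) (k0 r y L a : R) :
  0 <= C -> 0 < sigma_tail_sq l sigma -> (0 < N)%N -> (0 < n)%N ->
  1 <= ln (N%:R : R) -> r = n%:R / N%:R -> y = ln (N%:R : R) `^ C ->
  L = C ^+ 2 * 16 `^ C * y ->
  let c := sigma_tail_sq l sigma in let S0 := gauss_norm 2 sigma ^+ 2 in
  k0 = C ^+ 2 * 16 `^ C * (S0 / c ^+ 3 + S0 / c + 3 * S0 * (S0 / c ^+ 3)) +
    psi_cst sigma * (S0 / c ^+ 3) ->
  r <= 1 -> r * y ^+ 2 <= ball_prob M sigma / 2 -> a = 4 * (k0 + 1) * (r * y ^+ 2) ->
  0 < a /\ bad_prob sigma l N n M L a <= ln (N%:R : R) `^ (- C).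
Proof.
move=> C0 c0 N0 n0 l1 rE yE LE c S0 kE r1 ry aE.
have Nr : 0 < N%:R :> R by rewrite ltr0n.
have nr : 1 <= n%:R :> R by rewrite ler1n.
have y1 : 1 <= y.
  have e1 : 1 `^ C = 1 :> R by rewrite powR1.
  rewrite yE -[leLHS]e1; apply: ge0_ler_powR => //; rewrite ?nnegrE ?ler01 //; exact: (le_trans ler01 l1).
have r0 : 0 < r by rewrite rE divr_gt0 //; lra.
have y0 : 0 < y by lra.
have S00 : 0 <= S0 by exact: sqr_ge0.
have q3 : 0 <= S0 / c ^+ 3 by rewrite divr_ge0 // exprn_ge0 // ltW.
have q1 : 0 <= S0 / c by rewrite divr_ge0 // ltW.
have psi0 : 0 <= psi_cst sigma.
  apply: divr_ge0 => //; apply: addr_ge0; apply: Ex_ge0 => z; first exact: sqr_ge0.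
  by rewrite (exprM _ 2 2) sqr_ge0.
set q0 := S0 / c ^+ 3 + S0 / c + 3 * S0 * (S0 / c ^+ 3) in kE.
have q00 : 0 <= q0 by apply: addr_ge0; [apply: addr_ge0 | apply: mulr_ge0 => //; apply: mulr_ge0].
set K1 := C ^+ 2 * 16 `^ C in LE kE.
have K10 : 0 <= K1 by rewrite mulr_ge0 ?sqr_ge0 ?powR_ge0.
set ps := psi_cst sigma * (S0 / c ^+ 3) in kE.
have ps0 : 0 <= ps by exact: mulr_ge0.
have kq : 0 <= K1 * q0 by exact: mulr_ge0.
have k00 : 0 <= k0 by rewrite kE addr_ge0.
have a0 : 0 < a.
  rewrite aE; apply: mulr_gt0; first by lra.
  by apply: mulr_gt0 => //; exact: exprn_gt0.
split=> //; have p0 := ball_prob_gt0 M sigma; set p := ball_prob M sigma in ry p0 *.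
rewrite powRN -yE /bad_prob -/c -/S0 -/q0 -/p.
have e1 : n%:R / (N%:R * p) <= y^-1 / 2.
  have -> : n%:R / (N%:R * p) = r / p by rewrite rE; field; rewrite !lt0r_neq0.
  rewrite ler_pdivrMr // -(ler_pM2r (exprn_gt0 2 y0)).
  have -> : y^-1 / 2 * p * y ^+ 2 = p / 2 * y by field; rewrite lt0r_neq0.
  by apply: (le_trans ry); rewrite ler_peMr //; lra.
have e2 : n.+1%:R * (N%:R^-1 * (L * q0 + N%:R^-1 * n%:R * psi_cst sigma * (S0 / c ^+ 3))) <=
    2 * r * y * k0.
  have -> : N%:R^-1 * n%:R * psi_cst sigma * (S0 / c ^+ 3) = r * ps by rewrite rE /ps; ring.
  apply: (@le_trans _ _ (2 * n%:R * (N%:R^-1 * (y * k0)))); last first.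
    by rewrite rE le_eqVlt; apply/orP; left; apply/eqP; ring.
  apply: ler_pM.
  - by [].
  - apply: mulr_ge0; first by rewrite invr_ge0 ltW.
    by apply: addr_ge0; apply: mulr_ge0 => //; [rewrite LE mulr_ge0 // ltW | exact: ltW].
  - by rewrite -addn1 natrD; lra.
  rewrite ler_wpM2l ?invr_ge0 ?(ltW Nr) // LE kE.
  rewrite [leRHS](_ : _ = K1 * y * q0 + y * ps); last by ring.
  by rewrite lerD2l ler_wpM2r // (le_trans r1).
set Vb := _.+1%:R * _ in e2 *.
have e3 : Vb / a <= y^-1 / 2.
  rewrite ler_pdivrMr //; apply: (le_trans e2).
  have -> : y^-1 / 2 * a = 2 * r * y * (k0 + 1) by rewrite aE; field; rewrite lt0r_neq0.
  by apply: ler_wpM2l; [rewrite !mulr_ge0 // ltW | lra].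
by lra.
Qed.

(** The choice [t^2 = a + eta^2 + Cr] balances the terms in [t] against those in [1 / t]: each of
    [a], [eta^2] and [Cr] divided by [t] is at most [t]. *)
Lemma gen_excess_le d0 (Om : measurableType d0) (P : probability Om R) (sigma g : R -> R)
    (l d n : nat) (X : 'M[R]_(d, n)) (s : R) (x : Om -> 'cV[R]_d) (eta t a : R) :
  0 < sigma_tail_sq l sigma -> 0 <= eta -> eta <= 2^-1 -> 0 < a ->
  let Cr := Ex P (fun o => cross (fun i => col i X) (x o) l.+1) in
  let T := Ex (@std_gauss R) (fun y => g y ^+ 2) in
  let c := sigma_tail_sq l sigma in let S0 := gauss_norm 2 sigma ^+ 2 in
  let k4 := 4 * S0 ^+ 2 * (S0 / c ^+ 3) in
  0 <= Cr -> t = Num.sqrt (a + eta ^+ 2 + Cr) ->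
  [/\ 0 < t, 0 <= gen_excess P sigma g l X s x eta t a &
  gen_excess P sigma g l X s x eta t a <=
    2 * T * Cr + s ^+ 2 * (2 * k4 + S0 / c + 3) * t].
Proof.
move=> c0 eta0 eta1 a0 Cr T c S0 k4 Cr0 tE.
have u0 : 0 < a + eta ^+ 2 + Cr.
  by apply: ltr_pwDl => //; apply: ltr_pwDl => //; exact: sqr_ge0.
have t0 : 0 < t by rewrite tE sqrtr_gt0.
have tt : t ^+ 2 = a + eta ^+ 2 + Cr by rewrite tE sqr_sqrtr // ltW.
have S00 : 0 <= S0 by exact: sqr_ge0.
have q3 : 0 <= S0 / c ^+ 3 by rewrite divr_ge0 // exprn_ge0 // ltW.
have q1 : 0 <= S0 / c by rewrite divr_ge0 // ltW.
have k40 : 0 <= k4 by apply: mulr_ge0 => //; apply: mulr_ge0 => //; exact: sqr_ge0.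
have T0 : 0 <= T by apply: Ex_ge0 => y; exact: sqr_ge0.
have ti : 0 <= t^-1 by rewrite invr_ge0 ltW.
have div z : 0 <= z -> z <= t ^+ 2 -> t^-1 * z <= t.
  by move=> z0 zt; rewrite ler_pdivrMl // -expr2.
have e0 := sqr_ge0 eta.
have d1 : t^-1 * Cr <= t by apply: div => //; rewrite tt; lra.
have d2 : t^-1 * eta ^+ 2 <= t by apply: div => //; rewrite tt; lra.
have d3 : t^-1 * a <= t by apply: div; rewrite ?tt; lra.
have p1 := mulr_ge0 ti Cr0; have p2 := mulr_ge0 ti e0; have p3 := mulr_ge0 ti (ltW a0).
have E0 : 0 < 1 - eta by lra.
have T1 : T / (1 - eta) <= 2 * T by rewrite ler_pdivrMr //; nra.
have T2 : 0 <= T / (1 - eta) by rewrite divr_ge0 // ltW.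
have s20 := sqr_ge0 s.
have GE : gen_excess P sigma g l X s x eta t a =
    T / (1 - eta) * Cr + s ^+ 2 * (k4 * (t^-1 * Cr) + t * (S0 / c) + t + k4 * (t^-1 * eta ^+ 2) + 2 * (t^-1 * a)).
  by rewrite /gen_excess -/Cr -/T -/c -/S0 -/k4; ring.
have m1 := mulr_ge0 k40 p1; have m2 := mulr_ge0 k40 p2; have m3 := mulr_ge0 (ltW t0) q1.
split=> //; rewrite GE.
  apply: addr_ge0; first exact: mulr_ge0.
  by apply: mulr_ge0 => //; lra.
apply: lerD; first exact: ler_wpM2r.
rewrite -mulrA; apply: ler_wpM2l => //.
have n1 := ler_wpM2l k40 d1; have n2 := ler_wpM2l k40 d2.
rewrite [leRHS](_ : _ = k4 * t + t * (S0 / c) + t + k4 * t + 2 * t); last by ring.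
lra.
Qed.

Section Growth.
Variables (N : nat -> nat) (C : R).
Hypotheses (C0 : 0 < C) (NC : (N n)%:R / (n%:R * ln (N n)%:R `^ (2 * C))
     @[n --> \oo] --> (+oo : set_system R)).

Lemma growth_ratio : (fun n => n%:R / (N n)%:R * ln (N n)%:R `^ (2 * C)) @ \oo --> (0 : R).
Proof.
apply/cvgrPdist_le => e e0; have := NC => /cvgryPge /(_ e^-1) [m _ Hm].
exists m => // n mn; have := Hm n mn; rewrite /= sub0r normrN.
set w := ln _ `^ _; have w0 : 0 <= w by exact: powR_ge0.
rewrite ger0_norm; last by rewrite mulr_ge0 // divr_ge0.
have [->|n0] := eqVneq n%:R (0 : R); first by rewrite !mul0r => _; exact: ltW.
have [->|wn0] := eqVneq w 0; first by rewrite !mulr0 => _; exact: ltW.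
have nr : 0 < n%:R :> R by rewrite lt_neqAle eq_sym n0 /=.
have wr : 0 < w by rewrite lt_neqAle eq_sym wn0.
rewrite ler_pdivlMr ?mulr_gt0 // => H.
have Nr : 0 < (N n)%:R :> R by apply: lt_le_trans H; rewrite !mulr_gt0 ?invr_gt0.
rewrite mulrAC ler_pdivrMr //.
by have := ler_wpM2l (ltW e0) H; rewrite mulrA divff ?mul1r // lt0r_neq0.
Qed.

(** If [2 <= N n <= m], the ratio in [NC] is at most [m / (n (ln 2)^(2 C))], below 1 for large [n].
    If [N n <= 1], the logarithm is 0, by convention at 0, so for [C > 0] the denominator is 0 and
    the quotient takes the default value 0. *)
Lemma growth_large (m : nat) : \forall n \near \oo, (m < N n)%N.
Proof.
have l2 : 0 < ln 2 `^ (2 * C) :> R by rewrite powR_gt0 // ln_gt0 // ltr1n.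
pose b := m%:R / ln 2 `^ (2 * C) : R.
have := NC => /cvgryPge /(_ 1) [k _ Hk].
exists (maxn k (Num.Def.trunc b).+1) => // n /=; rewrite geq_max => /andP[kn bn].
have := Hk n kn; rewrite /= ltnNge => H; apply/negP => Nm; move: H; apply/negP; rewrite -ltNge.
have [N1|N2] := leqP (N n) 1.
  have -> : ln (N n)%:R = 0 :> R.
    by case: (N n) N1 => [|[|//]] _; rewrite ?ln1 // ln0.
  by rewrite powR0 ?mulr0 ?invr0 ?mulr0 // lt0r_neq0 // mulr_gt0.
have nr : 0 < n%:R :> R by rewrite ltr0n (leq_trans _ bn).
have lnN : ln 2 `^ (2 * C) <= ln (N n)%:R `^ (2 * C) :> R.
  apply: ge0_ler_powR; rewrite ?nnegrE ?ln_ge0 ?ler1n //; first by rewrite mulr_ge0 // ltW.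
    exact: ltnW.
  by rewrite ler_ln ?posrE ?ltr0n ?ler_nat // (ltn_trans _ N2).
rewrite ltr_pdivrMr; last by rewrite mulr_gt0 // (lt_le_trans l2).
rewrite mul1r; apply: (@le_lt_trans _ _ m%:R); first by rewrite ler_nat.
apply: (@lt_le_trans _ _ (n%:R * ln 2 `^ (2 * C))); last by rewrite ler_wpM2l ?(ltW nr).
rewrite -ltr_pdivrMr // -/b; apply: (lt_le_trans (truncnS_gt b)); by rewrite ler_nat.
Qed.

End Growth.
End Rates.

Lemma Ex_cvg0 d0 (Om : measurableType d0) (R : realType) (P : probability Om R)
    (f : nat -> Om -> R) (B : R) :
  (forall n, measurable_fun setT (f n)) ->
  {ae P, forall o, forall n, 0 <= f n o <= B} ->
  {ae P, forall o, f n o @[n --> \oo] --> (0 : R)} ->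
  Ex P (f n) @[n --> \oo] --> (0 : R).
Proof.
move=> mf fB f0.
have h1 n : measurable_fun setT (fun o => (f n o)%:E) by apply/measurable_EFinP.
have h2 : {ae P, forall o, setT o -> (f n o)%:E @[n --> \oo] --> (cst 0%E o : \bar R)}.
  by apply: filterS f0 => o h _; apply: cvg_EFin => //; exact: nearW.
have h3 : P.-integrable setT (cst B%:E) by exact: finite_measure_integrable_cst.
have h4 : {ae P, forall o, forall n, setT o -> (`|(f n o)%:E| <= cst B%:E o)%E}.
  by apply: filterS fB => o h n _; case/andP: (h n) => h0 hB; rewrite /= lee_fin ger0_norm.
have [_ _ H] := dominated_convergence measurableT h1 (measurable_cst _) h2 h3 h4.
by move: H; rewrite integral0 => /fine_cvg.
Qed.

Theorem theorem2p13 (R : realType) (disp : measure_display)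
  (Omega : measurableType disp) (P : probability Omega R)
  (sigma : R -> R) (Csigma : R)
  (sigma_meas : measurable_fun setT sigma)
  (Csigma_ge0 : 0 <= Csigma)
  (sigma_growth : forall t, `|sigma t| <= Csigma * (1 + `|t|) `^ Csigma)
  (d : nat -> nat) (d_growing : d @ \oo --> \oo)
  (X : forall n, 'M[R]_(d n, n))
  (X_unit : forall n (i : 'I_n), frob (col i (X n)) = 1)
  (l : nat)
  (l_least : is_least (fun k =>
     frob (hadamard_pow ((X n)^T *m X n) k.+1 - 1%:M) @[n --> \oo] --> (0 : R))
     l)
  (sigma_tail_gt0 : 0 < sigma_tail_sq l sigma)
  (n0 : nat)
  (n0_least : is_least (fun m => forall n, (m <= n)%N ->
     (forall i j : 'I_n, i != j ->
        `|dot (col i (X n)) (col j (X n))| <= (Num.sqrt 2)^-1) /\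
     frob (hadamard_pow ((X n)^T *m X n) l.+1 - 1%:M)
       <= sigma_tail_sq l sigma / (4 * gauss_norm 4 sigma ^+ 2)) n0)
  (tau : R -> R) (tau_L4 : tau \in Lfun std_gauss 4%:E)
  (tau_zeta : forall k, (k <= l)%N -> zeta k sigma != 0 -> zeta k tau != 0)
  (tau_tail : R -> R) (tau_tailP : is_hermite_tail l tau tau_tail)
  (sigma_eps : R) (sigma_eps_ge0 : 0 <= sigma_eps)
  (N : nat -> nat)
  (W : forall n, Omega -> 'M[R]_(N n, d n))
  (beta : forall n, Omega -> 'cV[R]_(d n))
  (eps : forall n, Omega -> 'cV[R]_n)
  (x : forall n, Omega -> 'cV[R]_(d n))
  (W_law : forall n, iid P (centered_gauss 1) (entries (W n)))
  (beta_law : forall n, iid P (centered_gauss 1) (entries (beta n)))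
  (eps_law : forall n, iid P (centered_gauss sigma_eps) (entries (eps n)))
  (x_meas : forall n ij, measurable_fun setT (entries (x n) ij))
  (indep : forall n, independent_algebras P
     (tnth [tuple sigma_algebra_of (entries (W n));
                  sigma_algebra_of (entries (beta n));
                  sigma_algebra_of (entries (eps n));
                  sigma_algebra_of (entries (x n))]))
  (x_as : {ae P, forall omega,
     (forall n, frob (x n omega) = 1) /\
     Num.sqrt n%:R * frob (hadamard_pow ((X n)^T *m x n omega) l.+1)
       @[n --> \oo] --> (0 : R)})
  (n1 : nat)
  (n1_least : is_least (fun m => {ae P, forall omega,
     forall n, (m <= n)%N ->
       (forall i : 'I_n,
          `|dot (x n omega) (col i (X n))| <= (Num.sqrt 2)^-1) /\
       frob (hadamard_pow ((X n)^T *m x n omega) l.+1)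
         <= sigma_tail_sq l sigma / (4 * gauss_norm 4 sigma ^+ 2)}) n1)
  (lambda : R) (lambda_ge0 : 0 <= lambda)
  (N_growth : (N n)%:R / (n%:R * ln (N n)%:R `^ (2 * Csigma))
     @[n --> \oo] --> (+oo : set_system R)) :
  exists o1 o2 : nat -> R,
    [/\ o1 @ \oo --> (0 : R),
        o2 @ \oo --> (0 : R)
      & forall n, (maxn n0 n1 <= n)%N ->
        let PflSq :=
          ('E_P[fun omega => (tau_tail (dot (beta n omega) (x n omega)) ^+ 2)%R])%E
        in
        let middle :=
          (PflSq + (sigma_eps ^+ 2)%:E
             * 'E_P[fun omega => variance_term sigma l lambda (X n) (x n omega)]
             - (o1 n)%:E)%E in
        ((1 - ln (N n)%:R `^ (- Csigma))%:E
           <= P [set omega |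
                (middle <= gen_error P sigma tau lambda
                             (X n) (beta n) (eps n) (x n) (W n omega))%E
                /\ (PflSq - (o2 n)%:E <= middle)%E])%E].
Proof.
(* A zero exponent would give [sigma = 0] and contradict the positive tail variance. Positivity is
   what allows the growth condition to force [N n] to infinity. *)
have C1 : 0 < Csigma.
  rewrite lt_neqAle Csigma_ge0 andbT eq_sym; apply/eqP => C0.
  have s0 t : sigma t = 0.
    by apply/eqP; rewrite -normr_le0 (le_trans (sigma_growth t)) // C0 mul0r.
  have S0 : gauss_norm 2 sigma ^+ 2 = 0.
    rewrite (gauss_norm2 sigma_meas Csigma_ge0 sigma_growth).
    transitivity (Ex (@std_gauss R) (fun _ => 0)); last exact: Ex_cst.
    by apply: eq_Ex => t; rewrite s0 expr0n.
  move: sigma_tail_gt0; rewrite /sigma_tail_sq S0 sub0r oppr_gt0 ltNge sumr_ge0 // => k _.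
  exact: sqr_ge0.
have s2 := mom_L2 (mom_sigma sigma_meas Csigma_ge0 sigma_growth).
have t2 := Lfun4_L2 tau_L4.
have [M lM zM] : exists2 M, (l < M)%N & zeta M sigma != 0.
  apply: (exists_high_degree s2); move: sigma_tail_gt0.
  by rewrite /sigma_tail_sq (gauss_norm2 sigma_meas Csigma_ge0 sigma_growth) subr_gt0.
set c := sigma_tail_sq l sigma in sigma_tail_gt0 *.
pose S0 := gauss_norm 2 sigma ^+ 2.
pose B0 := c / (4 * gauss_norm 4 sigma ^+ 2).
have xs1 n i : dot (col i (X n)) (col i (X n)) = 1 by rewrite -frob_col_sqr X_unit expr1n.
have xsr n : (maxn n0 n1 <= n)%N -> forall i j : 'I_n, i != j ->
    `|dot (col i (X n)) (col j (X n))| <= (Num.sqrt 2)^-1.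
  by rewrite geq_max => /andP[h _]; exact: (n0_least.1 n h).1.
have adm n : (maxn n0 n1 <= n)%N -> {ae P, forall o, admissible (X n) (x n o)}.
  rewrite geq_max => /andP[_ h]; apply: filterS (filterI x_as n1_least.1) => o [[xn _] hn].
  by split; [rewrite -frob_col_sqr xn expr1n | exact: (hn n h).1].
pose cr n o := cross (fun i => col i (X n)) (x n o) l.+1.
have crE n o : cr n o = frob (hadamard_pow ((X n)^T *m x n o) l.+1) ^+ 2.
  by rewrite (cross_frob _ _ (fun i => erefl)).
pose Cr n := Ex P (cr n).
have Cr_cvg : Cr n @[n --> \oo] --> (0 : R).
  (* Below the threshold [cr n] has no common bound, so it is cut to 0 there; this leaves the limit
     unchanged and provides the majorant [B0^2] for dominated convergence. *)
  pose f n o := if (maxn n0 n1 <= n)%N then cr n o else 0.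
  have f0 n o : 0 <= f n o by rewrite /f; case: ifP => // _; rewrite crE sqr_ge0.
  have : Ex P (f n) @[n --> \oo] --> (0 : R).
    apply: (@Ex_cvg0 _ _ _ _ _ (B0 ^+ 2)).
    - move=> n; rewrite /f; have [h|_] := leqP (maxn n0 n1) n; last exact: measurable_cst.
      exact: (intg_measurable (cross_intg l (x_meas n) (adm n h))).
    - apply: filterS n1_least.1 => o hn n; rewrite f0 /= /f.
      have [|_] := leqP (maxn n0 n1) n; last exact: sqr_ge0.
      rewrite geq_max crE => /andP[_ h]; apply: lerXn2r; rewrite ?nnegrE ?sqrtr_ge0 //.
        by apply: le_trans (hn n h).2; exact: sqrtr_ge0.
      exact: (hn n h).2.
    apply: filterS x_as => o [_ h].
    pose u n := Num.sqrt n%:R * frob (hadamard_pow ((X n)^T *m x n o) l.+1).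
    (* [u n ^ 2] is [n] times [cr n], hence dominates [f n] once [n >= 1]. *)
    have hh : u n * u n @[n --> \oo] --> (0 : R).
      by rewrite -(mulr0 (0 : R)); exact: (cvgM h h).
    apply: (squeeze_cvgr (f := fun _ => 0 : R) _ (cvg_cst _) hh).
    exists 1%N => // n /= n_gt0; rewrite f0 /= /u -expr2 exprMn sqr_sqrtr ?ler0n //.
    rewrite /f; case: ifP => _; last by rewrite mulr_ge0 ?ler0n ?sqr_ge0.
    by rewrite crE ler_peMl ?sqr_ge0 ?ler1n.
  apply: cvg_trans; apply: near_eq_cvg; exists (maxn n0 n1) => // n /= h.
  by apply: eq_Ex => o; rewrite /f h.
pose eta n := frob (hadamard_pow ((X n)^T *m X n) l.+1 - 1%:M).
have eta_cvg : eta n @[n --> \oo] --> (0 : R) := l_least.1.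
have eta0 n : 0 <= eta n by exact: sqrtr_ge0.
pose A n := n%:R / (N n)%:R * ln (N n)%:R `^ (2 * Csigma).
have A_cvg : A n @[n --> \oo] --> (0 : R) := growth_ratio N_growth.
pose K := Csigma ^+ 2 * 16 `^ Csigma.
pose k0 := K * (S0 / c ^+ 3 + S0 / c + 3 * S0 * (S0 / c ^+ 3)) +
  psi_cst sigma * (S0 / c ^+ 3).
(* The Markov threshold of [bad_prob_le] and, on the next line, the balancing parameter of
   [gen_excess_le]; both tend to 0. *)
pose a n := 4 * (k0 + 1) * A n.
pose t n := Num.sqrt (a n + eta n ^+ 2 + Cr n).
have t_cvg : t n @[n --> \oo] --> (0 : R).
  have h : (fun n => a n + eta n * eta n + Cr n) @ \oo --> (0 : R).
    rewrite (_ : (0 : R) = 4 * (k0 + 1) * 0 + 0 * 0 + 0); last by rewrite !mulr0 !addr0.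
    apply: cvgD => //; apply: cvgD; last exact: (cvgM eta_cvg eta_cvg).
    by apply: cvgM => //; exact: cvg_cst.
  have := cvg_comp _ _ h (sqrt_continuous (x := 0)); rewrite sqrtr0.
  by apply: cvg_trans; apply: near_eq_cvg; apply: nearW => n; rewrite /t expr2.
pose T := Ex (@std_gauss R) (fun y => tau_tail y ^+ 2).
have T0 : 0 <= T by apply: Ex_ge0 => y; exact: sqr_ge0.
have p0 := ball_prob_gt0 M sigma.
have [ns Hns] : exists ns, forall n, (ns <= n)%N ->
    [/\ (maxn n0 n1 <= n)%N, (0 < n)%N, (0 < N n)%N /\ 1 <= ln (N n)%:R :> R,
        A n <= 1 /\ A n <= ball_prob M sigma / 2 & eta n <= 2^-1].
  have half0 (r : R) : 0 < r -> 0 < r / 2 by move=> r0; rewrite divr_gt0.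
  have i2 : 0 < 2^-1 :> R by rewrite invr_gt0.
  have [k1 _ h1] := growth_large C1 N_growth (Num.Def.trunc (expR 1 : R)).+1.
  have [k2 _ h2] := cvgr_le _ A_cvg _ (@ltr01 R).
  have [k3 _ h3] := cvgr_le _ A_cvg _ (half0 _ p0).
  have [k4 _ h4] := cvgr_le _ eta_cvg _ i2.
  exists (maxn (maxn n0 n1) (maxn 1 (maxn (maxn k1 k2) (maxn k3 k4)))) => n.
  rewrite 4!geq_max => /and3P[nn n_gt0].
  rewrite 2!geq_max => /andP[/andP[l1 l2] /andP[l3 l4]].
  have Nn := h1 n l1; split=> //; [split | split | exact: h4].
  - exact: leq_trans Nn.
  - rewrite -[leLHS](expRK 1) ler_ln ?posrE ?expR_gt0 ?ltr0n ?(leq_trans _ Nn) //.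
    by apply: (le_trans (ltW (truncnS_gt _))); rewrite ler_nat ltnW.
  - exact: h2.
  - exact: h3.
have a_bad n : (ns <= n)%N -> 0 < a n /\
    bad_prob sigma l (N n) n M (K * ln (N n)%:R `^ Csigma) (a n) <= ln (N n)%:R `^ (- Csigma).
  move=> /Hns[_ n_gt0 [N_gt0 l1] [A1 Ap] _].
  have yy : ln (N n)%:R `^ (2 * Csigma) = (ln (N n)%:R `^ Csigma) ^+ 2 :> R.
    by rewrite mulrC -powR_mulrn ?powR_ge0 // powRrM.
  have y1 : 1 <= ln (N n)%:R `^ (2 * Csigma) :> R.
    have e1 : 1 `^ (2 * Csigma) = 1 :> R by rewrite powR1.
    rewrite -[leLHS]e1; apply: ge0_ler_powR => //; rewrite ?nnegrE ?ler01 ?mulr_ge0 //.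
    exact: (le_trans ler01 l1).
  apply: (bad_prob_le (k0 := k0) (r := n%:R / (N n)%:R) (y := ln (N n)%:R `^ Csigma)) => //.
  - apply: le_trans A1; rewrite ler_peMr // divr_ge0 //.
  - by rewrite -yy.
  - by rewrite /a /A yy.
have Cr0 n : 0 <= Cr n by apply: Ex_ge0 => o; rewrite crE sqr_ge0.
pose ge n := gen_excess P sigma tau_tail l (X n) sigma_eps (x n) (eta n) (t n) (a n).
pose B := 2 * (4 * S0 ^+ 2 * (S0 / c ^+ 3)) + S0 / c + 3.
have ge_le n : (ns <= n)%N ->
    [/\ 0 < t n, 0 <= ge n & ge n <= 2 * T * Cr n + sigma_eps ^+ 2 * B * t n].
  move=> h; have [_ _ _ _ e1] := Hns n h; have [a0 _] := a_bad n h.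
  exact: (@gen_excess_le _ _ _ P sigma tau_tail l _ _ (X n) sigma_eps (x n) (eta n) (t n) (a n)
    sigma_tail_gt0 (eta0 n) e1 a0 (Cr0 n) erefl).
(* The probability bound is claimed for every [n] above [maxn n0 n1], also below [ns]. There the
   constant makes the middle term nonpositive, because the variance integral is at most [S0 / c],
   and the event is the whole space. *)
pose o1 n := if (ns <= n)%N then ge n else T + sigma_eps ^+ 2 * (S0 / c).
have o1_cvg : o1 n @[n --> \oo] --> (0 : R).
  have hh : (fun n => 2 * T * Cr n + sigma_eps ^+ 2 * B * t n) @ \oo --> (0 : R).
    rewrite (_ : (0 : R) = 2 * T * 0 + sigma_eps ^+ 2 * B * 0); last by rewrite !mulr0 addr0.
    by apply: cvgD; apply: cvgM => //; exact: cvg_cst.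
  apply: (squeeze_cvgr (f := fun _ => 0 : R) _ (cvg_cst _) hh).
  by exists ns => // n /= h; rewrite /o1 h; have [_ -> ->] := ge_le n h.
(* The same error serves twice: the second inequality only drops the nonnegative variance term, so
   it is deterministic. *)
exists o1, o1; split=> // n hn; cbv zeta.
rewrite (tail_integral tau_tailP (W_law n) (beta_law n) (eps_law n) (x_meas n) (indep n) (adm n hn)) -/T.
set V := ('E_P[fun omega => variance_term sigma l lambda (X n) (x n omega)])%E.
have V0 : (0 <= V)%E.
  rewrite /V unlock; apply: integral_ge0 => o _; rewrite lee_fin.
  exact: (variance_term_ge0 sigma l lambda (xs1 n) (xsr n hn)).
have Vle : (V <= (S0 / c)%:E)%E.
  exact: (variance_integral_le sigma_tail_gt0 lambda_ge0 (beta_law n) (x_meas n) (xs1 n)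
    (xsr n hn) (adm n hn)).
have [v VE] : exists v, V = v%:E.
  by case: V V0 Vle => // v _ _; exists v.
rewrite VE in V0 Vle *; rewrite lee_fin in V0; rewrite lee_fin in Vle.
have lower : (T%:E - (o1 n)%:E <= T%:E + (sigma_eps ^+ 2)%:E * v%:E - (o1 n)%:E)%E.
  by rewrite -EFinM -EFinD -!EFinB lee_fin lerD2r lerDl mulr_ge0 ?sqr_ge0.
have [h|h] := leqP ns n.
  have [_ n_gt0 [N_gt0 l1] _ e1] := Hns n h.
  have [t0 _ _] := ge_le n h; have [a0 bad] := a_bad n h.
  have Nr : 0 < (N n)%:R :> R by rewrite ltr0n.
  apply: (@le_trans _ _ ((1 - bad_prob sigma l (N n) n M (K * ln (N n)%:R `^ Csigma) (a n))%:E)).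
    by rewrite lee_fin lerB.
  have := fixed_size sigma_meas Csigma_ge0 sigma_growth t2 tau_tailP sigma_tail_gt0
    sigma_eps_ge0 lambda_ge0 N_gt0 (W_law n) (beta_law n) (eps_law n) (x_meas n) (indep n)
    (xs1 n) (xsr n hn) (adm n hn) (eta0 n) e1 _ lM zM _
    (fun y => sigma_sq_le Csigma_ge0 sigma_growth y l1 Nr) t0 a0.
  rewrite -/V VE -/T -/(ge n).
  have -> : [set o | (T%:E + (sigma_eps ^+ 2)%:E * v%:E <= gen_error P sigma tau lambda (X n)
        (beta n) (eps n) (x n) (W n o) + (ge n)%:E)%E] =
      [set omega | (T%:E + (sigma_eps ^+ 2)%:E * v%:E - (o1 n)%:E <= gen_error P sigma tau lambda
        (X n) (beta n) (eps n) (x n) (W n omega))%E /\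
        (T%:E - (o1 n)%:E <= T%:E + (sigma_eps ^+ 2)%:E * v%:E - (o1 n)%:E)%E].
    apply/seteqP; split => o => [H|[H _]].
      by split=> //; rewrite leeBlDr // /o1 h; exact: H.
    by move: H; rewrite leeBlDr // /o1 h; exact.
  apply.
  - by rewrite -(off_frob (xs1 n) l.+1 (fun i => erefl)).
  - by rewrite !mulr_ge0 ?sqr_ge0 ?powR_ge0.
have -> : [set omega | (T%:E + (sigma_eps ^+ 2)%:E * v%:E - (o1 n)%:E <= gen_error P sigma tau lambda
        (X n) (beta n) (eps n) (x n) (W n omega))%E /\
        (T%:E - (o1 n)%:E <= T%:E + (sigma_eps ^+ 2)%:E * v%:E - (o1 n)%:E)%E] = setT.
  apply/seteqP; split => // o _; split=> //; apply: (@le_trans _ _ 0%E).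
    have -> : o1 n = T + sigma_eps ^+ 2 * (S0 / c) by rewrite /o1 leqNgt h.
    change ((T + sigma_eps ^+ 2 * v - (T + sigma_eps ^+ 2 * (S0 / c)))%:E <= 0%:E)%E.
    rewrite lee_fin subr_le0 lerD2l.
    by rewrite ler_wpM2l ?sqr_ge0.
  by rewrite /gen_error unlock; apply: integral_ge0 => o' _; rewrite lee_fin sqr_ge0.
by rewrite probability_setT lee_fin gerBl powR_ge0.
Qed.
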